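(* Let $\{T_t\}_{t\ge 0}$ be a $C_0$-semigroup of bounded operators on $L^2(0,\infty)$ satisfying $T_t^*S_t=I$ for all $t\ge 0$. Then there exists $p\in\mathcal{O}$ such that $A_p$ is the generator of $\{T_t\}_{t\geq 0}$. Moreover, there exists a positive number $a$ (in particular such that $\xi_{p,z}$ is defined for $\mathrm{Re}\, z>a$) such that for all $f\in D(A_p)$, all $t>0$ and all $b>a$, the function $T_tf$ is given by $$T_tf=S_tf+\lim_{r\to+\infty}\frac{1}{2\pi i}\int_{b-ir}^{b+ir}e^{zt}(f,\xi_{p,z})\,e_z\,dz ,$$ where the integral is an $L^2(0,\infty)$-valued integral along the vertical segment from $b-ir$ to $b+ir$ and the limit is in $L^2(0,\infty)$.
   Context: All functions are complex valued. $\{S_t\}_{t\ge0}$ is the shift semigroup on $L^2(0,\infty)$: $(S_tf)(x)=0$ for $x<t$ and $(S_tf)(x)=f(x-t)$ for $x\ge t$. Its generator is $A$, $Af=-f'$, with $D(A)$ the set of locally absolutely continuous $f\in L^2(0,\infty)$ on $[0,\infty)$ with $f'\in L^2(0,\infty)$ and $f(0)=0$; its adjoint is $A^*f=f'$ with $D(A^* )$ the set of locally absolutely continuous $f\in L^2(0,\infty)$ on $[0,\infty)$ with $f'\in L^2(0,\infty)$ (no boundary condition). $(f,g)=\int_0^\infty f(x)g(x)\,dx$ is the bilinear pairing, and $e_z(x)=e^{-zx}$ for $\mathrm{Re}\, z>0$. $\mathcal{O}=\{p\in D(A^* ):\ p'\notin D(A)\}$. For $p\in\mathcal O$, $A_p$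 is the operator with domain $D(A_p)=\{g\in D(A^* ):\ (g,p)+(g',p')=0\}$ and $A_pg=-g'$. For $p\in D(A^* )$ and $\mathrm{Re}\, z>0$ put $\mathcal{M}[p](z)=(1-z^2)\int_0^\infty p(x)e^{-zx}dx+p(0)z$. When $\mathcal{M}[p](z)\ne0$, $\xi_{p,z}\in L^2(0,\infty)$ is $$\xi_{p,z}(x)=-\frac{(1-z^2)\int_0^\infty e^{-zt}p(x+t)\,dt+zp(x)+p'(x)}{\mathcal{M}[p](z)}.$$ *)

(* Defs.v *)
From HB Require Import structures.
From mathcomp Require Import all_boot all_order all_algebra.
From mathcomp Require Import all_classical all_reals all_analysis.
From mathcomp Require Import complex.

Set Implicit Arguments.
Unset Strict Implicit.
Unset Printing Implicit Defensive.
Import Order.TTheory GRing.Theory Num.Theory.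
Import numFieldNormedType.Exports Normc.
Local Open Scope classical_set_scope.
Local Open Scope ring_scope.
Local Open Scope complex_scope.

(* L^2(0,oo) is represented by functions R -> R[i], identified when they agree
   almost everywhere on ]0, +oo[ (eqL2 below); values on ]-oo, 0[ never matter. *)

Notation "''Fun' ( R )" := (Real.sort R -> complex (Real.sort R))
  (at level 8, format "''Fun' ( R )").

Definition halfline (R : realType) : set R := `]0, +oo[.

Definition eqL2 (R : realType) (f g : 'Fun(R)) : Prop :=
  ae_eq (@lebesgue_measure R) (@halfline R) f g.

Definition L2 (R : realType) : set 'Fun(R) := [set f : 'Fun(R) |
  [/\ measurable_fun (@halfline R) (fun x : R => complex.Re (f x)),
      measurable_fun (@halfline R) (fun x : R => complex.Im (f x)) &
      (\int[@lebesgue_measure R]_(x in @halfline R)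
          ((normc (f x)) ^+ 2)%:E < +oo)%E]].

Definition normL2 (R : realType) (f : 'Fun(R)) : R :=
  Num.sqrt (\int[@lebesgue_measure R]_(x in @halfline R) (normc (f x)) ^+ 2).

Definition cvgL2 (R : realType) (I : Type) (F : set_system I)
    (u : I -> 'Fun(R)) (f : 'Fun(R)) : Prop :=
  [/\ \forall i \near F, L2 (u i), L2 f &
      normL2 (fun x => u i x - f x) @[i --> F] --> (0 : R)].

(* Integral over ]0, +oo[ of a complex-valued function. *)
Definition integralC (R : realType) (f : 'Fun(R)) : R[i] :=
  (\int[@lebesgue_measure R]_(x in @halfline R) complex.Re (f x)) +i*
  (\int[@lebesgue_measure R]_(x in @halfline R) complex.Im (f x)).

Definition pairing (R : realType) (f g : 'Fun(R)) : R[i] :=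
  integralC (fun x => f x * g x).

Definition expC (R : realType) (z : R[i]) : R[i] :=
  (expR (complex.Re z))%:C *
    (cos (complex.Im z) +i* sin (complex.Im z)).

Definition e_ (R : realType) (z : R[i]) : 'Fun(R) :=
  fun x => expC (- z * x%:C).

(* Linearity and boundedness make such a T compatible with eqL2. *)
Definition bounded_operator (R : realType) (T : 'Fun(R) -> 'Fun(R)) : Prop :=
  [/\ forall f, L2 f -> L2 (T f),
      forall (c : R[i]) f g, L2 f -> L2 g ->
        eqL2 (T (fun x => c * f x + g x)) (fun x => c * T f x + T g x) &
      exists K : R, forall f, L2 f -> normL2 (T f) <= K * normL2 f].

(* Only the operators T t with 0 <= t are constrained. *)
Definition C0_semigroup (R : realType) (T : R -> 'Fun(R) -> 'Fun(R)) : Prop :=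
  [/\ forall t, 0 <= t -> bounded_operator (T t),
      forall f, L2 f -> eqL2 (T 0 f) f,
      forall s t f, 0 <= s -> 0 <= t -> L2 f ->
        eqL2 (T (s + t) f) (T s (T t f)) &
      forall f, L2 f -> cvgL2 (0 : R)^'+ (fun t => T t f) f].

(* Graph of the generator: f is in its domain and is sent to g. *)
Definition generator_graph (R : realType) (T : R -> 'Fun(R) -> 'Fun(R))
    (f g : 'Fun(R)) : Prop :=
  L2 f /\
  cvgL2 (0 : R)^'+ (fun t x => (t^-1)%:C * (T t f x - f x)) g.

(* T^* g = h, for the adjoint with respect to the bilinear pairing. *)
Definition adjoint_graph (R : realType) (T : 'Fun(R) -> 'Fun(R))
    (g h : 'Fun(R)) : Prop :=
  [/\ L2 g, L2 h & forall f, L2 f -> pairing (T f) g = pairing f h].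

Definition shiftS (R : realType) (t : R) (f : 'Fun(R)) : 'Fun(R) :=
  fun x => if x < t then 0 else f (x - t).

Definition abs_continuous (R : realType) (a b : R) (f : 'Fun(R)) : Prop :=
  forall e : R, 0 < e -> exists2 d : R, 0 < d &
    forall (n : nat) (u v : nat -> R),
      (forall i, (i < n)%N -> [/\ a <= u i, u i <= v i & v i <= b]) ->
      trivIset `I_n (fun i => [set` `]u i, v i[]) ->
      \sum_(i < n) (v i - u i) < d ->
      \sum_(i < n) normc (f (v i) - f (u i)) < e.

Definition loc_abs_continuous (R : realType) (f : 'Fun(R)) : Prop :=
  forall b : R, 0 < b -> abs_continuous 0 b f.

Definition ae_derivative (R : realType) (f g : 'Fun(R)) : Prop :=
  {ae @lebesgue_measure R, forall x, halfline x ->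
    is_derive x (1 : R) (fun y => complex.Re (f y)) (complex.Re (g x)) /\
    is_derive x (1 : R) (fun y => complex.Im (f y)) (complex.Im (g x))}.

(* f', as a square-integrable representative; it is the junk value 0 when the
   a.e. derivative is not in L^2(0,oo). *)
Definition derivL2 (R : realType) (f : 'Fun(R)) : 'Fun(R) :=
  xget (fun=> 0) [set g : 'Fun(R) | L2 g /\ ae_derivative f g].

(* The elements of D(A^* ) are given by their continuous representatives, so
   that f 0 is meaningful. *)
Definition domAstar (R : realType) : set 'Fun(R) := [set f : 'Fun(R) |
  [/\ loc_abs_continuous f, L2 f & exists g, L2 g /\ ae_derivative f g]].

Definition domA (R : realType) : set 'Fun(R) :=
  [set f : 'Fun(R) | domAstar f /\ f 0 = 0].

Definition calO (R : realType) : set 'Fun(R) :=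
  [set p : 'Fun(R) | domAstar p /\ ~ exists2 u, domA u & eqL2 (derivL2 p) u].

Definition domAp (R : realType) (p : 'Fun(R)) : set 'Fun(R) :=
  [set g : 'Fun(R) |
    domAstar g /\ pairing g p + pairing (derivL2 g) (derivL2 p) = 0].

(* Graph of A_p, closed under a.e. equality. *)
Definition opAp (R : realType) (p f h : 'Fun(R)) : Prop :=
  exists g, [/\ domAp p g, eqL2 f g & eqL2 h (fun x => - derivL2 g x)].

Definition calM (R : realType) (p : 'Fun(R)) (z : R[i]) : R[i] :=
  (1 - z ^+ 2) * integralC (fun x => p x * e_ z x) + p 0 * z.

Definition xi (R : realType) (p : 'Fun(R)) (z : R[i]) : 'Fun(R) := fun x =>
  - (((1 - z ^+ 2) * integralC (fun t => e_ z t * p (x + t))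
      + z * p x + derivL2 p x) / calM p z).

Definition segment_pt (R : realType) (z0 z1 : R[i]) (s : R) : R[i] :=
  z0 + s%:C * (z1 - z0).

(* J is the integral of F along the segment from z0 to z1: the limit in
   L^2(0,oo), as the mesh tends to 0, of the tagged Riemann sums. *)
Definition segment_integral (R : realType) (F : R[i] -> 'Fun(R))
    (z0 z1 : R[i]) (J : 'Fun(R)) : Prop :=
  [/\ forall s : R, 0 <= s <= 1 -> L2 (F (segment_pt z0 z1 s)), L2 J &
    forall e : R, 0 < e -> exists2 d : R, 0 < d &
      forall (n : nat) (s c : nat -> R),
        s 0%N = 0 -> s n = 1 ->
        (forall i, (i < n)%N -> s i <= c i <= s i.+1 /\ s i.+1 - s i < d) ->
        normL2 (fun x =>
          \sum_(i < n) (segment_pt z0 z1 (s i.+1) - segment_pt z0 z1 (s i)) *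
             F (segment_pt z0 z1 (c i)) x - J x) < e].

(* Main.v *)
Require Import Defs.
From HB Require Import structures.
From mathcomp Require Import all_boot all_order all_algebra.
From mathcomp Require Import all_classical all_reals all_analysis.
From mathcomp Require Import complex.
From mathcomp Require Import measurable_realfun ring lra.
Import Order.TTheory GRing.Theory Num.Theory.
Import numFieldNormedType.Exports.
Import Normc.
Set Implicit Arguments.
Unset Strict Implicit.
Unset Printing Implicit Defensive.
Local Open Scope classical_set_scope.
Local Open Scope ring_scope.
Local Open Scope complex_scope.

(** The identity [T_t^* S_t = I] says that the part of [T_t f] beyond [t] is the
    translate of [f]. Hence a whole orbit is encoded by one function [u] on the
    real line, the profile of [f], with [T_t f (x) = u (x - t)]; the semigroup law
    shifts profiles, and the resolvent is
    [R(z) f (x) = e^(-zx) \int_(y < x) e^(zy) u(y) dy]. So the generator is [- d/dx]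
    restricted by the single boundary condition [g 0 = R(l) (l g + g') 0] for one
    fixed [l]. By the Riesz theorem the continuous functional [g 0 - R(l) (l g + g') 0]
    of the graph of [A^*] has the form [(g, p) + (g', p')], which gives [p]; its value
    at [e_z] is [M[p](z)], nonzero since [e_z] is no eigenvector of the generator,
    and [(f, xi_(p,z)) = R(z) f 0].

    For the inversion formula put [k = b f - h], where [h] is the image of [f] under
    the generator, and [kappa(y) = e^(by) u_k(y)] for [y < 0]. Fubini turns the
    integral over the segment into
    [e^(b(t-x)) \int (Si (2r(t-x)) - Si (2r(t-x+y))) / pi kappa(y) dy], while
    [T_t f - S_t f] is the same expression with [Si / pi] replaced by the indicator
    of the positive axis. Since [1/2 + Si (V) / pi] minus that indicator
    is O(1/V), it is square integrable in [V]; with [V = 2r(t-x)] its squared norm is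
    O(1/r), and Minkowski's integral inequality bounds the L^2 error. *)

(** * Complex-valued measurable functions and their integrals *)

(** For each [t] the function [T t f] is fixed only up to a null set, so nothing makes
    [(t, x) |-> T t f x] measurable. This obstacle shapes the proof: the profile is glued from the
    countably many [T n f], and [(s, x) |-> u (x - s)] is then a jointly measurable version of the
    orbit, to which Fubini and Minkowski apply. The only L^2-valued integral is the Riemann integral
    that the formula itself names.

    A single boundary condition suffices because [g] and [R(l) (l g + g')] solve the same
    first-order equation: they differ by a multiple of [e_l], so equality at [0] is equality
    everywhere.

    The function [b f - h] enters because [R(z) f 0] need not be absolutely integrable along the
    vertical line. For [f] in the domain, the resolvent identity writes it as the difference of two
    bounded Fourier transforms divided by [i eta]; adding the contributions of [eta] and [- eta]
    leaves sines over [eta], whence the sine integral and a limit over symmetric segments. *)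

Section normc_facts.
Context {R : realType}.
Implicit Types z w : R[i].

Lemma normc_ge0 z : 0 <= normc z.
Proof. by case: z => a b; exact: sqrtr_ge0. Qed.

Lemma normc_sqr z : normc z ^+ 2 = complex.Re z ^+ 2 + complex.Im z ^+ 2.
Proof. by case: z => a b; rewrite /= sqr_sqrtr// addr_ge0// sqr_ge0. Qed.

Lemma normc_geRe z : `|complex.Re z| <= normc z.
Proof.
rewrite -(ler_pXn2r (n := 2))// ?nnegrE ?normc_ge0//.
by rewrite normc_sqr -normrX ger0_norm ?sqr_ge0// lerDl sqr_ge0.
Qed.

Lemma normc_geIm z : `|complex.Im z| <= normc z.
Proof.
rewrite -(ler_pXn2r (n := 2))// ?nnegrE ?normc_ge0//.
by rewrite normc_sqr -normrX ger0_norm ?sqr_ge0// lerDr sqr_ge0.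
Qed.

Lemma normc_leReIm z : normc z <= `|complex.Re z| + `|complex.Im z|.
Proof.
rewrite -(ler_pXn2r (n := 2))// ?nnegrE ?normc_ge0 ?addr_ge0//.
rewrite normc_sqr sqrrD -!normrX (ger0_norm (sqr_ge0 _)) (ger0_norm (sqr_ge0 (complex.Im z))).
by rewrite lerD2r lerDl mulrn_wge0// mulr_ge0.
Qed.

Lemma normc_real (x : R) : normc x%:C = `|x|.
Proof. by rewrite /= expr0n/= addr0 sqrtr_sqr. Qed.

Lemma normcJ_real z : normc (z^*)%C = normc z.
Proof. by case: z => a b /=; rewrite sqrrN. Qed.

Lemma normcB z w : normc (z - w) = normc (w - z).
Proof. by rewrite -normcN opprB. Qed.

Lemma normc_triB z w : normc (z - w) <= normc z + normc w.
Proof. by rewrite -(normcN w); exact: le_normcD. Qed.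

Lemma normc_tri3 (a z w : R[i]) : normc (z - w) <= normc (z - a) + normc (a - w).
Proof. by apply: le_trans (le_normcD _ _); rewrite addrA subrK. Qed.

Lemma normc_sum (n : nat) (f : nat -> R[i]) :
  normc (\sum_(i < n) f i) <= \sum_(i < n) normc (f i).
Proof.
elim: n => [|n ih]; first by rewrite !big_ord0 normc0.
by rewrite !big_ord_recr/=; apply: le_trans (le_normcD _ _) _; rewrite lerD2r.
Qed.

Lemma normc_sqD z w : normc (z + w) ^+ 2 <= 2 * normc z ^+ 2 + 2 * normc w ^+ 2.
Proof.
have h := le_normcD z w.
have h0 := normc_ge0 (z + w); have h1 := normc_ge0 z; have h2 := normc_ge0 w.
have h3 := sqr_ge0 (normc z - normc w).
by move: h h0 h1 h2 h3; move: (normc _) (normc _) (normc _) => a b c *; nra.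
Qed.

Lemma normc_eq0P z : normc z = 0 -> z = 0.
Proof. exact: eq0_normc. Qed.

Lemma cReM z w : complex.Re (z * w) =
  complex.Re z * complex.Re w - complex.Im z * complex.Im w.
Proof. by case: z w => a b [c d]. Qed.

Lemma cImM z w : complex.Im (z * w) =
  complex.Re z * complex.Im w + complex.Im z * complex.Re w.
Proof. by case: z w => a b [c d]. Qed.

Lemma cReD z w : complex.Re (z + w) = complex.Re z + complex.Re w.
Proof. by case: z w => a b [c d]. Qed.

Lemma cImD z w : complex.Im (z + w) = complex.Im z + complex.Im w.
Proof. by case: z w => a b [c d]. Qed.

Lemma cReN z : complex.Re (- z) = - complex.Re z.
Proof. by case: z. Qed.

Lemma cImN z : complex.Im (- z) = - complex.Im z.
Proof. by case: z. Qed.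

Lemma ReImE z w : complex.Re z = complex.Re w -> complex.Im z = complex.Im w -> z = w.
Proof. by case: z w => a b [c d] /= -> ->. Qed.

Lemma expCD z w : expC (z + w) = expC z * expC w.
Proof.
rewrite /expC cReD cImD expRD cosD sinD.
by apply: ReImE; rewrite !(cReM, cImM)/=; ring.
Qed.

Lemma expC0 : expC (0 : R[i]) = 1.
Proof. by rewrite /expC/= expR0 cos0 sin0 mul1r. Qed.

Lemma normc_expC z : normc (expC z) = expR (complex.Re z).
Proof.
rewrite /expC normcM normc_real ger0_norm ?expR_ge0//.
by rewrite /normc cos2Dsin2 sqrtr1 mulr1.
Qed.

Lemma expCN z : expC z * expC (- z) = 1.
Proof. by rewrite -expCD subrr expC0. Qed.

Lemma expC_neq0 z : expC z != 0.
Proof. by apply/eqP => h; have := expCN z; rewrite h mul0r => /eqP; rewrite eq_sym oner_eq0. Qed.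

Lemma cReMr z (x : R) : complex.Re (z * x%:C) = complex.Re z * x.
Proof. by rewrite cReM/= mulr0 subr0. Qed.

Lemma cImMr z (x : R) : complex.Im (z * x%:C) = complex.Im z * x.
Proof. by rewrite cImM/= mulr0 add0r. Qed.

End normc_facts.

Section cmeas.
Context d {T : measurableType d} {R : realType}.
Implicit Types f g : T -> R[i].

Definition cmeas f := measurable_fun setT (fun x => complex.Re (f x)) /\
  measurable_fun setT (fun x => complex.Im (f x)).

Lemma cmeas_cst (c : R[i]) : cmeas (fun=> c).
Proof. by split; exact: measurable_cst. Qed.

Lemma cmeasD f g : cmeas f -> cmeas g -> cmeas (fun x => f x + g x).
Proof.
move=> [f1 f2] [g1 g2]; split.
  by under eq_fun do rewrite cReD; exact: measurable_funD.
by under eq_fun do rewrite cImD; exact: measurable_funD.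
Qed.

Lemma cmeasN f : cmeas f -> cmeas (fun x => - f x).
Proof.
move=> [f1 f2]; split.
  by under eq_fun do rewrite cReN; exact: measurableT_comp.
by under eq_fun do rewrite cImN; exact: measurableT_comp.
Qed.

Lemma cmeasB f g : cmeas f -> cmeas g -> cmeas (fun x => f x - g x).
Proof. by move=> mf mg; apply: cmeasD => //; exact: cmeasN. Qed.

Lemma cmeasM f g : cmeas f -> cmeas g -> cmeas (fun x => f x * g x).
Proof.
move=> [f1 f2] [g1 g2]; split.
  by under eq_fun do rewrite cReM; apply: measurable_funB; exact: measurable_funM.
by under eq_fun do rewrite cImM; apply: measurable_funD; exact: measurable_funM.
Qed.

Lemma cmeas_real (h : T -> R) : measurable_fun setT h -> cmeas (fun x => (h x)%:C).
Proof. by move=> mh; split => //=; exact: measurable_cst. Qed.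

Lemma cmeas_if (b : T -> bool) f g : measurable_fun setT b ->
  cmeas f -> cmeas g -> cmeas (fun x => if b x then f x else g x).
Proof.
move=> mb [f1 f2] [g1 g2]; split.
  by under eq_fun do rewrite fun_if; exact: measurable_fun_ifT.
by under eq_fun do rewrite fun_if; exact: measurable_fun_ifT.
Qed.

Lemma cmeasJ f : cmeas f -> cmeas (fun x => ((f x)^*)%C).
Proof.
move=> [f1 f2]; split.
  rewrite (_ : (fun x => _) = (fun x => complex.Re (f x)))//.
  by apply/funext => x; case: (f x).
rewrite (_ : (fun x => _) = (fun x => - complex.Im (f x))).
  exact: measurableT_comp.
by apply/funext => x; case: (f x).
Qed.

Lemma cmeas_expC f : cmeas f -> cmeas (fun x => expC (f x)).
Proof.
move=> [f1 f2]; rewrite /expC; apply: cmeasM.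
  apply: cmeas_real; exact: (measurableT_comp (@measurable_expR R)).
split => /=.
  by apply: (measurableT_comp _ f2); apply: continuous_measurable_fun; exact: continuous_cos.
by apply: (measurableT_comp _ f2); apply: continuous_measurable_fun; exact: continuous_sin.
Qed.

Lemma measurable_normc_sq f : cmeas f -> measurable_fun setT (fun x => normc (f x) ^+ 2).
Proof.
move=> [f1 f2]; under eq_fun do rewrite normc_sqr.
by apply: measurable_funD; exact: measurable_funX.
Qed.

Lemma measurable_normc f : cmeas f -> measurable_fun setT (fun x => normc (f x)).
Proof.
move=> mf; rewrite (_ : (fun x => _) = (fun x => Num.sqrt (normc (f x) ^+ 2))).
  have := measurable_normc_sq mf; apply: measurableT_comp.
  by apply: continuous_measurable_fun; exact: sqrt_continuous.
by apply/funext => x; rewrite sqrtr_sqr ger0_norm// normc_ge0.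
Qed.

End cmeas.

Lemma cmeas_comp d1 d2 (T1 : measurableType d1) (T2 : measurableType d2)
    (R : realType) (f : T2 -> R[i]) (g : T1 -> T2) :
  cmeas f -> measurable_fun setT g -> cmeas (fun x => f (g x)).
Proof. by move=> [f1 f2] mg; split; [exact: (measurableT_comp f1)|exact: (measurableT_comp f2)]. Qed.

(** * Integrals of nonnegative functions and the Cauchy-Schwarz inequality *)

Section rint.
Context d {T : measurableType d} {R : realType} (mu : {measure set T -> \bar R}).
Implicit Types f g : T -> R.

Definition rint f : \bar R := (\int[mu]_x (f x)%:E)%E.

Lemma rint_ge0 f : (forall x, 0 <= f x) -> (0 <= rint f)%E.
Proof. by move=> f0; apply: integral_ge0 => x _; rewrite lee_fin. Qed.

Lemma rint_le f g : measurable_fun setT f -> measurable_fun setT g ->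
  (forall x, 0 <= f x) -> (forall x, f x <= g x) -> (rint f <= rint g)%E.
Proof.
move=> mf mg f0 fg; apply: ge0_le_integral => //.
- by move=> x _; rewrite lee_fin.
- exact/measurable_EFinP.
- exact/measurable_EFinP.
- by move=> x _; rewrite lee_fin.
Qed.

Lemma rint_ae_le f g : measurable_fun setT f -> measurable_fun setT g ->
  (forall x, 0 <= f x) -> (forall x, 0 <= g x) ->
  {ae mu, forall x, f x <= g x} -> (rint f <= rint g)%E.
Proof.
move=> mf mg f0 g0 fg; apply: ae_ge0_le_integral => //.
- by move=> x _; rewrite lee_fin.
- exact/measurable_EFinP.
- by move=> x _; rewrite lee_fin.
- exact/measurable_EFinP.
- by apply: filterS fg => x h _; rewrite lee_fin.
Qed.

Lemma rint_ae_eq f g : measurable_fun setT f -> measurable_fun setT g ->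
  (forall x, 0 <= f x) -> (forall x, 0 <= g x) ->
  {ae mu, forall x, f x = g x} -> rint f = rint g.
Proof.
move=> mf mg f0 g0 fg; apply/eqP; rewrite eq_le !rint_ae_le//.
- by apply: filterS fg => x ->.
- by apply: filterS fg => x ->.
Qed.

Lemma rintD f g : measurable_fun setT f -> measurable_fun setT g ->
  (forall x, 0 <= f x) -> (forall x, 0 <= g x) ->
  rint (fun x => f x + g x) = (rint f + rint g)%E.
Proof.
move=> mf mg f0 g0; rewrite /rint -ge0_integralD//.
- by move=> x _; rewrite lee_fin.
- exact/measurable_EFinP.
- by move=> x _; rewrite lee_fin.
- exact/measurable_EFinP.
Qed.

Lemma rintZ f (k : R) : measurable_fun setT f ->
  (forall x, 0 <= f x) -> 0 <= k -> rint (fun x => k * f x) = (k%:E * rint f)%E.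
Proof.
move=> mf f0 k0; rewrite /rint -ge0_integralZl_EFin//.
- by move=> x _; rewrite lee_fin.
- exact/measurable_EFinP.
Qed.

Lemma rint_eq0 f : measurable_fun setT f -> (forall x, 0 <= f x) ->
  (rint f <= 0)%E -> {ae mu, forall x, f x = 0}.
Proof.
move=> mf f0 h; have /ae_eq_integral_abs : (\int[mu]_x `|(f x)%:E|)%E = 0.
  apply/eqP; rewrite eq_le; apply/andP; split.
    apply: le_trans h; rewrite le_eqVlt; apply/orP; left; apply/eqP.
    by apply: eq_integral => x _; rewrite gee0_abs// lee_fin.
  by apply: integral_ge0 => x _.
move=> /(_ measurableT); have mEf : measurable_fun setT (EFin \o f) by exact/measurable_EFinP.
by move=> /(_ mEf); apply: filterS => x /(_ I) /= [].
Qed.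

Lemma fine_rint f : (forall x, 0 <= f x) -> (rint f < +oo)%E ->
  (fine (rint f))%:E = rint f.
Proof. by move=> f0 h; rewrite fineK// ge0_fin_numE// rint_ge0. Qed.

Lemma le_of_eps (r s c : R) : 0 <= c -> (forall e, 0 < e -> r <= s + e * c) -> r <= s.
Proof.
move=> c0 h; apply/ler_addgt0Pr => e e0.
have c1 : 0 < c + 1 by rewrite ltr_wpDl.
apply: (le_trans (h (e / (c + 1)) _)); first by rewrite divr_gt0.
rewrite lerD2l -mulrA ger_pMr// mulrC ler_pdivrMr// mul1r; lra.
Qed.

(** Integrate [f g <= t/2 f^2 + g^2/(2t)]. The best [t] is [B / A]; as [A] or [B] may vanish, it is
    replaced by [(B + e) / (A + e)], and [e] tends to [0] at the end through [le_of_eps]. *)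
Lemma rint_CS f g (A B : R) : measurable_fun setT f -> measurable_fun setT g ->
  (forall x, 0 <= f x) -> (forall x, 0 <= g x) -> 0 <= A -> 0 <= B ->
  (rint (fun x => (f x ^+ 2)%R) <= (A ^+ 2)%:E)%E ->
  (rint (fun x => (g x ^+ 2)%R) <= (B ^+ 2)%:E)%E ->
  (rint (fun x => (f x * g x)%R) <= (A * B)%:E)%E.
Proof.
move=> mf mg f0 g0 A0 B0 hA hB.
have mf2 : measurable_fun setT (fun x => f x ^+ 2) by exact: measurable_funX.
have mg2 : measurable_fun setT (fun x => g x ^+ 2) by exact: measurable_funX.
have gen (a b s u : R) : u * s = 1 -> 0 < s -> a * b <= u / 2 * a ^+ 2 + s / 2 * b ^+ 2.
  move=> us s0.
  have : 0 <= s * (u * a - b) ^+ 2 by rewrite mulr_ge0 ?sqr_ge0// ltW.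
  have -> : s * (u * a - b) ^+ 2 =
    (u * s) * u * a ^+ 2 - 2 * (u * s) * a * b + s * b ^+ 2 by ring.
  by rewrite us; lra.
have aux (s e u : R) : 0 <= s -> 0 < e -> 0 < u -> (s + e) * u = 1 -> u * s ^+ 2 <= s.
  move=> s0 e0 u0 h.
  have h1 : 0 <= u * e * s by rewrite !mulr_ge0// ltW.
  have h2 : (s + e) * u * s = s by rewrite h mul1r.
  by lra.
have key e : 0 < e -> (rint (fun x => (f x * g x)%R) <= (A * B + e * ((A + B) / 2))%:E)%E.
  move=> e0; pose t := (B + e) / (A + e).
  have Ae : 0 < A + e by rewrite ltr_wpDl.
  have Be : 0 < B + e by rewrite ltr_wpDl.
  have t0 : 0 < t by rewrite divr_gt0.
  have tt : t * t^-1 = 1 by rewrite mulfV// gt_eqF.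
  have ti0 : 0 < t^-1 by rewrite invr_gt0.
  apply: (@le_trans _ _ (rint (fun x => (t / 2 * f x ^+ 2 + t^-1 / 2 * g x ^+ 2)%R))).
    apply: rint_le.
    - exact: measurable_funM.
    - by apply: measurable_funD; apply: measurable_funM.
    - by move=> x; exact: mulr_ge0.
    - by move=> x; exact: gen.
  rewrite rintD//; last 4 first.
  - exact: measurable_funM.
  - exact: measurable_funM.
  - by move=> x; rewrite mulr_ge0 ?sqr_ge0// divr_ge0// ltW.
  - by move=> x; rewrite mulr_ge0 ?sqr_ge0// divr_ge0// ltW.
  rewrite !rintZ//; last 4 first.
  - by move=> x; exact: sqr_ge0.
  - by rewrite divr_ge0// ltW.
  - by move=> x; exact: sqr_ge0.
  - by rewrite divr_ge0// ltW.
  apply: (@le_trans _ _ ((t / 2)%:E * (A ^+ 2)%:E + (t^-1 / 2)%:E * (B ^+ 2)%:E)%E).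
    by apply: leeD; apply: lee_wpmul2l; rewrite ?lee_fin ?divr_ge0// ltW.
  rewrite -!EFinM -EFinD lee_fin /t invf_div.
  set u := (A + e)^-1; set v := (B + e)^-1.
  have hu : (A + e) * u = 1 by rewrite mulfV// gt_eqF.
  have hv : (B + e) * v = 1 by rewrite mulfV// gt_eqF.
  have u0 : 0 < u by rewrite invr_gt0.
  have v0 : 0 < v by rewrite invr_gt0.
  have h1 : u * A ^+ 2 <= A by exact: aux hu.
  have h2 : v * B ^+ 2 <= B by exact: aux hv.
  have h3 : (B + e) * (u * A ^+ 2) <= (B + e) * A by rewrite ler_pM2l.
  have h4 : (A + e) * (v * B ^+ 2) <= (A + e) * B by rewrite ler_pM2l.
  by clear -h3 h4; clearbody u v; lra.
have fg0 : (0 <= rint (fun x => (f x * g x)%R))%E by apply: rint_ge0 => x; exact: mulr_ge0.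
have fin : rint (fun x => (f x * g x)%R) \is a fin_num.
  by rewrite ge0_fin_numE//; apply: le_lt_trans (key 1 ltr01) _; rewrite ltry.
rewrite -(fineK fin) lee_fin; apply: (@le_of_eps _ _ ((A + B) / 2)).
  by rewrite divr_ge0// addr_ge0.
by move=> e e0; rewrite -lee_fin fineK//; exact: key.
Qed.

End rint.

(** * Complex integrals and squared L^2 norms *)

Section cint.
Context d {T : measurableType d} {R : realType} (mu : {measure set T -> \bar R}).
Implicit Types f g : T -> R[i].

Definition cL1 f := cmeas f /\ (rint mu (fun x => normc (f x)) < +oo)%E.

Definition cI f : R[i] :=
  (\int[mu]_x complex.Re (f x)) +i* (\int[mu]_x complex.Im (f x)).

Lemma cL1_Re f : cL1 f -> mu.-integrable setT (EFin \o (fun x => complex.Re (f x))).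
Proof.
move=> [[f1 f2] fi]; apply/integrableP; split; first exact/measurable_EFinP.
apply: le_lt_trans fi; apply: rint_le.
- exact: measurableT_comp.
- exact: measurable_normc.
- by [].
- by move=> x; exact: normc_geRe.
Qed.

Lemma cL1_Im f : cL1 f -> mu.-integrable setT (EFin \o (fun x => complex.Im (f x))).
Proof.
move=> [[f1 f2] fi]; apply/integrableP; split; first exact/measurable_EFinP.
apply: le_lt_trans fi; apply: rint_le.
- exact: measurableT_comp.
- exact: measurable_normc.
- by [].
- by move=> x; exact: normc_geIm.
Qed.

Lemma cL1_le f (g : T -> R) : cmeas f -> measurable_fun setT g ->
  (forall x, normc (f x) <= g x) -> (rint mu g < +oo)%E -> cL1 f.
Proof.
move=> mf mg fg gi; split => //; apply: le_lt_trans gi; apply: rint_le => //.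
- exact: measurable_normc.
- by move=> x; exact: normc_ge0.
Qed.

Lemma cL1D f g : cL1 f -> cL1 g -> cL1 (fun x => f x + g x).
Proof.
move=> [mf fi] [mg gi]; apply: (@cL1_le _ (fun x => normc (f x) + normc (g x))).
- exact: cmeasD.
- by apply: measurable_funD; exact: measurable_normc.
- by move=> x; exact: le_normcD.
- rewrite rintD; [exact: lte_add_pinfty|exact: measurable_normc|exact: measurable_normc| |].
    by move=> x; exact: normc_ge0.
  by move=> x; exact: normc_ge0.
Qed.

Lemma cL1Z (c : R[i]) f : cL1 f -> cL1 (fun x => c * f x).
Proof.
move=> [mf fi]; apply: (@cL1_le _ (fun x => normc c * normc (f x))).
- by apply: cmeasM => //; exact: cmeas_cst.
- by apply: measurable_funM => //; exact: measurable_normc.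
- by move=> x; rewrite normcM.
- rewrite rintZ ?normc_ge0//; [|exact: measurable_normc|by move=> x; exact: normc_ge0].
  by rewrite lte_mul_pinfty// lee_fin normc_ge0.
Qed.

Lemma cL1N f : cL1 f -> cL1 (fun x => - f x).
Proof. by move=> /(cL1Z (-1)); under eq_fun do rewrite mulN1r. Qed.

Lemma cL1B f g : cL1 f -> cL1 g -> cL1 (fun x => f x - g x).
Proof. by move=> h1 h2; apply: cL1D => //; exact: cL1N. Qed.

Lemma cL1_0 : cL1 (fun=> 0).
Proof.
split; first exact: cmeas_cst.
by rewrite /rint; under eq_integral do rewrite normc0; rewrite integral0 ltry.
Qed.

Lemma cID f g : cL1 f -> cL1 g -> cI (fun x => f x + g x) = cI f + cI g.
Proof.
move=> hf hg; rewrite /cI; apply: ReImE => /=.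
  under eq_Rintegral do rewrite cReD.
  by rewrite RintegralD//; exact: cL1_Re.
under eq_Rintegral do rewrite cImD.
by rewrite RintegralD//; exact: cL1_Im.
Qed.

Lemma cIZ (c : R[i]) f : cL1 f -> cI (fun x => c * f x) = c * cI f.
Proof.
move=> hf; rewrite /cI; apply: ReImE; rewrite (cReM, cImM)/=.
  under eq_Rintegral do rewrite cReM.
  rewrite RintegralB ?RintegralZl//; try by [exact: cL1_Re|exact: cL1_Im].
    exact: (integrableZl measurableT (complex.Re c) (cL1_Re hf)).
  exact: (integrableZl measurableT (complex.Im c) (cL1_Im hf)).
under eq_Rintegral do rewrite cImM.
rewrite RintegralD ?RintegralZl//; try by [exact: cL1_Re|exact: cL1_Im].
  exact: (integrableZl measurableT (complex.Re c) (cL1_Im hf)).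
exact: (integrableZl measurableT (complex.Im c) (cL1_Re hf)).
Qed.

Lemma cIN f : cL1 f -> cI (fun x => - f x) = - cI f.
Proof.
move=> hf; rewrite -mulN1r -cIZ//; congr cI; apply/funext => x.
by rewrite mulN1r.
Qed.

Lemma cIB f g : cL1 f -> cL1 g -> cI (fun x => f x - g x) = cI f - cI g.
Proof. by move=> hf hg; rewrite cID ?cIN//; exact: cL1N. Qed.

Lemma cI_ae f g : cmeas f -> cmeas g -> {ae mu, forall x, f x = g x} -> cI f = cI g.
Proof.
move=> [f1 f2] [g1 g2] fg; rewrite /cI /Rintegral; congr (fine _ +i* fine _).
  apply: ae_eq_integral => //; try exact/measurable_EFinP.
  by apply: filterS fg => x -> _.
apply: ae_eq_integral => //; try exact/measurable_EFinP.
by apply: filterS fg => x -> _.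
Qed.

Lemma cI_eq f g : (forall x, f x = g x) -> cI f = cI g.
Proof. by move=> h; congr cI; apply/funext. Qed.

Lemma cI0 : cI (fun=> 0) = 0.
Proof.
rewrite /cI /Rintegral /=; by rewrite integral0.
Qed.

Lemma norm_cI f : cmeas f -> ((normc (cI f))%:E <= rint mu (fun x => normc (f x)))%E.
Proof.
move=> mf; have [fi|] := boolP (rint mu (fun x => normc (f x)) < +oo)%E; last first.
  by rewrite -leNgt leye_eq => /eqP ->; rewrite leey.
have hf : cL1 f by split.
have [/normc_eq0P ->|n0] := eqVneq (normc (cI f)) 0.
  by rewrite normc0; apply: rint_ge0 => x; exact: normc_ge0.
(* A unimodular factor that turns the integral into its modulus. Only the real part of [c * f] then
   contributes, and it is at most the modulus of [f]. *)
pose c := ((cI f)^*)%C * ((normc (cI f))^-1)%:C.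
have nc : normc c = 1.
  by rewrite /c normcM normcJ_real normc_real ger0_norm ?invr_ge0 ?normc_ge0// mulfV.
have -> : normc (cI f) = complex.Re (cI (fun x => c * f x)).
  rewrite cIZ// /c; have h := normc_sqr (cI f).
  rewrite mulrAC cReMr; move: h n0; case: (cI f) => a b.
  rewrite [complex.Re (_ +i* _)]/= [complex.Im (_ +i* _)]/= => h n0.
  have -> : complex.Re ((a +i* b)^*%C * (a +i* b)) = normc (a +i* b) ^+ 2.
    by rewrite h /=; ring.
  by rewrite expr2 mulfK.
apply: (@le_trans _ _ (rint mu (fun x => `|complex.Re (c * f x)|))).
  have h := cL1_Re (cL1Z c hf).
  have := le_abse_integral mu measurableT (measurable_int _ h).
  apply: le_trans; rewrite /= /Rintegral -[X in (_ <= `|X|)%E]fineK.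
    by rewrite abse_EFin lee_fin ler_norm.
  exact: integrable_fin_num.
apply: rint_le => //.
- by apply: measurableT_comp => //; have [[]] := cL1Z c hf.
- exact: measurable_normc.
- by move=> x; apply: le_trans (normc_geRe _) _; rewrite normcM nc mul1r.
Qed.

Lemma norm_cI_le f (g : T -> R) (A : R) : cmeas f -> measurable_fun setT g ->
  (forall x, normc (f x) <= g x) -> (rint mu g <= A%:E)%E -> normc (cI f) <= A.
Proof.
move=> mf mg fg hA; rewrite -lee_fin; apply: le_trans (norm_cI mf) _.
apply: le_trans hA; apply: rint_le => //; first exact: measurable_normc.
by move=> x; exact: normc_ge0.
Qed.

Definition N2 f : \bar R := rint mu (fun x => normc (f x) ^+ 2).

Lemma N2_ge0 f : (0 <= N2 f)%E.
Proof. by apply: rint_ge0 => x; exact: sqr_ge0. Qed.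

Lemma N2_le f g : cmeas f -> cmeas g -> (forall x, normc (f x) <= normc (g x)) ->
  (N2 f <= N2 g)%E.
Proof.
move=> mf mg h; apply: rint_le.
- exact: measurable_normc_sq.
- exact: measurable_normc_sq.
- by move=> x; exact: sqr_ge0.
- by move=> x; rewrite lerXn2r// nnegrE normc_ge0.
Qed.

Lemma N2D f g : cmeas f -> cmeas g ->
  (N2 (fun x => f x + g x)%R <= 2%:E * (N2 f + N2 g))%E.
Proof.
move=> mf mg.
have m1 := measurable_normc_sq mf; have m2 := measurable_normc_sq mg.
have -> : (2%:E * (N2 f + N2 g) =
   rint mu (fun x => 2 * (normc (f x) ^+ 2 + normc (g x) ^+ 2))%R)%E.
  rewrite rintZ ?rintD//; try by move=> x; rewrite ?addr_ge0 ?sqr_ge0.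
  exact: measurable_funD.
apply: rint_le.
- by apply: measurable_normc_sq; exact: cmeasD.
- by apply: measurable_funM => //; exact: measurable_funD.
- by move=> x; exact: sqr_ge0.
- by move=> x; rewrite mulrDr; exact: normc_sqD.
Qed.

Lemma N2Z (c : R[i]) f : cmeas f -> N2 (fun x => c * f x) = ((normc c ^+ 2)%:E * N2 f)%E.
Proof.
move=> mf; rewrite /N2 -rintZ ?sqr_ge0//; last 2 first.
- exact: measurable_normc_sq.
- by move=> x; exact: sqr_ge0.
- by congr rint; apply/funext => x; rewrite normcM exprMn.
Qed.

Lemma N2_ae f g : cmeas f -> cmeas g -> {ae mu, forall x, f x = g x} -> N2 f = N2 g.
Proof.
move=> mf mg fg; apply: rint_ae_eq; try exact: measurable_normc_sq.
- by move=> x; exact: sqr_ge0.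
- by move=> x; exact: sqr_ge0.
- by apply: filterS fg => x ->.
Qed.

Lemma N2_eq0 f : cmeas f -> (N2 f <= 0)%E -> {ae mu, forall x, f x = 0}.
Proof.
move=> mf /rint_eq0 h; have := h (measurable_normc_sq mf) (fun x => sqr_ge0 _).
by apply: filterS => x /eqP; rewrite sqrf_eq0 => /eqP /normc_eq0P.
Qed.

Lemma cCS f g (A B : R) : cmeas f -> cmeas g -> 0 <= A -> 0 <= B ->
  (N2 f <= (A ^+ 2)%:E)%E -> (N2 g <= (B ^+ 2)%:E)%E ->
  (rint mu (fun x => normc (f x * g x)%R) <= (A * B)%:E)%E.
Proof.
move=> mf mg A0 B0 hA hB.
rewrite (_ : (fun x => _) = (fun x => normc (f x) * normc (g x))); last first.
  by apply/funext => x; rewrite normcM.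
apply: rint_CS => //; try exact: measurable_normc.
- by move=> x; exact: normc_ge0.
- by move=> x; exact: normc_ge0.
Qed.

Lemma N2_fin f : (N2 f < +oo)%E -> N2 f = ((Num.sqrt (fine (N2 f))) ^+ 2)%:E.
Proof.
move=> h; rewrite sqr_sqrtr ?fine_ge0 ?N2_ge0// fineK// ge0_fin_numE// N2_ge0//.
Qed.

Lemma cL1_CS f g : cmeas f -> cmeas g -> (N2 f < +oo)%E -> (N2 g < +oo)%E ->
  cL1 (fun x => f x * g x).
Proof.
move=> mf mg hf hg; split; first exact: cmeasM.
have := @cCS f g _ _ mf mg (sqrtr_ge0 (fine (N2 f))) (sqrtr_ge0 (fine (N2 g))).
rewrite -!N2_fin// => /(_ (lexx _) (lexx _)) h; apply: le_lt_trans h _; exact: ltry.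
Qed.

Lemma N2_fineD f g : cmeas f -> cmeas g -> (N2 f < +oo)%E -> (N2 g < +oo)%E ->
  (N2 (fun x => f x + g x)%R < +oo)%E.
Proof.
move=> mf mg hf hg; apply: le_lt_trans (N2D mf mg) _.
by apply: lte_mul_pinfty => //; exact: lte_add_pinfty.
Qed.

(* [A] only needs to dominate the total mass of the weight [m]; this avoids
   the indeterminate product [0 * oo]. *)
Lemma weighted_CS (m : T -> R) f (A : R) : measurable_fun setT m ->
  (forall x, 0 <= m x) -> 0 < A -> (rint mu m <= A%:E)%E -> cmeas f ->
  ((normc (cI (fun x => (m x)%:C * f x)) ^+ 2)%:E <=
    A%:E * rint mu (fun x => (m x * normc (f x) ^+ 2)%R))%E.
Proof.
move=> mm m0 A0 hA mf.
set B := rint _ _.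
have B0 : (0 <= B)%E.
  by apply: rint_ge0 => x; rewrite mulr_ge0 ?sqr_ge0.
have msq : measurable_fun setT (fun x => Num.sqrt (m x)).
  apply: (measurableT_comp _ mm).
  by apply: continuous_measurable_fun; exact: sqrt_continuous.
have mn := measurable_normc mf.
have [Bfin|] := boolP (B < +oo)%E; last first.
  rewrite -leNgt leye_eq => /eqP ->; rewrite gt0_muley ?leey//.
have BE : B = (Num.sqrt (fine B) ^+ 2)%:E.
  by rewrite sqr_sqrtr ?fine_ge0// fineK// ge0_fin_numE.
have AE : A = Num.sqrt A ^+ 2 by rewrite sqr_sqrtr// ltW.
have mcf : cmeas (fun x => (m x)%:C * f x).
  by apply: cmeasM => //; exact: cmeas_real.
have : (rint mu (fun x => (Num.sqrt (m x) * (Num.sqrt (m x) * normc (f x)))%R) <=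
    (Num.sqrt A * Num.sqrt (fine B))%:E)%E.
  apply: rint_CS => //.
  - exact: measurable_funM.
  - by move=> x; rewrite mulr_ge0// normc_ge0.
  - rewrite -AE; apply: le_trans hA.
    by rewrite le_eqVlt; apply/orP; left; apply/eqP; congr rint; apply/funext => x; rewrite sqr_sqrtr.
  - rewrite -BE le_eqVlt; apply/orP; left; apply/eqP; congr rint; apply/funext => x.
    by rewrite exprMn sqr_sqrtr.
move=> h; have h1 : normc (cI (fun x => (m x)%:C * f x)) <= Num.sqrt A * Num.sqrt (fine B).
  rewrite -lee_fin; apply: le_trans (norm_cI mcf) _; apply: le_trans h.
  rewrite le_eqVlt; apply/orP; left; apply/eqP; congr rint; apply/funext => x.
  by rewrite normcM normc_real ger0_norm// mulrA -expr2 sqr_sqrtr.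
by rewrite BE -EFinM lee_fin [X in _ <= X * _]AE -exprMn lerXn2r// nnegrE ?normc_ge0// mulr_ge0.
Qed.

End cint.
Arguments cI {d T R} mu f.
Arguments N2 {d T R} mu f.
Arguments cL1 {d T R} mu f.

(** * Fubini's theorem and Minkowski's integral inequality *)

Section fubini.
Context d1 d2 {T1 : measurableType d1} {T2 : measurableType d2} {R : realType}
  (m1 : {sigma_finite_measure set T1 -> \bar R})
  (m2 : {sigma_finite_measure set T2 -> \bar R}).
Implicit Types F : T1 * T2 -> R[i].

Lemma measurable_fun_slice1 d (T : measurableType d) (h : T1 * T2 -> T) (x : T1) :
  measurable_fun setT h -> measurable_fun setT (fun y => h (x, y)).
Proof. by move=> mh; apply: (measurableT_comp mh); exact: measurable_pair1. Qed.

Lemma measurable_fun_slice2 d (T : measurableType d) (h : T1 * T2 -> T) (y : T2) :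
  measurable_fun setT h -> measurable_fun setT (fun x => h (x, y)).
Proof. by move=> mh; apply: (measurableT_comp mh); exact: measurable_pair2. Qed.

Lemma cmeas_slice1 F x : cmeas F -> cmeas (fun y => F (x, y)).
Proof. by move=> [h1 h2]; split; [exact: (measurable_fun_slice1 _ h1)|exact: (measurable_fun_slice1 _ h2)]. Qed.

Lemma cmeas_slice2 F y : cmeas F -> cmeas (fun x => F (x, y)).
Proof. by move=> [h1 h2]; split; [exact: (measurable_fun_slice2 _ h1)|exact: (measurable_fun_slice2 _ h2)]. Qed.

Lemma rint_tonelli (h : T1 * T2 -> R) : measurable_fun setT h -> (forall x, 0 <= h x) ->
  (\int[m1]_x rint m2 (fun y => h (x, y)) = \int[m2]_y rint m1 (fun x => h (x, y)))%E.
Proof.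
move=> mh h0; apply: (fubini_tonelli (EFin \o h)).
- exact/measurable_EFinP.
- by move=> x; rewrite /= lee_fin.
Qed.

End fubini.

Section fubini_measurable.
Context d1 d2 {T1 : measurableType d1} {T2 : measurableType d2} {R : realType}
  (m2 : {sigma_finite_measure set T2 -> \bar R}).

Lemma measurable_rint (h : T1 * T2 -> R) : measurable_fun setT h -> (forall x, 0 <= h x) ->
  measurable_fun setT (fun x => rint m2 (fun y => h (x, y))).
Proof.
move=> mh h0; apply: (measurable_fun_fubini_tonelli_F (EFin \o h)).
- exact/measurable_EFinP.
- by move=> x; rewrite /= lee_fin.
Qed.

(** The integral of a slice is a difference of two measurable extended-valued functions, and [fine]
    is measurable and sends infinite values to [0]; slices that fail to be integrable therefore do
    no harm. *)
Lemma measurable_Rint (h : T1 * T2 -> R) : measurable_fun setT h ->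
  measurable_fun setT (fun x => \int[m2]_y h (x, y)).
Proof.
move=> mh; have mEh : measurable_fun setT (EFin \o h) by exact/measurable_EFinP.
rewrite /Rintegral; under eq_fun do rewrite integralE.
apply: (measurableT_comp (fine_measurable measurableT)); apply: emeasurable_funB.
- rewrite (_ : (fun x => _) = fubini_F m2 ((EFin \o h)^\+)%E); last first.
    by apply/funext => x; apply: eq_integral => y _; rewrite !funeposE.
  apply: measurable_fun_fubini_tonelli_F; last by move=> x; exact: funepos_ge0.
  exact: measurable_funepos.
- rewrite (_ : (fun x => _) = fubini_F m2 ((EFin \o h)^\-)%E); last first.
    by apply/funext => x; apply: eq_integral => y _; rewrite !funenegE.
  apply: measurable_fun_fubini_tonelli_F; last by move=> x; exact: funeneg_ge0.
  exact: measurable_funeneg.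
Qed.

Lemma cmeas_cI (F : T1 * T2 -> R[i]) : cmeas F -> cmeas (fun x => cI m2 (fun y => F (x, y))).
Proof.
move=> [h1 h2]; rewrite /cmeas /=.
have h1' := measurable_Rint h1; have h2' := measurable_Rint h2.
by split.
Qed.

End fubini_measurable.

Section fubini_complex.
Context d1 d2 {T1 : measurableType d1} {T2 : measurableType d2} {R : realType}
  (m1 : {sigma_finite_measure set T1 -> \bar R})
  (m2 : {sigma_finite_measure set T2 -> \bar R}).
Implicit Types F : T1 * T2 -> R[i].

Lemma cL1_prod F : cmeas F ->
  (\int[m1]_x rint m2 (fun y => normc (F (x, y))) < +oo)%E -> cL1 (m1 \x m2)%E F.
Proof.
move=> mF hF; split => //; rewrite /rint.
have mn := measurable_normc mF.
rewrite (@fubini_tonelli1 _ _ _ _ _ m1 m2 (EFin \o (fun z => normc (F z))))//.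
  exact/measurable_EFinP.
by move=> x; rewrite /= lee_fin normc_ge0.
Qed.

(** The real-valued inner integral coincides with the extended one where the slice is integrable,
    that is for almost every [x], which is enough under the outer integral. *)
Lemma Rintegral_prod1 (h : T1 * T2 -> R) : (m1 \x m2)%E.-integrable setT (EFin \o h) ->
  \int[m1]_x \int[m2]_y h (x, y) = \int[(m1 \x m2)%E]_z h z.
Proof.
move=> ih; rewrite /Rintegral -(integral12_prod_meas1 ih).
congr fine; apply: ae_eq_integral => //.
- have mh : measurable_fun setT h by apply/measurable_EFinP; exact: measurable_int ih.
  by apply/measurable_EFinP; exact: (measurable_Rint m2 mh).
- exact: measurable_fubini_F ih.
- have := ae_integrable1 ih; apply: filterS => x ix _ /=.
  by rewrite /fubini_F fineK//; exact: integrable_fin_num.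
Qed.

Lemma Rintegral_prod2 (h : T1 * T2 -> R) : (m1 \x m2)%E.-integrable setT (EFin \o h) ->
  \int[m2]_y \int[m1]_x h (x, y) = \int[(m1 \x m2)%E]_z h z.
Proof.
move=> ih; rewrite /Rintegral -(integral21_prod_meas1 ih).
congr fine; apply: ae_eq_integral => //.
- have mh : measurable_fun setT h by apply/measurable_EFinP; exact: measurable_int ih.
  have mhs : measurable_fun setT (fun z : T2 * T1 => h (z.2, z.1)).
    by apply: (measurableT_comp mh); exact: measurable_fun_pair measurable_snd measurable_fst.
  by apply/measurable_EFinP; exact: (measurable_Rint m1 mhs).
- exact: measurable_fubini_G ih.
- have := ae_integrable2 ih; apply: filterS => x ix _ /=.
  by rewrite /fubini_G fineK//; exact: integrable_fin_num.
Qed.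

Lemma cI_fubini F : cmeas F ->
  (\int[m1]_x rint m2 (fun y => normc (F (x, y))) < +oo)%E ->
  cI m1 (fun x => cI m2 (fun y => F (x, y))) = cI m2 (fun y => cI m1 (fun x => F (x, y))).
Proof.
move=> mF hF; have h := cL1_prod mF hF.
rewrite /cI /=; apply: ReImE => /=.
  by rewrite (Rintegral_prod1 (cL1_Re h)) -(Rintegral_prod2 (cL1_Re h)).
by rewrite (Rintegral_prod1 (cL1_Im h)) -(Rintegral_prod2 (cL1_Im h)).
Qed.

Lemma cL1_cI F : cmeas F ->
  (\int[m1]_x rint m2 (fun y => normc (F (x, y))) < +oo)%E ->
  cL1 m1 (fun x => cI m2 (fun y => F (x, y))).
Proof.
move=> mF hF; split; first exact: cmeas_cI.
apply: le_lt_trans hF; apply: ge0_le_integral => //.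
- by move=> x _; rewrite lee_fin normc_ge0.
- by apply/measurable_EFinP; apply: measurable_normc; exact: cmeas_cI.
- exact: (measurable_rint m2 (measurable_normc mF) (fun z => normc_ge0 _)).
- by move=> x _; apply: norm_cI; exact: cmeas_slice1.
Qed.

(** For each [y], Cauchy-Schwarz with weight [m] bounds the squared inner integral by [A] times the
    integral of [m |F|^2]; Tonelli then exchanges the integrals. In the applications [m] is an
    exponential, a uniform average over []0, s[], or the modulus of an exponentially weighted
    profile. *)
Lemma minkowski_integral_sq (m : T1 -> R) F (A : R) : measurable_fun setT m -> (forall x, 0 <= m x) ->
  0 < A -> (rint m1 m <= A%:E)%E -> cmeas F ->
  (N2 m2 (fun y => cI m1 (fun x => (m x)%:C * F (x, y))%R) <=
   A%:E * \int[m1]_x ((m x)%:E * N2 m2 (fun y => F (x, y))))%E.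
Proof.
move=> mm m0 A0 hA mF.
have mmF : measurable_fun setT (fun z : T1 * T2 => m z.1 * normc (F z) ^+ 2).
  apply: measurable_funM; last exact: measurable_normc_sq.
  exact: (measurableT_comp mm).
have mmF0 z : 0 <= m z.1 * normc (F z) ^+ 2 by rewrite mulr_ge0// sqr_ge0.
have -> : (\int[m1]_x ((m x)%:E * N2 m2 (fun y => F (x, y))) =
    \int[m2]_y rint m1 (fun x => m x * normc (F (x, y)) ^+ 2)%R)%E.
  rewrite -(rint_tonelli m1 m2 mmF)//; apply: eq_integral => x _.
  rewrite /N2 -rintZ//; first exact: (measurable_normc_sq (cmeas_slice1 _ mF)).
  by move=> y; exact: sqr_ge0.
rewrite -ge0_integralZl//; last 3 first.
- rewrite (_ : (fun y => _) = fubini_G m1 (EFin \o (fun z : T1 * T2 => m z.1 * normc (F z) ^+ 2)))//.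
  by apply: measurable_fun_fubini_tonelli_G; [exact/measurable_EFinP|move=> z; rewrite /= lee_fin].
- by move=> y _; apply: rint_ge0 => x; exact: (mmF0 (x, y)).
- by rewrite lee_fin ltW.
have mmF' : cmeas (fun z : T2 * T1 => (m z.2)%:C * F (z.2, z.1)).
  apply: cmeasM; first by apply: cmeas_real; exact: (measurableT_comp mm).
  by apply: (cmeas_comp mF); exact: measurable_fun_pair measurable_snd measurable_fst.
apply: ge0_le_integral => //.
- by move=> y _; rewrite lee_fin sqr_ge0.
- apply/measurable_EFinP; apply: measurable_normc_sq.
  exact: (cmeas_cI m1 mmF').
- apply: measurable_funeM.
  rewrite (_ : (fun y => _) = fubini_G m1 (EFin \o (fun z : T1 * T2 => m z.1 * normc (F z) ^+ 2)))//.
  by apply: measurable_fun_fubini_tonelli_G; [exact/measurable_EFinP|move=> z; rewrite /= lee_fin].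
- by move=> y _; apply: weighted_CS => //; exact: cmeas_slice2.
Qed.

End fubini_complex.

#[global] Instance lebesgue_ae_filter (R : realType) :
  Filter (nbhs (almost_everywhere (@lebesgue_measure R))).
Proof. exact: (ae_filter_ringOfSetsType (@lebesgue_measure R)). Qed.

(** * Invariance of Lebesgue measure under translation and reflection *)

Section lebesgue_invariance.
Context {R : realType}.
Notation mu := (@lebesgue_measure R).

Lemma lebesgue_measure_shift (c : R) (A : set R) : measurable A ->
  pushforward mu ((fun x => x + c) : _ -> measurableTypeR R) A = mu A.
Proof.
have mshift : measurable_fun setT (fun x : R => x + c) by exact: measurable_funD.
move=> mA; apply/esym/lebesgue_measure_unique => //= _ [[a b]] _ <-.
rewrite /pushforward.
have -> : (fun x : R => x + c) @^-1` `]a, b] = `]a - c, b - c]%classic.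
  by apply/seteqP; split => x /=; rewrite !in_itv/= ltrBlDr lerBrDr.
rewrite !lebesgue_measure_itv/= !lte_fin ltrD2r -!EFinB.
by case: ifP => // _; congr EFin; ring.
Qed.

Section invariant_map.
Variable phi : R -> R.
Hypothesis mphi : measurable_fun setT phi.
Hypothesis phimu : forall A, measurable A ->
  pushforward mu (phi : _ -> measurableTypeR R) A = mu A.

Lemma ge0_integral_invariant (f : R -> \bar R) : measurable_fun setT f ->
  (forall x, 0 <= f x)%E -> (\int[mu]_x f (phi x) = \int[mu]_x f x)%E.
Proof.
move=> mf f0.
have := @ge0_integral_pushforward _ _ (measurableTypeR R) (measurableTypeR R) R phi mphi mu setT f measurableT mf.
rewrite preimage_setT => <-; last by move=> x _; exact: f0.
by apply: eq_measure_integral => A mA _; exact: phimu.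
Qed.

Lemma integral_invariant (f : R -> \bar R) : measurable_fun setT f ->
  (\int[mu]_x f (phi x) = \int[mu]_x f x)%E.
Proof.
move=> mf; rewrite integralE [RHS]integralE; congr (_ - _)%E.
  rewrite -(ge0_integral_invariant (measurable_funepos mf))//.
  by apply: eq_integral => x _; rewrite !funeposE.
rewrite -(ge0_integral_invariant (measurable_funeneg mf))//.
by apply: eq_integral => x _; rewrite !funenegE.
Qed.

Lemma cI_invariant (f : R -> R[i]) : cmeas f -> cI mu (fun x => f (phi x)) = cI mu f.
Proof.
move=> [f1 f2]; rewrite /cI /Rintegral; congr (fine _ +i* fine _).
  by rewrite (integral_invariant (f := fun x => (complex.Re (f x))%:E))//; exact/measurable_EFinP.
by rewrite (integral_invariant (f := fun x => (complex.Im (f x))%:E))//; exact/measurable_EFinP.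
Qed.

Lemma rint_invariant (f : R -> R) : measurable_fun setT f ->
  rint mu (fun x => f (phi x)) = rint mu f.
Proof.
move=> mf; rewrite /rint (integral_invariant (f := fun x => (f x)%:E))//; exact/measurable_EFinP.
Qed.

End invariant_map.

Lemma cI_shift (c : R) (f : R -> R[i]) : cmeas f -> cI mu (fun x => f (x + c)) = cI mu f.
Proof. by apply: cI_invariant; [exact: measurable_funD|exact: lebesgue_measure_shift]. Qed.

Lemma cI_opp (f : R -> R[i]) : cmeas f -> cI mu (fun x => f (- x)) = cI mu f.
Proof. by apply: cI_invariant; [exact: oppr_measurable|exact: lebesgue_measureN]. Qed.

Lemma rint_shift (c : R) (f : R -> R) : measurable_fun setT f ->
  rint mu (fun x => f (x + c)) = rint mu f.
Proof. by apply: rint_invariant; [exact: measurable_funD|exact: lebesgue_measure_shift]. Qed.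

Lemma rint_opp (f : R -> R) : measurable_fun setT f -> rint mu (fun x => f (- x)) = rint mu f.
Proof. by apply: rint_invariant; [exact: oppr_measurable|exact: lebesgue_measureN]. Qed.

Lemma ae_invariant (phi : R -> R) (P : R -> Prop) : measurable_fun setT phi ->
  (forall A, measurable A -> pushforward mu (phi : _ -> measurableTypeR R) A = mu A) ->
  {ae mu, forall x, P x} -> {ae mu, forall x, P (phi x)}.
Proof.
move=> mphi h [A [mA A0 hA]]; exists (phi @^-1` A); split.
- by have := mphi measurableT _ mA; rewrite setTI.
- by have := h _ mA; rewrite A0.
- by move=> x /= hx; apply: hA.
Qed.

Lemma ae_shift (c : R) (P : R -> Prop) :
  {ae mu, forall x, P x} -> {ae mu, forall x, P (x + c)}.
Proof. by apply: ae_invariant; [exact: measurable_funD|exact: lebesgue_measure_shift]. Qed.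

End lebesgue_invariance.

(** * The space L^2(0, oo) *)

Section halfline_L2.
Context {R : realType}.
Notation mu := (@lebesgue_measure R).
Implicit Types f g h : R -> R[i].

(** Extension by zero to the whole line, where translations, reflections and Fubini apply without
    any bookkeeping of domains. *)
Definition pos f : R -> R[i] := fun x => if 0 < x then f x else 0.

Lemma measurable_halfline : measurable (@halfline R).
Proof. exact: measurable_itv. Qed.
Hint Resolve measurable_halfline : core.

Lemma halflineE (x : R) : halfline x = (0 < x) :> Prop.
Proof. by rewrite /halfline /= in_itv/= andbT. Qed.

Lemma mem_halfline (x : R) : (x \in @halfline R) = (0 < x).
Proof. by apply/idP/idP; rewrite inE halflineE. Qed.

Lemma cmeas_pos f : cmeas (pos f) <->
  measurable_fun (@halfline R) (fun x => complex.Re (f x)) /\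
  measurable_fun (@halfline R) (fun x => complex.Im (f x)).
Proof.
have h1 : (fun x => complex.Re (pos f x)) = (fun x => complex.Re (f x)) \_ (@halfline R).
  by apply/funext => x; rewrite /pos patchE mem_halfline; case: ifP.
have h2 : (fun x => complex.Im (pos f x)) = (fun x => complex.Im (f x)) \_ (@halfline R).
  by apply/funext => x; rewrite /pos patchE mem_halfline; case: ifP.
rewrite /cmeas h1 h2.
by rewrite -!(measurable_restrictT _ measurable_halfline).
Qed.

Lemma cmeas_pos_of f : cmeas f -> cmeas (pos f).
Proof.
by move=> mf; apply: cmeas_if mf (cmeas_cst _); exact: measurable_fun_ltr.
Qed.

Lemma integralCE f : integralC f = cI mu (pos f).
Proof.
rewrite /integralC /cI; congr (_ +i* _); rewrite Rintegral_mkcond;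
  by apply: eq_Rintegral => x _; rewrite /pos patchE mem_halfline; case: ifP.
Qed.

Lemma pairingE f g : pairing f g = cI mu (fun x => pos f x * pos g x).
Proof.
rewrite /pairing integralCE; apply: cI_eq => x.
by rewrite /pos; case: ifP; rewrite ?mul0r.
Qed.

Lemma integral_halfline_normc f :
  (\int[mu]_(x in @halfline R) ((normc (f x)) ^+ 2)%:E)%E = N2 mu (pos f).
Proof.
rewrite integral_mkcond /N2 /rint; apply: eq_integral => x _.
by rewrite patchE mem_halfline /pos; case: ifP => //; rewrite normc0 expr0n.
Qed.

Lemma L2P f : L2 f <-> cmeas (pos f) /\ (N2 mu (pos f) < +oo)%E.
Proof.
rewrite /L2 /= integral_halfline_normc; split.
  by move=> [h1 h2 h3]; split => //; apply/cmeas_pos.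
by move=> [/cmeas_pos [h1 h2] h3].
Qed.

(** Estimates are made on the squared norm: [n2D] replaces the triangle inequality at the cost of a
    factor [2], and square roots disappear. *)
Definition n2 f : R := fine (N2 mu (pos f)).

Lemma n2_ge0 f : 0 <= n2 f.
Proof. by rewrite fine_ge0// N2_ge0. Qed.

Lemma normL2E f : normL2 f = Num.sqrt (n2 f).
Proof. by rewrite /normL2 /Rintegral integral_halfline_normc. Qed.

Lemma normL2_sqr f : normL2 f ^+ 2 = n2 f.
Proof. by rewrite normL2E sqr_sqrtr// n2_ge0. Qed.

Lemma normL2_ge0 f : 0 <= normL2 f.
Proof. by rewrite normL2E. Qed.

Lemma n2E f : L2 f -> N2 mu (pos f) = (n2 f)%:E.
Proof. by move=> /L2P [_ h]; rewrite /n2 fineK// ge0_fin_numE// N2_ge0. Qed.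

Lemma N2_n2_le f (A : R) : L2 f -> (N2 mu (pos f) <= A%:E)%E -> n2 f <= A.
Proof. by move=> hf; rewrite n2E// lee_fin. Qed.

Lemma posD f g : pos (fun x => f x + g x) = (fun x => pos f x + pos g x).
Proof. by apply/funext => x; rewrite /pos; case: ifP => // _; rewrite addr0. Qed.

Lemma posZ (c : R[i]) f : pos (fun x => c * f x) = (fun x => c * pos f x).
Proof. by apply/funext => x; rewrite /pos; case: ifP => // _; rewrite mulr0. Qed.

Lemma posB f g : pos (fun x => f x - g x) = (fun x => pos f x - pos g x).
Proof. by apply/funext => x; rewrite /pos; case: ifP => // _; rewrite subr0. Qed.

Lemma pos_pos f : pos (pos f) = pos f.
Proof. by apply/funext => x; rewrite /pos; case: ifP => // ->. Qed.

Lemma L2_pos f : L2 (pos f) <-> L2 f.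
Proof. by rewrite !L2P pos_pos. Qed.

Lemma L2_0 : L2 (fun _ : R => 0 : R[i]).
Proof.
apply/L2P; have -> : pos (fun=> 0) = fun=> 0 by apply/funext => x; rewrite /pos if_same.
split; first exact: cmeas_cst.
rewrite /N2 /rint; under eq_integral do rewrite normc0 expr0n.
by rewrite integral0.
Qed.

Lemma L2D f g : L2 f -> L2 g -> L2 (fun x => f x + g x).
Proof.
move=> /L2P [mf hf] /L2P [mg hg]; apply/L2P; rewrite posD; split.
  exact: cmeasD.
exact: N2_fineD.
Qed.

Lemma L2Z (c : R[i]) f : L2 f -> L2 (fun x => c * f x).
Proof.
move=> /L2P [mf hf]; apply/L2P; rewrite posZ; split.
  by apply: cmeasM => //; exact: cmeas_cst.
by rewrite N2Z// lte_mul_pinfty// lee_fin sqr_ge0.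
Qed.

Lemma L2N f : L2 f -> L2 (fun x => - f x).
Proof. by move=> /(L2Z (-1)); under eq_fun do rewrite mulN1r. Qed.

Lemma L2B f g : L2 f -> L2 g -> L2 (fun x => f x - g x).
Proof. by move=> hf hg; apply: L2D => //; exact: L2N. Qed.

Lemma n2D f g : L2 f -> L2 g -> n2 (fun x => f x + g x) <= 2 * (n2 f + n2 g).
Proof.
move=> hf hg; apply: N2_n2_le; first exact: L2D.
have [mf _] := (L2P f).1 hf; have [mg _] := (L2P g).1 hg.
by rewrite posD; have := N2D mu mf mg; rewrite !n2E.
Qed.

Lemma n2Z (c : R[i]) f : L2 f -> n2 (fun x => c * f x) = normc c ^+ 2 * n2 f.
Proof.
move=> hf; have [mf _] := (L2P f).1 hf.
by rewrite {1}/n2 posZ N2Z// n2E.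
Qed.

Lemma n2N f : L2 f -> n2 (fun x => - f x) = n2 f.
Proof.
move=> hf; rewrite -[RHS]mul1r -[X in _ = X * _](expr1n _ 2) -(@normc1 R) -normcN -n2Z//.
by congr n2; apply/funext => x; rewrite mulN1r.
Qed.

Lemma n2B f g : L2 f -> L2 g -> n2 (fun x => f x - g x) <= 2 * (n2 f + n2 g).
Proof. by move=> hf hg; rewrite -(n2N hg); apply: n2D => //; exact: L2N. Qed.

Lemma eqL2P f g : eqL2 f g <-> {ae mu, forall x, pos f x = pos g x}.
Proof.
rewrite /eqL2 /ae_eq; split; apply: filterS => x h.
  by rewrite /pos; case: ifP => // x0; apply: h; rewrite halflineE.
by rewrite halflineE => x0; move: h; rewrite /pos x0.
Qed.

Lemma eqL2_refl f : eqL2 f f.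
Proof. by apply/eqL2P; apply: filterE. Qed.

Lemma eqL2_sym f g : eqL2 f g -> eqL2 g f.
Proof. by move=> /eqL2P h; apply/eqL2P; apply: filterS h. Qed.

Lemma eqL2_trans f g h : eqL2 f g -> eqL2 g h -> eqL2 f h.
Proof.
move=> /eqL2P h1 /eqL2P h2; apply/eqL2P.
by apply: filterS2 h1 h2 => x -> ->.
Qed.

Lemma n2_eqL2 f g : L2 f -> L2 g -> eqL2 f g -> n2 f = n2 g.
Proof.
by move=> /L2P [mf _] /L2P [mg _] /eqL2P h; congr fine; exact: N2_ae.
Qed.

Lemma n2_sub_eq0 f g : L2 f -> L2 g -> n2 (fun x => f x - g x) <= 0 -> eqL2 f g.
Proof.
move=> hf hg h; apply/eqL2P.
have hfg := L2B hf hg.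
have [mfg _] := (L2P _).1 hfg.
have : (N2 mu (pos (fun x => (f x - g x)%R)) <= 0)%E by rewrite n2E// lee_fin.
move=> h0; have := N2_eq0 (mu := mu) mfg h0; apply: filterS => x; rewrite posB => /eqP.
by rewrite subr_eq0 => /eqP.
Qed.

Lemma eqL2_n2 f g : L2 f -> L2 g -> eqL2 f g -> n2 (fun x => f x - g x) = 0.
Proof.
move=> hf hg /eqL2P h.
have -> : 0 = n2 (fun _ : R => 0 : R[i]).
  rewrite /n2 (_ : pos _ = fun=> 0).
    by rewrite /N2 /rint; under eq_integral do rewrite normc0 expr0n; rewrite integral0.
  by apply/funext => x; rewrite /pos if_same.
apply: n2_eqL2; [exact: L2B|exact: L2_0|apply/eqL2P].
by apply: filterS h => x; rewrite posB => ->; rewrite /pos if_same subrr.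
Qed.

Lemma pairing_L1 f g : L2 f -> L2 g -> cL1 mu (fun x => pos f x * pos g x).
Proof. by move=> /L2P [mf hf] /L2P [mg hg]; exact: cL1_CS. Qed.

Lemma pairing_CS f g : L2 f -> L2 g -> normc (pairing f g) <= normL2 f * normL2 g.
Proof.
move=> hf hg; have [mf _] := (L2P f).1 hf; have [mg _] := (L2P g).1 hg.
rewrite -lee_fin pairingE; apply: le_trans (norm_cI mu (cmeasM mf mg)) _.
apply: cCS => //; try exact: normL2_ge0.
  by rewrite normL2_sqr n2E.
by rewrite normL2_sqr n2E.
Qed.

Lemma pairingDl f g h : L2 f -> L2 g -> L2 h ->
  pairing (fun x => f x + g x) h = pairing f h + pairing g h.
Proof.
move=> hf hg hh; rewrite !pairingE posD -cID; [|exact: pairing_L1..].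
by apply: cI_eq => x; rewrite mulrDl.
Qed.

Lemma pairingZl (c : R[i]) f h : L2 f -> L2 h ->
  pairing (fun x => c * f x) h = c * pairing f h.
Proof.
move=> hf hh; rewrite !pairingE posZ -cIZ; [|exact: pairing_L1].
by apply: cI_eq => x; rewrite mulrA.
Qed.

Lemma pairingC f g : pairing f g = pairing g f.
Proof. by rewrite !pairingE; apply: cI_eq => x; rewrite mulrC. Qed.

Lemma pairingDr f g h : L2 f -> L2 g -> L2 h ->
  pairing h (fun x => f x + g x) = pairing h f + pairing h g.
Proof. by move=> *; rewrite pairingC pairingDl// ![pairing h _]pairingC. Qed.

Lemma pairingZr (c : R[i]) f h : L2 f -> L2 h ->
  pairing h (fun x => c * f x) = c * pairing h f.
Proof. by move=> *; rewrite pairingC pairingZl// ![pairing h _]pairingC. Qed.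

Lemma pairingNr f h : L2 f -> L2 h -> pairing h (fun x => - f x) = - pairing h f.
Proof.
move=> hf hh; rewrite -mulN1r -pairingZr//; congr pairing.
by apply/funext => x; rewrite mulN1r.
Qed.

Lemma pairingNl f h : L2 f -> L2 h -> pairing (fun x => - f x) h = - pairing f h.
Proof. by move=> *; rewrite pairingC pairingNr// pairingC. Qed.

Lemma pairingBl f g h : L2 f -> L2 g -> L2 h ->
  pairing (fun x => f x - g x) h = pairing f h - pairing g h.
Proof. by move=> hf hg hh; rewrite pairingDl ?pairingNl//; exact: L2N. Qed.

Lemma pairingBr f g h : L2 f -> L2 g -> L2 h ->
  pairing h (fun x => f x - g x) = pairing h f - pairing h g.
Proof. by move=> hf hg hh; rewrite pairingDr ?pairingNr//; exact: L2N. Qed.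

Lemma pairing_eqL2 f f' g g' : L2 f -> L2 f' -> L2 g -> L2 g' ->
  eqL2 f f' -> eqL2 g g' -> pairing f g = pairing f' g'.
Proof.
move=> /L2P [mf _] /L2P [mf' _] /L2P [mg _] /L2P [mg' _] /eqL2P h1 /eqL2P h2.
rewrite !pairingE; apply: cI_ae; [exact: cmeasM|exact: cmeasM|].
by apply: filterS2 h1 h2 => x -> ->.
Qed.

(** Since the pairing is bilinear, the squared norm of [f - g] is its pairing with the complex
    conjugate of [f - g], which again lies in L^2. *)
Lemma pairing_nondeg f g : L2 f -> L2 g ->
  (forall h, L2 h -> pairing f h = pairing g h) -> eqL2 f g.
Proof.
move=> hf hg hfg; apply: n2_sub_eq0 => //.
have hd := L2B hf hg.
pose c x := ((f x - g x)^*)%C.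
have posc : pos c = (fun x => ((pos (fun x => f x - g x) x)^*)%C).
  by apply/funext => x; rewrite /pos /c; case: ifP => // _; rewrite conjc0.
have hc : L2 c.
  have [m i] := (L2P _).1 hd; apply/L2P; rewrite posc; split; first exact: cmeasJ.
  by rewrite /N2; under eq_fun do rewrite normcJ_real.
have : pairing (fun x => f x - g x) c = 0 by rewrite pairingBl// hfg// subrr.
rewrite pairingE /cI => -[+ _].
rewrite /n2 /N2 /rint /Rintegral => <-; rewrite le_eqVlt; apply/orP; left; apply/eqP.
congr fine; apply: eq_integral => x _; congr EFin; rewrite posc normc_sqr.
by case: (pos _ x) => a b /=; ring.
Qed.

End halfline_L2.
#[global] Hint Resolve measurable_halfline : core.

(** * Absolutely continuous functions *)

Section derivatives.
Context {R : realType}.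
Notation mu := (@lebesgue_measure R).

Lemma is_derive_eps (f : R -> R) (x l : R) : is_derive x (1 : R) f l ->
  forall e, 0 < e -> exists2 d : R, 0 < d &
    forall h, `|h| < d -> `|f (x + h) - f x - l * h| <= e * `|h|.
Proof.
move=> [dfx dfl] e e0.
have : (fun h => h^-1 *: ((f \o shift x) (h *: (1 : R)) - f x)) @ (0 : R)^' --> l.
  by rewrite -dfl; exact: dfx.
move=> /cvgrPdist_le /(_ _ e0) /nbhs_ballP [d d0 hd]; exists d => // h hd'.
have [->|h0] := eqVneq h 0; first by rewrite addr0 subrr mulr0 subrr normr0 mulr0.
have := hd h; rewrite /ball/= sub0r normrN => /(_ hd' h0).
rewrite /shift /= [h *: 1]mulr1 (addrC h x) => H.
have -> : f (x + h) - f x - l * h = - h * (l - h^-1 *: (f (x + h) - f x)).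
  rewrite -[h^-1 *: _]/(h^-1 * _); field; exact: h0.
by rewrite normrM normrN mulrC ler_wpM2r.
Qed.

Definition cderiv (x : R) (F : R -> R[i]) (l : R[i]) :=
  is_derive x (1 : R) (fun y => complex.Re (F y)) (complex.Re l) /\
  is_derive x (1 : R) (fun y => complex.Im (F y)) (complex.Im l).

Lemma cderiv_eps x F l : cderiv x F l -> forall e, 0 < e -> exists2 d : R, 0 < d &
  forall h, `|h| < d -> normc (F (x + h) - F x - l * h%:C) <= e * `|h|.
Proof.
move=> [h1 h2] e e0; have e2 : 0 < e / 2 by rewrite divr_gt0.
have [d1 d10 hd1] := is_derive_eps h1 e2; have [d2 d20 hd2] := is_derive_eps h2 e2.
exists (Num.min d1 d2); first by rewrite lt_min d10.
move=> h; rewrite lt_min => /andP[/hd1 k1 /hd2 k2].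
apply: le_trans (normc_leReIm _) _.
rewrite !(cReD, cReN, cImD, cImN) cReMr cImMr.
by apply: le_trans (lerD k1 k2) _; rewrite -mulrDl -splitr.
Qed.

Lemma cderivM x F G l k : cderiv x F l -> cderiv x G k ->
  cderiv x (fun y => F y * G y) (l * G x + F x * k).
Proof.
move=> [f1 f2] [g1 g2]; split.
  under eq_fun do rewrite cReM.
  have h := is_deriveB (is_deriveM f1 g1) (is_deriveM f2 g2).
  apply: is_derive_eq h _; rewrite cReD !cReM; rewrite /GRing.scale /=; ring.
under eq_fun do rewrite cImM.
have h := is_deriveD (is_deriveM f1 g2) (is_deriveM f2 g1).
apply: is_derive_eq h _; rewrite cImD !cImM; rewrite /GRing.scale /=; ring.
Qed.

Lemma cderivD x F G l k : cderiv x F l -> cderiv x G k ->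
  cderiv x (fun y => F y + G y) (l + k).
Proof.
move=> [f1 f2] [g1 g2]; split.
  by under eq_fun do rewrite cReD; rewrite cReD; exact: is_deriveD.
by under eq_fun do rewrite cImD; rewrite cImD; exact: is_deriveD.
Qed.

Lemma cderiv_cst x c : cderiv x (fun=> c) 0.
Proof. by split; exact: is_derive_cst. Qed.

Lemma cderiv_exp x (z : R[i]) : cderiv x (fun y => expC (z * y%:C)) (z * expC (z * x%:C)).
Proof.
have lin (c : R) : is_derive x (1 : R) (fun y => c * y) c.
  have h := is_deriveM (is_derive_cst c x (1 : R)) (is_derive_id x (1 : R)).
  by apply: is_derive_eq h _; rewrite /GRing.scale/= mulr0 addr0 mulr1.
have hE : is_derive x (1 : R) (fun y => expR (complex.Re z * y))
    (complex.Re z * expR (complex.Re z * x)).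
  have h := is_derive1_comp (is_derive_expR (complex.Re z * x)) (lin (complex.Re z)).
  by apply: is_derive_eq h _; rewrite mulrC.
have hc : is_derive x (1 : R) (fun y => cos (complex.Im z * y))
    (- complex.Im z * sin (complex.Im z * x)).
  have h := is_derive1_comp (is_derive_cos (complex.Im z * x)) (lin (complex.Im z)).
  by apply: is_derive_eq h _; ring.
have hs : is_derive x (1 : R) (fun y => sin (complex.Im z * y))
    (complex.Im z * cos (complex.Im z * x)).
  have h := is_derive1_comp (is_derive_sin (complex.Im z * x)) (lin (complex.Im z)).
  by apply: is_derive_eq h _; rewrite mulrC.
rewrite /expC; split.
  under eq_fun do rewrite cReM cReMr cImMr /= mul0r subr0.
  have h := is_deriveM hE hc; apply: is_derive_eq h _.
  by rewrite /GRing.scale/= !(cReMr, cImMr) !(cReM, cImM)/=; ring.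
under eq_fun do rewrite cImM cReMr cImMr /= mul0r addr0.
have h := is_deriveM hE hs; apply: is_derive_eq h _.
by rewrite /GRing.scale/= !(cReMr, cImMr) !(cReM, cImM)/=; ring.
Qed.

Lemma cderiv_unique x F l k : cderiv x F l -> cderiv x F k -> l = k.
Proof. by move=> [[_ h1] [_ h2]] [[_ h3] [_ h4]]; apply: ReImE; rewrite -?h1 -?h2. Qed.

End derivatives.

Section ac_constant.
Context {R : realType}.
Notation mu := (@lebesgue_measure R).

(* The sup argument replaces a Vitali covering: [ac_step F U e x] says that
   the increment of F over [0, x] is at most e x up to finitely many disjoint
   intervals inside the small open set U. *)
Definition ac_step (F : R -> R[i]) (U : set R) (e x : R) : Prop :=
  exists n (u v : nat -> R),
    [/\ forall i, (i < n)%N -> [/\ 0 <= u i, u i <= v i & v i <= x],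
        trivIset `I_n (fun i => [set` `]u i, v i[]),
        forall i, (i < n)%N -> [set` `]u i, v i[] `<=` U &
        normc (F x - F 0) <= e * x + \sum_(i < n) normc (F (v i) - F (u i))].

Lemma ac_step0 F U e : ac_step F U e 0.
Proof.
exists 0%N, (fun=> 0), (fun=> 0); split => //.
by rewrite subrr normc0 big_ord0 mulr0 addr0.
Qed.

Lemma ac_step_good F U e x y : ac_step F U e x -> x <= y ->
  normc (F y - F x) <= e * (y - x) -> ac_step F U e y.
Proof.
move=> [n [u [v [h1 h2 h3 h4]]]] xy h; exists n, u, v; split => //.
  by move=> i /h1 [? ? vx]; split => //; exact: le_trans xy.
apply: le_trans (normc_tri3 (F x) _ _) _.
have -> : e * y = e * (y - x) + e * x by ring.
by rewrite -addrA; exact: lerD.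
Qed.

Lemma ac_step_bad F U e x y : 0 <= e -> 0 <= x -> ac_step F U e x -> x <= y ->
  [set` `]x, y[] `<=` U -> ac_step F U e y.
Proof.
move=> e0 x0 [n [u [v [h1 h2 h3 h4]]]] xy xyU.
pose u' i := if (i < n)%N then u i else x; pose v' i := if (i < n)%N then v i else y.
exists n.+1, u', v'; split.
- move=> i _; rewrite /u' /v'; case: ifP => [/h1 [? ? vx]|_]; split => //.
  exact: le_trans xy.
- move=> i j /= iN jN; rewrite /u' /v'.
  case: ifP => ni; case: ifP => nj.
  + exact: h2.
  + move=> [t [] /=]; rewrite !in_itv/= => /andP[_ tv] /andP[xt _].
    by have [_ _ vx] := h1 _ ni; have := lt_trans (lt_le_trans tv vx) xt; rewrite ltxx.
  + move=> [t [] /=]; rewrite !in_itv/= => /andP[xt _] /andP[_ tv].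
    by have [_ _ vx] := h1 _ nj; have := lt_trans (lt_le_trans tv vx) xt; rewrite ltxx.
  + move=> _; have -> : i = n by apply/eqP; rewrite eqn_leq -ltnS iN leqNgt ni.
    by apply/eqP; rewrite eq_sym eqn_leq -ltnS jN leqNgt nj.
- by move=> i _; rewrite /u' /v'; case: ifP => [/h3|].
- have un : u' n = x by rewrite /u' ltnn.
  have vn : v' n = y by rewrite /v' ltnn.
  rewrite big_ord_recr/= un vn.
  rewrite (eq_bigr (fun i : 'I_n => normc (F (v i) - F (u i)))); last first.
    by move=> i _; rewrite /u' /v' ltn_ord.
  apply: le_trans (normc_tri3 (F x) _ _) _; rewrite [X in X <= _]addrC [X in _ <= X]addrA lerD2r.
  by apply: le_trans h4 _; rewrite lerD2r ler_wpM2l.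
Qed.

Lemma sum_len_le (U : set R) (n : nat) (u v : nat -> R) : measurable U ->
  (forall i, (i < n)%N -> u i <= v i) ->
  trivIset `I_n (fun i => [set` `]u i, v i[]) ->
  (forall i, (i < n)%N -> [set` `]u i, v i[] `<=` U) ->
  ((\sum_(i < n) (v i - u i))%:E <= mu U)%E.
Proof.
move=> mU h1 h2 h3.
have -> : ((\sum_(i < n) (v i - u i))%:E = mu (\big[setU/set0]_(i < n) [set` `]u i, v i[]))%E.
  rewrite (measure_semi_additive_ord_I mu (F := fun i => [set` `]u i, v i[]))//; last first.
    by apply: bigsetU_measurable => i _; exact: measurable_itv.
  rewrite -sumEFin; apply: eq_bigr => i _.
  have /= := lebesgue_measure_itv (`]u i, v i[%O : interval R).
  rewrite lte_fin lt_neqAle h1// andbT => H; apply: etrans (esym H).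
  by case: eqP => [->|_]; rewrite ?subrr.
apply: le_measure; rewrite ?inE//; first by apply: bigsetU_measurable.
by apply: (big_ind (fun S => S `<=` U)) => // [A B AU BU t []|i _]; [exact: AU|exact: BU|exact: h3].
Qed.

(** The exceptional points lie in an open [U] so small that absolute continuity at level [e] bounds
    the total increment over disjoint intervals inside [U]; elsewhere increments are at most [e]
    times the length. Together they give [e * (b + 1)]. *)
Lemma ac_deriv0_const (F : R -> R[i]) (b : R) : 0 < b -> abs_continuous 0 b F ->
  {ae mu, forall x, 0 < x < b -> cderiv x F 0} -> F b = F 0.
Proof.
move=> b0 acF [A [mA A0 hA]].
have key e : 0 < e -> normc (F b - F 0) <= 0 + e * (b + 1).
  move=> e0; have [d d0 hd] := acF e e0.
  (* The derivative is known only inside []0, b[], so both endpoints join the exceptional set. *)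
  pose N := A `|` ([set 0] `|` [set b]).
  have mN : measurable N by apply: measurableU => //; apply: measurableU; exact: measurable_set1.
  have N0 : mu N = 0.
    apply/eqP; rewrite -measure_le0; apply: le_trans (measureU2 mu _ _) _ => //.
      by apply: measurableU; exact: measurable_set1.
    have A0' : (mu A <= 0)%E by rewrite A0.
    have s0 : (mu ([set 0%R] `|` [set b]) <= 0)%E.
      apply: le_trans (measureU2 mu (measurable_set1 _) (measurable_set1 _)) _.
      by have /= -> := lebesgue_measure_set1 (0 : R); have /= -> := lebesgue_measure_set1 b; rewrite adde0.
    by apply: le_trans (leeD A0' s0) _; rewrite adde0.
  have N0' : (mu N < +oo)%E by rewrite N0 ltry.
  have [U [oU NU hU]] := lebesgue_regularity_outer mN N0' d0.
  have mU : measurable U by exact: open_measurable.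
  have mUd : (mu U < d%:E)%E.
    have -> : U = N `|` (U `\` N) by rewrite setDUK.
    apply: le_lt_trans (measureU2 mu mN (measurableD mU mN)) _.
    have N0'' : (mu N <= 0)%E by rewrite N0.
    by apply: le_lt_trans (leeD N0'' (lexx _)) _; rewrite add0e.
  (* Around every [c], a step reaching some [x <= c] close by extends to the nearby [y >= c]. If [c]
     is exceptional the interval is charged to the family inside [U]; otherwise differentiability at
     [c] is used on both sides of it. *)
  have local c : 0 <= c <= b -> exists2 dl, 0 < dl & forall x y,
      0 <= x -> y <= b -> c - dl < x -> x <= c -> c <= y -> y < c + dl ->
      ac_step F U e x -> ac_step F U e y.
    move=> /andP[c0 cb]; have [cN|cN] := pselect (N c).
      have : nbhs c U by apply: open_nbhs_nbhs; split => //; exact: NU.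
      move=> /nbhs_ballP [dl dl0 hdl]; exists dl => // x y x0 yb cx xc cy ycd hx.
      apply: (ac_step_bad (ltW e0) x0 hx) => [|t /=]; first exact: le_trans cy.
      rewrite in_itv/= => /andP[xt ty]; apply: hdl; rewrite /ball/= ltr_distlC.
      by rewrite (lt_trans cx xt) (lt_trans ty ycd).
    have c0' : 0 < c.
      rewrite lt_neqAle c0 andbT; apply/eqP => c00; apply: cN; right; left; by rewrite -c00.
    have cb' : c < b.
      rewrite lt_neqAle cb andbT; apply/eqP => cbb; apply: cN; right; right; by rewrite cbb.
    have : cderiv c F 0.
      apply: contrapT => nd; apply: cN; left; apply: hA => /= /(_ _) h.
      by apply: nd; apply: h; rewrite c0' cb'.
    move=> /cderiv_eps /(_ e e0) [dl dl0 hdl]; exists dl => // x y x0 yb cx xc cy ycd hx.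
    have xy : x <= y by exact: le_trans cy.
    apply: (ac_step_good hx xy).
    apply: le_trans (normc_tri3 (F c) _ _) _.
    have h1 : normc (F y - F c) <= e * (y - c).
      have := hdl (y - c); rewrite mul0r subr0 (addrC c) subrK ger0_norm ?subr_ge0//.
      by apply; rewrite ltrBlDl.
    have h2 : normc (F c - F x) <= e * (c - x).
      have := hdl (x - c); rewrite mul0r subr0 (addrC c) subrK distrC ger0_norm ?subr_ge0//.
      by rewrite normcB; apply; rewrite ltrBlDl -ltrBlDr.
    by apply: le_trans (lerD h1 h2) _; rewrite -mulrDr addrA subrK.
  pose S := [set x | 0 <= x <= b /\ ac_step F U e x].
  have S0 : S 0 by split; [rewrite lexx ltW|exact: ac_step0].
  have hS : has_sup S.
    by split; [exists 0|exists b => x [/andP[]]].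
  pose c := sup S.
  have cb : 0 <= c <= b.
    apply/andP; split; first by apply: sup_upper_bound.
    by apply: ge_sup; [exists 0|move=> x [/andP[]]].
  have [dl dl0 hdl] := local c cb.
  have [x [/andP[x0 xb] hx] cx] := sup_adherent dl0 hS.
  have xc : x <= c by apply: sup_upper_bound => //; split => //; rewrite x0.
  have [/andP[c0 cb']] : 0 <= c <= b by [].
  have Sc : ac_step F U e c by apply: (hdl x c) => //; rewrite ltrDl.
  (* Were the supremum [c] below [b], the same extension would produce a point of [S] beyond it. *)
  have Sb : ac_step F U e b.
    have [cltb|bc] := ltP c b; last by have -> : b = c by apply/eqP; rewrite eq_le bc cb'.
    pose y := Num.min b (c + dl / 2).
    have cy : c < y by rewrite lt_min cltb ltrDl divr_gt0.
    have : S y.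
      split; first by rewrite (le_trans c0 (ltW cy)) ge_min lexx.
      apply: (hdl x y) => //; rewrite ?ge_min ?lexx// ?ltW//.
      by rewrite gt_min ltrD2l ltr_pdivrMr// ltr_pMr// ltr1n orbT.
    move=> /(sup_upper_bound hS); rewrite -/c leNgt cy//.
  have [n [u [v [h1 h2 h3 h4]]]] := Sb.
  apply: le_trans h4 _; rewrite add0r mulrDr mulr1 lerD2l ltW//.
  apply: hd => //.
  rewrite -lte_fin; apply: le_lt_trans mUd; apply: sum_len_le => // i /h1 []//.
apply/eqP; rewrite -subr_eq0; apply/eqP; apply: normc_eq0P; apply/eqP.
rewrite eq_le normc_ge0 andbT; apply: (@le_of_eps R _ _ (b + 1)) => //.
by rewrite addr_ge0// ltW.
Qed.

End ac_constant.

(** * Integrals over bounded intervals *)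

Section interval_integral.
Context {R : realType}.
Notation mu := (@lebesgue_measure R).
Implicit Types f g : R -> R[i].

Lemma ae_neq (c : R) : {ae mu, forall x, x <> c}.
Proof.
exists [set c]; split; [exact: measurable_set1|exact: lebesgue_measure_set1|].
by move=> x /= /contrapT.
Qed.

(** Cut-off to an open interval, empty when [b <= a]: integrals over reversed intervals are [0]
    instead of changing sign. *)
Definition iv (a b : R) f : R -> R[i] := fun y => if (a < y) && (y < b) then f y else 0.

Definition Int (a b : R) f : R[i] := cI mu (iv a b f).

Lemma measurable_between (a b : R) : measurable_fun setT (fun y : R => (a < y) && (y < b)).
Proof. by apply: measurable_and; exact: measurable_fun_ltr. Qed.

Lemma measurable_between_nat (a b : R) :
  measurable_fun setT (fun y : R => ((a < y) && (y < b))%:R : R).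
Proof.
rewrite (_ : (fun y : R => _) = (fun y => if (a < y) && (y < b) then 1 else 0)).
  by apply: measurable_fun_ifT => //; exact: measurable_between.
by apply/funext => y; case: ifP.
Qed.

Lemma cmeas_iv a b f : cmeas f -> cmeas (iv a b f).
Proof. by move=> mf; apply: cmeas_if mf (cmeas_cst _); exact: measurable_between. Qed.

Lemma iv_pos a b f : 0 <= a -> iv a b f = iv a b (pos f).
Proof.
move=> a0; apply/funext => y; rewrite /iv /pos; case: ifP => // /andP[ay _].
by rewrite (le_lt_trans a0 ay).
Qed.

Lemma cmeas_iv_pos a b f : 0 <= a -> cmeas (pos f) -> cmeas (iv a b f).
Proof. by move=> a0 mf; rewrite iv_pos//; exact: cmeas_iv. Qed.

Lemma normc_iv_le a b c d f y : c <= a -> b <= d -> normc (iv a b f y) <= normc (iv c d f y).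
Proof.
move=> ca bd; rewrite /iv; case: ifP => [/andP[ay yb]|_]; last by rewrite normc0 normc_ge0.
by rewrite (le_lt_trans ca ay) (lt_le_trans yb bd).
Qed.

Lemma rint_between (a b : R) : a <= b ->
  rint mu (fun y : R => ((a < y) && (y < b))%:R) = (b - a)%:E.
Proof.
move=> ab; rewrite /rint.
have -> : (b - a)%:E = mu `]a, b[%classic.
  have /= := lebesgue_measure_itv (`]a, b[%O : interval R).
  rewrite lte_fin lt_neqAle ab andbT => H; apply: etrans (esym H).
  by case: eqP => [->|_]; rewrite ?subrr.
rewrite -[mu _]/(mu `]a, b[%classic) -(setIT `]a, b[%classic) -integral_indic//.
by apply: eq_integral => x _; rewrite indicE mem_setE in_itv/=.
Qed.

Lemma N2_between a b : a <= b -> N2 mu (iv a b (fun=> 1)) = (b - a)%:E.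
Proof.
move=> ab; rewrite -rint_between//; apply: eq_integral => y _.
by rewrite /iv; case: ifP => _; rewrite ?normc1 ?normc0 ?expr1n ?expr0n.
Qed.

Lemma iv_mul1 a b f y : iv a b f y = iv a b (fun=> 1) y * iv a b f y.
Proof. by rewrite /iv; case: ifP; rewrite ?mul1r ?mul0r. Qed.

Lemma cL1_iv a b f : cmeas (iv a b f) -> (N2 mu (iv a b f) < +oo)%E -> cL1 mu (iv a b f).
Proof.
move=> mf hf; have [ab|ba] := leP a b.
  have := cL1_CS (mu := mu) (cmeas_iv a b (cmeas_cst 1)) mf.
  rewrite N2_between// ltry => /(_ isT hf).
  by rewrite (_ : (fun x => _) = iv a b f)//; apply/funext => y; rewrite -iv_mul1.
rewrite (_ : iv a b f = fun=> 0); first exact: cL1_0.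
apply/funext => y; rewrite /iv; case: ifP => // /andP[ay yb].
by have := lt_trans (lt_trans ay yb) ba; rewrite ltxx.
Qed.

Lemma Int_split a b c f : a <= b -> b <= c -> cL1 mu (iv a c f) ->
  cL1 mu (iv a b f) -> cL1 mu (iv b c f) -> Int a c f = Int a b f + Int b c f.
Proof.
move=> ab bc h1 h2 h3; rewrite /Int -cID//; apply: cI_ae.
- by case: h1.
- by apply: cmeasD; [case: h2|case: h3].
- have := ae_neq b; apply: filterS => y yb; rewrite /iv.
  have [ylt|ygt|//] := ltgtP y b.
    by rewrite (lt_le_trans ylt bc) addr0.
  by rewrite (le_lt_trans ab ygt) add0r.
Qed.

Lemma Int_ge a b f : b <= a -> Int a b f = 0.
Proof.
move=> ba; rewrite /Int (_ : iv a b f = fun=> 0) ?cI0//; apply/funext => y.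
rewrite /iv; case: ifP => // /andP[ay yb].
by have := lt_le_trans (lt_trans ay yb) ba; rewrite ltxx.
Qed.

(** Square integrability up to the point [0]. It is the condition under which Cauchy-Schwarz gives
    absolute continuity of the primitive with an explicit modulus, and it survives multiplication by
    locally bounded measurable functions. *)
Definition L2loc g := cmeas (pos g) /\ forall b, (N2 mu (iv 0 b g) < +oo)%E.

Lemma L2_L2loc g : L2 g -> L2loc g.
Proof.
move=> /L2P [mg hg]; split => // b; apply: le_lt_trans hg.
apply: N2_le => //; first exact: cmeas_iv_pos.
move=> x; rewrite /iv /pos; case: ifP => [/andP[-> _]//|_].
by rewrite normc0 normc_ge0.
Qed.

Lemma L2loc_iv g a b : L2loc g -> 0 <= a -> cL1 mu (iv a b g).
Proof.
move=> [mg hg] a0; have m := cmeas_iv_pos b a0 mg.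
apply: cL1_iv => //; apply: le_lt_trans (hg b); apply: N2_le => //.
  exact: cmeas_iv_pos.
by move=> y; exact: normc_iv_le.
Qed.

Lemma Int_sub g u v : L2loc g -> 0 <= u -> u <= v -> Int 0 v g - Int 0 u g = Int u v g.
Proof.
move=> hg u0 uv; rewrite (Int_split u0 uv); [|exact: L2loc_iv..].
by rewrite addrC addKr.
Qed.

Lemma Int_bound g u v : L2loc g -> 0 <= u ->
  normc (Int u v g) <= fine (rint mu (fun y => normc (iv u v g y))).
Proof.
move=> hg u0; have [m i] := L2loc_iv v hg u0.
rewrite -lee_fin fineK; first exact: norm_cI.
by rewrite ge0_fin_numE// rint_ge0// => x; exact: normc_ge0.
Qed.

(** At most one of the disjoint intervals contains [y], so the sum is [0] or [1]. In [Int_loc_ac]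
    this makes the squared norm of the sum of indicators equal to the total length. *)
Lemma indic_disjoint (n : nat) (u v : nat -> R) (y : R) :
  trivIset `I_n (fun i => [set` `]u i, v i[]) ->
  (\sum_(i < n) ((u i < y) && (y < v i))%:R : R) ^+ 2 =
  \sum_(i < n) ((u i < y) && (y < v i))%:R.
Proof.
move=> tI.
have [/existsP [i hi]|/existsPn h] := boolP [exists i : 'I_n, (u i < y) && (y < v i)].
  rewrite (bigD1 i)//= hi big1 ?addr0 ?expr1n// => j ji.
  case: (boolP (_ && _)) => // hj; case/eqP: ji; apply/val_inj.
  by apply: tI; rewrite /= ?ltn_ord//; exists y; rewrite /= !in_itv/=.
by rewrite big1 ?expr0n// => i _; rewrite (negbTE (h i)).
Qed.

Lemma rint_sum (n : nat) (F : nat -> R -> R) : (forall i, measurable_fun setT (F i)) ->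
  (forall i x, 0 <= F i x) ->
  rint mu (fun x => \sum_(i < n) F i x) = (\sum_(i < n) rint mu (F i))%E.
Proof.
move=> mF F0; elim: n => [|n ih].
  rewrite big_ord0 /rint; under eq_integral do rewrite big_ord0; exact: integral0.
rewrite big_ord_recr/= -ih -rintD//.
- by congr rint; apply/funext => x; rewrite big_ord_recr.
- by apply: measurable_sum => i; exact: mF.
- exact: mF.
- by move=> x; apply: sumr_ge0 => i _; exact: F0.
Qed.

(** The increments add up to at most the integral of [|g|] over the union of the intervals, which
    Cauchy-Schwarz bounds by the square root of the total length times [A], the norm of [g] on []0,
    b[]. This dictates [(e / (A + 1)) ^+ 2], where the [1] covers the case [A = 0]. *)
Lemma Int_loc_ac g (c : R[i]) f : L2loc g ->
  (forall x, 0 <= x -> f x = c + Int 0 x g) -> loc_abs_continuous f.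
Proof.
move=> hg hf b b0 e e0.
have [mg ig] := hg.
pose A := Num.sqrt (fine (N2 mu (iv 0 b g))).
have A0 : 0 <= A by exact: sqrtr_ge0.
exists ((e / (A + 1)) ^+ 2).
  by rewrite exprn_gt0// divr_gt0// ltr_wpDl.
move=> n u v huv tI hs.
pose s (y : R) : R := \sum_(i < n) ((u i < y) && (y < v i))%:R.
have mind i := measurable_between_nat (u i) (v i).
have ms : measurable_fun setT s by apply: measurable_sum => i; exact: mind.
have mgb := cmeas_iv_pos b (lexx 0) mg.
have h1 : \sum_(i < n) normc (f (v i) - f (u i)) <=
    \sum_(i < n) fine (rint mu (fun y => normc (iv (u i) (v i) g y))).
  apply: ler_sum => i _; have [u0 uv vb] := huv i (ltn_ord i).
  rewrite !hf ?(le_trans u0 uv)// opprD addrACA subrr add0r Int_sub//.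
  exact: Int_bound.
apply: le_lt_trans h1 _.
have h2 : ((\sum_(i < n) fine (rint mu (fun y => normc (iv (u i) (v i) g y))))%:E <=
    rint mu (fun y => (s y * normc (iv 0 b g y))%R))%E.
  have -> : rint mu (fun y => (s y * normc (iv 0 b g y))%R) =
      (\sum_(i < n) rint mu (fun y => ((u i < y) && (y < v i))%:R * normc (iv 0 b g y))%R)%E.
    rewrite -(rint_sum n (F := fun i y => ((u i < y) && (y < v i))%:R * normc (iv 0 b g y))).
    - by congr rint; apply/funext => y; rewrite /s mulr_suml.
    - by move=> i; apply: measurable_funM => //; exact: measurable_normc.
    - by move=> i y; rewrite mulr_ge0// normc_ge0.
  rewrite -sumEFin; apply: lee_sum => i _.
  have [u0 uv vb] := huv i (ltn_ord i).
  rewrite fineK; last first.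
    by rewrite ge0_fin_numE ?rint_ge0//; [have [] := L2loc_iv (v i) hg u0|move=> x; exact: normc_ge0].
  rewrite le_eqVlt; apply/orP; left; apply/eqP; congr rint; apply/funext => y.
  rewrite /iv; case: ifP => [/andP[uy yv]|]; last by rewrite normc0 mul0r.
  by rewrite (le_lt_trans u0 uy) (lt_le_trans yv vb) mul1r.
rewrite -lte_fin; apply: le_lt_trans h2 _.
have s0 y : 0 <= s y by apply: sumr_ge0 => i _.
have S0 : 0 <= \sum_(i < n) (v i - u i).
  by apply: sumr_ge0 => i _; have [_ uv _] := huv i (ltn_ord i); rewrite subr_ge0.
have := @rint_CS _ _ _ mu s (fun y => normc (iv 0 b g y))
  (Num.sqrt (\sum_(i < n) (v i - u i))) A ms (measurable_normc mgb) s0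
  (fun y => normc_ge0 _) (sqrtr_ge0 _) A0.
have -> : rint mu (fun x => (s x ^+ 2)%R) = (\sum_(i < n) (v i - u i))%:E.
  rewrite -sumEFin (_ : (fun x => s x ^+ 2) = s); last first.
    by apply/funext => y; rewrite /s indic_disjoint.
  rewrite /s (rint_sum n (F := fun i y => ((u i < y) && (y < v i))%:R))//.
  apply: eq_bigr => i _; rewrite rint_between//.
  by have [_ uv _] := huv i (ltn_ord i).
rewrite sqr_sqrtr// => /(_ (lexx _)).
have -> : rint mu (fun x => (normc (iv 0 b g x) ^+ 2)%R) = (A ^+ 2)%:E.
  by rewrite -N2_fin.
move=> /(_ (lexx _)) h; apply: le_lt_trans h _; rewrite lte_fin.
have A1 : 0 < A + 1 by rewrite ltr_wpDl.
have : Num.sqrt (\sum_(i < n) (v i - u i)) < e / (A + 1).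
  rewrite -(ltr_pXn2r (n := 2)) ?nnegrE ?sqrtr_ge0// ?sqr_sqrtr//.
  by rewrite divr_ge0// ltW.
move=> hlt; apply: (@le_lt_trans _ _ (e / (A + 1) * A)).
  by rewrite ler_wpM2r// ltW.
by rewrite mulrAC ltr_pdivrMr// ltr_pM2l// ltrDl.
Qed.

End interval_integral.

(** * Primitives of locally square integrable functions *)

Section primitives.
Context {R : realType}.
Notation mu := (@lebesgue_measure R).
Implicit Types f g : R -> R[i].

Lemma ae_derivativeP f g : ae_derivative f g <->
  {ae mu, forall x, 0 < x -> cderiv x f (g x)}.
Proof. by split; apply: filterS => x h x0; apply: h; move: x0; rewrite halflineE. Qed.

Lemma cderiv_near x f f' l : 0 < x -> (forall y, 0 <= y -> f y = f' y) ->
  cderiv x f l -> cderiv x f' l.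
Proof.
move=> x0 ff [h1 h2].
have nx : \forall y \near x, f y = f' y.
  by near=> y; apply: ff; apply: ltW; near: y; exact: lt_nbhsr.
split; [apply: near_eq_is_derive h1|apply: near_eq_is_derive h2];
  by apply: filterS nx => y ->.
Unshelve. all: by end_near. Qed.

Lemma measurable_if_lt (h : R -> R) (b : R) : measurable_fun setT h ->
  measurable_fun setT (fun y : R => if y < b then h y else 0).
Proof. by move=> mh; apply: measurable_fun_ifT => //; exact: measurable_fun_ltr. Qed.

Lemma measurable_norm (h : R -> R) : measurable_fun setT h ->
  measurable_fun setT (fun y : R => `|h y|).
Proof. by move=> mh; exact: measurableT_comp. Qed.

(** Lebesgue's differentiation theorem in the form [FTC1Ny], whose lower limit is [-oo]; [Int_deriv]
    applies it to functions extended by zero to the left of [0]. *)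
Lemma real_Int_derive (h : R -> R) : measurable_fun setT h ->
  (forall b : R, (rint mu (fun y : R => if y < b then `|h y| else 0)%R < +oo)%E) ->
  {ae mu, forall x, is_derive x (1 : R) (fun b => \int[mu]_y (if y < b then h y else 0)%R) (h x)}.
Proof.
move=> mh hb.
have mE : measurable_fun setT (EFin \o h) by exact/measurable_EFinP.
have mlt (b : R) : measurable_fun setT (fun y : R => y < b) by exact: measurable_fun_ltr.
have intb (c : R) : mu.-integrable `]-oo, c] (EFin \o h).
  apply/integrableP; split; first exact: measurable_funTS.
  apply: le_lt_trans (hb (c + 1)).
  rewrite integral_mkcond /rint; apply: ge0_le_integral => //.
  - by move=> x _; rewrite patchE; case: ifP => //= _; rewrite lee_fin.
  - apply/(measurable_restrictT _ (measurable_itv _)); apply: measurable_funTS.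
    exact: measurableT_comp.
  - by apply/measurable_EFinP; exact: (measurable_if_lt _ (measurable_norm mh)).
  - move=> x _; rewrite patchE mem_setE in_itv/=; case: ifP => [xc|_].
      by rewrite (le_lt_trans xc) ?ltrDl.
    by case: ifP; rewrite lee_fin.
have loch : locally_integrable setT h.
  split => //; first exact: openT.
  move=> K _ /[dup] cK /compact_bounded [M [_ /(_ (M + 1))]]; rewrite ltrDl => /(_ ltr01) KM.
  have mK : measurable K by apply: closed_measurable; apply: compact_closed.
  apply: le_lt_trans (hb (M + 2)).
  rewrite integral_mkcond /rint; apply: ge0_le_integral => //.
  - by move=> x _; rewrite patchE; case: ifP => //= _; rewrite lee_fin.
  - apply/(measurable_restrictT _ mK); apply: measurable_funTS.
    apply/measurable_EFinP; exact: measurableT_comp.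
  - by apply/measurable_EFinP; exact: (measurable_if_lt _ (measurable_norm mh)).
  - move=> x _; rewrite patchE; case: ifPn => [xK|_]; last first.
      by case: ifP; rewrite lee_fin.
    have : `|x| <= M + 1 by apply: KM; rewrite -inE.
    rewrite ler_norml => /andP[_ xM]; rewrite (le_lt_trans xM)//.
    by rewrite ltrD2l ltr1n.
have := FTC1Ny intb loch; apply: filterS => x [dF Fx].
have -> : (fun b => \int[mu]_y (if y < b then h y else 0)%R) =
    (fun b => \int[mu]_(t in `]-oo, b]) h t)%R.
  apply/funext => b; rewrite -Rintegral_itv_bndo_bndc; last first.
    by apply: integrableS (intb b) => //; apply: subset_itvl; rewrite bnd_simp.
  rewrite [RHS]Rintegral_mkcond; apply: eq_Rintegral => y _.
  by rewrite patchE mem_setE in_itv/=.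
by split; [exact: dF|rewrite -derive1E].
Qed.

Lemma Int_deriv g (c : R[i]) f : L2loc g ->
  (forall x, 0 <= x -> f x = c + Int 0 x g) -> ae_derivative f g.
Proof.
move=> hg hf; apply/ae_derivativeP; have [mg ig] := hg.
have ivE b : iv 0 b g = fun y : R => if y < b then pos g y else 0.
  by apply/funext => y; rewrite /iv /pos; case: (0 < y); case: (y < b).
have mb (b : R) : measurable_fun setT (fun y : R => y < b) by exact: measurable_fun_ltr.
have [mr mi] := mg.
have hr : {ae mu, forall x, is_derive x (1 : R)
    (fun b => \int[mu]_y (if y < b then complex.Re (pos g y) else 0)%R) (complex.Re (pos g x))}.
  apply: real_Int_derive => // b.
  have [_] := L2loc_iv b hg (lexx 0); apply: le_lt_trans; apply: rint_le.
  - exact: (measurable_if_lt _ (measurable_norm mr)).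
  - exact: (measurable_normc (cmeas_iv_pos b (lexx 0) mg)).
  - by move=> x; case: ifP.
  - move=> x; rewrite ivE; case: ifP => _; [exact: normc_geRe|exact: normc_ge0].
have hi : {ae mu, forall x, is_derive x (1 : R)
    (fun b => \int[mu]_y (if y < b then complex.Im (pos g y) else 0)%R) (complex.Im (pos g x))}.
  apply: real_Int_derive => // b.
  have [_] := L2loc_iv b hg (lexx 0); apply: le_lt_trans; apply: rint_le.
  - exact: (measurable_if_lt _ (measurable_norm mi)).
  - exact: (measurable_normc (cmeas_iv_pos b (lexx 0) mg)).
  - by move=> x; case: ifP.
  - move=> x; rewrite ivE; case: ifP => _; [exact: normc_geIm|exact: normc_ge0].
apply: filterS2 hr hi => x h1 h2 x0.
apply: (cderiv_near x0 (f := fun x => c + Int 0 x g)); first by move=> y y0; rewrite hf.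
have gx : g x = 0 + g x by rewrite add0r.
rewrite gx; apply: cderivD; first exact: cderiv_cst.
have -> : g x = pos g x by rewrite /pos x0.
split.
  have -> : (fun b => complex.Re (Int 0 b g)) =
      (fun b => \int[mu]_y (if y < b then complex.Re (pos g y) else 0)%R); last exact: h1.
    apply/funext => b; rewrite /Int ivE /cI/=.
    by apply: eq_Rintegral => y _; case: ifP.
have -> : (fun b => complex.Im (Int 0 b g)) =
      (fun b => \int[mu]_y (if y < b then complex.Im (pos g y) else 0)%R); last exact: h2.
    apply/funext => b; rewrite /Int ivE /cI/=.
  by apply: eq_Rintegral => y _; case: ifP.
Qed.

Lemma ac_sub f g b : abs_continuous 0 b f -> abs_continuous 0 b g ->
  abs_continuous 0 b (fun x => f x - g x).
Proof.
move=> hf hg e e0; have e2 : 0 < e / 2 by rewrite divr_gt0.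
have [d1 d10 h1] := hf _ e2; have [d2 d20 h2] := hg _ e2.
exists (Num.min d1 d2); first by rewrite lt_min d10.
move=> n u v huv tI; rewrite lt_min => /andP[s1 s2].
have k1 := h1 n u v huv tI s1; have k2 := h2 n u v huv tI s2.
apply: (@le_lt_trans _ _ (\sum_(i < n) normc (f (v i) - f (u i)) +
   \sum_(i < n) normc (g (v i) - g (u i)))); last first.
  by rewrite [e]splitr; exact: ltrD.
rewrite -big_split/=; apply: ler_sum => i _.
have -> : f (v i) - g (v i) - (f (u i) - g (u i)) = (f (v i) - f (u i)) - (g (v i) - g (u i)).
  by ring.
exact: normc_triB.
Qed.

(** For [0 <= x] this amounts to [f x = f 0 + Int 0 x g] with [g] in [L2loc], by [int_primitive] and
    [primitive_int]. Values of [f] at negative points are unconstrained. *)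
Definition primitive f g := [/\ loc_abs_continuous f, ae_derivative f g & L2loc g].

Lemma int_primitive g (c : R[i]) f : L2loc g ->
  (forall x, 0 <= x -> f x = c + Int 0 x g) -> primitive f g.
Proof. by move=> hg hf; split => //; [exact: Int_loc_ac hg hf|exact: Int_deriv hg hf]. Qed.

(** The difference of the two sides is absolutely continuous with zero derivative almost everywhere,
    hence constant. *)
Lemma primitive_int f g x : primitive f g -> 0 <= x -> f x = f 0 + Int 0 x g.
Proof.
move=> [acf /ae_derivativeP df hg]; rewrite le_eqVlt => /predU1P[<-|x0].
  by rewrite Int_ge// addr0.
have [acF /ae_derivativeP dF _] := @int_primitive g 0 (fun x => 0 + Int 0 x g) hg (fun x _ => erefl).
have := @ac_deriv0_const R (fun x => f x - (0 + Int 0 x g)) x x0 (ac_sub (acf _ x0) (acF _ x0)).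
rewrite (Int_ge g (lexx 0)) !add0r subr0 => <-; first by rewrite subrK.
apply: filterS2 df dF => y h1 h2 /andP[y0 _].
have := h2 y0 => k2; have := h1 y0 => k1.
have kN : cderiv y (fun z => -1 * (0 + Int 0 z g)) (0 * (0 + Int 0 y g) + (-1) * g y).
  by apply: cderivM => //; exact: cderiv_cst.
have := cderivD k1 kN; rewrite mul0r add0r mulN1r subrr.
by under eq_fun do rewrite mulN1r.
Qed.

Lemma primitive_bound f g b : primitive f g -> exists2 M : R, 0 < M &
  forall x, 0 <= x <= b -> normc (f x) <= M.
Proof.
move=> h; have [_ _ hg] := h; have [mg ig] := hg.
pose K := fine (rint mu (fun y => normc (iv 0 b g y))).
have K0 : 0 <= K by apply: fine_ge0; apply: rint_ge0 => x; exact: normc_ge0.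
exists (normc (f 0) + K + 1).
  by rewrite ltr_wpDl// addr_ge0// normc_ge0.
move=> x /andP[x0 xb]; rewrite (primitive_int h x0).
apply: le_trans (le_normcD _ _) _; rewrite -addrA lerD2l.
apply: (@le_trans _ _ K); last by rewrite lerDl.
apply: le_trans (Int_bound x hg (lexx 0)) _.
have [m1 i1] := L2loc_iv x hg (lexx 0); have [m2 i2] := L2loc_iv b hg (lexx 0).
rewrite fine_le ?ge0_fin_numE ?rint_ge0//; try by move=> y; exact: normc_ge0.
apply: rint_le; [exact: measurable_normc|exact: measurable_normc| |].
- by move=> y; exact: normc_ge0.
- by move=> y; exact: normc_iv_le.
Qed.

(** Measurability is read off the integral representation: [Int 0 x g] is a partial integral of a
    function measurable in both variables. *)
Lemma primitive_cmeas f g : primitive f g -> cmeas (pos f).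
Proof.
move=> h; have [_ _ [mg _]] := h.
have -> : pos f = pos (fun x => f 0 + Int 0 x g).
  by apply/funext => x; rewrite /pos; case: ifP => // x0; rewrite (primitive_int h (ltW x0)).
apply: cmeas_pos_of; apply: cmeasD; first exact: cmeas_cst.
apply: (cmeas_cI mu (F := fun z : R * R => iv 0 z.1 g z.2)).
have -> : (fun z : R * R => iv 0 z.1 g z.2) =
    (fun z : R * R => if z.2 < z.1 then pos g z.2 else 0).
  by apply/funext => -[a y]/=; rewrite /iv /pos; case: (0 < y); case: (y < a).
apply: cmeas_if; last exact: cmeas_cst.
  by apply: measurable_fun_ltr; [exact: measurable_snd|exact: measurable_fst].
by apply: (cmeas_comp mg); exact: measurable_snd.
Qed.

Lemma L2locD f g : L2loc f -> L2loc g -> L2loc (fun x => f x + g x).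
Proof.
move=> [mf hf] [mg hg]; split; first by rewrite posD; exact: cmeasD.
move=> b; rewrite (_ : iv 0 b _ = fun x => iv 0 b f x + iv 0 b g x).
  by apply: N2_fineD => //; exact: cmeas_iv_pos.
by apply/funext => x; rewrite /iv; case: ifP => // _; rewrite addr0.
Qed.

Lemma L2loc_mul_bounded f g : cmeas (pos f) ->
  (forall b : R, exists2 M : R, 0 < M & forall x, 0 <= x <= b -> normc (f x) <= M) ->
  L2loc g -> L2loc (fun x => f x * g x).
Proof.
move=> mf bf [mg hg]; split.
  rewrite (_ : pos _ = fun x => pos f x * pos g x); first exact: cmeasM.
  by apply/funext => x; rewrite /pos; case: ifP => // _; rewrite mul0r.
move=> b; have [M M0 hM] := bf b.
apply: (@le_lt_trans _ _ (N2 mu (fun x => M%:C * iv 0 b g x))); last first.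
  by rewrite N2Z ?lte_mul_pinfty ?lee_fin ?sqr_ge0//; exact: cmeas_iv_pos.
have ivM x : iv 0 b (fun x => f x * g x) x = iv 0 b f x * iv 0 b g x.
  by rewrite /iv; case: ifP => // _; rewrite mul0r.
apply: N2_le.
- rewrite (_ : iv _ _ _ = fun x => iv 0 b f x * iv 0 b g x); last exact/funext.
  by apply: cmeasM; exact: cmeas_iv_pos.
- by apply: cmeasM; [exact: cmeas_cst|exact: cmeas_iv_pos].
- move=> x; rewrite ivM !normcM normc_real (gtr0_norm M0) ler_wpM2r ?normc_ge0//.
  rewrite /iv; case: ifP => [/andP[x0 xb]|_]; last by rewrite normc0 ltW.
  by apply: hM; rewrite !ltW.
Qed.

Lemma primitive_mul f1 g1 f2 g2 : primitive f1 g1 -> primitive f2 g2 ->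
  primitive (fun x => f1 x * f2 x) (fun x => g1 x * f2 x + f1 x * g2 x).
Proof.
move=> h1 h2; have [ac1 /ae_derivativeP d1 l1] := h1; have [ac2 /ae_derivativeP d2 l2] := h2.
split.
- move=> b b0 e e0.
  have [M1 M10 hM1] := primitive_bound b h1; have [M2 M20 hM2] := primitive_bound b h2.
  have e1 : 0 < e / (2 * M2) by rewrite divr_gt0// mulr_gt0.
  have e2 : 0 < e / (2 * M1) by rewrite divr_gt0// mulr_gt0.
  have [r1 r10 k1] := ac1 b b0 _ e1; have [r2 r20 k2] := ac2 b b0 _ e2.
  exists (Num.min r1 r2); first by rewrite lt_min r10.
  move=> n u v huv tI; rewrite lt_min => /andP[s1 s2].
  have {k1} := k1 n u v huv tI s1; have {k2} := k2 n u v huv tI s2.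
  rewrite ltr_pdivlMr ?mulr_gt0// => k2; rewrite ltr_pdivlMr ?mulr_gt0// => k1.
  apply: (@le_lt_trans _ _ (M2 * (\sum_(i < n) normc (f1 (v i) - f1 (u i))) +
     M1 * (\sum_(i < n) normc (f2 (v i) - f2 (u i))))).
    rewrite !mulr_sumr -big_split/=; apply: ler_sum => i _.
    have [u0 uv vb] := huv i (ltn_ord i).
    have -> : f1 (v i) * f2 (v i) - f1 (u i) * f2 (u i) =
    f2 (v i) * (f1 (v i) - f1 (u i)) + f1 (u i) * (f2 (v i) - f2 (u i)) by ring.
  apply: le_trans (le_normcD _ _) _; rewrite !normcM; apply: lerD.
    by rewrite ler_wpM2r ?normc_ge0// hM2// (le_trans u0 uv).
  by rewrite ler_wpM2r ?normc_ge0// hM1// u0 (le_trans uv vb).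
  move: k1 k2; move: (\sum_(i < n) normc (f1 _ - _)) (\sum_(i < n) normc (f2 _ - _)) => S1 S2; lra.
- apply/ae_derivativeP; apply: filterS2 d1 d2 => x k1 k2 x0.
  by apply: cderivM; [exact: k1|exact: k2].
- apply: L2locD.
    rewrite (_ : (fun x => _) = fun x => f2 x * g1 x); last by apply/funext => x; rewrite mulrC.
    by apply: L2loc_mul_bounded => //; [exact: primitive_cmeas h2|move=> b; exact: primitive_bound h2].
  by apply: L2loc_mul_bounded => //; [exact: primitive_cmeas h1|move=> b; exact: primitive_bound h1].
Qed.

Lemma primitive_D f1 g1 f2 g2 : primitive f1 g1 -> primitive f2 g2 ->
  primitive (fun x => f1 x + f2 x) (fun x => g1 x + g2 x).
Proof.
move=> h1 h2; have [_ _ l1] := h1; have [_ _ l2] := h2.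
apply: (int_primitive (c := f1 0 + f2 0)); first exact: L2locD.
move=> x x0; rewrite (primitive_int h1 x0) (primitive_int h2 x0) addrACA; congr (_ + _).
rewrite /Int -cID; [|exact: L2loc_iv..].
by apply: cI_eq => y; rewrite /iv; case: ifP => // _; rewrite addr0.
Qed.

End primitives.

(** * Dominated convergence *)

Section dominated.
Context d {T : measurableType d} {R : realType} (mu : {measure set T -> \bar R}).

Lemma rint_dct (h : nat -> T -> R) (g : T -> R) :
  (forall n, measurable_fun setT (h n)) -> measurable_fun setT g ->
  (forall n x, 0 <= h n x <= g x) -> (rint mu g < +oo)%E ->
  (forall x, h n x @[n --> \oo] --> (0 : R)) ->
  fine (rint mu (h n)) @[n --> \oo] --> (0 : R).
Proof.
move=> mh mg hg gi h0.
have g0 x : 0 <= g x by have /andP[a b] := hg 0%N x; exact: le_trans b.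
have ig : mu.-integrable setT (EFin \o g).
  apply/integrableP; split; first exact/measurable_EFinP.
  by apply: le_lt_trans gi; apply: rint_le => // [|x]; [exact: measurableT_comp|rewrite ger0_norm].
have := @dominated_cvg _ _ _ mu setT measurableT (fun n x => (h n x)%:E) (cst 0%E) (EFin \o g).
move=> /(_ (fun n => (measurable_EFinP _ _).2 (mh n))).
have H1 : forall x, setT x -> (h x0 x)%:E @[x0 --> \oo] --> (cst 0%E x : \bar R).
  by move=> x _; apply: cvg_EFin; [exact: nearW|exact: h0].
have H2 : forall n x, setT x -> (`|(h n x)%:E| <= (EFin \o g) x)%E.
  by move=> n x _; have /andP[a b] := hg n x; rewrite /= lee_fin ger0_norm.
move=> /(_ H1 (fun x _ => isT) ig H2); rewrite integral0.
by move=> /fine_cvgP [_]; apply: cvg_trans; apply: near_eq_cvg; exact: nearW.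
Qed.

Lemma rint_dct_lt (h : nat -> T -> R) (g : T -> R) (e : R) :
  (forall n, measurable_fun setT (h n)) -> measurable_fun setT g ->
  (forall n x, 0 <= h n x <= g x) -> (rint mu g < +oo)%E ->
  (forall x, h n x @[n --> \oo] --> (0 : R)) -> 0 < e ->
  \forall n \near \oo, (rint mu (h n) <= e%:E)%E.
Proof.
move=> mh mg hg gi h0 e0.
have := rint_dct mh mg hg gi h0 => /cvgrPdist_le /(_ e e0).
apply: filterS => n; rewrite sub0r normrN => hn.
have hn0 : (0 <= rint mu (h n))%E by apply: rint_ge0 => x; have /andP[] := hg n x.
have hfin : (rint mu (h n) < +oo)%E.
  by apply: le_lt_trans gi; apply: rint_le => // x; have /andP[] := hg n x.
rewrite -(fineK (x := rint mu (h n))) ?ge0_fin_numE// lee_fin.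
by apply: le_trans hn; rewrite ler_norm.
Qed.

End dominated.

(** * Integration by parts on the half-line *)

Section ibp.
Context {R : realType}.
Notation mu := (@lebesgue_measure R).
Implicit Types f g : R -> R[i].

Lemma rint_tail (m : R -> R) (e : R) : measurable_fun setT m -> (forall x, 0 <= m x) ->
  (rint mu m < +oo)%E -> 0 < e ->
  exists2 X : R, 0 <= X & (rint mu (fun y => if X < y then m y else 0)%R <= e%:E)%E.
Proof.
move=> mm m0 mi e0.
have mh (X : R) : measurable_fun setT (fun y => if X < y then m y else 0).
  by apply: measurable_fun_ifT => //; exact: measurable_fun_ltr.
have := @rint_dct_lt _ _ _ mu (fun n y => if n%:R < y then m y else 0) m e
  (fun n => mh _) mm.
case=> //.
- by move=> n x; case: ifP; rewrite ?lexx m0.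
- move=> x; apply: cvg_near_cst; near=> n; rewrite ltNge.
  suff -> : x <= n%:R by [].
  by near: n; exact: nbhs_infty_ger.
- move=> n _ /(_ n (leqnn n)) h; exists n%:R => //.
Unshelve. all: by end_near. Qed.

Lemma primitive_eq f f' g : (forall x, 0 <= x -> f x = f' x) -> primitive f g -> primitive f' g.
Proof.
move=> ff h; have [_ _ hg] := h; apply: (int_primitive (c := f 0)) => // x x0.
by rewrite -ff// (primitive_int h x0).
Qed.

Lemma primitive_ae f g g' : L2loc g' -> {ae mu, forall x, pos g x = pos g' x} -> primitive f g -> primitive f g'.
Proof.
move=> hg' gg h; have [_ _ hg] := h; apply: (int_primitive (c := f 0)) => // x x0.
rewrite (primitive_int h x0); congr (_ + _); apply: cI_ae.
- by case: (L2loc_iv x hg (lexx 0)).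
- by case: (L2loc_iv x hg' (lexx 0)).
- apply: filterS gg => y; rewrite /pos /iv; case: (0 < y) => //= ->//.
Qed.

Lemma primitive_deriv_unique f g g' : primitive f g -> primitive f g' -> eqL2 g g'.
Proof.
move=> [_ /ae_derivativeP h1 _] [_ /ae_derivativeP h2 _]; apply/eqL2P.
apply: filterS2 h1 h2 => x k1 k2; rewrite /pos; case: ifP => // x0.
exact: cderiv_unique (k1 x0) (k2 x0).
Qed.

Lemma domAstarP f : domAstar f <-> exists g, [/\ L2 f, L2 g & primitive f g].
Proof.
split.
  move=> [acf hf [g [hg dg]]]; exists g; split => //; split => //; exact: L2_L2loc.
by move=> [g [hf hg [acf dg _]]]; split => //; exists g.
Qed.

Lemma derivL2P f : domAstar f -> L2 (derivL2 f) /\ primitive f (derivL2 f).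
Proof.
move=> [acf hf ex].
have : [set g : 'Fun(R) | L2 g /\ ae_derivative f g] (derivL2 f).
  by rewrite /derivL2; apply: xgetPex.
by move=> [hg dg]; split => //; split => //; exact: L2_L2loc.
Qed.

Lemma derivL2_primitive f g : L2 f -> L2 g -> primitive f g -> eqL2 (derivL2 f) g.
Proof.
move=> hf hg h; have df : domAstar f by apply/domAstarP; exists g.
by have [_ h'] := derivL2P df; exact: primitive_deriv_unique h' h.
Qed.

(** Integrability of [h'] makes [h] converge at infinity to [l]. A nonzero limit would keep
    [normc h] above [normc l / 2] beyond some [X], against the integrability of [h]. *)
Lemma primitive_lim0 h h' : primitive h h' -> cL1 mu (pos h) -> cL1 mu (pos h') ->
  cI mu (pos h') = - h 0.
Proof.
move=> H [mh ih] [mh' ih'].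
have l2 : L2loc h' by case: H.
pose l := h 0 + cI mu (pos h').
suff : l = 0 by rewrite /l addrC => /eqP; rewrite addr_eq0 => /eqP.
have [//|l0] := eqVneq l 0; exfalso.
have nl0 : 0 < normc l.
  by rewrite lt_neqAle normc_ge0 andbT eq_sym; apply: contra l0 => /eqP/normc_eq0P ->.
have e0 : 0 < normc l / 2 by rewrite divr_gt0.
have [X X0 hX] := rint_tail (measurable_normc mh') (fun x => normc_ge0 _) ih' e0.
have key x : X < x -> normc l / 2 <= normc (h x).
  move=> Xx; have x0 := le_lt_trans X0 Xx.
  have hE : l - h x = cI mu (fun y => if x < y then pos h' y else 0).
    rewrite (primitive_int H (ltW x0)) /l opprD addrACA subrr add0r /Int -cIB; last 2 first.
    - by split.
    - exact: L2loc_iv.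
    apply: cI_ae.
    - by apply: cmeasB => //; exact: cmeas_iv_pos.
    - by apply: cmeas_if mh' (cmeas_cst _); exact: measurable_fun_ltr.
    - have := ae_neq x; apply: filterS => y yx; rewrite /iv /pos.
      by case: (ltgtP y x) => [yx'|xy|/yx//]; case: (ltP 0 y) => //= y0; rewrite ?subrr ?subr0.
  have hn : normc (l - h x) <= normc l / 2.
    rewrite hE; rewrite -lee_fin; apply: le_trans hX.
    apply: le_trans (norm_cI mu _) _.
      by apply: cmeas_if mh' (cmeas_cst _); exact: measurable_fun_ltr.
    have mX (Z : R) : measurable_fun setT (fun y : R => if Z < y then normc (pos h' y) else 0).
      by apply: measurable_fun_ifT => //; [exact: measurable_fun_ltr|exact: measurable_normc].
    rewrite (_ : (fun y => normc _) = (fun y : R => if x < y then normc (pos h' y) else 0)); last first.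
      by apply/funext => y; case: ifP => // _; rewrite normc0.
    apply: rint_le; [exact: mX|exact: mX| |].
    - by move=> y; case: ifP => // _; exact: normc_ge0.
    - move=> y; case: ifP => [xy|_]; first by rewrite (lt_trans Xx xy).
      by case: ifP => // _; exact: normc_ge0.
  have : normc l <= normc (l - h x) + normc (h x).
    by apply: le_trans (le_normcD _ _); rewrite subrK.
  by move: hn; lra.
have Kfin := ih; pose K := fine (rint mu (fun x => normc (pos h x))).
have KE : rint mu (fun x => normc (pos h x)) = K%:E.
  by rewrite /K fineK// ge0_fin_numE// rint_ge0// => x; exact: normc_ge0.
have K0 : 0 <= K by apply: fine_ge0; apply: rint_ge0 => x; exact: normc_ge0.
(* The length for which the lower bound [normc l / 2 * N] equals [K + 1], more than the whole
   integral of [normc h]. *)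
pose N := (K + 1) / (normc l / 2).
have N0 : 0 < N by rewrite divr_gt0// ltr_wpDl.
have : ((normc l / 2 * N)%:E <= K%:E)%E.
  rewrite -KE.
  have -> : ((normc l / 2 * N)%:E = rint mu (fun y => normc l / 2 * ((X < y) && (y < X + N))%:R)%R)%E.
    rewrite (rintZ mu (f := fun y : R => ((X < y) && (y < X + N))%:R)) ?ltW//; last first.
      exact: measurable_between_nat.
    by rewrite rint_between ?lerDl ?ltW// (addrC X) addrK.
  apply: rint_le.
  - by apply: measurable_funM => //; exact: measurable_between_nat.
  - exact: measurable_normc.
  - by move=> y; rewrite mulr_ge0// ltW.
  - move=> y; case: (boolP (_ && _)) => [/andP[Xy _]|_]; last by rewrite mulr0 normc_ge0.
    by rewrite mulr1 /pos (le_lt_trans X0 Xy) key.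
rewrite lee_fin /N mulrC divfK ?gt_eqF// -subr_ge0 => hh.
by move: hh; lra.
Qed.

(** Products of two L^2 functions are integrable, so [primitive_lim0] applies to the product [f g]
    and infinity contributes no boundary term. *)
Lemma pairing_ibp f f' g g' : L2 f -> L2 f' -> L2 g -> L2 g' -> primitive f f' -> primitive g g' ->
  pairing f' g + pairing f g' = - (f 0 * g 0).
Proof.
move=> hf hf' hg hg' h1 h2.
have H := primitive_mul h1 h2.
have posM (a b : R -> R[i]) : pos (fun x => a x * b x) = fun x => pos a x * pos b x.
  by apply/funext => x; rewrite /pos; case: ifP => // _; rewrite mul0r.
rewrite -(primitive_lim0 H); last 2 first.
- by rewrite posM; exact: pairing_L1.
- by rewrite posD !posM; apply: cL1D; exact: pairing_L1.
by rewrite posD !posM cID ?pairingE//; exact: pairing_L1.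
Qed.

(** The exponential is Lipschitz on [[0, b]]. The mean value theorem is applied to the real and
    imaginary parts separately, whence the constant [2 * L]. *)
Lemma expC_loc_ac (z : R[i]) : loc_abs_continuous (fun x : R => expC (z * x%:C)).
Proof.
move=> b b0 e e0.
pose L := normc z * expR (`|complex.Re z| * b).
have dE x : cderiv x (fun y => expC (z * y%:C)) (z * expC (z * x%:C)) := cderiv_exp x z.
have bnd x : 0 <= x -> x <= b -> normc (z * expC (z * x%:C)) <= L.
  move=> x0 xb; rewrite normcM ler_wpM2l ?normc_ge0// normc_expC cReMr ler_expR.
  apply: (@le_trans _ _ (`|complex.Re z| * x)); first by rewrite ler_wpM2r// ler_norm.
  by rewrite ler_wpM2l.
have L0 : 0 <= L by rewrite mulr_ge0 ?normc_ge0 ?expR_ge0.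
have lip (h : R -> R) (dh : R -> R) u v : (forall x : R, is_derive x (1 : R) h (dh x)) ->
    (forall x, 0 <= x -> x <= b -> `|dh x| <= L) -> 0 <= u -> u <= v -> v <= b ->
    `|h v - h u| <= L * (v - u).
  move=> hd hL u0 uv vb.
  have [c cin ->] := MVT_segment uv (fun x _ => hd x) (continuous_subspaceT
    (fun x => differentiable_continuous ((derivable1_diffP _ _).1 (@ex_derive _ _ _ _ _ _ _ (hd x))))).
  move: cin; rewrite in_itv/= => /andP[uc cv].
  rewrite normrM (ger0_norm (x := v - u)) ?subr_ge0// ler_wpM2r ?subr_ge0//.
  by apply: hL; [exact: le_trans uc|exact: le_trans vb].
have L1 : 0 < 2 * L + 1 by rewrite ltr_wpDl// mulr_ge0.
exists (e / (2 * L + 1)); first by rewrite divr_gt0.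
move=> n u v huv _ hs.
apply: (@le_lt_trans _ _ (2 * L * \sum_(i < n) (v i - u i))).
  rewrite mulr_sumr; apply: ler_sum => i _; have [u0 uv vb] := huv i (ltn_ord i).
  apply: le_trans (normc_leReIm _) _; rewrite !(cReD, cReN, cImD, cImN).
  rewrite -mulrA mulrDl mul1r; apply: lerD.
    apply: (lip (fun x => complex.Re (expC (z * x%:C))) (fun x => complex.Re (z * expC (z * x%:C)))) => //.
      by move=> x; case: (dE x).
    by move=> x x0 xb; apply: le_trans (normc_geRe _) (bnd x x0 xb).
  apply: (lip (fun x => complex.Im (expC (z * x%:C))) (fun x => complex.Im (z * expC (z * x%:C)))) => //.
    by move=> x; case: (dE x).
  by move=> x x0 xb; apply: le_trans (normc_geIm _) (bnd x x0 xb).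
have S0 : 0 <= \sum_(i < n) (v i - u i).
  by apply: sumr_ge0 => i _; have [_ uv _] := huv i (ltn_ord i); rewrite subr_ge0.
move: hs; rewrite ltr_pdivlMr//; move: S0; move: (\sum_(i < n) _) => S S0.
by rewrite mulrDr mulr1 mulrC => hs; apply: le_lt_trans hs; rewrite lerDl.
Qed.

Lemma cmeas_exp (z : R[i]) : cmeas (fun x : R => expC (z * x%:C)).
Proof. by apply: cmeas_expC; apply: cmeasM; [exact: cmeas_cst|exact: cmeas_real]. Qed.

Lemma primitive_exp (z : R[i]) : primitive (fun x : R => expC (z * x%:C)) (fun x => z * expC (z * x%:C)).
Proof.
split; first exact: expC_loc_ac.
  by apply/ae_derivativeP; apply: nearW => x _; exact: cderiv_exp.
have m : cmeas (fun x : R => z * expC (z * x%:C)) by apply: cmeasM; [exact: cmeas_cst|exact: cmeas_exp].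
split; first exact: cmeas_pos_of.
move=> b; have [b0|b0] := leP b 0.
  rewrite (_ : iv 0 b _ = fun=> 0).
    by rewrite /N2 /rint; under eq_integral do rewrite normc0 expr0n; rewrite integral0.
  apply/funext => y; rewrite /iv; case: ifP => // /andP[y0 yb].
  by have := lt_le_trans (lt_trans y0 yb) b0; rewrite ltxx.
pose M := normc z * expR (`|complex.Re z| * b).
apply: (@le_lt_trans _ _ (N2 mu (fun x => M%:C * iv 0 b (fun=> 1) x))); last first.
  rewrite N2Z; last by apply: cmeas_iv; exact: cmeas_cst.
  by rewrite N2_between ?ltW// -EFinM ltry.
apply: N2_le.
- exact: cmeas_iv.
- by apply: cmeasM; [exact: cmeas_cst|apply: cmeas_iv; exact: cmeas_cst].
- move=> x; rewrite normcM normc_real ger0_norm ?mulr_ge0 ?normc_ge0 ?expR_ge0//.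
  rewrite /iv; case: ifP => [/andP[x0 xb]|_]; last by rewrite normc0 mulr0.
  rewrite normc1 mulr1 normcM ler_wpM2l ?normc_ge0// normc_expC cReMr ler_expR.
  apply: (@le_trans _ _ (`|complex.Re z| * x)); first by rewrite ler_wpM2r ?ler_norm// ltW.
  by rewrite ler_wpM2l// ltW.
Qed.

End ibp.

(** * The Riesz representation theorem *)

Section real_riesz.
Context d {T : measurableType d} {R : realType}
  (mu : {sigma_finite_measure set T -> \bar R}).
Implicit Types h k : T -> R.

Definition sqint h := measurable_fun setT h /\ (rint mu (fun x => h x ^+ 2)%R < +oo)%E.

Definition sqn h : R := fine (rint mu (fun x => h x ^+ 2)).

Lemma sqnE h : sqint h -> rint mu (fun x => h x ^+ 2) = (sqn h)%:E.
Proof.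
by move=> [_ i]; rewrite /sqn fineK// ge0_fin_numE// rint_ge0// => x; exact: sqr_ge0.
Qed.

Lemma sqn_ge0 h : 0 <= sqn h.
Proof. by apply: fine_ge0; apply: rint_ge0 => x; exact: sqr_ge0. Qed.

Lemma measurable_sq h : measurable_fun setT h -> measurable_fun setT (fun x => h x ^+ 2).
Proof. exact: measurable_funX. Qed.

Lemma sqint_le h k : measurable_fun setT h -> sqint k -> (forall x, `|h x| <= `|k x|) ->
  sqint h.
Proof.
move=> mh [mk ik] hk; split => //; apply: le_lt_trans ik; apply: rint_le.
- exact: measurable_sq.
- exact: measurable_sq.
- by move=> x; exact: sqr_ge0.
- move=> x; rewrite -(real_normK (num_real (h x))) -(real_normK (num_real (k x))).
  by rewrite lerXn2r// nnegrE.
Qed.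

Lemma sqintD h k : sqint h -> sqint k -> sqint (fun x => h x + k x).
Proof.
move=> [mh ih] [mk ik]; split; first exact: measurable_funD.
have m1 := measurable_sq mh; have m2 := measurable_sq mk.
apply: (@le_lt_trans _ _ (rint mu (fun x => 2 * (h x ^+ 2 + k x ^+ 2))%R)).
  apply: rint_le.
  - by apply: measurable_sq; exact: measurable_funD.
  - by apply: measurable_funM => //; exact: measurable_funD.
  - by move=> x; exact: sqr_ge0.
  - by move=> x; have := sqr_ge0 (h x - k x); nra.
rewrite rintZ//; last 2 first.
- exact: measurable_funD.
- by move=> x; rewrite addr_ge0// sqr_ge0.
rewrite rintD//; try by move=> x; exact: sqr_ge0.
by rewrite lte_mul_pinfty// lte_add_pinfty.
Qed.

Lemma sqintZ (a : R) h : sqint h -> sqint (fun x => a * h x).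
Proof.
move=> [mh ih]; split; first exact: measurable_funM.
under eq_fun do rewrite exprMn.
rewrite rintZ ?sqr_ge0//; last 2 first.
- exact: measurable_sq.
- by move=> x; exact: sqr_ge0.
by rewrite lte_mul_pinfty// lee_fin sqr_ge0.
Qed.

Lemma sqint_prod h k : sqint h -> sqint k ->
  mu.-integrable setT (EFin \o (fun x => h x * k x)).
Proof.
move=> [mh ih] [mk ik]; have m1 := measurable_sq mh; have m2 := measurable_sq mk.
apply/integrableP; split; first by apply/measurable_EFinP; exact: measurable_funM.
apply: (@le_lt_trans _ _ (rint mu (fun x => h x ^+ 2 + k x ^+ 2)%R)).
  apply: rint_le.
  - by apply: measurableT_comp => //; exact: measurable_funM.
  - exact: measurable_funD.
  - by [].
  - move=> x; rewrite ler_norml; have := sqr_ge0 (h x - k x); have := sqr_ge0 (h x + k x).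
    by have := sqr_ge0 (h x); have := sqr_ge0 (k x) => *; apply/andP; split; nra.
rewrite rintD//; try by move=> x; exact: sqr_ge0.
exact: lte_add_pinfty.
Qed.

Lemma sqint_CS h k : sqint h -> sqint k ->
  (\int[mu]_x (h x * k x)) ^+ 2 <= sqn h * sqn k.
Proof.
move=> hh hk; have [mh ih] := hh; have [mk ik] := hk.
have ihk := sqint_prod hh hk.
have := @rint_CS _ _ _ mu (fun x => `|h x|) (fun x => `|k x|) (Num.sqrt (sqn h)) (Num.sqrt (sqn k)).
have mn (f : T -> R) : measurable_fun setT f -> measurable_fun setT (fun x => `|f x|).
  by move=> mf; exact: measurableT_comp.
move=> /(_ (mn _ mh) (mn _ mk) (fun x => normr_ge0 _) (fun x => normr_ge0 _)
  (sqrtr_ge0 _) (sqrtr_ge0 _)).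
rewrite !sqr_sqrtr ?sqn_ge0// -!sqnE//.
have e1 : forall f : T -> R, rint mu (fun x => (`|f x| ^+ 2)%R) = rint mu (fun x => (f x ^+ 2)%R).
  by move=> f; congr rint; apply/funext => x; rewrite real_normK// num_real.
rewrite !e1 => /(_ (lexx _) (lexx _)) H.
have K : `|\int[mu]_x (h x * k x)| <= Num.sqrt (sqn h) * Num.sqrt (sqn k).
  rewrite -lee_fin (EFin_normr_Rintegral measurableT)//; apply: le_trans H.
  apply: le_trans (le_abse_integral _ measurableT (measurable_int _ ihk)) _.
  rewrite le_eqVlt; apply/orP; left; apply/eqP; apply: eq_integral => x _.
  by rewrite /= normrM.
rewrite -[sqn h]sqr_sqrtr ?sqn_ge0// -[sqn k]sqr_sqrtr ?sqn_ge0// -exprMn.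
by rewrite -(real_normK (num_real (\int[mu]_x _))) lerXn2r// nnegrE mulr_ge0.
Qed.

Variables w wi : T -> R.
Hypothesis w0 : forall x, 0 < w x.
Hypothesis wwi : forall x, w x * wi x = 1.
Hypothesis mwi : measurable_fun setT wi.
Hypothesis sw : sqint w.

Variable psi : (T -> R) -> R.
Variable C : R.
Hypothesis C0 : 0 <= C.
Hypothesis psi_lin : forall a h k, sqint h -> sqint k ->
  psi (fun x => a * h x + k x) = a * psi h + psi k.
Hypothesis psi_bnd : forall h, sqint h -> psi h ^+ 2 <= C * sqn h.

(** A charge must be finite on every measurable set, while the indicator of a set of infinite
    measure is not square integrable. The square integrable positive weight [w] repairs this; the
    density of the charge is divided by [w] afterwards to give [theta]. *)
Let ind (A : set T) : T -> R := fun x => \1_A x * w x.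

Let ind_sq (A : set T) : measurable A -> sqint (ind A).
Proof.
move=> mA; apply: sqint_le sw _.
  by apply: measurable_funM; [exact: measurable_indic|case: sw].
move=> x; rewrite normrM indicE; case: (_ \in _); first by rewrite normr1 mul1r.
by rewrite normr0 mul0r.
Qed.

Let psi0 : psi (fun=> 0) = 0.
Proof.
have s0 : sqint (fun=> 0).
  by apply: (sqint_le _ sw); [exact: measurable_cst|move=> x; rewrite normr0].
have := psi_bnd s0; rewrite /sqn /rint.
under eq_integral do rewrite expr0n.
by rewrite integral0 /= mulr0 => h; apply/eqP; rewrite -sqrf_eq0 eq_le h sqr_ge0.
Qed.

Let psiD h k : sqint h -> sqint k -> psi (fun x => h x + k x) = psi h + psi k.
Proof.
by move=> hh hk; rewrite -[in RHS](mul1r (psi h)) -psi_lin//; congr psi; apply/funext => x; rewrite mul1r.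
Qed.

Let psiZ a h : sqint h -> psi (fun x => a * h x) = a * psi h.
Proof.
move=> hh; have s0 : sqint (fun=> 0).
  by apply: (sqint_le _ sw); [exact: measurable_cst|move=> x; rewrite normr0].
by rewrite -[RHS]addr0 -psi0 -psi_lin//; congr psi; apply/funext => x; rewrite addr0.
Qed.

Let nu (A : set T) : \bar R := (psi (ind A))%:E.

Let nu0 : nu set0 = 0%E.
Proof.
rewrite /nu (_ : ind set0 = fun=> 0) ?psi0//.
by apply/funext => x; rewrite /ind indic0 mul0r.
Qed.

Let nufin (A : set T) : d.-measurable A -> nu A \is a fin_num.
Proof. by []. Qed.

(** The weighted indicators of the partial unions tend in L^2 to that of the whole union, by
    dominated convergence under [w^2], and [psi] is continuous for the L^2 norm. *)
Let nu_sigma : semi_sigma_additive nu.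
Proof.
move=> F mF tF mUF.
have finE n : (\sum_(0 <= i < n) nu (F i) = nu (\big[setU/set0]_(i < n) F i))%E.
  elim: n => [|n ih]; first by rewrite big_geq// big_ord0 nu0.
  have mU : measurable (\big[setU/set0]_(i < n) F i) by apply: bigsetU_measurable.
  rewrite big_nat_recr//= ih /nu -EFinD -psiD; [|exact: ind_sq..].
  congr (psi _)%:E; apply/funext => x; rewrite /ind big_ord_recr/= -mulrDl; congr (_ * _).
  rewrite !indicE in_setU; case: (boolP (x \in F n)) => xn; last by rewrite orbF addr0.
  rewrite orbT; case: (boolP (x \in \big[_/_]_(_ < _) _)) => [|_]; last by rewrite add0r.
  rewrite inE -bigcup_mkord => -[i /= ilt Fix]; exfalso.
  have := tF i n I I; rewrite inE in xn => /(_ (ex_intro _ x (conj Fix xn))) e.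
  by rewrite e ltnn in ilt.
under eq_fun do rewrite finE.
rewrite /nu; apply: cvg_EFin; first exact: nearW.
set UF := \bigcup_n F n.
have mUn n : measurable (\big[setU/set0]_(i < n) F i) by apply: bigsetU_measurable.
pose D n x : R := ind UF x - ind (\big[setU/set0]_(i < n) F i) x.
have sD n : sqint (D n).
  have -> : D n = fun x => ind UF x + -1 * ind (\big[setU/set0]_(i < n) F i) x.
    by apply/funext => x; rewrite mulN1r.
  by apply: sqintD; [exact: ind_sq|apply: sqintZ; exact: ind_sq].
have psiDn n : psi (ind UF) - psi (ind (\big[setU/set0]_(i < n) F i)) = psi (D n).
  rewrite -mulN1r -psiZ; last exact: ind_sq.
  rewrite -psiD; [|exact: ind_sq|apply: sqintZ; exact: ind_sq].
  by congr psi; apply/funext => x; rewrite mulN1r.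
have lim0 : fine (rint mu (fun x => D n x ^+ 2)) @[n --> \oo] --> (0 : R).
  apply: (rint_dct (g := fun x => w x ^+ 2)).
  - by move=> n; apply: measurable_sq; case: (sD n).
  - by apply: measurable_sq; case: sw.
  - move=> n x; rewrite sqr_ge0/= /D /ind -mulrBl exprMn; apply: ler_piMl; first exact: sqr_ge0.
    rewrite !indicE; case: (_ \in _); case: (_ \in _);
      by rewrite ?subrr ?subr0 ?sub0r ?sqrrN ?expr1n ?expr0n.
  - by case: sw.
  - move=> x; apply: cvg_near_cst.
    have [[i _ Fix]|nx] := pselect (UF x).
      exists i.+1 => // n /= ni; rewrite /D /ind -mulrBl !indicE.
      rewrite mem_set; last by exists i.
      rewrite mem_set ?subrr ?mul0r ?expr0n//.
      by rewrite -bigcup_mkord; exists i.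
    apply: nearW => n; rewrite /D /ind -mulrBl !indicE memNset// memNset ?subrr ?mul0r ?expr0n//.
    by rewrite -bigcup_mkord => -[i _ Fix]; apply: nx; exists i.
apply/cvgrPdist_le => e e0.
have e1 : 0 < e ^+ 2 / (C + 1) by rewrite divr_gt0// ?exprn_gt0// ltr_wpDl.
have := lim0 => /cvgrPdist_le /(_ _ e1); apply: filterS => n.
rewrite sub0r normrN => hn.
suff K : `|psi (D n)| ^+ 2 <= e ^+ 2.
  by rewrite /= psiDn; move: K; rewrite ler_pXn2r// nnegrE ltW.
rewrite real_normK ?num_real//.
apply: le_trans (psi_bnd (sD n)) _.
apply: (@le_trans _ _ ((C + 1) * sqn (D n))).
  by rewrite ler_wpM2r ?sqn_ge0// lerDl.
rewrite mulrC -ler_pdivlMr; last by rewrite ltr_wpDl.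
by apply: le_trans hn; rewrite ler_norm.
Qed.

HB.instance Definition _ := isCharge.Build d T R nu nu0 nufin nu_sigma.

Let nu_mu : nu `<< mu.
Proof.
move=> A hA B mB BA; have B0 := hA B mB BA.
rewrite /nu; congr EFin; apply/eqP; rewrite -sqrf_eq0 eq_le sqr_ge0 andbT.
apply: le_trans (psi_bnd (ind_sq mB)) _.
suff -> : sqn (ind B) = 0 by rewrite mulr0.
rewrite /sqn (_ : rint _ _ = 0%E)//.
have -> : rint mu (fun x => (ind B x ^+ 2)%R) = (\int[mu]_(x in B) `|(w x ^+ 2)%:E|)%E.
  rewrite [RHS]integral_mkcond /rint; apply: eq_integral => x _.
  rewrite /ind patchE indicE; case: (x \in B); rewrite ?mul1r ?mul0r ?expr0n//.
  by rewrite gee0_abs// lee_fin sqr_ge0.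
apply: integral_abs_eq0 => //.
by apply/measurable_EFinP; apply: measurable_funTS; apply: measurable_sq; case: sw.
Qed.

Let kap x : R := fine (Radon_Nikodym nu mu x).

Let kapE x : (kap x)%:E = Radon_Nikodym nu mu x.
Proof. by rewrite /kap fineK// Radon_Nikodym_fin_num. Qed.

Let kap_int : mu.-integrable setT (EFin \o kap).
Proof.
have -> : EFin \o kap = Radon_Nikodym nu mu by apply/funext => x /=; rewrite kapE.
exact: Radon_Nikodym_integrable.
Qed.

Let mkap : measurable_fun setT kap.
Proof. by apply/measurable_EFinP; exact: measurable_int kap_int. Qed.

Let theta x : R := kap x * wi x.

Let mtheta : measurable_fun setT theta.
Proof. exact: measurable_funM. Qed.

Let wi0 x : 0 < wi x.
Proof. by rewrite -(pmulr_rgt0 _ (w0 x)) wwi. Qed.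

Let good h := [/\ sqint h, mu.-integrable setT (EFin \o (fun x => h x * theta x)) &
  psi h = \int[mu]_x (h x * theta x)].

Let good_ind (A : set T) : measurable A -> good (ind A).
Proof.
move=> mA; have E : (fun x => ind A x * theta x) = kap \_ A.
  apply/funext => x; rewrite /ind /theta mulrACA wwi mulr1 patchE indicE.
  by case: (x \in A); rewrite ?mul1r ?mul0r.
have iA : mu.-integrable A (EFin \o kap) by exact: integrableS kap_int.
split; first exact: ind_sq.
  rewrite E; have := (integrable_mkcond (EFin \o kap) mA).1 iA.
  by rewrite restrict_EFin.
rewrite E -Rintegral_mkcond /Rintegral.
have -> : (\int[mu]_(x in A) (kap x)%:E = nu A)%E.
  by rewrite (Radon_Nikodym_integral nu_mu mA); apply: eq_integral => x _; rewrite kapE.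
by [].
Qed.

Let good_lin a h k : good h -> good k -> good (fun x => a * h x + k x).
Proof.
move=> [sh ih eh] [sk ik ek].
have E : (fun x => (a * h x + k x) * theta x) =
    (fun x => a * (h x * theta x) + k x * theta x).
  by apply/funext => x; rewrite mulrDl mulrA.
have iah : mu.-integrable setT (EFin \o (fun x => a * (h x * theta x))).
  exact: (integrableZl measurableT a ih).
split.
- by apply: sqintD => //; exact: sqintZ.
- by rewrite E; exact: (integrableD measurableT iah ik).
- by rewrite E psi_lin// eh ek RintegralD// RintegralZl.
Qed.

Let good0 : good (fun=> 0).
Proof.
have -> : (fun=> 0) = ind set0 :> (T -> R).
  by apply/funext => x; rewrite /ind indic0 mul0r.
exact: good_ind.
Qed.

Import HBNNSimple.

Let good_nnsfun (g : {nnsfun T >-> R}) : good (fun x => g x * w x).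
Proof.
have -> : (fun x => g x * w x) =
    fun x => \sum_(y <- finmap.enum_fset (fset_set (range g))) y * ind (g @^-1` [set y]) x.
  apply/funext => x; rewrite {1}(fimfunE g) fsbig_finite//= mulr_suml.
  by apply: eq_bigr => y _; rewrite /ind mulrA.
elim: (finmap.enum_fset _) => [|y s ih].
  by under eq_fun do rewrite big_nil; exact: good0.
under eq_fun do rewrite big_cons; apply: good_lin => //.
by apply: good_ind; exact: measurable_sfunP.
Qed.

(** Simple functions increase to [p / w]; multiplied by [w] they are combinations of weighted
    indicators, on which the representation is already known. *)
Let approx (p : T -> R) : measurable_fun setT p -> (forall x, 0 <= p x) ->
  exists g : nat -> T -> R, [/\ forall n, good (g n), forall n x, 0 <= g n x <= p x,
    forall x, {homo (fun n => g n x) : n m / (n <= m)%N >-> n <= m} &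
    forall x, g n x @[n --> \oo] --> p x].
Proof.
move=> mp p0.
have mq : measurable_fun setT (fun x => (p x * wi x)%:E).
  by apply/measurable_EFinP; exact: measurable_funM.
have q0 x : 0 <= p x * wi x by rewrite mulr_ge0// ltW.
pose s := nnsfun_approx measurableT mq.
have sc x : s n x @[n --> \oo] --> p x * wi x.
  have := @cvg_nnsfun_approx _ _ _ _ measurableT _ mq (fun x _ => q0 x) x I.
  by move=> /fine_cvgP [_]; apply: cvg_trans; apply: near_eq_cvg; exact: nearW.
have sh x : {homo (fun n => s n x) : n m / (n <= m)%N >-> n <= m}.
  by move=> n m nm; have := nd_nnsfun_approx measurableT mq nm => /lefP; exact.
exists (fun n x => s n x * w x); split.
- by move=> n; exact: good_nnsfun.
- move=> n x; rewrite mulr_ge0 ?(ltW (w0 x))//=.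
  have := nondecreasing_cvgn_le (sh x) (cvgP _ (sc x)) n.
  rewrite (cvg_lim _ (sc x))// => h.
  have : s n x * w x <= p x * wi x * w x by rewrite ler_wpM2r// ltW.
  by rewrite -mulrA (mulrC (wi x)) wwi mulr1.
- by move=> x n m nm; rewrite ler_wpM2r ?(ltW (w0 x))//; exact: (sh x n m nm).
- move=> x; have -> : p x = p x * wi x * w x by rewrite -mulrA (mulrC (wi x)) wwi mulr1.
  by apply: cvgM (sc x) _; exact: cvg_cst.
Qed.

(** The square integrability of [theta] is obtained by testing [psi] on [theta] from below. Let [p]
    be the positive part of [a * theta] and [g] an approximant of [p]. Then
    [sqn g <= \int g p = a * psi g], and boundedness of [psi] gives [(sqn g)^2 <= C * sqn g], so
    [sqn g <= C]; monotone convergence passes to [p]. *)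
Let theta_part (a : R) : `|a| = 1 ->
  (rint mu (fun x => Num.max (a * theta x) 0 ^+ 2)%R <= C%:E)%E.
Proof.
move=> a1; set p := fun x => Num.max (a * theta x) 0.
have mp : measurable_fun setT p.
  by apply: measurable_maxr; [exact: measurable_funM|exact: measurable_cst].
have p0 x : 0 <= p x by rewrite /p le_max lexx orbT.
have [g [gg g0p gh gc]] := approx mp p0.
have bnd n : sqn (g n) <= C.
  have [sg ig eg] := gg n.
  have E : (fun x => a * (g n x * theta x)) = fun x => g n x * p x.
    apply/funext => x; rewrite mulrCA /p; have /andP[gx0 gxp] := g0p n x.
    have [h|h] := leP (a * theta x) 0; last by [].
    have : g n x = 0 by apply/eqP; rewrite eq_le gx0 andbT; move: gxp; rewrite /p max_r.
    by move=> ->; rewrite !mul0r.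
  have ia : mu.-integrable setT (EFin \o (fun x => g n x * p x)).
    by rewrite -E; exact: (integrableZl measurableT a ig).
  have h1 : sqn (g n) <= a * psi (g n).
    rewrite eg -RintegralZl//.
    have -> : \int[mu]_x (a * (g n x * theta x)) = \int[mu]_x (g n x * p x).
      by apply: eq_Rintegral => x _; rewrite -[LHS]/((fun x => a * (g n x * theta x)) x) E.
    rewrite /sqn /rint -/(Rintegral mu setT (fun x => g n x ^+ 2)).
    apply: le_Rintegral => //.
      by have := sqint_prod sg sg; under [X in _ \o X]eq_fun do rewrite -expr2.
    by move=> x _; have /andP[gx0 gxp] := g0p n x; rewrite expr2 ler_wpM2l.
  have h2 : sqn (g n) ^+ 2 <= C * sqn (g n).
    apply: le_trans (psi_bnd sg).
    have -> : psi (g n) ^+ 2 = (a * psi (g n)) ^+ 2.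
      by rewrite exprMn -(real_normK (num_real a)) a1 expr1n mul1r.
    by rewrite lerXn2r// nnegrE ?sqn_ge0// (le_trans (sqn_ge0 _) h1).
  have := sqn_ge0 (g n); rewrite le_eqVlt => /predU1P[<-//|s0].
  by move: h2; rewrite expr2 ler_pM2r.
have mg n : measurable_fun setT (fun x => (g n x ^+ 2)%:E).
  by apply/measurable_EFinP; apply: measurable_sq; have [[]] := gg n.
have limE x : limn (fun n => (g n x ^+ 2)%:E) = (p x ^+ 2)%:E.
  apply/cvg_lim => //; apply: cvg_EFin; first exact: nearW.
  apply: cvg_trans (cvgM (gc x) (gc x)); apply: near_eq_cvg; apply: nearW => n.
  by rewrite /= expr2.
have hm x : setT x -> {homo (fun n => (g n x ^+ 2)%:E) : n m / (n <= m)%N >-> (n <= m)%E}.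
  move=> _ n m nm; rewrite lee_fin lerXn2r ?nnegrE//; [by have /andP[] := g0p n x|by have /andP[] := g0p m x|exact: (gh x n m nm)].
have := @monotone_convergence _ _ _ mu setT measurableT (fun n x => (g n x ^+ 2)%:E) mg
  (fun n x _ => sqr_ge0 _) hm.
rewrite /rint; under eq_integral do rewrite limE.
move=> ->; apply: lime_le.
  apply: ereal_nondecreasing_is_cvgn => n m nm; apply: ge0_le_integral => //.
  - by move=> x _; rewrite lee_fin sqr_ge0.
  - by move=> x _; exact: hm.
apply: nearW => n; have [sg _ _] := gg n.
by have := sqnE sg; rewrite /rint => ->; rewrite lee_fin.
Qed.

Let theta_sq : sqint theta.
Proof.
split => //.
have m1 : measurable_fun setT (fun x => Num.max (1 * theta x) 0 ^+ 2).
  by apply: measurable_sq; apply: measurable_maxr; [exact: measurable_funM|exact: measurable_cst].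
have m2 : measurable_fun setT (fun x => Num.max (-1 * theta x) 0 ^+ 2).
  by apply: measurable_sq; apply: measurable_maxr; [exact: measurable_funM|exact: measurable_cst].
apply: (@le_lt_trans _ _ (rint mu (fun x => Num.max (1 * theta x) 0 ^+ 2)%R +
   rint mu (fun x => Num.max (-1 * theta x) 0 ^+ 2)%R)%E); last first.
  apply: lte_add_pinfty; first by apply: le_lt_trans (theta_part (normr1 _)) _; rewrite ltry.
  by apply: le_lt_trans (theta_part _) _; rewrite ?ltry// normrN1.
rewrite -rintD//; try by move=> x; exact: sqr_ge0.
apply: rint_le => //.
- exact: measurable_sq.
- exact: measurable_funD.
- by move=> x; exact: sqr_ge0.
- move=> x; rewrite mul1r mulN1r.
  have [h|h] := leP (theta x) 0.
    by rewrite max_l ?oppr_ge0// sqrrN expr0n add0r.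
  rewrite max_r; first by rewrite expr0n/= addr0.
  by rewrite oppr_le0 ltW.
Qed.

(** [psi] and integration against [theta] agree on the approximants and are both continuous in L^2.
    Hence [D] is unchanged when [h] is replaced by [h - g n], whose norm tends to [0]. *)
Let good_ge0 h : sqint h -> (forall x, 0 <= h x) -> psi h = \int[mu]_x (h x * theta x).
Proof.
move=> sh h0; have [mh ih] := sh.
have [g [gg g0p gh gc]] := approx mh h0.
pose D := psi h - \int[mu]_x (h x * theta x).
have sd n : sqint (fun x => h x + -1 * g n x).
  by apply: sqintD => //; apply: sqintZ; have [] := gg n.
have DE n : D = psi (fun x => h x + -1 * g n x) - \int[mu]_x ((h x + -1 * g n x) * theta x).
  have [sg ig eg] := gg n.
  have E : (fun x => (h x + -1 * g n x) * theta x) = (fun x => h x * theta x + -1 * (g n x * theta x)).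
    by apply/funext => x; ring.
  rewrite psiD// ?psiZ//; last exact: sqintZ.
  rewrite (_ : \int[mu]_x _ = \int[mu]_x (h x * theta x) - \int[mu]_x (g n x * theta x)).
    by rewrite eg /D; ring.
  rewrite -(RintegralB measurableT (sqint_prod sh theta_sq) ig).
  by apply: eq_Rintegral => x _; ring.
have bound n : D ^+ 2 <= sqn (fun x => h x + -1 * g n x) * (2 * (C + sqn theta)).
  rewrite (DE n).
  have h1 := psi_bnd (sd n); have h2 := sqint_CS (sd n) theta_sq.
  move: h1 h2; move: (psi _) (\int[mu]_x _) (sqn _) (sqn theta) => a b c e h1 h2.
  by have := sqr_ge0 (a + b); nra.
have lim0 : sqn (fun x => h x + -1 * g n x) @[n --> \oo] --> (0 : R).
  apply: (rint_dct (g := fun x => h x ^+ 2)) => //.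
  - by move=> n; apply: measurable_sq; case: (sd n).
  - exact: measurable_sq.
  - move=> n x; rewrite sqr_ge0/= mulN1r; have /andP[a b] := g0p n x.
    have := mulr_ge0 a (_ : 0 <= 2 * h x - g n x); rewrite subr_ge0 => K.
    have : 0 <= g n x * (2 * h x - g n x) by apply: K; lra.
    by move=> ?; nra.
  - move=> x; have hx : h x + -1 * g n x @[n --> \oo] --> h x + -1 * h x.
      by apply: cvgD; [exact: cvg_cst|apply: cvgM (gc x); exact: cvg_cst].
    have -> : (0 : R) = (h x + -1 * h x) * (h x + -1 * h x) by rewrite mulN1r subrr mulr0.
    under eq_fun do rewrite expr2.
    exact: (cvgM hx hx).
have K0 : 0 <= 2 * (C + sqn theta) by rewrite mulr_ge0// addr_ge0// sqn_ge0.
suff hD : D ^+ 2 <= 0.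
  by apply/eqP; rewrite -subr_eq0 -sqrf_eq0 eq_le hD sqr_ge0.
apply: (@le_of_eps _ _ 0 _ K0) => e e0; rewrite add0r.
have := lim0 => /cvgrPdist_le /(_ e e0) [n _ /(_ n (leqnn n))].
rewrite sub0r normrN /= => hn; apply: le_trans (bound n) _.
by rewrite ler_wpM2r//; apply: le_trans hn; rewrite ler_norm.
Qed.

Lemma real_riesz : exists2 th, sqint th &
  forall h, sqint h -> psi h = \int[mu]_x (h x * th x).
Proof.
exists theta => // h sh; have [mh ih] := sh.
have sp : sqint (fun x => Num.max (h x) 0).
  apply: (sqint_le _ sh); first by apply: measurable_maxr => //; exact: measurable_cst.
  by move=> x; have [hx|hx] := leP (h x) 0; rewrite ?normr0.
have sm : sqint (fun x => Num.max (- h x) 0).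
  apply: (sqint_le _ sh).
    by apply: measurable_maxr; [exact: measurableT_comp|exact: measurable_cst].
  by move=> x; have [hx|hx] := leP (- h x) 0; rewrite ?normr0// normrN.
have E : h = fun x => Num.max (h x) 0 + -1 * Num.max (- h x) 0.
  apply/funext => x; have [hx|hx] := leP (h x) 0.
    by rewrite max_l ?oppr_ge0// mulN1r opprK add0r.
  rewrite max_r; first by rewrite mulr0 addr0.
  by rewrite oppr_le0 ltW.
rewrite {1}E psiD//; last exact: sqintZ.
rewrite psiZ// good_ge0//; last by move=> x; rewrite le_max lexx orbT.
rewrite good_ge0//; last by move=> x; rewrite le_max lexx orbT.
rewrite -RintegralZl//; last exact: sqint_prod.
rewrite -RintegralD//; [|exact: sqint_prod|]; last first.
  exact: (integrableZl measurableT (-1) (sqint_prod sm theta_sq)).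
by apply: eq_Rintegral => x _; rewrite [in RHS]E mulrDl mulrA.
Qed.

End real_riesz.

Section complex_riesz.
Context {R : realType}.
Notation mu := (@lebesgue_measure R).
Implicit Types (f g : 'Fun(R)) (h : R -> R).

Lemma sqint_gauss : @sqint _ _ _ mu (fun x : R => expR (- x ^+ 2)).
Proof.
have mg : measurable_fun setT (fun x : R => expR (- x ^+ 2)) := @measurable_gauss_fun R.
split; first exact: mg.
apply: (@le_lt_trans _ _ (rint mu (fun x : R => expR (- x ^+ 2)))).
  apply: rint_le => //; first exact: measurable_funX.
  - move=> x; rewrite expr2; apply: ler_piMl; first exact: expR_ge0.
    by rewrite -expR0 ler_expR oppr_le0 sqr_ge0.
by rewrite /rint -/(gauss_fun) integralT_gauss ltry.
Qed.

Lemma L2_real h : sqint mu h -> L2 (fun x => (h x)%:C).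
Proof.
move=> [mh ih]; apply/L2P; have mp : cmeas (fun x => (h x)%:C) by exact: cmeas_real.
split; first exact: cmeas_pos_of.
apply: le_lt_trans ih; apply: rint_le.
- by apply: measurable_normc_sq; exact: cmeas_pos_of.
- exact: measurable_sq.
- by move=> x; exact: sqr_ge0.
- move=> x; rewrite /pos; case: ifP => _; first by rewrite normc_real real_normK ?num_real.
  by rewrite normc0 expr0n sqr_ge0.
Qed.

Lemma n2_real h : sqint mu h -> n2 (fun x => (h x)%:C) <= sqn mu h.
Proof.
move=> sh; have [mh ih] := sh; apply: N2_n2_le; first exact: L2_real.
rewrite -sqnE//; apply: rint_le.
- by apply: measurable_normc_sq; apply: cmeas_pos_of; exact: cmeas_real.
- exact: measurable_sq.
- by move=> x; exact: sqr_ge0.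
- move=> x; rewrite /pos; case: ifP => _; first by rewrite normc_real real_normK ?num_real.
  by rewrite normc0 expr0n sqr_ge0.
Qed.

Lemma sqint_Re f : L2 f -> sqint mu (fun x => complex.Re (pos f x)).
Proof.
move=> /L2P [mf i]; split; first by case: mf.
apply: le_lt_trans i; apply: rint_le.
- by apply: measurable_sq; case: mf.
- exact: measurable_normc_sq.
- by move=> x; exact: sqr_ge0.
- by move=> x; rewrite normc_sqr lerDl sqr_ge0.
Qed.

Lemma sqint_Im f : L2 f -> sqint mu (fun x => complex.Im (pos f x)).
Proof.
move=> /L2P [mf i]; split; first by case: mf.
apply: le_lt_trans i; apply: rint_le.
- by apply: measurable_sq; case: mf.
- exact: measurable_normc_sq.
- by move=> x; exact: sqr_ge0.
- by move=> x; rewrite normc_sqr lerDr sqr_ge0.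
Qed.

(** On real functions the real and imaginary parts of [phi] are real-linear and bounded, so they
    have representers [t1] and [t2]. Complex linearity does the rest, and [t1 + i t2] appears
    without conjugation because the pairing is bilinear. *)
Lemma riesz (phi : 'Fun(R) -> R[i]) (C : R) : 0 <= C ->
  (forall c f g, L2 f -> L2 g -> phi (fun x => c * f x + g x) = c * phi f + phi g) ->
  (forall f, L2 f -> normc (phi f) ^+ 2 <= C * n2 f) ->
  exists2 th, L2 th & forall f, L2 f -> phi f = pairing f th.
Proof.
move=> C0 lin bnd.
pose P h := phi (fun x => (h x)%:C).
have linP a h k : sqint mu h -> sqint mu k ->
    P (fun x => a * h x + k x) = a%:C * P h + P k.
  move=> sh sk; rewrite /P -lin; try exact: L2_real.
  by congr phi; apply/funext => x; rewrite rmorphD rmorphM.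
have bndP h : sqint mu h -> normc (P h) ^+ 2 <= C * sqn mu h.
  move=> sh; apply: le_trans (bnd _ (L2_real sh)) _.
  by rewrite ler_wpM2l// n2_real.
(* The weight demanded by [real_riesz] is the Gaussian, whose reciprocal is explicit. *)
have wwi (x : R) : expR (- x ^+ 2) * expR (x ^+ 2) = 1.
  by rewrite -expRD addNr expR0.
have mwi : measurable_fun setT (fun x : R => expR (x ^+ 2)).
  by apply: (measurableT_comp (@measurable_expR R)); exact: measurable_funX.
have RR (psi : (R -> R) -> R) :
    (forall a h k, sqint mu h -> sqint mu k -> psi (fun x => a * h x + k x) = a * psi h + psi k) ->
    (forall h, sqint mu h -> psi h ^+ 2 <= C * sqn mu h) ->
    exists2 th, sqint mu th & forall h, sqint mu h -> psi h = \int[mu]_x (h x * th x).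
  have w0 (x : R) : 0 < expR (- x ^+ 2) by exact: expR_gt0.
  move=> l b; have := @real_riesz _ _ R mu (fun x => expR (- x ^+ 2)) (fun x => expR (x ^+ 2)) w0 wwi mwi sqint_gauss psi C C0 l b.
  by [].
have [t1 s1 e1] : exists2 th, sqint mu th &
    forall h, sqint mu h -> complex.Re (P h) = \int[mu]_x (h x * th x).
  apply: RR => [a h k sh sk|h sh].
    by rewrite linP// cReD cReM/= mul0r subr0.
  by apply: le_trans (bndP _ sh); rewrite normc_sqr lerDl sqr_ge0.
have [t2 s2 e2] : exists2 th, sqint mu th &
    forall h, sqint mu h -> complex.Im (P h) = \int[mu]_x (h x * th x).
  apply: RR => [a h k sh sk|h sh].
    by rewrite linP// cImD cImM/= mul0r addr0.
  by apply: le_trans (bndP _ sh); rewrite normc_sqr lerDr sqr_ge0.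
pose th : 'Fun(R) := fun x => (t1 x) +i* (t2 x).
have thE x : th x = 'i%C * (t2 x)%:C + (t1 x)%:C.
  by apply: ReImE; rewrite ?cReD ?cImD ?cReM ?cImM/=; ring.
have Lth : L2 th.
  have -> : th = fun x => 'i%C * (t2 x)%:C + (t1 x)%:C by apply/funext => x; rewrite thE.
  by apply: L2D; [apply: L2Z; exact: L2_real|exact: L2_real].
exists th => // f Lf.
have Lp : L2 (pos f) by apply/L2_pos.
have sR := sqint_Re Lf; have sI := sqint_Im Lf.
have pR : P (fun x => complex.Re (pos f x)) = \int[mu]_x (complex.Re (pos f x) * t1 x) +i*
    \int[mu]_x (complex.Re (pos f x) * t2 x).
  by apply: ReImE => /=; rewrite ?e1 ?e2.
have pI : P (fun x => complex.Im (pos f x)) = \int[mu]_x (complex.Im (pos f x) * t1 x) +i*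
    \int[mu]_x (complex.Im (pos f x) * t2 x).
  by apply: ReImE => /=; rewrite ?e1 ?e2.
have phipos : phi (pos f) = 'i%C * P (fun x => complex.Im (pos f x)) + P (fun x => complex.Re (pos f x)).
  rewrite /P -lin; try exact: L2_real.
  congr phi; apply/funext => x.
  by apply: ReImE; rewrite ?cReD ?cImD ?cReM ?cImM/=; ring.
(* [phi] sees only the half-line: [f - pos f] has norm [0], and the norm bounds [phi]. *)
have -> : phi f = phi (pos f).
  have Ld : L2 (fun x => -1 * pos f x + f x) by apply: L2D => //; exact: L2Z.
  apply/eqP; rewrite -subr_eq0 -[- phi (pos f)]mulN1r addrC -lin//; apply/eqP/normc_eq0P.
  apply/eqP; rewrite -sqrf_eq0 eq_le sqr_ge0 andbT; apply: le_trans (bnd _ Ld) _.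
  suff -> : n2 (fun x => -1 * pos f x + f x) = 0 by rewrite mulr0.
  rewrite /n2 (_ : pos _ = fun=> 0).
    rewrite (_ : N2 mu _ = 0%E)//; apply/eqP; rewrite eq_le N2_ge0 andbT /N2 /rint.
    by under eq_integral do rewrite normc0 expr0n; rewrite integral0.
  by rewrite posD posZ pos_pos; apply/funext => x; rewrite mulN1r addNr.
rewrite phipos pR pI pairingE.
have -> : cI mu (fun x => pos f x * pos th x) = cI mu (fun x => pos f x * th x).
  by apply: cI_eq => x; rewrite /pos; case: ifP => _ //; rewrite !mul0r.
rewrite /cI; apply: ReImE => /=; rewrite ?cReD ?cImD ?cReM ?cImM/=.
  rewrite !mul0r !mul1r sub0r addrC.
  rewrite -RintegralB//; try exact: sqint_prod.
  by apply: eq_Rintegral => x _; rewrite cReM.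
rewrite !mul0r !mul1r add0r addrC.
rewrite -RintegralD//; try exact: sqint_prod.
by apply: eq_Rintegral => x _; rewrite cImM.
Qed.

End complex_riesz.

(** * Improper integrals on the half-line *)

Section half_line_ftc.
Context {R : realType}.
Notation mu := (@lebesgue_measure R).

Lemma rint_ftc (f F : R -> R) (a l : R) : (forall x, a <= x -> 0 <= f x) -> continuous f ->
  (forall x : R, is_derive x 1 F (f x)) -> F x @[x --> +oo] --> l ->
  rint mu (fun y => if a < y then f y else 0) = (l - F a)%:E.
Proof.
move=> f0 cf dF Fl.
have Fd x : derivable F x 1 by have [] := dF x.
have cF : continuous F by move=> x; apply: differentiable_continuous; apply/derivable1_diffP.
rewrite EFinB -(@ge0_continuous_FTC2y _ f F a l f0) //.
- rewrite -integral_itv_obnd_cbnd; last first.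
    by apply/measurable_EFinP; apply: measurable_funTS; exact: continuous_measurable_fun.
  rewrite [RHS]integral_mkcond /rint; apply: eq_integral => x _.
  by rewrite patchE mem_setE in_itv/= andbT; case: ifP.
- exact: continuous_subspaceT.
- exact: (cvg_at_right_filter (cF a)).
- by move=> x _; rewrite derive1E; exact: derive_val.
Qed.

Lemma rint_exp_tail (p a : R) : 0 < p ->
  rint mu (fun s => if a < s then expR (- p * s) else 0) = (p^-1 * expR (- p * a))%:E.
Proof.
move=> p0.
have lin (x c : R) : is_derive x (1 : R) (fun y => c * y) c.
  have h := is_deriveM (is_derive_cst c x (1 : R)) (is_derive_id x (1 : R)).
  by apply: is_derive_eq h _; rewrite /GRing.scale/= mulr0 addr0 mulr1.
have d (x : R) : is_derive x (1 : R) (fun s => - p^-1 * expR (- p * s)) (expR (- p * x)).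
  have h1 := is_derive1_comp (is_derive_expR (- p * x)) (lin x (- p)).
  have h := is_deriveM (is_derive_cst (- p^-1) x (1 : R)) h1.
  by apply: is_derive_eq h _; rewrite /GRing.scale/=; field; rewrite lt0r_neq0.
have lim : - p^-1 * expR (- p * x) @[x --> +oo] --> (0 : R).
  rewrite -(mulr0 (- p^-1)); apply: cvgM; first exact: cvg_cst.
  have h : p * x @[x --> +oo] --> +oo by apply: gt0_cvgMry => //; exact: cvg_id.
  under eq_fun do rewrite mulNr.
  exact: (cvg_comp _ _ h (@cvgr_expR R)).
rewrite (rint_ftc _ _ d lim).
- by rewrite sub0r mulNr opprK.
- by move=> x _; exact: expR_ge0.
- move=> x; apply: (continuous_comp (f := fun s => - p * s)); last exact: continuous_expR.
  by apply: cvgM; [exact: cvg_cst|exact: cvg_id].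
Qed.

End half_line_ftc.

(** * Profiles and the resolvent of the semigroup *)

Section semigroup.
Context {R : realType} (T : R -> 'Fun(R) -> 'Fun(R)).
Notation mu := (@lebesgue_measure R).
Hypothesis semigroupT : C0_semigroup T.
Hypothesis TstarS : forall (t : R) (f : 'Fun(R)), 0 <= t -> L2 f ->
  adjoint_graph (T t) (shiftS t f) f.
Implicit Types (f g k : 'Fun(R)) (s t : R).

Lemma T_L2 t f : 0 <= t -> L2 f -> L2 (T t f).
Proof. by move=> t0; have [h _ _ _] := semigroupT; have [+ _ _] := h _ t0; exact. Qed.

Lemma T_lin t c f g : 0 <= t -> L2 f -> L2 g ->
  eqL2 (T t (fun x => c * f x + g x)) (fun x => c * T t f x + T t g x).
Proof. by move=> t0; have [h _ _ _] := semigroupT; have [_ + _] := h _ t0; exact. Qed.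

Lemma T_bound t : 0 <= t -> exists2 K, 0 <= K & forall f, L2 f -> n2 (T t f) <= K * n2 f.
Proof.
move=> t0; have [h _ _ _] := semigroupT; have [hL _ [K hK]] := h _ t0.
exists (K ^+ 2); first exact: sqr_ge0.
move=> f Lf; rewrite -!normL2_sqr -exprMn; have := hK _ Lf; have := normL2_ge0 (T t f).
by move=> a b; rewrite lerXn2r ?nnegrE// (le_trans a b).
Qed.

Lemma T_eqL2 t f g : 0 <= t -> L2 f -> L2 g -> eqL2 f g -> eqL2 (T t f) (T t g).
Proof.
move=> t0 Lf Lg fg; have [K K0 hK] := T_bound t0.
have LT := T_L2 t0.
have Ld : L2 (fun x => -1 * g x + f x) by apply: L2D => //; exact: L2Z.
apply: n2_sub_eq0; [exact: LT|exact: LT|].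
have e1 : eqL2 (fun x => T t f x - T t g x) (T t (fun x => -1 * g x + f x)).
  apply: eqL2_sym; apply: eqL2_trans (T_lin (-1) t0 Lg Lf) _; apply/eqL2P/filterE => x.
  by rewrite /pos mulN1r addrC.
rewrite (n2_eqL2 _ _ e1); [|apply: L2B; exact: LT|exact: LT].
apply: le_trans (hK _ Ld) _.
have -> : (fun x => -1 * g x + f x) = (fun x => f x - g x).
  by apply/funext => x; rewrite mulN1r addrC.
by rewrite eqL2_n2// mulr0.
Qed.

Lemma T_add s t f : 0 <= s -> 0 <= t -> L2 f -> eqL2 (T (s + t) f) (T s (T t f)).
Proof. by have [_ _ h _] := semigroupT; exact: h. Qed.

Lemma T_0 f : L2 f -> eqL2 (T 0 f) f.
Proof. by have [_ h _ _] := semigroupT; exact: h. Qed.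

Lemma eqL2_at f g (c : R) : eqL2 f g -> {ae mu, forall y, 0 < y + c -> f (y + c) = g (y + c)}.
Proof.
move=> fg; apply: (ae_shift c (P := fun x => 0 < x -> f x = g x)).
by apply: filterS fg => x; rewrite halflineE.
Qed.

Lemma L2_translate t f : 0 <= t -> L2 f -> L2 (fun x => f (x + t)).
Proof.
move=> t0 /L2P [mf jf]; apply/L2P.
have m1 : cmeas (fun x : R => pos f (x + t)).
  by apply: (cmeas_comp mf); exact: measurable_funD.
have e1 : pos (fun x : R => f (x + t)) = pos (fun x : R => pos f (x + t)).
  apply/funext => x; rewrite /pos; case: ifP => // x0.
  by rewrite ltr_wpDr.
rewrite e1; split; first exact: cmeas_pos_of.
apply: le_lt_trans jf.
have m2 := measurable_normc_sq mf.
rewrite -[leRHS](rint_shift t m2).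
apply: N2_le => //; first exact: cmeas_pos_of.
by move=> x; rewrite /pos; case: ifP => // _; rewrite normc0 normc_ge0.
Qed.

(* The hypothesis [T_t^* S_t = I] says that the part of [T_t f] beyond [t] is the
   translate of [f]. *)
Lemma T_translate t f : 0 <= t -> L2 f -> eqL2 (fun x => T t f (x + t)) f.
Proof.
move=> t0 Lf; have LT := T_L2 t0 Lf.
have LTt := L2_translate t0 LT.
apply: pairing_nondeg => // h Lh.
have [LS _ /(_ _ Lf) <-] := TstarS t0 Lh.
have [mS _] := (L2P _).1 LS; have [mT _] := (L2P _).1 LT.
have [mh _] := (L2P _).1 Lh; have [mTt _] := (L2P _).1 LTt.
have mp : cmeas (fun x => pos (T t f) x * pos (shiftS t h) x) by exact: cmeasM.
rewrite !pairingE -[RHS](cI_shift t)//; apply: cI_ae; first exact: cmeasM.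
  by apply: (cmeas_comp mp); exact: measurable_funD.
apply: filterS (ae_neq 0) => x xn0; rewrite /pos /shiftS.
have [x0|x0] := ltP 0 x.
  have -> : (x + t < t) = false by apply/negbTE; rewrite -leNgt lerDr ltW.
  by rewrite ltr_wpDr// addrK.
have -> : x + t < t by rewrite gtrDr lt_neqAle x0 andbT; apply/eqP.
by rewrite if_same !mulr0.
Qed.

(** Apply [T_translate] at time [t - s] to [T s f]. This is what makes the profile independent of
    the time used to read it. *)
Lemma T_consistent s t f : 0 <= s -> s <= t -> L2 f ->
  {ae mu, forall y, 0 < y + s -> T s f (y + s) = T t f (y + t)}.
Proof.
move=> s0 st Lf; have d0 : 0 <= t - s by rewrite subr_ge0.
have LT := T_L2 s0 Lf.
have h1 := eqL2_at s (T_translate d0 LT).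
have e : eqL2 (T t f) (T (t - s) (T s f)) by have := T_add d0 s0 Lf; rewrite subrK.
have h2 := eqL2_at t e.
apply: filterS2 h1 h2 => y + + y0 => /(_ y0) <- ->; last by apply: lt_le_trans y0 _; rewrite lerD2l.
by congr (T _ _ _); ring.
Qed.

(** [T s f] reappears inside [T t f], moved to the right by [t - s]; going from [s] to [t] only adds
    mass on []0, t - s]]. *)
Lemma n2_T_mono s t f : 0 <= s -> s <= t -> L2 f -> n2 (T s f) <= n2 (T t f).
Proof.
move=> s0 st Lf; have t0 := le_trans s0 st.
have LTs := T_L2 s0 Lf; have LTt := T_L2 t0 Lf.
apply: N2_n2_le => //; rewrite -n2E//.
have [ms _] := (L2P _).1 LTs; have [mt _] := (L2P _).1 LTt.
have m2 := measurable_normc_sq mt.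
rewrite -[leRHS](rint_shift (t - s) m2); apply: rint_ae_le.
- exact: measurable_normc_sq.
- by apply: (measurableT_comp m2); exact: measurable_funD.
- by move=> x; exact: sqr_ge0.
- by move=> x; exact: sqr_ge0.
have := ae_shift (- s) (T_consistent s0 st Lf); apply: filterS => x.
rewrite subrK /pos; have [x0 /(_ isT) ->|_ _] := ltP 0 x; last by rewrite normc0 expr0n sqr_ge0.
rewrite ifT; first by rewrite -addrA (addrC (- s)).
by apply: lt_le_trans x0 _; rewrite lerDl subr_ge0.
Qed.

(* Since [n2 (T t f)] increases with [t], the growth bound needs no uniform boundedness
   principle. *)
Lemma T_growth : exists2 w, 0 < w &
  forall t f, 0 <= t -> L2 f -> n2 (T t f) <= expR (2 * w * (t + 1)) * n2 f.
Proof.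
have [K K0 hK] := T_bound ler01.
exists (1 + K) => [|t f t0 Lf]; first by rewrite ltr_wpDr.
pose E := expR (2 * (1 + K)).
have KE : K <= E by apply: le_trans (expR_ge1Dx _); lra.
have hn n : n2 (T n%:R f) <= E ^+ n * n2 f.
  elim: n => [|n ih].
    by rewrite expr0 mul1r le_eqVlt (n2_eqL2 _ _ (T_0 Lf)) ?eqxx//; exact: T_L2.
  have LT := T_L2 (ler0n R n) Lf.
  have -> : n.+1%:R = 1 + n%:R :> R by rewrite -natr1 addrC.
  rewrite (n2_eqL2 _ _ (T_add ler01 (ler0n R n) Lf)); last 2 first.
  - by apply: T_L2 => //; rewrite addr_ge0.
  - exact: T_L2.
  apply: le_trans (hK _ LT) _; rewrite exprS -mulrA.
  by apply: ler_pM => //; exact: n2_ge0.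
have := truncn_itv t0 => /andP[t1 t2].
apply: le_trans (n2_T_mono t0 (ltW t2) Lf) _; apply: le_trans (hn _) _.
rewrite ler_wpM2r ?n2_ge0// /E -expRM_natl ler_expR.
rewrite -mulr_natl [leRHS]mulrC ler_wpM2r//; first by lra.
by rewrite mulr1 -[leLHS]natr1 lerD2r.
Qed.

(** At [y] the profile is read from [T n f], with [n] the first natural number above [max (- y) 0].
    Integer times keep the number of operators involved countable, so that the null sets on which
    they disagree add up to a null set and the glued function is measurable. *)
Definition profile f : 'Fun(R) := fun y =>
  let n := (Num.truncn (Num.max (- y) 0)).+1 in pos (T n%:R f) (y + n%:R).

Lemma cmeas_profile f : L2 f -> cmeas (profile f).
Proof.
move=> Lf.
pose E (n : nat) := [set y : R | n%:R <= Num.max (- y) 0 < n.+1%:R].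
have mmax : measurable_fun setT (fun y : R => Num.max (- y) 0).
  by apply: measurable_maxr; [exact: oppr_measurable|exact: measurable_cst].
have mE n : measurable (E n).
  have -> : E n = (fun y : R => Num.max (- y) 0) @^-1` `[n%:R, n.+1%:R[%classic.
    by apply/seteqP; split => y; rewrite /E /= in_itv.
  by rewrite -[X in measurable X]setTI; exact: mmax.
have UE : \bigcup_n E n = setT.
  apply/seteqP; split => // y _; exists (Num.truncn (Num.max (- y) 0)) => //=.
  by apply: truncn_itv; rewrite le_max lexx orbT.
have key n : {in E n, forall y, profile f y = pos (T n.+1%:R f) (y + n.+1%:R)}.
  move=> y; rewrite inE /E /= => h; rewrite /profile.
  suff /eqP -> : Num.truncn (Num.max (- y) 0) == n by [].
  by rewrite truncn_eq// le_max lexx orbT.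
have mn n : cmeas (fun y : R => pos (T n.+1%:R f) (y + n.+1%:R)).
  have [m _] := (L2P _).1 (T_L2 (ler0n R n.+1) Lf).
  by apply: (cmeas_comp m); exact: measurable_funD.
rewrite /cmeas -UE; split; apply/(measurable_fun_bigcup _ mE) => n.
  apply: (eq_measurable_fun (fun y : R => complex.Re (pos (T n.+1%:R f) (y + n.+1%:R)))).
    by move=> y yE; rewrite (key n).
  by apply: measurable_funTS; case: (mn n).
apply: (eq_measurable_fun (fun y : R => complex.Im (pos (T n.+1%:R f) (y + n.+1%:R)))).
  by move=> y yE; rewrite (key n).
by apply: measurable_funTS; case: (mn n).
Qed.

Lemma profileE t f : 0 <= t -> L2 f ->
  {ae mu, forall y, 0 < y + t -> profile f y = T t f (y + t)}.
Proof.
move=> t0 Lf.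
have : {ae mu, forall y, forall n : nat, 0 < y + n%:R -> 0 < y + t ->
    T n%:R f (y + n%:R) = T t f (y + t)}.
  apply/ae_foralln => n; have [nt|tn] := leP n%:R t.
    by apply: filterS (T_consistent (ler0n _ _) nt Lf) => y h /h.
  by apply: filterS (T_consistent t0 (ltW tn) Lf) => y h _ /h ->.
apply: filterS => y h yt; rewrite /profile.
set n := (Num.truncn _).+1.
have yn : 0 < y + n%:R.
  have : 0 <= Num.max (- y) 0 by rewrite le_max lexx orbT.
  move=> /truncn_itv/andP[_]; rewrite -/n gt_max => /andP[+ _].
  by rewrite -subr_gt0 opprK addrC.
by rewrite /pos yn; exact: h.
Qed.

(** Reduces an identity between profiles to the half-lines [y > - n], on each of which the single
    operator [T n] represents the profile. *)
Lemma ae_nat_shift (P : R -> Prop) :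
  (forall n : nat, {ae mu, forall y, 0 < y + n%:R -> P y}) -> {ae mu, forall y, P y}.
Proof.
move=> h; apply: filterS (_ : {ae mu, forall y, forall n : nat, 0 < y + n%:R -> P y}).
  move=> y /(_ (Num.truncn (Num.max (- y) 0)).+1); apply.
  have : 0 <= Num.max (- y) 0 by rewrite le_max lexx orbT.
  move=> /truncn_itv/andP[_]; rewrite gt_max => /andP[+ _].
  by rewrite -subr_gt0 opprK addrC.
exact/ae_foralln.
Qed.

Lemma profile_lin c f g : L2 f -> L2 g ->
  {ae mu, forall y, profile (fun x => c * f x + g x) y = c * profile f y + profile g y}.
Proof.
move=> Lf Lg; apply: ae_nat_shift => n; have n0 := ler0n R n.
have Lfg : L2 (fun x => c * f x + g x) by apply: L2D => //; exact: L2Z.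
have h1 := profileE n0 Lf; have h2 := profileE n0 Lg; have h3 := profileE n0 Lfg.
have h4 := eqL2_at n%:R (T_lin c n0 Lf Lg).
by apply: filterS2 h1 (filterI h2 (filterI h3 h4)) => y e1 [e2 [e3 e4]] y0; rewrite e1// e2// e3// e4.
Qed.

Lemma profile_T s f : 0 <= s -> L2 f ->
  {ae mu, forall y, profile (T s f) y = profile f (y - s)}.
Proof.
move=> s0 Lf; apply: ae_nat_shift => n; have n0 := ler0n R n.
have LT := T_L2 s0 Lf.
have h1 := profileE n0 LT.
have h2 := ae_shift (- s) (profileE (addr_ge0 n0 s0) Lf).
have h3 := eqL2_at n%:R (T_add n0 s0 Lf).
apply: filterS3 h1 h2 h3 => y e1 e2 e3 y0; rewrite e1// -e3// e2; last by rewrite addrCA subrK addrC.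
by congr (T _ _ _); ring.
Qed.

Lemma profile_eqL2 f g : L2 f -> L2 g -> eqL2 f g -> {ae mu, forall y, profile f y = profile g y}.
Proof.
move=> Lf Lg fg; apply: ae_nat_shift => n; have n0 := ler0n R n.
have h1 := profileE n0 Lf; have h2 := profileE n0 Lg.
have h3 := eqL2_at n%:R (T_eqL2 n0 Lf Lg fg).
by apply: filterS3 h1 h2 h3 => y e1 e2 e3 y0; rewrite e1// e2// e3.
Qed.

Lemma profile_shift t f : 0 <= t -> L2 f -> eqL2 (fun x => profile f (x - t)) (T t f).
Proof.
move=> t0 Lf; have := ae_shift (- t) (profileE t0 Lf); apply: filterS => x.
by rewrite subrK halflineE.
Qed.

Lemma profile_pos f : L2 f -> eqL2 (profile f) f.
Proof.
move=> Lf; have := profile_shift (lexx 0) Lf; under eq_fun do rewrite subr0.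
by move=> h; apply: eqL2_trans h (T_0 Lf).
Qed.

Lemma N2_profile_shift t f : 0 <= t -> L2 f ->
  N2 mu (pos (fun x => profile f (x - t))) = (n2 (T t f))%:E.
Proof.
move=> t0 Lf; have LT := T_L2 t0 Lf; rewrite -n2E//; have [m _] := (L2P _).1 LT.
apply: N2_ae => //; last by apply/eqL2P; exact: profile_shift.
apply: cmeas_pos_of; apply: (cmeas_comp (cmeas_profile Lf)); exact: measurable_funD.
Qed.

End semigroup.

Section exp_tails.
Context d {T : measurableType d} {R : realType} (mu : {measure set T -> \bar R}).

Lemma integral_le_rint (h : T -> \bar R) (g : T -> R) : (forall s, 0 <= h s)%E ->
  measurable_fun setT h -> measurable_fun setT g -> (forall s, h s <= (g s)%:E)%E ->
  (\int[mu]_s h s <= rint mu g)%E.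
Proof.
move=> h0 mh mg hg; apply: ge0_le_integral => //.
exact/measurable_EFinP.
Qed.

End exp_tails.

(** * The resolvent as a Laplace transform *)

Section resolvent.
Context {R : realType} (T : R -> 'Fun(R) -> 'Fun(R)).
Notation mu := (@lebesgue_measure R).
Notation RR := (measurableTypeR R).
Hypothesis semigroupT : C0_semigroup T.
Hypothesis TstarS : forall (t : R) (f : 'Fun(R)), 0 <= t -> L2 f ->
  adjoint_graph (T t) (shiftS t f) f.
Variable w : R.
Hypothesis w0 : 0 < w.
Hypothesis growth : forall t f, 0 <= t -> L2 f ->
  n2 (T t f) <= expR (2 * w * (t + 1)) * n2 f.
Implicit Types (f g k : 'Fun(R)) (s t : R) (z : R[i]).
Local Notation u := (profile T).

Lemma measurable_negpart : measurable_fun setT (fun y : R => Num.max (- y) 0).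
Proof. by apply: measurable_maxr; [exact: oppr_measurable|exact: measurable_cst]. Qed.

Lemma measurable_exp_lin (a : R) (h : R -> R) : measurable_fun setT h ->
  measurable_fun setT (fun y : R => expR (a * h y)).
Proof.
by move=> mh; apply: (measurableT_comp (@measurable_expR R)); exact: measurable_funM.
Qed.

Lemma measurable_cut (a : R) (h : R -> R) : measurable_fun setT h ->
  measurable_fun setT (fun y : R => if a < y then h y else 0).
Proof. by move=> mh; apply: measurable_fun_ifT => //; exact: measurable_fun_ltr. Qed.

Definition exp_tail (p a s : R) : R := if a < s then expR (- p * s) else 0.

Lemma exp_tail_ge0 p a s : 0 <= exp_tail p a s.
Proof. by rewrite /exp_tail; case: ifP => // _; exact: expR_ge0. Qed.

Lemma measurable_exp_tail p a : measurable_fun setT (exp_tail p a).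
Proof. by apply: measurable_cut; exact: (measurable_exp_lin _ (@measurable_id _ _ setT)). Qed.

Lemma rint_exp_tailZ (c p a : R) : 0 <= c -> 0 < p ->
  rint mu (fun s => c * exp_tail p a s) = (c * (p^-1 * expR (- p * a)))%:E.
Proof.
move=> c0 p0; rewrite (rintZ mu (measurable_exp_tail p a) (exp_tail_ge0 p a) c0).
by rewrite EFinM -(rint_exp_tail a p0).
Qed.

(* Exchange the integrals in [\int_(s > 0) expR (- p s) `|T s f|^2]. *)
Lemma profile_weighted (p : R) f : 2 * w < p -> L2 f ->
  (rint mu (fun y => expR (- p * Num.max (- y) 0) * normc (u f y) ^+ 2)%R <=
   (p * expR (2 * w) / (p - 2 * w) * n2 f)%:E)%E.
Proof.
move=> wp Lf; have p0 : 0 < p by rewrite (lt_trans _ wp)// mulr_gt0.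
have mu_ := cmeas_profile semigroupT Lf.
have m2 : measurable_fun setT (fun y : R => normc (u f y) ^+ 2) by exact: measurable_normc_sq.
have mw := measurable_exp_lin (- p) measurable_negpart.
have gb s : 0 < s ->
    expR (- p * s) * n2 (T s f) <= expR (2 * w) * n2 f * expR (- (p - 2 * w) * s).
  move=> s0; apply: (@le_trans _ _ (expR (- p * s) * (expR (2 * w * (s + 1)) * n2 f))).
    by rewrite ler_wpM2l ?expR_ge0// growth// ltW.
  rewrite mulrA [leRHS]mulrAC -!expRD le_eqVlt; apply/orP; left; apply/eqP.
  by congr (expR _ * _); ring.
have mk : measurable_fun setT (fun y : R => expR (- p * Num.max (- y) 0) * normc (u f y) ^+ 2).
  exact: measurable_funM.
have k0 (y : R) : 0 <= expR (- p * Num.max (- y) 0) * normc (u f y) ^+ 2.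
  by rewrite mulr_ge0 ?expR_ge0// sqr_ge0.
have p1 : 0 <= p^-1 by rewrite invr_ge0 ltW.
suff e3 : ((p^-1)%:E * rint mu (fun y => expR (- p * Num.max (- y) 0) * normc (u f y) ^+ 2)%R <=
    (expR (2 * w) / (p - 2 * w) * n2 f)%:E)%E.
  move: e3; rewrite muleC lee_pdivrMr// -EFinM => e3; apply: le_trans e3 _; rewrite lee_fin.
  by rewrite le_eqVlt; apply/orP; left; apply/eqP; ring.
pose h (z : RR * RR) : R := (if Num.max (- z.2) 0 < z.1 then expR (- p * z.1) else 0) *
  normc (u f z.2) ^+ 2.
have mh : measurable_fun setT h.
  apply: measurable_funM; last exact: (measurableT_comp m2 measurable_snd).
  apply: measurable_fun_ifT => //.
    apply: measurable_fun_ltr; last exact: measurable_fst.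
    exact: (measurableT_comp measurable_negpart measurable_snd).
  exact: (measurableT_comp (measurable_exp_lin (- p) (@measurable_id _ _ setT)) measurable_fst).
have h0 q : 0 <= h q.
  by rewrite mulr_ge0 ?sqr_ge0//; case: ifP => // _; exact: expR_ge0.
have tonelli := rint_tonelli mu mu mh h0.
have e1 y : rint mu (fun s => h (s, y)) =
    (p^-1 * (expR (- p * Num.max (- y) 0) * normc (u f y) ^+ 2))%:E.
  have E := rint_exp_tailZ (Num.max (- y) 0) (sqr_ge0 (normc (u f y))) p0.
  rewrite (_ : p^-1 * _ = normc (u f y) ^+ 2 * (p^-1 * expR (- p * Num.max (- y) 0))); last by ring.
  by rewrite -E; congr rint; apply/funext => s; exact: mulrC.
have e2 : (\int[mu]_s rint mu (fun y => h (s, y)) <=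
    (expR (2 * w) / (p - 2 * w) * n2 f)%:E)%E.
  have d0 : 0 < p - 2 * w by rewrite subr_gt0.
  have c0 : 0 <= expR (2 * w) * n2 f by rewrite mulr_ge0 ?expR_ge0 ?n2_ge0.
  have E := rint_exp_tailZ 0 c0 d0.
  rewrite (_ : _ * n2 f = expR (2 * w) * n2 f * ((p - 2 * w)^-1 * expR (- (p - 2 * w) * 0))); last first.
    by rewrite mulr0 expR0 mulr1 mulrAC.
  rewrite -E; apply: (@integral_le_rint _ _ _ mu (fun s => rint mu (fun y => h (s, y)))).
  - by move=> s; apply: rint_ge0 => y; exact: h0.
  - exact: (measurable_rint mu mh h0).
  - exact: (measurable_funM (measurable_cst _) (measurable_exp_tail _ _)).
  move=> s; rewrite /exp_tail; have [s0|s0] := ltP 0 s; last first.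
    have hz : (fun y => h (s, y)) = fun=> 0.
      apply/funext => y.
      have sl : s <= Num.max (- y) 0 by apply: le_trans s0 _; rewrite le_max lexx orbT.
      by rewrite /h /= ltNge sl mul0r.
    by rewrite hz mulr0 /rint integral0.
  have -> : rint mu (fun y => h (s, y)) = (expR (- p * s) * n2 (T s f))%:E.
    rewrite EFinM -(N2_profile_shift semigroupT TstarS (ltW s0) Lf).
    have m3 : cmeas (pos (fun x : R => u f (x - s))).
      by apply: cmeas_pos_of; apply: (cmeas_comp mu_); exact: measurable_funD.
    have m4 := measurable_normc_sq m3.
    have m5 : measurable_fun setT (fun y : R => normc (pos (fun x : R => u f (x - s)) (y + s)) ^+ 2).
      by apply: (measurableT_comp m4); exact: measurable_funD.
    rewrite /N2 -(rint_shift s m4) -(rintZ mu m5 (fun y => sqr_ge0 _) (expR_ge0 _)).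
    congr rint; apply/funext => y; rewrite /h /= /pos addrK gt_max s0 andbT.
    have -> : (- y < s) = (0 < y + s) by rewrite -subr_gt0 opprK addrC.
    case: (0 < y + s); first by [].
    by rewrite normc0 expr0n mul0r mulr0.
  by rewrite lee_fin; exact: gb.
rewrite -(rintZ mu mk k0 p1); apply: le_trans e2; rewrite tonelli.
by under eq_integral do rewrite e1.
Qed.

Definition past z f (x : R) : 'Fun(R) := fun y => if y < x then expC (z * y%:C) * u f y else 0.

(** The Laplace transform of the orbit at the point [x], after the substitution [y = x - s]. It is
    given at every [x], not almost everywhere, so its value at [0] is meaningful. *)
Definition resol z f : 'Fun(R) := fun x => expC (- z * x%:C) * cI mu (past z f x).

Lemma cmeas_past z f x : L2 f -> cmeas (past z f x).
Proof.
move=> Lf; apply: cmeas_if; first exact: measurable_fun_ltr.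
  by apply: cmeasM; [exact: cmeas_exp|exact: cmeas_profile].
exact: cmeas_cst.
Qed.

(** The integrand is split as [f1 * f2] by moving a weight [expR (p / 2 * max (- y) 0)] from one
    factor to the other. [profile_weighted] controls [f2] because [2 * w < p], and [f1] is square
    integrable because [p < 2 * Re z]; [p = w + Re z] lies in between. The constant is uniform in
    [f], as the Riesz theorem will require. *)
Lemma past_bound z x : w < complex.Re z -> exists2 C, 0 <= C & forall f, L2 f ->
  (rint mu (fun y => normc (past z f x y)) <= (Num.sqrt (C * n2 f))%:E)%E.
Proof.
move=> wz; pose a := complex.Re z; pose p := w + a.
have p2w : 2 * w < p by rewrite /p mulr_natl mulr2n ltrD2l.
have q0 : 0 < 2 * a - p by rewrite /p /a; lra.
have p0 : 0 < p by rewrite (lt_trans _ p2w)// mulr_gt0.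
pose q := 2 * a - p.
have mn := measurable_negpart.
(* For [y <= 0] the squared modulus of [f1] is [expR (q * y)]; for [0 < y < x] it exceeds this by
   the factor [expR (p * y)], which the first exponential of [A] covers. *)
pose A : R := expR (p * `|x|) * (q^-1 * expR (- q * - x)).
pose B : R := p * expR (2 * w) / (p - 2 * w).
have A0 : 0 <= A by rewrite !mulr_ge0 ?expR_ge0 ?invr_ge0 ?ltW.
have B0 : 0 <= B by rewrite /B !mulr_ge0 ?expR_ge0 ?invr_ge0 ?subr_ge0 ?ltW.
exists (A * B); first exact: mulr_ge0.
move=> f Lf.
pose f1 : 'Fun(R) := fun y => if y < x then expC (z * y%:C) * (expR (p / 2 * Num.max (- y) 0))%:C else 0.
pose f2 : 'Fun(R) := fun y => (expR (- (p / 2) * Num.max (- y) 0))%:C * u f y.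
have m1 : cmeas f1.
  apply: cmeas_if; [exact: measurable_fun_ltr| |exact: cmeas_cst].
  by apply: cmeasM; [exact: cmeas_exp|apply: cmeas_real; exact: measurable_exp_lin].
have m2 : cmeas f2.
  by apply: cmeasM; [apply: cmeas_real; exact: measurable_exp_lin|exact: cmeas_profile].
have -> : (fun y => normc (past z f x y)) = fun y => normc (f1 y * f2 y).
  apply/funext => y; congr normc; rewrite /past /f1 /f2; case: ifP => _; last by rewrite mul0r.
  rewrite mulrA; congr (_ * _); rewrite -mulrA -rmorphM -expRD mulNr subrr expR0.
  by rewrite mulr1.
have n1 : (N2 mu f1 <= (Num.sqrt A ^+ 2)%:E)%E.
  rewrite sqr_sqrtr// -(rint_exp_tailZ (- x) (expR_ge0 _) q0).
  rewrite /N2 -(rint_opp (measurable_normc_sq m1)); apply: rint_le.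
  - by apply: (measurableT_comp (measurable_normc_sq m1)); exact: oppr_measurable.
  - exact: (measurable_funM (measurable_cst _) (measurable_exp_tail _ _)).
  - by move=> y; exact: sqr_ge0.
  move=> y; rewrite /f1 /exp_tail ltrNl; case: ifP => yx; last first.
    by rewrite normc0 expr0n mulr0.
  rewrite normcM normc_expC normc_real ger0_norm ?expR_ge0// -expRD expr2 -!expRD ler_expR.
  rewrite cReMr -/a opprK; rewrite ltrNl in yx.
  have [hy|hy] := leP y 0; rewrite /q; last first.
    have := ler_norm x; have := normr_ge0 x; nra.
  have h1 : p * - y <= p * `|x|.
    rewrite ler_wpM2l ?(ltW p0)//; apply: le_trans (ler_norm _).
    by rewrite lerNl; apply: ltW; move: yx; rewrite ltrNl.
  lra.
have n2_ : (N2 mu f2 <= (Num.sqrt (B * n2 f) ^+ 2)%:E)%E.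
  rewrite sqr_sqrtr; last by apply: mulr_ge0 => //; exact: n2_ge0.
  have := profile_weighted p2w Lf; apply: le_trans; rewrite le_eqVlt; apply/orP; left; apply/eqP.
  congr rint; apply/funext => y; rewrite /f2 normcM exprMn normc_real ger0_norm ?expR_ge0//.
  by rewrite expr2 -expRD; congr (expR _ * _); field.
have K := cCS (mu := mu) m1 m2 (sqrtr_ge0 _) (sqrtr_ge0 _) n1 n2_.
apply: (le_trans K).
by rewrite -sqrtrM// mulrA.
Qed.

Lemma past_L1 z f x : w < complex.Re z -> L2 f -> cL1 mu (past z f x).
Proof.
move=> wz Lf; have [C _ hC] := past_bound x wz; split; first exact: cmeas_past.
by apply: le_lt_trans (hC _ Lf) _; exact: ltry.
Qed.

Lemma resol_lin z c f g x : w < complex.Re z -> L2 f -> L2 g ->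
  resol z (fun x => c * f x + g x) x = c * resol z f x + resol z g x.
Proof.
move=> wz Lf Lg; rewrite /resol mulrCA -mulrDr; congr (_ * _).
have Lfg : L2 (fun x => c * f x + g x) by apply: L2D => //; exact: L2Z.
have c1 := past_L1 x wz Lf; have c2 := past_L1 x wz Lg.
rewrite -(cIZ _ c1) -(cID (cL1Z _ c1) c2).
apply: cI_ae; first exact: cmeas_past.
  by case: (cL1D (cL1Z c c1) c2).
apply: filterS (profile_lin semigroupT TstarS c Lf Lg) => y e.
rewrite /past e; case: ifP => _; last by rewrite mulr0 addr0.
by rewrite mulrDr mulrCA.
Qed.

Lemma resol_eqL2 z f g x : w < complex.Re z -> L2 f -> L2 g -> eqL2 f g ->
  resol z f x = resol z g x.
Proof.
move=> wz Lf Lg fg; congr (_ * _); apply: cI_ae; [exact: cmeas_past|exact: cmeas_past|].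
by apply: filterS (profile_eqL2 semigroupT TstarS Lf Lg fg) => y e; rewrite /past e.
Qed.

Lemma resol0_bound z : w < complex.Re z -> exists2 C, 0 <= C & forall f, L2 f ->
  normc (resol z f 0) ^+ 2 <= C * n2 f.
Proof.
move=> wz; have [C C0 hC] := past_bound 0 wz; exists C => // f Lf.
rewrite /resol mulr0 expC0 mul1r.
have := le_trans (norm_cI mu (cmeas_past z 0 Lf)) (hC _ Lf); rewrite lee_fin => h.
have h2 : 0 <= C * n2 f by rewrite mulr_ge0 ?n2_ge0.
by rewrite -(sqr_sqrtr h2) lerXn2r ?nnegrE ?normc_ge0 ?sqrtr_ge0.
Qed.

Lemma past_opp z f x s : expC (- z * x%:C) * past z f x (- s + x) =
  if 0 < s then expC (- z * s%:C) * u f (x - s) else 0.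
Proof.
rewrite /past (addrC (- s)) gtrBl; case: ifP => _; last by rewrite mulr0.
by rewrite mulrA -expCD; congr (expC _ * _); rewrite rmorphB; ring.
Qed.

Lemma resol_conv z f x : w < complex.Re z -> L2 f ->
  resol z f x = cI mu (fun s => if 0 < s then expC (- z * s%:C) * u f (x - s) else 0).
Proof.
move=> wz Lf; rewrite /resol -cIZ; last exact: past_L1.
have m1 : cmeas (fun y : R => expC (- z * x%:C) * past z f x y).
  by apply: cmeasM; [exact: cmeas_cst|exact: cmeas_past].
rewrite -(cI_shift x m1) -cI_opp; last first.
  by apply: (cmeas_comp m1); exact: measurable_funD.
by apply: cI_eq => s; exact: past_opp.
Qed.

Lemma resol_conv_L1 z f x : w < complex.Re z -> L2 f ->
  cL1 mu (fun s => if 0 < s then expC (- z * s%:C) * u f (x - s) else 0).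
Proof.
move=> wz Lf; have [m1 j1] := cL1Z (expC (- z * x%:C)) (past_L1 x wz Lf).
have n1 := measurable_normc m1.
have n2_ : measurable_fun setT (fun y : R => normc (expC (- z * x%:C) * past z f x (y + x))).
  by apply: (measurableT_comp n1); exact: measurable_funD.
have E : (fun s => if 0 < s then expC (- z * s%:C) * u f (x - s) else 0) =
    fun s => expC (- z * x%:C) * past z f x (- s + x).
  by apply/funext => s; rewrite past_opp.
rewrite E; split; last by move: j1; rewrite -(rint_shift x n1) -(rint_opp n2_).
apply: (cmeas_comp m1 (g := fun s : R => - s + x)).
by apply: measurable_funD; [exact: oppr_measurable|exact: measurable_cst].
Qed.

(** A jointly measurable version of [e^(-zs) T_s f (x)] for [0 < x]. *)
Definition trail z f (q : RR * RR) : R[i] :=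
  if 0 < q.2 then expC (- z * q.1%:C) * u f (q.2 - q.1) else 0.

Lemma cmeas_trail z f : L2 f -> cmeas (trail z f).
Proof.
move=> Lf; have mf := cmeas_profile semigroupT Lf.
apply: cmeas_if; [|apply: cmeasM|exact: cmeas_cst].
- by apply: measurable_fun_ltr; [exact: measurable_cst|exact: measurable_snd].
- exact: (cmeas_comp (cmeas_exp (- z)) measurable_fst).
- apply: (cmeas_comp mf); apply: measurable_funB; [exact: measurable_snd|exact: measurable_fst].
Qed.

Lemma N2_trail z f s : 0 <= s -> L2 f ->
  N2 mu (fun x => trail z f (s, x)) = (expR (- (2 * complex.Re z) * s) * n2 (T s f))%:E.
Proof.
move=> s0 Lf; rewrite EFinM -(N2_profile_shift semigroupT TstarS s0 Lf).
have m : cmeas (pos (fun x : R => u f (x - s))).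
  apply: cmeas_pos_of; apply: (cmeas_comp (cmeas_profile semigroupT Lf)); exact: measurable_funD.
have -> : expR (- (2 * complex.Re z) * s) = normc (expC (- z * s%:C)) ^+ 2.
  by rewrite normc_expC cReMr cReN expr2 -expRD; congr expR; ring.
rewrite -(N2Z mu _ m); congr N2; apply/funext => x; rewrite /trail /pos /=.
by case: ifP => _ //; rewrite mulr0.
Qed.

Lemma cmeas_resol z f : L2 f -> cmeas (resol z f).
Proof.
move=> Lf; apply: cmeasM; first exact: cmeas_exp.
pose F (q : RR * RR) := past z f q.1 q.2.
suff mF : cmeas F by exact: (cmeas_cI mu mF).
apply: cmeas_if; [|apply: cmeasM|exact: cmeas_cst].
- by apply: measurable_fun_ltr; [exact: measurable_snd|exact: measurable_fst].
- exact: (cmeas_comp (cmeas_exp z) measurable_snd).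
- exact: (cmeas_comp (cmeas_profile semigroupT Lf) measurable_snd).
Qed.

(** Factor [e^(-zs) T_s f] into [e^(-(Re z - w) s)] and a family whose squared norm stays below
    [expR (2 * w) * n2 f] by the growth bound. Minkowski's inequality with the exponential as weight
    yields [1 / (Re z - w)] twice: as the mass of the weight and as its integral against the
    bound. *)
Lemma resol_bound z f : w < complex.Re z -> L2 f ->
  (N2 mu (pos (resol z f)) <= (expR (2 * w) / (complex.Re z - w) ^+ 2 * n2 f)%:E)%E.
Proof.
move=> wz Lf; have g0 : 0 < complex.Re z - w by rewrite subr_gt0.
have gi0 : 0 < (complex.Re z - w)^-1 by rewrite invr_gt0.
have mm := measurable_exp_tail (complex.Re z - w) 0.
have m0 := exp_tail_ge0 (complex.Re z - w) 0.
have hA : (rint mu (exp_tail (complex.Re z - w) 0) <= ((complex.Re z - w)^-1)%:E)%E.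
  by rewrite (rint_exp_tail 0 g0) mulr0 expR0 mulr1.
(* Subtracting [Re z - w] leaves an exponent with real part exactly [w], just enough to absorb the
   growth. *)
have mF := cmeas_trail (z - (complex.Re z - w)%:C) Lf.
have c0 : 0 <= expR (2 * w) * n2 f by rewrite mulr_ge0 ?expR_ge0 ?n2_ge0.
have bound s : (0 < s) -> expR (- (2 * w) * s) * n2 (T s f) <= expR (2 * w) * n2 f.
  move=> s0; apply: (@le_trans _ _ (expR (- (2 * w) * s) * (expR (2 * w * (s + 1)) * n2 f))).
    by rewrite ler_wpM2l ?expR_ge0// growth// ltW.
  rewrite mulrA -expRD le_eqVlt; apply/orP; left; apply/eqP.
  by congr (expR _ * _); ring.
have ReE : complex.Re (z - (complex.Re z - w)%:C) = w by rewrite cReD cReN /=; ring.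
have E : pos (resol z f) = fun x => cI mu (fun s => (exp_tail (complex.Re z - w) 0 s)%:C *
    trail (z - (complex.Re z - w)%:C) f (s, x)).
  apply/funext => x; rewrite /pos; case: ifP => x0; last first.
    by rewrite -(cI0 mu); apply: cI_eq => s; rewrite /trail /= x0 mulr0.
  rewrite resol_conv//; apply: cI_eq => s; rewrite /exp_tail /trail /= x0.
  case: ifP => _; last by rewrite mul0r.
  rewrite mulrA; congr (_ * _).
  have -> : (expR (- (complex.Re z - w) * s))%:C = expC ((- (complex.Re z - w) * s)%:C).
    by rewrite /expC /= cos0 sin0 mulr1.
  by rewrite -expCD; congr expC; rewrite rmorphM rmorphN; ring.
have K := minkowski_integral_sq (m1 := mu) mu mm m0 gi0 hA mF.
rewrite E; apply: (le_trans K).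
apply: (@le_trans _ _ (((complex.Re z - w)^-1)%:E *
    ((expR (2 * w) * n2 f * ((complex.Re z - w)^-1 * expR (- (complex.Re z - w) * 0)))%:E))%E); last first.
  rewrite -EFinM lee_fin mulr0 expR0 mulr1 le_eqVlt; apply/orP; left; apply/eqP.
  by field; rewrite lt0r_neq0.
rewrite lee_pmul2l// -(rint_exp_tailZ 0 c0 g0).
apply: integral_le_rint.
- by move=> s; apply: mule_ge0; [rewrite lee_fin; exact: m0|exact: N2_ge0].
- apply: emeasurable_funM; first exact/measurable_EFinP.
  exact: (measurable_rint mu (measurable_normc_sq mF) (fun q => sqr_ge0 _)).
- exact: (measurable_funM (measurable_cst _) (measurable_exp_tail _ _)).
move=> s; have [s0|s0] := ltP 0 s; last first.
  have -> : exp_tail (complex.Re z - w) 0 s = 0 by rewrite /exp_tail ltNge s0.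
  by rewrite mul0e mulr0.
rewrite (N2_trail _ (ltW s0) Lf) ReE -EFinM lee_fin mulrC.
exact: (ler_wpM2r (m0 s) (bound s s0)).
Qed.

Lemma resol_L2 z f : w < complex.Re z -> L2 f -> L2 (resol z f).
Proof.
move=> wz Lf; apply/L2P; split; first by apply: cmeas_pos_of; exact: cmeas_resol.
by apply: le_lt_trans (resol_bound wz Lf) _; exact: ltry.
Qed.

Lemma n2_resol z f : w < complex.Re z -> L2 f ->
  n2 (resol z f) <= expR (2 * w) / (complex.Re z - w) ^+ 2 * n2 f.
Proof. by move=> wz Lf; apply: N2_n2_le; [exact: resol_L2|exact: resol_bound]. Qed.

Lemma L2_profile f : L2 f -> L2 (u f).
Proof.
move=> Lf; have e := profile_pos semigroupT TstarS Lf; have m := cmeas_profile semigroupT Lf.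
apply/L2P; split; first exact: cmeas_pos_of.
have [mf jf] := (L2P _).1 Lf; apply: le_lt_trans jf; rewrite le_eqVlt; apply/orP; left; apply/eqP.
by apply: N2_ae => //; [exact: cmeas_pos_of|apply/eqL2P].
Qed.

(** For [0 <= x] the resolvent is [e^(-zx) (R(z) f 0 + \int_0^x e^(zy) u(y) dy)], and [u = f] almost
    everywhere there; the product rule gives the equation [g' = f - z g]. *)
Lemma primitive_resol z f : w < complex.Re z -> L2 f ->
  primitive (resol z f) (fun x => f x - z * resol z f x).
Proof.
move=> wz Lf; have mf := cmeas_profile semigroupT Lf.
have LE : L2loc (fun y => expC (z * y%:C) * u f y).
  apply: L2loc_mul_bounded.
  - by apply: cmeas_pos_of; exact: cmeas_exp.
  - by move=> b; exact: primitive_bound b (primitive_exp z).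
  - by apply: L2_L2loc; exact: L2_profile.
pose G x := resol z f 0 + Int 0 x (fun y => expC (z * y%:C) * u f y).
have hG : primitive G (fun y => expC (z * y%:C) * u f y) by apply: int_primitive LE _.
have h := primitive_mul (primitive_exp (- z)) hG.
have E x : 0 <= x -> expC (- z * x%:C) * G x = resol z f x.
  move=> x0; congr (_ * _); rewrite /G /resol mulr0 expC0 mul1r /Int.
  have c1 := past_L1 0 wz Lf; have c2 := L2loc_iv x LE (lexx 0).
  rewrite -cID//; apply: cI_ae; first by case: (cL1D c1 c2).
    exact: cmeas_past.
  apply: filterS (ae_neq 0) => y y0; rewrite /past /iv.
  have [ylt|ygt|//] := ltgtP y 0; first by rewrite addr0 (lt_le_trans ylt x0).
  by rewrite add0r.
have h2 := primitive_eq E h; apply: primitive_ae h2.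
  by apply: L2_L2loc; apply: L2B => //; apply: L2Z; exact: resol_L2.
have /eqL2P e := profile_pos semigroupT TstarS Lf.
apply: filterS e => x; rewrite /pos; case: ifP => // x0 e.
rewrite -mulrA (E x (ltW x0)) mulrA -expCD -mulrDl addNr mul0r expC0 mul1r e addrC.
by rewrite mulNr.
Qed.

Definition trail_pair z f g (q : RR * RR) : R[i] :=
  if 0 < q.1 then trail z f q * pos g q.2 else 0.

(** The weak form of [R(z) = \int e^(-zs) T_s ds], by Fubini. It stands in for an L^2-valued
    integral when an operator has to be moved inside. *)
Lemma pairing_resol z f g : w < complex.Re z -> L2 f -> L2 g ->
  pairing (resol z f) g =
  cI mu (fun s => if 0 < s then expC (- z * s%:C) * pairing (T s f) g else 0).
Proof.
move=> wz Lf Lg; have g0 : 0 < complex.Re z - w by rewrite subr_gt0.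
have [mg jg] := (L2P _).1 Lg.
have c0 : 0 <= expR w * Num.sqrt (n2 f) * Num.sqrt (n2 g).
  by rewrite !mulr_ge0 ?expR_ge0 ?sqrtr_ge0.
have bound s : 0 < s -> (rint mu (fun x => normc (trail z f (s, x) * pos g x)%R) <=
    (expR w * Num.sqrt (n2 f) * Num.sqrt (n2 g) * expR (- (complex.Re z - w) * s))%:E)%E.
  move=> s0; have mo : cmeas (fun x => trail z f (s, x)) by exact: (cmeas_slice1 s (cmeas_trail z Lf)).
  have A0 : 0 <= expR (w - (complex.Re z - w) * s) * Num.sqrt (n2 f).
    by rewrite mulr_ge0 ?expR_ge0 ?sqrtr_ge0.
  have hf : (N2 mu (fun x => trail z f (s, x)) <=
      ((expR (w - (complex.Re z - w) * s) * Num.sqrt (n2 f)) ^+ 2)%:E)%E.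
    rewrite (N2_trail z (ltW s0) Lf) lee_fin exprMn sqr_sqrtr ?n2_ge0//.
    apply: (@le_trans _ _ (expR (- (2 * complex.Re z) * s) * (expR (2 * w * (s + 1)) * n2 f))).
      by rewrite ler_wpM2l ?expR_ge0// growth// ltW.
    rewrite mulrA -expRD expr2 -expRD le_eqVlt; apply/orP; left; apply/eqP.
    by congr (expR _ * _); ring.
  have hg : (N2 mu (pos g) <= (Num.sqrt (n2 g) ^+ 2)%:E)%E.
    by rewrite sqr_sqrtr ?n2_ge0// n2E.
  have K := cCS mo mg A0 (sqrtr_ge0 _) hf hg.
  apply: (le_trans K).
  rewrite lee_fin expRD mulNr le_eqVlt; apply/orP; left; apply/eqP; ring.
have slice (s : R) : 0 < s ->
    cI mu (fun x => trail z f (s, x) * pos g x) = expC (- z * s%:C) * pairing (T s f) g.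
  move=> s0; have LT := T_L2 semigroupT (ltW s0) Lf; have [mT _] := (L2P _).1 LT.
  rewrite pairingE -cIZ; last exact: pairing_L1.
  apply: cI_ae.
  - exact: (cmeasM (cmeas_slice1 s (cmeas_trail z Lf)) mg).
  - exact: (cmeasM (cmeas_cst _) (cmeasM mT mg)).
  have /eqL2P e := profile_shift semigroupT TstarS (ltW s0) Lf.
  apply: filterS e => x; rewrite /trail /= /pos; case: ifP => x0; last by rewrite !mul0r mulr0.
  by move=> ->; rewrite mulrA.
have mG : cmeas (trail_pair z f g).
  apply: cmeas_if; [|apply: cmeasM|exact: cmeas_cst].
  - by apply: measurable_fun_ltr; [exact: measurable_cst|exact: measurable_fst].
  - exact: cmeas_trail.
  - exact: (cmeas_comp mg measurable_snd).
have GL : (\int[mu]_s rint mu (fun x => normc (trail_pair z f g (s, x))) < +oo)%E.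
  apply: (@le_lt_trans _ _ (rint mu (fun s => expR w * Num.sqrt (n2 f) * Num.sqrt (n2 g) *
      exp_tail (complex.Re z - w) 0 s)%R)); last by rewrite (rint_exp_tailZ 0 c0 g0) ltry.
  apply: integral_le_rint.
  - by move=> s; apply: rint_ge0 => x; exact: normc_ge0.
  - exact: (measurable_rint mu (measurable_normc mG) (fun q => normc_ge0 _)).
  - exact: (measurable_funM (measurable_cst _) (measurable_exp_tail _ _)).
  move=> s; rewrite /trail_pair /exp_tail /=; case: ifP => s0; first exact: bound.
  have -> : (fun=> normc (0 : R[i])) = (fun=> 0) :> (R -> R) by apply/funext => ?; rewrite normc0.
  by rewrite mulr0 /rint integral0.
have F := cI_fubini mG GL.
have e1 : pairing (resol z f) g = cI mu (fun x => cI mu (fun s => trail_pair z f g (s, x))).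
  rewrite pairingE; apply: cI_eq => x; rewrite /trail_pair /=; rewrite {1}/pos; case: ifP => x0; last first.
    by rewrite mul0r -[LHS](cI0 mu); apply: cI_eq => s; rewrite /trail /= x0 mul0r if_same.
  rewrite mulrC (resol_conv x wz Lf).
  apply: etrans (esym (cIZ (pos g x) (resol_conv_L1 x wz Lf))) _.
  apply: cI_eq => s; rewrite /trail /= x0; case: ifP => _; last by rewrite mulr0.
  by rewrite mulrC.
rewrite e1 -F; apply: cI_eq => s; rewrite /trail_pair /=; case: ifP => s0; last by rewrite cI0.
exact: slice.
Qed.

End resolvent.

(** * Limits in the squared norm *)

Section limits.
Context {R : realType}.
Implicit Types (v : R -> 'Fun(R)) (g : 'Fun(R)).

Lemma cvgL2_right_n2 v g : cvgL2 (0 : R)^'+ v g -> forall e, 0 < e ->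
  exists2 d : R, 0 < d & forall t, 0 < t -> t < d ->
    L2 (v t) /\ n2 (fun x => v t x - g x) <= e.
Proof.
move=> [nL Lg cv] e e0.
have e1 : 0 < Num.sqrt e by rewrite sqrtr_gt0.
have := cv => /cvgrPdist_le /(_ _ e1) => nc.
have [d /= d0 hd] := filterI nL nc; exists d => // t t0 td.
have [/= h1 h2] : L2 (v t) /\ `|0 - normL2 (fun x => v t x - g x)| <= Num.sqrt e.
  by apply: hd => //=; rewrite sub0r normrN gtr0_norm.
split=> //; rewrite -normL2_sqr; move: h2; rewrite sub0r normrN ger0_norm ?normL2_ge0// => h2.
by rewrite -(sqr_sqrtr (ltW e0)) lerXn2r ?nnegrE ?normL2_ge0 ?sqrtr_ge0.
Qed.

Lemma n2_cvgL2 (F : set_system R) {FF : ProperFilter F} v g : L2 g ->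
  (forall e, 0 < e -> \forall t \near F, L2 (v t) /\ n2 (fun x => v t x - g x) <= e) ->
  cvgL2 F v g.
Proof.
move=> Lg h; split => //; first by apply: filterS (h 1 ltr01) => t [].
apply/cvgrPdist_le => e e0; have e1 : 0 < e ^+ 2 by rewrite exprn_gt0.
apply: filterS (h _ e1) => t [_]; rewrite sub0r normrN ger0_norm ?normL2_ge0// => k.
rewrite -(@ler_pXn2r _ 2) ?nnegrE ?normL2_ge0 ?(ltW e0)//.
by rewrite normL2_sqr.
Qed.

Lemma n2_cvgL2_right v g : L2 g ->
  (forall e, 0 < e -> exists2 d : R, 0 < d & forall t, 0 < t -> t < d ->
    L2 (v t) /\ n2 (fun x => v t x - g x) <= e) ->
  cvgL2 (0 : R)^'+ v g.
Proof.
move=> Lg h; apply: n2_cvgL2 => // e /h [d d0 hd]; exists d => //= t /=.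
by rewrite sub0r normrN => td t0; apply: hd => //; apply: le_lt_trans td; exact: ler_norm.
Qed.

Lemma expC_small (z : R[i]) (e : R) : 0 < e -> exists2 d : R, 0 < d & forall h, `|h| < d ->
  normc (expC (z * h%:C) - 1 - z * h%:C) <= e * `|h|.
Proof.
move=> e0; have [d d0 hd] := cderiv_eps (cderiv_exp 0 z) e0; exists d => // h /hd.
by rewrite add0r mulr0 expC0 mulr1.
Qed.

Lemma expC_near1 (z : R[i]) (e : R) : 0 < e -> exists2 d : R, 0 < d & forall h, `|h| < d ->
  normc (expC (z * h%:C) - 1) <= e.
Proof.
move=> e0; have [d d0 hd] := expC_small z ltr01.
have c0 : 0 < 1 + normc z by rewrite ltr_wpDr// normc_ge0.
exists (Num.min d (e / (1 + normc z))); first by rewrite lt_min d0 divr_gt0.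
move=> h; rewrite lt_min => /andP[/hd h1]; rewrite ltr_pdivlMr// => h2.
have -> : expC (z * h%:C) - 1 = (expC (z * h%:C) - 1 - z * h%:C) + z * h%:C by ring.
apply: le_trans (le_normcD _ _) _; apply: le_trans (ltW h2).
by rewrite mulrDr mulr1 normcM normc_real (mulrC (normc z)) lerD2r -[leRHS]mul1r.
Qed.

Lemma n2_tri (f g h : 'Fun(R)) : L2 f -> L2 g -> L2 h ->
  n2 (fun x => f x - h x) <= 2 * (n2 (fun x => f x - g x) + n2 (fun x => g x - h x)).
Proof.
move=> Lf Lg Lh.
have -> : (fun x => f x - h x) = fun x => (f x - g x) + (g x - h x).
  by apply/funext => x; ring.
by apply: n2D; exact: L2B.
Qed.

Lemma eqL2_of_small (f g : 'Fun(R)) : L2 f -> L2 g ->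
  (forall e, 0 < e -> n2 (fun x => f x - g x) <= e) -> eqL2 f g.
Proof.
move=> Lf Lg h; apply: n2_sub_eq0 => //.
by apply: (@le_of_eps _ _ 0 1) => // e e0; rewrite add0r mulr1; exact: h.
Qed.

Lemma n2_sub_eqL2 (f f' g g' : 'Fun(R)) : L2 f -> L2 f' -> L2 g -> L2 g' ->
  eqL2 f f' -> eqL2 g g' -> n2 (fun x => f x - g x) = n2 (fun x => f' x - g' x).
Proof.
move=> Lf Lf' Lg Lg' /eqL2P h1 /eqL2P h2; apply: n2_eqL2; [exact: L2B|exact: L2B|].
by apply/eqL2P; apply: filterS2 h1 h2 => x; rewrite !posB => -> ->.
Qed.

End limits.

(** * The generator and its resolvent *)

Section generator.
Context {R : realType} (T : R -> 'Fun(R) -> 'Fun(R)).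
Notation mu := (@lebesgue_measure R).
Notation RR := (measurableTypeR R).
Hypothesis semigroupT : C0_semigroup T.
Hypothesis TstarS : forall (t : R) (f : 'Fun(R)), 0 <= t -> L2 f ->
  adjoint_graph (T t) (shiftS t f) f.
Variable w : R.
Hypothesis w0 : 0 < w.
Hypothesis growth : forall t f, 0 <= t -> L2 f ->
  n2 (T t f) <= expR (2 * w * (t + 1)) * n2 f.
Implicit Types (f g k : 'Fun(R)) (s t : R) (z : R[i]).
Local Notation u := (profile T).
Local Notation Rz := (resol T).

Let TL2 t f : 0 <= t -> L2 f -> L2 (T t f) := @T_L2 R T semigroupT t f.
Let RL2 z f (wz : w < complex.Re z) (Lf : L2 f) : L2 (Rz z f) :=
  resol_L2 semigroupT TstarS w0 growth wz Lf.
Let L1 z f x (wz : w < complex.Re z) (Lf : L2 f) : cL1 mu (past T z f x) :=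
  past_L1 semigroupT TstarS w0 growth x wz Lf.

(** Each [T_s] has a transpose on all of L^2, whereas the hypothesis describes it only on shifted
    functions. In [resol_T] it lets [T_s] pass under the Laplace integral. *)
Lemma pairing_T_riesz s g : 0 <= s -> L2 g ->
  exists2 th, L2 th & forall f, L2 f -> pairing (T s f) g = pairing f th.
Proof.
move=> s0 Lg; have [K K0 hK] := T_bound semigroupT s0.
apply: (@riesz R (fun f => pairing (T s f) g) (K * n2 g)).
- by rewrite mulr_ge0 ?n2_ge0.
- move=> c f h Lf Lh; have Lc : L2 (fun x => c * f x + h x) by apply: L2D => //; exact: L2Z.
  have LT := TL2 s0 Lf; have LTh := TL2 s0 Lh; have LcT := L2Z c LT.
  have e := T_lin semigroupT c s0 Lf Lh.
  rewrite (pairing_eqL2 (TL2 s0 Lc) (L2D LcT LTh) Lg Lg e (eqL2_refl g)).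
  by rewrite pairingDl// pairingZl.
- move=> f Lf; have LT := TL2 s0 Lf.
  have h := pairing_CS LT Lg.
  apply: (@le_trans _ _ (n2 (T s f) * n2 g)).
    rewrite -!normL2_sqr -exprMn lerXn2r ?nnegrE ?normc_ge0//.
    by rewrite mulr_ge0 ?normL2_ge0.
  by rewrite mulrAC ler_wpM2r ?n2_ge0// hK.
Qed.

Lemma resol_T z s k : w < complex.Re z -> 0 <= s -> L2 k ->
  eqL2 (T s (Rz z k)) (Rz z (T s k)).
Proof.
move=> wz s0 Lk; have LR := RL2 wz Lk; have LT := TL2 s0 Lk.
apply: pairing_nondeg; [exact: TL2|exact: RL2|move=> g Lg].
have [th Lth hth] := pairing_T_riesz s0 Lg.
rewrite hth// (pairing_resol semigroupT TstarS w0 growth wz Lk Lth).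
rewrite (pairing_resol semigroupT TstarS w0 growth wz LT Lg).
apply: cI_eq => t; case: ifP => // t0; congr (_ * _).
have t1 := ltW t0; rewrite -hth; last exact: TL2.
have Lst : L2 (T (s + t) k) by apply: TL2 => //; exact: addr_ge0.
have e1 := T_add semigroupT s0 t1 Lk; have e2 := T_add semigroupT t1 s0 Lk.
apply: pairing_eqL2 => //; [by apply: TL2 => //; exact: TL2|by apply: TL2 => //; exact: TL2| |exact: eqL2_refl].
by apply: eqL2_trans (eqL2_sym e1) _; rewrite addrC.
Qed.

(** The value at [x] of [\int_0^s e^(-zt) T_t f dt], see [avgE]; the profile makes it defined at
    every [x]. *)
Definition avg z f s : 'Fun(R) := fun x =>
  expC (- z * x%:C) * Int (x - s) x (fun y => expC (z * y%:C) * u f y).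

Lemma past_shift z f s x : w < complex.Re z -> 0 <= s -> L2 f ->
  cI mu (past T z (T s f) x) = expC (z * s%:C) * cI mu (past T z f (x - s)).
Proof.
move=> wz s0 Lf; have LT := TL2 s0 Lf.
have mq := cmeas_past semigroupT z (x - s) Lf.
have mq' := cmeas_past semigroupT z x LT.
rewrite -(cIZ _ (L1 (x - s) wz Lf)) -(cI_shift s mq'); apply: cI_ae.
- by apply: (cmeas_comp mq'); exact: measurable_funD.
- exact: (cmeasM (cmeas_cst _) mq).
apply: filterS (ae_shift s (profile_T semigroupT TstarS s0 Lf)) => y e.
rewrite /past e addrK -ltrBrDr; case: ifP => _; last by rewrite mulr0.
rewrite mulrA -expCD; congr (expC _ * _).
by rewrite rmorphD; ring.
Qed.

(** Cutting the past of [x] at [x - s] gives [R(z) T_s = e^(zs) (R(z) - \int_0^s e^(-zt) T_t dt)],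
    from which the difference quotients of the resolvent are computed. *)
Lemma resol_shift z f s x : w < complex.Re z -> 0 <= s -> L2 f ->
  Rz z (T s f) x = expC (z * s%:C) * (Rz z f x - avg z f s x).
Proof.
move=> wz s0 Lf; have LT := TL2 s0 Lf.
pose E : 'Fun(R) := fun y => expC (z * y%:C) * u f y.
have mE : cmeas E by apply: cmeasM; [exact: cmeas_exp|exact: cmeas_profile].
have mp := cmeas_past semigroupT z x Lf.
have mx := L1 x wz Lf; have mxs := L1 (x - s) wz Lf.
have miv : cL1 mu (iv (x - s) x E).
  split; first exact: cmeas_iv.
  case: mx => _; apply: le_lt_trans; apply: rint_le.
  - by apply: measurable_normc; exact: cmeas_iv.
  - exact: (measurable_normc mp).
  - by move=> y; exact: normc_ge0.
  - move=> y; rewrite /iv /past; case: (y < x); last by rewrite andbF.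
    by rewrite andbT; case: ifP => // _; rewrite normc0 normc_ge0.
have e1 : cI mu (past T z f x) = cI mu (past T z f (x - s)) + Int (x - s) x E.
  rewrite /Int -(cID mxs miv); apply: cI_ae => //; first by case: (cL1D mxs miv).
  apply: filterS (ae_neq (x - s)) => y ys; rewrite /past /iv.
  have xs : x - s <= x by rewrite gerBl.
  have [ylt|ygt|//] := ltgtP y (x - s); first by rewrite (lt_le_trans ylt xs) addr0.
  by rewrite add0r.
rewrite /avg /resol e1 (past_shift x wz s0 Lf) -/E; ring.
Qed.

Lemma Int_1 (a b : R) : a <= b -> Int a b (fun=> 1) = (b - a)%:C.
Proof.
move=> ab; rewrite /Int /cI; apply: ReImE => /=; last first.
  rewrite /Rintegral (_ : (fun x => _) = (fun=> 0%E)) ?integral0//.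
  by apply/funext => x; rewrite /iv; case: ifP.
have -> : (fun x => complex.Re (iv a b (fun=> 1) x)) = (fun y : R => ((a < y) && (y < b))%:R).
  by apply/funext => x; rewrite /iv; case: ifP.
by have := rint_between ab; rewrite /rint /Rintegral => ->.
Qed.

Lemma iv_conv_L1 z f s x : w < complex.Re z -> L2 f ->
  cL1 mu (iv 0 s (fun t => expC (- z * t%:C) * u f (x - t))).
Proof.
move=> wz Lf; have [m j] := resol_conv_L1 semigroupT TstarS w0 growth x wz Lf.
have E : iv 0 s (fun t => expC (- z * t%:C) * u f (x - t)) =
    iv 0 s (fun t => if 0 < t then expC (- z * t%:C) * u f (x - t) else 0).
  by apply/funext => t; rewrite /iv; case: (0 < t).
rewrite E; split; first exact: cmeas_iv.
apply: le_lt_trans j; apply: rint_le.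
- by apply: measurable_normc; exact: cmeas_iv.
- exact: measurable_normc.
- by move=> t; exact: normc_ge0.
- by move=> t; rewrite /iv; case: ifP => // _; rewrite normc0 normc_ge0.
Qed.

Lemma avgE z f s x : w < complex.Re z -> L2 f ->
  avg z f s x = Int 0 s (fun t => expC (- z * t%:C) * u f (x - t)).
Proof.
move=> wz Lf.
pose E : 'Fun(R) := fun y => expC (z * y%:C) * u f y.
have mE : cmeas E by apply: cmeasM; [exact: cmeas_exp|exact: cmeas_profile].
have mx := L1 x wz Lf.
have miv : cL1 mu (iv (x - s) x E).
  split; first exact: cmeas_iv.
  case: mx => _; apply: le_lt_trans; apply: rint_le.
  - by apply: measurable_normc; exact: cmeas_iv.
  - by apply: measurable_normc; exact: cmeas_past.
  - by move=> y; exact: normc_ge0.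
  - move=> y; rewrite /iv /past; case: (y < x); last by rewrite andbF.
    by rewrite andbT; case: ifP => // _; rewrite normc0 normc_ge0.
rewrite /avg /Int -/E -(cIZ _ miv).
have m1 : cmeas (fun y : R => expC (- z * x%:C) * iv (x - s) x E y).
  by apply: cmeasM; [exact: cmeas_cst|exact: cmeas_iv].
rewrite -(cI_shift x m1) -cI_opp; last first.
  by apply: (cmeas_comp m1); exact: measurable_funD.
apply: cI_eq => t; rewrite /iv (addrC (- t)) gtrBl ltrD2l ltrN2 andbC.
case: ifP => _; last by rewrite mulr0.
by rewrite /E mulrA -expCD; congr (expC _ * _); rewrite rmorphB; ring.
Qed.

(** Minkowski's inequality for the uniform probability weight on []0, s[]: an average of functions
    whose squared distance to [f] is at most [e] keeps that distance. *)
Lemma avg_bound z f s (e : R) : w < complex.Re z -> L2 f -> 0 < s -> 0 <= e ->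
  (forall t, 0 < t -> t < s -> n2 (fun x => expC (- z * t%:C) * T t f x - f x) <= e) ->
  (N2 mu (pos (fun x => (s^-1)%:C * avg z f s x - u f x)%R) <= e%:E)%E.
Proof.
move=> wz Lf s0 e0 he.
have mf := cmeas_profile semigroupT Lf; have Lu := L2_profile semigroupT TstarS Lf.
have [mp _] := (L2P _).1 Lu.
pose m t : R := s^-1 * ((0 < t) && (t < s))%:R.
have mm : measurable_fun setT m.
  by apply: measurable_funM => //; exact: measurable_between_nat.
have m0 t : 0 <= m t by rewrite mulr_ge0// invr_ge0 ltW.
have hA (c : R) : 0 <= c -> rint mu (fun t => (m t * c)%R) = c%:E.
  move=> c0; have -> : (fun t => m t * c) = fun t : R => (s^-1 * c) * ((0 < t) && (t < s))%:R.
    by apply/funext => t; rewrite /m mulrAC.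
  rewrite (rintZ mu (measurable_between_nat 0 s) _ _).
  - by rewrite (rint_between (ltW s0)) -EFinM subr0; congr EFin; field; rewrite lt0r_neq0.
  - by move=> t.
  - by rewrite mulr_ge0// invr_ge0 ltW.
have hA1 : (rint mu m <= 1%:E)%E.
  by have := hA 1 ler01; under eq_fun do rewrite mulr1; move=> ->.
have mF : cmeas (fun q : RR * RR => trail T z f q - pos (u f) q.2).
  apply: cmeasB; first exact: (cmeas_trail semigroupT z Lf).
  exact: (cmeas_comp mp measurable_snd).
have hN t : 0 < t -> t < s ->
    (N2 mu (fun x => (trail T z f (t, x) - pos (u f) x)%R) <= e%:E)%E.
  move=> t0 ts; have LT := TL2 (ltW t0) Lf.
  have Ld : L2 (fun x => expC (- z * t%:C) * T t f x - f x) by apply: L2B => //; exact: L2Z.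
  have := he t t0 ts; rewrite -lee_fin -n2E//; apply: le_trans; rewrite le_eqVlt; apply/orP; left; apply/eqP.
  have [md _] := (L2P _).1 Ld.
  apply: N2_ae => //; first exact: (cmeas_slice1 t mF).
  have /eqL2P h1 := profile_shift semigroupT TstarS (ltW t0) Lf.
  have /eqL2P h2 := profile_pos semigroupT TstarS Lf.
  apply: filterS2 h1 h2 => x; rewrite /trail /pos /=; case: ifP => _; last by rewrite subrr.
  by move=> -> ->.
have E : pos (fun x => (s^-1)%:C * avg z f s x - u f x)%R =
    fun x => cI mu (fun t => (m t)%:C * (trail T z f (t, x) - pos (u f) x)).
  apply/funext => x; rewrite /pos; case: ifP => x0; last first.
    by rewrite -[LHS](cI0 mu); apply: cI_eq => t; rewrite /trail /= x0 subr0 mulr0.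
  rewrite avgE// /Int.
  have c1 := iv_conv_L1 s x wz Lf.
  have c2 : cL1 mu (iv 0 s (fun=> 1)).
    apply: cL1_iv; first by apply: cmeas_iv; exact: cmeas_cst.
    by rewrite N2_between ?ltW// ltry.
  have e1 := cIZ (s^-1)%:C c1; have e2 := cIZ ((s^-1)%:C * u f x) c2.
  have e3 := cIB (cL1Z (s^-1)%:C c1) (cL1Z ((s^-1)%:C * u f x) c2).
  have I1 := Int_1 (ltW s0); rewrite /Int subr0 in I1.
  have e4 : u f x = (s^-1)%:C * u f x * s%:C.
    by rewrite mulrAC -rmorphM mulVf ?mul1r// lt0r_neq0.
  rewrite {1}e4 -I1 -e1 -e2 -e3; apply: cI_eq => t.
  rewrite /m /iv /trail /= x0; case: (_ && _).
    by rewrite !mulr1; ring.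
  by rewrite !mulr0 mul0r subrr.
have K := minkowski_integral_sq (m1 := mu) mu mm m0 ltr01 hA1 mF.
rewrite E; apply: (le_trans K); rewrite mul1e -(hA e e0).
apply: integral_le_rint.
- by move=> t; apply: mule_ge0; [rewrite lee_fin; exact: m0|exact: N2_ge0].
- apply: emeasurable_funM; first exact/measurable_EFinP.
  exact: (measurable_rint mu (measurable_normc_sq mF) (fun q => sqr_ge0 _)).
- exact: (measurable_funM mm (measurable_cst _)).
move=> t; have [/andP[t0 ts]|] := boolP ((0 < t) && (t < s)); last first.
  by move=> /negbTE h; rewrite /m h mulr0 mul0e mul0r.
have m0t : (0 <= (m t)%:E)%E by rewrite lee_fin; exact: m0.
exact: (lee_wpmul2l m0t (hN t t0 ts)).
Qed.

Lemma T_near1 z f (e : R) : L2 f -> 0 < e -> exists2 d : R, 0 < d &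
  forall t, 0 < t -> t < d -> n2 (fun x => expC (z * t%:C) * T t f x - f x) <= e.
Proof.
move=> Lf e0; have [_ _ _ /(_ _ Lf) hC] := semigroupT.
have n0 := n2_ge0 f.
(* The first term will cost [2 * 4 * e1 = e / 4], with [2] from [n2D] and [4] bounding the squared
   exponential. *)
pose e1 : R := e / 32; have e10 : 0 < e1 by rewrite divr_gt0.
have [d1 d10 h1] := cvgL2_right_n2 hC e10.
pose e2 : R := Num.min 1 (e / (4 * (1 + n2 f))).
have e20 : 0 < e2 by rewrite lt_min ltr01 divr_gt0// mulr_gt0// ltr_wpDr.
have [d2 d20 h2] := expC_near1 z e20.
exists (Num.min d1 d2); first by rewrite lt_min d10.
move=> t t0; rewrite lt_min => /andP[t1 t2]; have LT := TL2 (ltW t0) Lf.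
have k2 : normc (expC (z * t%:C) - 1) <= e2 by apply: h2; rewrite gtr0_norm.
have [_ k1] := h1 t t0 t1.
have e2a : e2 <= 1 by rewrite ge_min lexx.
have e2b : e2 * (4 * (1 + n2 f)) <= e.
  by rewrite -ler_pdivlMr ?mulr_gt0 ?ltr_wpDr// ge_min lexx orbT.
have k3 : normc (expC (z * t%:C)) <= 2.
  have -> : expC (z * t%:C) = (expC (z * t%:C) - 1) + 1 by ring.
  apply: le_trans (le_normcD _ _) _; rewrite normc1.
  by apply: le_trans (lerD (le_trans k2 e2a) (lexx 1)) _; rewrite -[2]/(1 + 1).
have -> : (fun x => expC (z * t%:C) * T t f x - f x) =
   fun x => expC (z * t%:C) * (T t f x - f x) + (expC (z * t%:C) - 1) * f x.
  by apply/funext => x; ring.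
have Ld := L2B LT Lf.
apply: le_trans (n2D (L2Z _ Ld) (L2Z _ Lf)) _; rewrite !n2Z//.
have k4 : normc (expC (z * t%:C)) ^+ 2 <= 4.
  by have := normc_ge0 (expC (z * t%:C)); nra.
have k5 : normc (expC (z * t%:C) - 1) ^+ 2 <= e2.
  by have := normc_ge0 (expC (z * t%:C) - 1); nra.
have n1 := n2_ge0 (fun x => T t f x - f x).
have k6 : normc (expC (z * t%:C)) ^+ 2 * n2 (fun x => T t f x - f x) <= 4 * e1.
  by apply: ler_pM => //; exact: sqr_ge0.
have k7 : normc (expC (z * t%:C) - 1) ^+ 2 * n2 f <= e2 * n2 f by rewrite ler_wpM2r.
have : 0 <= e2 * 4 by rewrite mulr_ge0// ltW.
by rewrite /e1 in k6; lra.
Qed.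

Lemma avg_L2 z f s : w < complex.Re z -> L2 f -> 0 <= s -> L2 (avg z f s).
Proof.
move=> wz Lf s0; have LT := TL2 s0 Lf.
have -> : avg z f s = fun x => Rz z f x - expC (- (z * s%:C)) * Rz z (T s f) x.
  apply/funext => x; rewrite (resol_shift x wz s0 Lf) mulrA [expC _ * expC _]mulrC expCN mul1r.
  by ring.
by apply: L2B; [exact: RL2|apply: L2Z; exact: RL2].
Qed.

Lemma avg_cvg z f (e : R) : w < complex.Re z -> L2 f -> 0 < e -> exists2 d : R, 0 < d &
  forall s, 0 < s -> s < d -> n2 (fun x => (s^-1)%:C * avg z f s x - f x) <= e.
Proof.
move=> wz Lf e0; have [d d0 hd] := T_near1 (- z) Lf e0.
exists d => // s s0 sd; have La := avg_L2 wz Lf (ltW s0).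
have Lu := L2_profile semigroupT TstarS Lf.
have La' := L2Z (s^-1)%:C La.
rewrite (n2_sub_eqL2 La' La' Lf Lu (eqL2_refl _) (eqL2_sym (profile_pos semigroupT TstarS Lf))).
apply: N2_n2_le; first exact: L2B.
apply: avg_bound => //; first exact: ltW.
by move=> t t0 ts; apply: hd => //; exact: lt_trans ts sd.
Qed.

Lemma resolB z f g x : w < complex.Re z -> L2 f -> L2 g ->
  Rz z (fun y => f y - g y) x = Rz z f x - Rz z g x.
Proof.
move=> wz Lf Lg; rewrite (_ : (fun y => f y - g y) = fun y => -1 * g y + f y).
  by rewrite (resol_lin semigroupT TstarS w0 growth)// mulN1r addrC.
by apply/funext => y; rewrite mulN1r addrC.
Qed.

Lemma resolZ z c f x : w < complex.Re z -> L2 f ->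
  Rz z (fun y => c * f y) x = c * Rz z f x.
Proof.
move=> wz Lf; have Lc := L2Z c Lf.
rewrite (_ : (fun y => c * f y) = fun y => c * f y + (f y - f y)).
  by rewrite (resol_lin semigroupT TstarS w0 growth)//; [rewrite resolB// subrr addr0|exact: L2B].
by apply/funext => y; rewrite subrr addr0.
Qed.

(** By [resol_shift] the quotient is [(e^(zs) - 1) / s] times [R(z) f], minus [e^(zs) / s] times the
    average; the two parts tend to [z R(z) f] and to [f]. *)
Lemma resol_quotient z f (e : R) : w < complex.Re z -> L2 f -> 0 < e ->
  exists2 d : R, 0 < d & forall s, 0 < s -> s < d ->
    n2 (fun x => (s^-1)%:C * (Rz z (T s f) x - Rz z f x) - (z * Rz z f x - f x)) <= e.
Proof.
move=> wz Lf e0; have LR := RL2 wz Lf.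
have nR := n2_ge0 (Rz z f); have nf := n2_ge0 f.
pose e1 : R := Num.min 1 (e / (12 * (1 + n2 (Rz z f) + n2 f))).
have c0 : 0 < 12 * (1 + n2 (Rz z f) + n2 f).
  by rewrite mulr_gt0//; apply: ltr_wpDr => //; exact: ltr_wpDr.
have e10 : 0 < e1 by rewrite lt_min ltr01 divr_gt0.
have e1a : e1 <= 1 by rewrite ge_min lexx.
have e1b : e1 * (12 * (1 + n2 (Rz z f) + n2 f)) <= e.
  by rewrite -ler_pdivlMr// ge_min lexx orbT.
have e48 : 0 < e / 48 by rewrite divr_gt0.
have [d1 d10 h1] := expC_small z e10; have [d2 d20 h2] := expC_near1 z e10.
have [d3 d30 h3] := avg_cvg wz Lf e48.
exists (Num.min d1 (Num.min d2 d3)); first by rewrite !lt_min d10 d20.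
move=> s s0; rewrite !lt_min => /and3P[s1 s2 s3].
have {h1} := h1 s; rewrite gtr0_norm// => /(_ s1) k1.
have {h2} := h2 s; rewrite gtr0_norm// => /(_ s2) k2.
have {h3} k3 := h3 s s0 s3.
have La := avg_L2 wz Lf (ltW s0).
pose E := expC (z * s%:C).
have sC : (s^-1)%:C * s%:C = 1 :> R[i] by rewrite -rmorphM mulVf// lt0r_neq0.
(* Three errors: the second-order remainder of the exponential, the distance from the average to
   [f], and [e^(zs) - 1] acting on [f]. *)
have -> : (fun x => (s^-1)%:C * (Rz z (T s f) x - Rz z f x) - (z * Rz z f x - f x)) =
  fun x => ((s^-1)%:C * (E - 1 - z * s%:C)) * Rz z f x -
    (E * ((s^-1)%:C * avg z f s x - f x) + (E - 1) * f x).
  apply/funext => x; rewrite (resol_shift x wz (ltW s0) Lf) -/E.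
  have -> : (s^-1)%:C * (E - 1 - z * s%:C) = (s^-1)%:C * (E - 1) - z.
    by rewrite [LHS]mulrBr; congr (_ - _); rewrite mulrCA sC mulr1.
  by ring.
have La1 : L2 (fun x => (s^-1)%:C * avg z f s x - f x) by apply: L2B => //; exact: L2Z.
have n1 : normc ((s^-1)%:C * (E - 1 - z * s%:C)) <= e1.
  rewrite normcM normc_real gtr0_norm ?invr_gt0//.
  by rewrite mulrC ler_pdivrMr.
have nE : normc E <= 2.
  have -> : E = (E - 1) + 1 by ring.
  apply: le_trans (le_normcD _ _) _; rewrite normc1.
  by apply: le_trans (lerD (le_trans k2 e1a) (lexx 1)) _; rewrite -[2]/(1 + 1).
apply: le_trans (n2B (L2Z _ LR) (L2D (L2Z _ La1) (L2Z _ Lf))) _.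
have k4 := n2D (L2Z E La1) (L2Z (E - 1) Lf).
move: k4; rewrite !n2Z// => k4.
have q1 : normc ((s^-1)%:C * (E - 1 - z * s%:C)) ^+ 2 * n2 (Rz z f) <= e1 * n2 (Rz z f).
  by rewrite ler_wpM2r//; have := normc_ge0 ((s^-1)%:C * (E - 1 - z * s%:C)); nra.
have q2 : normc E ^+ 2 * n2 (fun x => (s^-1)%:C * avg z f s x - f x) <= 4 * (e / 48).
  apply: ler_pM => //; [exact: sqr_ge0|exact: n2_ge0|].
  by have := normc_ge0 E; nra.
have q3 : normc (E - 1) ^+ 2 * n2 f <= e1 * n2 f.
  by rewrite ler_wpM2r//; have := normc_ge0 (E - 1); nra.
have : 0 <= e1 * n2 f by rewrite mulr_ge0// ltW.
have : 0 <= e1 * n2 (Rz z f) by rewrite mulr_ge0// ltW.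
lra.
Qed.

(** As [R(z)] is bounded, it may be applied to the limit of the difference quotients of [f]:
    [R(z) h] is the limit of [s^-1 (R(z) T_s f - R(z) f)], which [resol_quotient] identifies as
    [z R(z) f - f]. *)
Lemma generator_resol z f h : w < complex.Re z -> generator_graph T f h ->
  eqL2 f (Rz z (fun x => z * f x - h x)).
Proof.
move=> wz [Lf cv]; have [_ Lh _] := cv.
have LRf := RL2 wz Lf; have LRh := RL2 wz Lh.
have Lq : L2 (fun x => z * Rz z f x - f x) by apply: L2B => //; exact: L2Z.
have e : eqL2 (Rz z h) (fun x => z * Rz z f x - f x).
  apply: eqL2_of_small => // e e0.
  have B0 : 0 <= expR (2 * w) / (complex.Re z - w) ^+ 2.
    by rewrite divr_ge0 ?expR_ge0// sqr_ge0.
  pose B := expR (2 * w) / (complex.Re z - w) ^+ 2 + 1.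
  have B1 : 0 < B by rewrite ltr_wpDl.
  have e4 : 0 < e / 4 by rewrite divr_gt0.
  have e5 : 0 < e / 4 / B by rewrite !divr_gt0.
  have [d1 d10 h1] := resol_quotient wz Lf e4; have [d2 d20 h2] := cvgL2_right_n2 cv e5.
  pose s := Num.min d1 d2 / 2.
  have m0 : 0 < Num.min d1 d2 by rewrite lt_min d10.
  have s0 : 0 < s by rewrite divr_gt0.
  have sm : s < Num.min d1 d2 by rewrite /s ltr_pdivrMr// ltr_pMr// ltr1n.
  move: sm; rewrite lt_min => /andP[s1 s2].
  have {h1} k1 := h1 s s0 s1; have {h2} [Lv k2] := h2 s s0 s2.
  have LT := TL2 (ltW s0) Lf.
  have LTf := L2B LT Lf.
  pose q x := (s^-1)%:C * (T s f x - f x).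
  have Rq x : Rz z q x = (s^-1)%:C * (Rz z (T s f) x - Rz z f x).
    by rewrite /q resolZ// resolB.
  have LRq := RL2 wz Lv.
  apply: le_trans (n2_tri LRh LRq Lq) _.
  have r1 : n2 (fun x => Rz z h x - Rz z q x) <= e / 4.
    have -> : (fun x => Rz z h x - Rz z q x) = Rz z (fun x => h x - q x).
      by apply/funext => x; rewrite resolB.
    apply: le_trans (n2_resol semigroupT TstarS w0 growth wz (L2B Lh Lv)) _.
    have -> : n2 (fun x => h x - q x) = n2 (fun x => q x - h x).
      by rewrite -(n2N (L2B Lv Lh)); congr n2; apply/funext => x; rewrite opprB.
    apply: (@le_trans _ _ (B * n2 (fun x => q x - h x))).
      by rewrite ler_wpM2r ?n2_ge0// lerDl.
    by rewrite mulrC -ler_pdivlMr.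
  have r2 : n2 (fun x => Rz z q x - (z * Rz z f x - f x)) <= e / 4.
    by move: k1; congr (n2 _ <= _); apply/funext => x; rewrite Rq.
  lra.
have -> : Rz z (fun x => z * f x - h x) = fun x => z * Rz z f x - Rz z h x.
  by apply/funext => x; rewrite resolB ?resolZ//; exact: L2Z.
move/eqL2P: e => e; apply/eqL2P; apply: filterS e => x.
by rewrite /pos; case: ifP => // _ ->; ring.
Qed.

(** For [f = R(z) k] the commutation [resol_T] turns the difference quotient of [f] into that of
    [resol_quotient], whose limit [z R(z) k - k] is [h]. *)
Lemma resol_generator z f h : w < complex.Re z -> L2 f -> L2 h ->
  eqL2 f (Rz z (fun x => z * f x - h x)) -> generator_graph T f h.
Proof.
move=> wz Lf Lh fE; split=> //; pose k x := z * f x - h x.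
have Lk : L2 k by apply: L2B => //; exact: L2Z.
have LR := RL2 wz Lk.
apply: n2_cvgL2_right => // e e0; have [d d0 hd] := resol_quotient wz Lk e0.
exists d => // s s0 sd; have LT := TL2 (ltW s0) Lf.
have Lv : L2 (fun x => (s^-1)%:C * (T s f x - f x)) by apply: L2Z; exact: L2B.
split => //; apply: le_trans (hd s s0 sd).
have LTk := TL2 (ltW s0) Lk; have LRT := RL2 wz LTk.
rewrite le_eqVlt; apply/orP; left; apply/eqP; apply: n2_sub_eqL2 => //.
- by apply: L2Z; exact: L2B.
- by apply: L2B => //; exact: L2Z.
- have /eqL2P e1 := T_eqL2 semigroupT (ltW s0) Lf LR fE.
  have /eqL2P e2 := resol_T wz (ltW s0) Lk; move/eqL2P: fE => e3.
  apply/eqL2P; apply: filterS3 e1 e2 e3 => x; rewrite /pos; case: ifP => // _ -> -> e3.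
  by rewrite {1}e3.
- move/eqL2P: fE => e3; apply/eqL2P; apply: filterS e3 => x; rewrite /pos; case: ifP => // _ e3.
  by rewrite -[Rz z k x]e3 /k; ring.
Qed.

End generator.

(** * The boundary functional *)

Section half_line_convolution.
Context {R : realType}.
Notation mu := (@lebesgue_measure R).
Notation RR := (measurableTypeR R).
Implicit Types (f g h : 'Fun(R)) (c s x : R) (z : R[i]).

Definition shift_kernel c z h (q : RR * RR) : R[i] :=
  if 0 < q.2 then expC (- z * q.1%:C) * pos h (q.2 + c * q.1) else 0.

(** Two operators in one: [c = 1] gives the integral in the numerator of [xi], and [c = -1] gives
    [volt]. They are transposes of each other, and sharing the definition lets one norm estimate
    serve both. *)
Definition shiftconv c z h : 'Fun(R) := fun x =>
  cI mu (fun s => if 0 < s then expC (- z * s%:C) * pos h (x + c * s) else 0).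

Lemma measurable_shift_mul c : measurable_fun setT (fun q : RR * RR => q.2 + c * q.1 : R).
Proof.
apply: measurable_funD; first exact: measurable_snd.
by apply: measurable_funM; [exact: measurable_cst|exact: measurable_fst].
Qed.

Lemma cmeas_shift_kernel c z h : cmeas (pos h) -> cmeas (shift_kernel c z h).
Proof.
move=> mh; apply: cmeas_if; [|apply: cmeasM|exact: cmeas_cst].
- by apply: measurable_fun_ltr; [exact: measurable_cst|exact: measurable_snd].
- exact: (cmeas_comp (cmeas_exp (- z)) measurable_fst).
- exact: (cmeas_comp mh (measurable_shift_mul c)).
Qed.

Lemma N2_shift_kernel c z h s : L2 h ->
  (N2 mu (fun x => shift_kernel c z h (s, x)) <= (expR (- (2 * complex.Re z) * s) * n2 h)%:E)%E.
Proof.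
move=> Lh; have [mh _] := (L2P _).1 Lh.
have m2 := measurable_normc_sq mh.
have mk := cmeas_slice1 s (cmeas_shift_kernel c z mh).
have ms : measurable_fun setT (fun x : R => normc (pos h (x + c * s)) ^+ 2).
  by apply: (measurableT_comp m2); exact: measurable_funD.
rewrite EFinM -n2E// /N2 -(rint_shift (c * s) m2).
rewrite -(rintZ mu ms (fun x => sqr_ge0 _) (expR_ge0 _)); apply: rint_le.
- exact: measurable_normc_sq.
- exact: (measurable_funM (measurable_cst _) ms).
- by move=> x; exact: sqr_ge0.
move=> x; rewrite /shift_kernel /=; case: ifP => _.
  rewrite normcM exprMn normc_expC cReMr cReN expr2 -expRD.
  by rewrite (_ : _ + _ = - (2 * complex.Re z) * s)//; ring.
by rewrite normc0 expr0n; apply: mulr_ge0; [exact: expR_ge0|exact: sqr_ge0].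
Qed.

Lemma cmeas_shiftconv c z h : cmeas (pos h) -> cmeas (shiftconv c z h).
Proof.
move=> mh.
suff mF : cmeas (fun q : RR * RR => if 0 < q.2 then expC (- z * q.2%:C) * pos h (q.1 + c * q.2) else 0).
  exact: (cmeas_cI mu mF).
apply: cmeas_if; [|apply: cmeasM|exact: cmeas_cst].
- by apply: measurable_fun_ltr; [exact: measurable_cst|exact: measurable_snd].
- exact: (cmeas_comp (cmeas_exp (- z)) measurable_snd).
- apply: (cmeas_comp mh (g := fun q : RR * RR => q.1 + c * q.2 : R)).
  apply: measurable_funD; first exact: measurable_fst.
  by apply: measurable_funM; [exact: measurable_cst|exact: measurable_snd].
Qed.

Lemma shiftconv_bound c z h : 0 < complex.Re z -> L2 h ->
  (N2 mu (pos (shiftconv c z h)) <= ((complex.Re z ^+ 2)^-1 * n2 h)%:E)%E.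
Proof.
move=> z0 Lh; have [mh _] := (L2P _).1 Lh.
have zi : 0 < (complex.Re z)^-1 by rewrite invr_gt0.
have mm := measurable_exp_tail (complex.Re z) 0.
have m0 := exp_tail_ge0 (complex.Re z) 0.
have hA : (rint mu (exp_tail (complex.Re z) 0) <= ((complex.Re z)^-1)%:E)%E.
  by rewrite (rint_exp_tail 0 z0) mulr0 expR0 mulr1.
have mF := cmeas_shift_kernel c (z - (complex.Re z)%:C) mh.
have E : pos (shiftconv c z h) = fun x => cI mu (fun s => (exp_tail (complex.Re z) 0 s)%:C *
    shift_kernel c (z - (complex.Re z)%:C) h (s, x)).
  apply/funext => x; rewrite /pos; case: ifP => x0; last first.
    by rewrite -[LHS](cI0 mu); apply: cI_eq => s; rewrite /shift_kernel /= x0 mulr0.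
  apply: cI_eq => s; rewrite /exp_tail /shift_kernel /= x0.
  case: ifP => _; last by rewrite mul0r.
  rewrite mulrA; congr (_ * _).
  have -> : (expR (- complex.Re z * s))%:C = expC ((- complex.Re z * s)%:C).
    by rewrite /expC /= cos0 sin0 mulr1.
  by rewrite -expCD; congr expC; rewrite rmorphM rmorphN; ring.
have K := minkowski_integral_sq (m1 := mu) mu mm m0 zi hA mF.
rewrite E; apply: (le_trans K).
have e1 : (complex.Re z ^+ 2)^-1 * n2 h = (complex.Re z)^-1 * (n2 h * ((complex.Re z)^-1 * expR (- complex.Re z * 0))).
  by rewrite mulr0 expR0 mulr1; field; rewrite lt0r_neq0.
rewrite e1 EFinM lee_pmul2l// -(rint_exp_tailZ 0 (n2_ge0 h) z0).
apply: integral_le_rint.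
- by move=> s; apply: mule_ge0; [rewrite lee_fin; exact: m0|exact: N2_ge0].
- apply: emeasurable_funM; first exact/measurable_EFinP.
  exact: (measurable_rint mu (measurable_normc_sq mF) (fun q => sqr_ge0 _)).
- exact: (measurable_funM (measurable_cst _) (measurable_exp_tail _ _)).
move=> s; have m0s : (0 <= (exp_tail (complex.Re z) 0 s)%:E)%E by rewrite lee_fin; exact: m0.
have := N2_shift_kernel c (z - (complex.Re z)%:C) s Lh.
have -> : complex.Re (z - (complex.Re z)%:C) = 0 by rewrite cReD cReN /= subrr.
rewrite mulr0 oppr0 mul0r expR0 mul1r => k.
apply: (le_trans (lee_wpmul2l m0s k)); rewrite -EFinM lee_fin mulrC.
exact: lexx.
Qed.

Lemma shiftconv_L2 c z h : 0 < complex.Re z -> L2 h -> L2 (shiftconv c z h).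
Proof.
move=> z0 Lh; have [mh _] := (L2P _).1 Lh; apply/L2P; split.
  by apply: cmeas_pos_of; exact: cmeas_shiftconv.
by apply: le_lt_trans (shiftconv_bound c z0 Lh) _; exact: ltry.
Qed.

Lemma n2_shiftconv c z h : 0 < complex.Re z -> L2 h ->
  n2 (shiftconv c z h) <= (complex.Re z ^+ 2)^-1 * n2 h.
Proof. by move=> z0 Lh; apply: N2_n2_le; [exact: shiftconv_L2|exact: shiftconv_bound]. Qed.

Definition shift_pair c z f g (q : RR * RR) : R[i] :=
  if 0 < q.1 then expC (- z * q.1%:C) * (pos f (q.2 + c * q.1) * pos g q.2) else 0.

Lemma cmeas_shift_pair c z f g : cmeas (pos f) -> cmeas (pos g) -> cmeas (shift_pair c z f g).
Proof.
move=> mf mg; apply: cmeas_if; [|apply: cmeasM|exact: cmeas_cst].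
- by apply: measurable_fun_ltr; [exact: measurable_cst|exact: measurable_fst].
- exact: (cmeas_comp (cmeas_exp (- z)) measurable_fst).
apply: cmeasM; first exact: (cmeas_comp mf (measurable_shift_mul c)).
exact: (cmeas_comp mg measurable_snd).
Qed.

Lemma shift_pair_bound c z f g : 0 < complex.Re z -> L2 f -> L2 g ->
  (\int[mu]_s rint mu (fun x => normc (shift_pair c z f g (s, x))) < +oo)%E.
Proof.
move=> z0 Lf Lg; have [mf _] := (L2P _).1 Lf; have [mg _] := (L2P _).1 Lg.
have mG := cmeas_shift_pair c z mf mg.
have c0 : 0 <= Num.sqrt (n2 f) * Num.sqrt (n2 g) by rewrite mulr_ge0 ?sqrtr_ge0.
apply: (@le_lt_trans _ _ (rint mu (fun s => Num.sqrt (n2 f) * Num.sqrt (n2 g) *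
    exp_tail (complex.Re z) 0 s)%R)); last by rewrite (rint_exp_tailZ 0 c0 z0) ltry.
apply: integral_le_rint.
- by move=> s; apply: rint_ge0 => x; exact: normc_ge0.
- exact: (measurable_rint mu (measurable_normc mG) (fun q => normc_ge0 _)).
- exact: (measurable_funM (measurable_cst _) (measurable_exp_tail _ _)).
move=> s; rewrite /shift_pair /exp_tail /=; case: ifP => s0; last first.
  have -> : (fun=> normc (0 : R[i])) = (fun=> 0) :> (R -> R) by apply/funext => ?; rewrite normc0.
  by rewrite mulr0 /rint integral0.
have ms : cmeas (fun x : R => pos f (x + c * s)).
  by apply: (cmeas_comp mf); exact: measurable_funD.
have hf : (N2 mu (fun x : R => pos f (x + c * s)) <= (Num.sqrt (n2 f) ^+ 2)%:E)%E.
  by rewrite sqr_sqrtr ?n2_ge0// -n2E// /N2 (rint_shift (c * s) (measurable_normc_sq mf)).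
have hg : (N2 mu (pos g) <= (Num.sqrt (n2 g) ^+ 2)%:E)%E by rewrite sqr_sqrtr ?n2_ge0// n2E.
have K := cCS (mu := mu) ms mg (sqrtr_ge0 _) (sqrtr_ge0 _) hf hg.
have -> : (fun x : R => normc (expC (- z * s%:C) * (pos f (x + c * s) * pos g x))) =
    fun x => expR (- complex.Re z * s) * normc (pos f (x + c * s) * pos g x).
  by apply/funext => x; rewrite normcM normc_expC cReMr cReN.
have mn := measurable_normc (cmeasM ms mg).
rewrite (rintZ mu mn (fun x => normc_ge0 _) (expR_ge0 _)) [in leRHS]mulrC EFinM.
by apply: lee_wpmul2l K; rewrite lee_fin expR_ge0.
Qed.

Lemma shiftconv_L1 (b : bool) z f x : 0 < complex.Re z -> L2 f ->
  cL1 mu (fun s => if 0 < s then expC (- z * s%:C) * pos f (x + (-1) ^+ b * s) else 0).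
Proof.
move=> z0 Lf; have [mf jf] := (L2P _).1 Lf; have mn := measurable_normc_sq mf.
have mlin : measurable_fun setT (fun s : R => x + (-1) ^+ b * s).
  by apply: measurable_funD => //; exact: measurable_funM.
have ms : cmeas (fun s : R => pos f (x + (-1) ^+ b * s)) := cmeas_comp mf mlin.
have me : cmeas (fun s : R => if 0 < s then expC (- z * s%:C) else 0).
  by apply: cmeas_if; [exact: measurable_fun_ltr|exact: cmeas_exp|exact: cmeas_cst].
have -> : (fun s => if 0 < s then expC (- z * s%:C) * pos f (x + (-1) ^+ b * s) else 0) =
    fun s => (if 0 < s then expC (- z * s%:C) else 0) * pos f (x + (-1) ^+ b * s).
  by apply/funext => s; case: ifP => // _; rewrite mul0r.
apply: cL1_CS => //.
- have z2 : 0 < 2 * complex.Re z by rewrite mulr_gt0.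
  have := rint_exp_tail 0 z2 => h.
  apply: (@le_lt_trans _ _ (rint mu (exp_tail (2 * complex.Re z) 0))); last by rewrite h ltry.
  apply: rint_le; [exact: measurable_normc_sq|exact: measurable_exp_tail|by move=> s; exact: sqr_ge0|].
  move=> s; rewrite /exp_tail; case: ifP => _; last by rewrite normc0 expr0n.
  rewrite normc_expC cReMr cReN expr2 -expRD.
  by rewrite (_ : - complex.Re z * s + - complex.Re z * s = - (2 * complex.Re z) * s)//; ring.
- apply: le_lt_trans jf; rewrite /N2.
  have m1 : measurable_fun setT (fun s : R => normc (pos f (s + x)) ^+ 2).
    by apply: (measurableT_comp mn); exact: measurable_funD.
  have e1 := rint_opp m1; have e2 := rint_shift x mn.
  case: b {mlin ms} => /=; first by under eq_fun do rewrite expr1 mulN1r addrC; rewrite e1 e2.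
  by under eq_fun do rewrite expr0 mul1r addrC; rewrite e2.
Qed.

Lemma pairing_shiftconv_l (b : bool) z f g : 0 < complex.Re z -> L2 f -> L2 g ->
  pairing (shiftconv ((-1) ^+ b) z f) g =
  cI mu (fun s => cI mu (fun x => shift_pair ((-1) ^+ b) z f g (s, x))).
Proof.
move=> z0 Lf Lg; have [mf _] := (L2P _).1 Lf; have [mg _] := (L2P _).1 Lg.
have F := cI_fubini (cmeas_shift_pair ((-1) ^+ b) z mf mg) (shift_pair_bound ((-1) ^+ b) z0 Lf Lg).
apply: etrans (esym F); rewrite pairingE; apply: cI_eq => x.
have [x0|x0] := ltP 0 x; last first.
  have pg : pos g x = 0 by rewrite /pos ltNge x0.
  rewrite pg mulr0 -[LHS](cI0 mu); apply: cI_eq => s.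
  by rewrite /shift_pair /= pg !mulr0 if_same.
rewrite {1}/pos x0 mulrC; apply: etrans (esym (cIZ (pos g x) (shiftconv_L1 b x z0 Lf))) _.
apply: cI_eq => s; rewrite /shift_pair /=; case: ifP => _; last by rewrite mulr0.
by rewrite mulrCA [pos g x * _]mulrC.
Qed.

(** For fixed [s], translating the variable by [(-1) ^+ b * s] carries one integrand into the other;
    negating [b] exchanges forward and backward shifts. *)
Lemma pairing_shiftconv (b : bool) z f g : 0 < complex.Re z -> L2 f -> L2 g ->
  pairing (shiftconv ((-1) ^+ b) z f) g = pairing f (shiftconv ((-1) ^+ ~~ b) z g).
Proof.
move=> z0 Lf Lg; rewrite [RHS]pairingC (pairing_shiftconv_l b z0 Lf Lg).
rewrite (pairing_shiftconv_l (~~ b) z0 Lg Lf).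
have [mf _] := (L2P _).1 Lf; have [mg _] := (L2P _).1 Lg.
apply: cI_eq => s; rewrite -[RHS](cI_shift ((-1) ^+ b * s)); last first.
  exact: (cmeas_slice1 s (cmeas_shift_pair _ z mg mf)).
apply: cI_eq => x; rewrite /shift_pair /=; case: ifP => // _; congr (_ * _).
by rewrite signrN mulNr addrK mulrC.
Qed.

(** The solution of [g' + z g = h] with [g 0 = 0], that is the resolvent of the generator [A] of the
    shift semigroup. *)
Definition volt z h : 'Fun(R) := fun x =>
  expC (- z * x%:C) * Int 0 x (fun y => expC (z * y%:C) * h y).

Lemma L2loc_exp_mul z h : L2 h -> L2loc (fun y => expC (z * y%:C) * h y).
Proof.
move=> Lh; apply: L2loc_mul_bounded; last exact: L2_L2loc.
- by apply: cmeas_pos_of; exact: cmeas_exp.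
- by move=> b; exact: primitive_bound b (primitive_exp z).
Qed.

Lemma volt0 z h : volt z h 0 = 0.
Proof. by rewrite /volt Int_ge// mulr0. Qed.

Lemma volt_shiftconv z h x : L2 h -> volt z h x = shiftconv ((-1) ^+ true) z h x.
Proof.
move=> Lh; have LE := L2loc_exp_mul z Lh.
have c1 := L2loc_iv x LE (lexx 0).
rewrite /volt /Int -(cIZ _ c1).
have [m1 _] := cL1Z (expC (- z * x%:C)) c1.
rewrite -(cI_shift x m1) -cI_opp; last first.
  by apply: (cmeas_comp m1); exact: measurable_funD.
apply: cI_eq => s; rewrite /iv /pos expr1 mulN1r (addrC (- s)) gtrBl andbC.
case: (0 < s) => /=; last by rewrite mulr0.
case: (0 < x - s); last by rewrite !mulr0.
by rewrite mulrA -expCD; congr (expC _ * _); rewrite rmorphB; ring.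
Qed.

Lemma volt_L2 z h : 0 < complex.Re z -> L2 h -> L2 (volt z h).
Proof.
move=> z0 Lh; rewrite (_ : volt z h = shiftconv ((-1) ^+ true) z h); first exact: shiftconv_L2.
by apply/funext => x; exact: volt_shiftconv.
Qed.

Lemma n2_volt z h : 0 < complex.Re z -> L2 h ->
  n2 (volt z h) <= (complex.Re z ^+ 2)^-1 * n2 h.
Proof.
move=> z0 Lh; rewrite (_ : volt z h = shiftconv ((-1) ^+ true) z h); first exact: n2_shiftconv.
by apply/funext => x; exact: volt_shiftconv.
Qed.

Lemma pairing_volt z f g : 0 < complex.Re z -> L2 f -> L2 g ->
  pairing (volt z f) g = pairing f (shiftconv 1 z g).
Proof.
move=> z0 Lf Lg; rewrite (_ : volt z f = shiftconv ((-1) ^+ true) z f).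
  by rewrite pairing_shiftconv.
by apply/funext => x; exact: volt_shiftconv.
Qed.

Lemma shiftconv1E z g x : 0 < x ->
  shiftconv 1 z g x = integralC (fun t => e_ z t * g (x + t)).
Proof.
move=> x0; rewrite integralCE; apply: cI_eq => s; rewrite {2}/pos /e_; case: ifP => // s0.
by rewrite mul1r /pos addr_gt0.
Qed.

Lemma primitive_volt z h : L2 h -> 0 < complex.Re z ->
  primitive (volt z h) (fun x => h x - z * volt z h x).
Proof.
move=> Lh z0; have LE := L2loc_exp_mul z Lh.
pose G x := Int 0 x (fun y => expC (z * y%:C) * h y).
have hG : primitive G (fun y => expC (z * y%:C) * h y).
  by apply: (int_primitive (c := 0)) LE _ => x _; rewrite add0r.
have h1 := primitive_mul (primitive_exp (- z)) hG.
apply: primitive_ae h1.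
  by apply: L2_L2loc; apply: L2B => //; apply: L2Z; exact: volt_L2.
apply: filterE => x; rewrite /pos; case: ifP => // _.
rewrite -mulrA -/(volt z h x) mulrA -expCD -mulrDl addNr mul0r expC0 mul1r addrC.
by rewrite mulNr.
Qed.

Lemma ae_mem_itv (P : R -> Prop) (a b : R) : a < b -> {ae mu, forall x, P x} ->
  exists2 x, a < x < b & P x.
Proof.
move=> ab [A [mA A0 hA]]; apply: contrapT => h.
have sub : `]a, b[%classic `<=` A.
  move=> x /=; rewrite in_itv /= => xab; apply: hA => /= Px; apply: h; exists x => //.
have := le_measure mu; rewrite /= => /(_ `]a, b[%classic A).
have -> : mu `]a, b[%classic = (b - a)%:E.
  have /= H := lebesgue_measure_itv (`]a, b[%O : interval R).
  by apply: etrans H _; rewrite lte_fin ab.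
rewrite !inE => /(_ (measurable_itv _) mA sub).
move=> k; have : ((b - a)%:E <= 0)%E by rewrite -A0; exact: k.
by rewrite lee_fin leNgt subr_gt0 ab.
Qed.

(** Points of agreement lie arbitrarily close to [x] on its right, and absolute continuity carries
    the equality to [x], the boundary point [0] included. *)
Lemma primitive_eqL2 f f' g g' x : primitive f g -> primitive f' g' -> eqL2 f f' -> 0 <= x -> f x = f' x.
Proof.
move=> [acf _ _] [acf' _ _] /eqL2P ff' x0.
apply/eqP; rewrite -subr_eq0; apply/eqP/normc_eq0P/eqP.
rewrite eq_le normc_ge0 andbT.
apply: (@le_of_eps _ _ 0 1) => // e e0; rewrite add0r mulr1.
have b0 : 0 < x + 1 by rewrite ltr_wpDl.
have acd := ac_sub (acf _ b0) (acf' _ b0).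
have [d d0 hd] := acd e e0.
have xd : x < x + Num.min d 1 by rewrite ltrDl lt_min d0 ltr01.
have [y /andP[xy yd] Py] := ae_mem_itv xd ff'.
have y0 : 0 < y by exact: le_lt_trans x0 xy.
move: Py; rewrite /pos y0 => Py.
have ydd : y - x < d by rewrite ltrBlDl (lt_le_trans yd)// lerD2l ge_min lexx.
have yx1 : y <= x + 1 by rewrite (le_trans (ltW yd))// lerD2l ge_min lexx orbT.
have := hd 1%N (fun=> x) (fun=> y).
rewrite !big_ord1 => k; apply: ltW; move: k; rewrite Py subrr sub0r.
rewrite -(normcN (f x - f' x)); apply => //; first by move=> i _; split => //; exact: ltW.
by move=> i j /=; rewrite !ltnS !leqn0 => /eqP -> /eqP ->.
Qed.

End half_line_convolution.

(** * Exponentials and variation of constants *)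

Section primitives_of_exponentials.
Context {R : realType}.
Notation mu := (@lebesgue_measure R).
Implicit Types (f g h : 'Fun(R)) (x : R) (z c : R[i]).

Lemma primitive_cst c : primitive (fun _ : R => c) (fun=> 0).
Proof.
apply: (int_primitive (c := c)); first exact: L2_L2loc (L2_0 (R := R)).
move=> x _; rewrite /Int (_ : iv 0 x _ = fun=> 0) ?cI0 ?addr0//.
by apply/funext => y; rewrite /iv if_same.
Qed.

Lemma primitive_Z c f g : primitive f g -> primitive (fun x => c * f x) (fun x => c * g x).
Proof.
move=> h; have := primitive_mul (primitive_cst c) h.
by under [X in primitive _ X]eq_fun do rewrite mul0r add0r.
Qed.

Lemma primitive_e z : primitive (e_ z) (fun x => - z * e_ z x).
Proof. exact: primitive_exp. Qed.

Lemma L2_e z : 0 < complex.Re z -> L2 (e_ z).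
Proof.
move=> z0; have z2 : 0 < 2 * complex.Re z by rewrite mulr_gt0.
have me : cmeas (pos (e_ z)) by apply: cmeas_pos_of; exact: cmeas_exp.
apply/L2P; split => //.
have h := rint_exp_tail 0 z2.
apply: (@le_lt_trans _ _ (rint mu (exp_tail (2 * complex.Re z) 0))); last by rewrite h ltry.
apply: rint_le; [exact: measurable_normc_sq|exact: measurable_exp_tail|by move=> s; exact: sqr_ge0|].
move=> s; rewrite /pos /exp_tail; case: ifP => _; last by rewrite normc0 expr0n.
rewrite normc_expC cReMr cReN expr2 -expRD.
by rewrite (_ : - complex.Re z * s + - complex.Re z * s = - (2 * complex.Re z) * s)//; ring.
Qed.

Lemma e0 z : e_ z 0 = 1.
Proof. by rewrite /e_ mulr0 expC0. Qed.

(** Variation of constants: integrate the derivative of [e^(zx) g] from [0] to [x]. *)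
Lemma volt_primitive z g g' x : primitive g g' -> 0 <= x ->
  volt z (fun y => z * g y + g' y) x = g x - g 0 * e_ z x.
Proof.
move=> hg x0; have h := primitive_mul (primitive_exp z) hg; have := primitive_int h x0.
rewrite mulr0 expC0 mul1r => E.
rewrite /volt; have -> : Int 0 x (fun y => expC (z * y%:C) * (z * g y + g' y)) =
    expC (z * x%:C) * g x - g 0.
  rewrite E addrC addKr; congr Int; apply/funext => y; ring.
by rewrite mulrBr mulrA -expCD -mulrDl addNr mul0r expC0 mul1r /e_ [g 0 * _]mulrC.
Qed.

Lemma volt_lin z c f g x : L2 f -> L2 g ->
  volt z (fun y => c * f y + g y) x = c * volt z f x + volt z g x.
Proof.
move=> Lf Lg; have c1 := L2loc_iv x (L2loc_exp_mul z Lf) (lexx 0).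
have c2 := L2loc_iv x (L2loc_exp_mul z Lg) (lexx 0).
rewrite /volt mulrCA -mulrDr; congr (_ * _).
rewrite /Int -(cIZ c c1) -(cID (cL1Z c c1) c2); apply: cI_eq => y; rewrite /iv.
by case: ifP => _; [ring|rewrite mulr0 addr0].
Qed.

End primitives_of_exponentials.

(** * The boundary condition and its representing function *)

Section boundary_functional.
Context {R : realType} (T : R -> 'Fun(R) -> 'Fun(R)).
Notation mu := (@lebesgue_measure R).
Hypothesis semigroupT : C0_semigroup T.
Hypothesis TstarS : forall (t : R) (f : 'Fun(R)), 0 <= t -> L2 f ->
  adjoint_graph (T t) (shiftS t f) f.
Variable w : R.
Hypothesis w0 : 0 < w.
Hypothesis growth : forall t f, 0 <= t -> L2 f ->
  n2 (T t f) <= expR (2 * w * (t + 1)) * n2 f.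
Implicit Types (f g k : 'Fun(R)) (s t : R) (z : R[i]).
Local Notation Rz := (resol T).

Let RL2 z f (wz : w < complex.Re z) (Lf : L2 f) : L2 (Rz z f) :=
  resol_L2 semigroupT TstarS w0 growth wz Lf.

(** [R(z) f] and [volt z f] solve the same equation [g' + z g = f], so they differ by the multiple
    of [e_ z] that the value at [0] dictates. *)
Lemma resol_volt z f x : w < complex.Re z -> L2 f -> 0 <= x ->
  Rz z f x = volt z f x + Rz z f 0 * e_ z x.
Proof.
move=> wz Lf x0; have h := volt_primitive z (primitive_resol semigroupT TstarS w0 growth wz Lf) x0.
have E : (fun y => z * Rz z f y + (f y - z * Rz z f y)) = f by apply/funext => y; ring.
by rewrite E in h; rewrite h subrK.
Qed.

Lemma resol_of_boundary z g g' x : w < complex.Re z -> L2 g -> L2 g' -> primitive g g' -> 0 <= x ->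
  g 0 = Rz z (fun y => z * g y + g' y) 0 -> g x = Rz z (fun y => z * g y + g' y) x.
Proof.
move=> wz Lg Lg' hg x0 E.
have Lk : L2 (fun y => z * g y + g' y) := L2D (L2Z z Lg) Lg'.
by rewrite (resol_volt wz Lk x0) -E (volt_primitive z hg x0) subrK.
Qed.

(** One point of the half-plane is enough: the domain of the generator is the range of the resolvent
    at any single point. *)
Let l : R[i] := (w + 1)%:C.
Let wl : w < complex.Re l.
Proof. by rewrite /= ltrDl. Qed.

(** Riesz in the graph space is reduced to Riesz in L^2 through [h = g + g']. Variation of constants
    at [z = 1] gives [g = volt 1 h + g 0 * e_ 1], so the functional equals [c * g 0 - psi h], where
    [psi] is bounded on L^2 and represented by [th]. Two integrations by parts return to the graph:
    [e_ 1] represents [g |-> g 0], and [q = volt 1 th], which satisfies [q + q' = th] and [q 0 = 0],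
    represents the pairing of [g + g'] with [th]. Hence [p] is [c * e_ 1] minus [q]. *)
Lemma exists_boundary_rep : exists p p' : 'Fun(R), [/\ L2 p, L2 p', primitive p p' &
  forall g g', L2 g -> L2 g' -> primitive g g' ->
    pairing g p + pairing g' p' = g 0 - Rz l (fun x => l * g x + g' x) 0].
Proof.
have r1 : 0 < complex.Re (1 : R[i]) by rewrite /= ltr01.
have [C C0 hC] := resol0_bound semigroupT TstarS w0 growth wl.
have lin := resol_lin semigroupT TstarS w0 growth.
(* The value of [R(l) (l g + g') 0] for the [g] with [g + g' = h] and [g 0 = 0], namely
   [g = volt 1 h]. *)
pose psi h := Rz l (fun x => (l - 1) * volt 1 h x + h x) 0.
have Lv (h : 'Fun(R)) : L2 h -> L2 (volt 1 h) by exact: volt_L2.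
have Lpsi (h : 'Fun(R)) : L2 h -> L2 (fun x => (l - 1) * volt 1 h x + h x).
  by move=> Lh; apply: L2D => //; apply: L2Z; exact: Lv.
have [th Lth hth] : exists2 th, L2 th & forall h, L2 h -> psi h = pairing h th.
  apply: (@riesz R psi (C * (2 * (normc (l - 1) ^+ 2 + 1)))).
  - by rewrite mulr_ge0// mulr_ge0// addr_ge0// sqr_ge0.
  - move=> c f g Lf Lg; rewrite /psi -lin; [|exact: wl|exact: Lpsi|exact: Lpsi].
    congr (Rz l _ 0); apply/funext => x; rewrite volt_lin//; ring.
  - move=> f Lf; apply: le_trans (hC _ (Lpsi f Lf)) _; rewrite -mulrA ler_wpM2l//.
    apply: le_trans (n2D (L2Z _ (Lv f Lf)) Lf) _; rewrite n2Z; last exact: Lv.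
    rewrite -[leRHS]mulrA ler_wpM2l// mulrDl mul1r lerD2r ler_wpM2l ?sqr_ge0//.
    by have := n2_volt r1 Lf; rewrite /= expr1n invr1 mul1r.
(* The value of the functional at [e_ 1], for which [g + g' = 0] and [l g + g' = (l - 1) e_ 1]. *)
pose c := 1 - Rz l (fun x => (l - 1) * e_ 1 x) 0.
have Le : L2 (e_ (1 : R[i])) by exact: L2_e.
have he := primitive_e (1 : R[i]).
have Lq := Lv th Lth.
have hq := primitive_volt Lth r1.
have Lq' : L2 (fun x => th x - 1 * volt 1 th x) := L2B Lth (L2Z 1 Lq).
pose p x := c * e_ 1 x + -1 * volt 1 th x.
pose p' x := c * (- 1 * e_ 1 x) + -1 * (th x - 1 * volt 1 th x).
have Le' : L2 (fun x => - 1 * e_ (1 : R[i]) x) by exact: L2Z.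
exists p, p'; split.
- exact: (L2D (L2Z c Le) (L2Z (-1) Lq)).
- exact: (L2D (L2Z c Le') (L2Z (-1) Lq')).
- by apply: primitive_D; exact: primitive_Z.
move=> g g' Lg Lg' hg.
have i1 := pairing_ibp Lg Lg' Le Le' hg he.
have i2 := pairing_ibp Lg Lg' Lq Lq' hg hq.
rewrite e0 mulr1 in i1; rewrite volt0 mulr0 oppr0 in i2.
have E1 : pairing g p = c * pairing g (e_ 1) - pairing g (volt 1 th).
  by rewrite (pairingDr (L2Z c Le) (L2Z (-1) Lq) Lg) (pairingZr _ Le Lg) (pairingZr _ Lq Lg) mulN1r.
have E2 : pairing g' p' = - c * pairing g' (e_ 1) - pairing g' th + pairing g' (volt 1 th).
  rewrite (pairingDr (L2Z c Le') (L2Z (-1) Lq') Lg') (pairingZr _ Le' Lg') (pairingZr _ Le Lg').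
  rewrite (pairingZr _ Lq' Lg') (pairingBr Lth (L2Z 1 Lq) Lg') (pairingZr _ Lq Lg').
  by ring.
have E3 : pairing g (fun x => - 1 * e_ 1 x) = - pairing g (e_ 1).
  by rewrite (pairingZr _ Le Lg) mulN1r.
have E4 : pairing g (fun x => th x - 1 * volt 1 th x) = pairing g th - pairing g (volt 1 th).
  by rewrite (pairingBr Lth (L2Z 1 Lq) Lg) (pairingZr _ Lq Lg) mul1r.
have Lgg : L2 (fun x => g x + g' x) by exact: L2D.
have E5 : pairing g th + pairing g' th = psi (fun x => g x + g' x).
  by rewrite hth// pairingDl.
have Lk : L2 (fun x => l * g x + g' x) := L2D (L2Z l Lg) Lg'.
have Ll : L2 (fun x => (l - 1) * e_ 1 x) by exact: L2Z.
have E6 : psi (fun x => g x + g' x) =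
    - g 0 * Rz l (fun x => (l - 1) * e_ 1 x) 0 + Rz l (fun x => l * g x + g' x) 0.
  rewrite -(lin l _ _ _ 0 wl Ll Lk); have Lr : L2 (fun x => - g 0 * ((l - 1) * e_ 1 x) + (l * g x + g' x)).
    exact: (L2D (L2Z _ Ll) Lk).
  apply: (resol_eqL2 semigroupT TstarS 0 wl (Lpsi _ Lgg) Lr).
  apply/eqL2P/filterE => x; rewrite /pos; case: ifP => // x0.
  have -> : volt 1 (fun y => g y + g' y) x = g x - g 0 * e_ 1 x.
    have <- := volt_primitive 1 hg (ltW x0); congr (volt 1 _ x).
    by apply/funext => y; rewrite mul1r.
  ring.
rewrite E3 in i1; rewrite E4 in i2.
have a1 : pairing g (e_ 1) = pairing g' (e_ 1) + g 0.
  by apply/eqP; rewrite -subr_eq0 -[g 0]opprK -i1; apply/eqP; ring.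
have a2 : pairing g' (volt 1 th) = pairing g (volt 1 th) - pairing g th.
  by apply/eqP; rewrite -subr_eq0 -i2; apply/eqP; ring.
have a3 : Rz l (fun x => l * g x + g' x) 0 =
    pairing g th + pairing g' th + g 0 * Rz l (fun x => (l - 1) * e_ 1 x) 0.
  by rewrite E5 E6; ring.
by rewrite E1 E2 a1 a2 a3 /c; ring.
Qed.

Section representer.
Variables p p' : 'Fun(R).
Hypotheses (Lp : L2 p) (Lp' : L2 p') (hp : primitive p p').
Hypothesis repr : forall g g', L2 g -> L2 g' -> primitive g g' ->
  pairing g p + pairing g' p' = g 0 - Rz l (fun x => l * g x + g' x) 0.

Let Lk g g' : L2 g -> L2 g' -> L2 (fun x => l * g x + g' x).
Proof. by move=> Lg Lg'; exact: (L2D (L2Z l Lg) Lg'). Qed.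

Lemma repr_derivL2 g g' : L2 g -> L2 g' -> primitive g g' ->
  pairing g p + pairing (derivL2 g) (derivL2 p) = pairing g p + pairing g' p'.
Proof.
move=> Lg Lg' hg; congr (_ + _).
have dg : domAstar g by apply/domAstarP; exists g'.
have dp : domAstar p by apply/domAstarP; exists p'.
have [Ldg _] := derivL2P dg; have [Ldp _] := derivL2P dp.
by apply: pairing_eqL2 => //; exact: derivL2_primitive.
Qed.

Lemma domApP g g' : L2 g -> L2 g' -> primitive g g' ->
  domAp p g <-> g 0 = Rz l (fun x => l * g x + g' x) 0.
Proof.
move=> Lg Lg' hg; have e := repr_derivL2 Lg Lg' hg; have r := repr Lg Lg' hg.
split=> [[_]|E]; first by rewrite e r => /eqP; rewrite subr_eq0 => /eqP.
split; first by apply/domAstarP; exists g'.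
by rewrite e r -E subrr.
Qed.

(** Elements of the generator's domain are the functions [R(l) k]; these meet the boundary condition
    because [l g + g' = k] for them. Conversely the boundary condition forces [g = R(l) (l g + g')]
    by uniqueness for the first-order equation. *)
Lemma opAp_generator f h : L2 f -> L2 h -> generator_graph T f h <-> opAp p f h.
Proof.
move=> Lf Lh; split.
  move=> G; have fE := generator_resol semigroupT TstarS w0 growth wl G.
  have Lkf : L2 (fun x => l * f x - h x) := L2B (L2Z l Lf) Lh.
  have LR := RL2 wl Lkf; have hR := primitive_resol semigroupT TstarS w0 growth wl Lkf.
  have LR' : L2 (fun x => (l * f x - h x) - l * Rz l (fun x => l * f x - h x) x).
    exact: (L2B Lkf (L2Z l LR)).
  have dR := derivL2_primitive LR LR' hR.
  exists (Rz l (fun x => l * f x - h x)); split => //.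
    apply/(domApP LR LR' hR); congr (Rz l _ 0); apply/funext => x; ring.
  move/eqL2P: dR => dR; move/eqL2P: fE => fE; apply/eqL2P.
  apply: filterS2 dR fE => x; rewrite /pos; case: ifP => // _ -> e.
  by rewrite -e; ring.
move=> [g [dg fg hdg]]; have [dsg _] := dg; have [Lg' hg] := derivL2P dsg.
have [_ Lg _] := dsg.
have g0 := (domApP Lg Lg' hg).1 dg.
have Lkg := Lk Lg Lg'.
apply: (resol_generator semigroupT TstarS w0 growth wl Lf Lh).
have Lkf : L2 (fun x => l * f x - h x) := L2B (L2Z l Lf) Lh.
have e x : Rz l (fun x => l * f x - h x) x = Rz l (fun x => l * g x + derivL2 g x) x.
  apply: (resol_eqL2 semigroupT TstarS x wl Lkf Lkg).
  move/eqL2P: fg => fg; move/eqL2P: hdg => hdg; apply/eqL2P.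
  by apply: filterS2 fg hdg => y; rewrite /pos; case: ifP => // _ -> ->; rewrite opprK.
move/eqL2P: fg => fg; apply/eqL2P; apply: filterS fg => x; rewrite /pos; case: ifP => // x0 ->.
rewrite (resol_of_boundary wl Lg Lg' hg (ltW x0) g0); exact: esym (e x).
Qed.

(* The functional [g |-> pairing g p + pairing g' p'] kills the range of the resolvent
   but not [e_ l]. *)
Lemma repr_e : pairing (e_ l) p + pairing (fun x => - l * e_ l x) p' = 1.
Proof.
have l0 : 0 < complex.Re l by rewrite (lt_trans w0).
have Le := L2_e l0; rewrite (repr Le (L2Z _ Le) (primitive_e l)) e0.
have -> : (fun x => l * e_ l x + - l * e_ l x) = fun x => 0 * e_ l x.
  by apply/funext => x; ring.
by rewrite (resolZ semigroupT TstarS w0 growth)// mul0r subr0.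
Qed.

Lemma repr_resol f : L2 f ->
  pairing (Rz l f) p + pairing (fun x => f x - l * Rz l f x) p' = 0.
Proof.
move=> Lf; have LR := RL2 wl Lf; have hR := primitive_resol semigroupT TstarS w0 growth wl Lf.
have LR' : L2 (fun x => f x - l * Rz l f x) := L2B Lf (L2Z l LR).
rewrite (repr LR LR' hR).
have -> : (fun x => l * Rz l f x + (f x - l * Rz l f x)) = f by apply/funext => x; ring.
exact: subrr.
Qed.

(** By [resol_shift] the averages [avg] are combinations of resolvents, and [s^-1 avg] tends to [f];
    so the range of [R(l)] is dense. *)
Lemma resol_range_dense q : L2 q -> (forall f, L2 f -> pairing (Rz l f) q = 0) ->
  forall f, L2 f -> pairing f q = 0.
Proof.
move=> Lq h f Lf; apply/normc_eq0P/eqP; rewrite eq_le normc_ge0 andbT.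
have nq := normL2_ge0 q.
apply: (@le_of_eps _ _ 0 (normL2 q)) => // e e0; rewrite add0r.
have e2 : 0 < e ^+ 2 by rewrite exprn_gt0.
have [d d0 hd] := avg_cvg semigroupT TstarS w0 growth wl Lf e2.
pose s := d / 2; have s0 : 0 < s by rewrite divr_gt0.
have sd : s < d by rewrite ltr_pdivrMr// ltr_pMr// ltr1n.
have k := hd s s0 sd.
have La := avg_L2 semigroupT TstarS w0 growth wl Lf (ltW s0).
have LT := T_L2 semigroupT (ltW s0) Lf.
have pa : pairing (avg T l f s) q = 0.
  have -> : avg T l f s = fun x => Rz l f x - expC (- (l * s%:C)) * Rz l (T s f) x.
    apply/funext => x; rewrite (resol_shift semigroupT TstarS w0 growth x wl (ltW s0) Lf).
    by rewrite mulrA [expC _ * expC _]mulrC expCN mul1r; ring.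
  have LR := RL2 wl Lf; have LRT := RL2 wl LT.
  by rewrite (pairingBl LR (L2Z _ LRT) Lq) (pairingZl _ LRT Lq) (h _ Lf) (h _ LT) mulr0 subr0.
have Ld : L2 (fun x => (s^-1)%:C * avg T l f s x - f x) := L2B (L2Z _ La) Lf.
have -> : pairing f q = - pairing (fun x => (s^-1)%:C * avg T l f s x - f x) q.
  by rewrite (pairingBl (L2Z _ La) Lf Lq) (pairingZl _ La Lq) pa mulr0 sub0r opprK.
rewrite normcN; apply: le_trans (pairing_CS Ld Lq) _; rewrite ler_wpM2r//.
by rewrite -(@ler_pXn2r _ 2) ?nnegrE ?normL2_ge0 ?(ltW e0)// normL2_sqr.
Qed.

(** If [p'] agreed with some [v] in the domain of [A], integration by parts without boundary term,
    as [v 0 = 0], would turn the functional into the pairing of [g] with [p - v']. Killing the dense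
    range of [R(l)], it would vanish, against its value [1] at [e_ l]. *)
Lemma calO_repr : calO p.
Proof.
have dp : domAstar p by apply/domAstarP; exists p'.
split => // -[v [dv v0] pv].
have [Lv' hv] := derivL2P dv; have [_ Lv _] := dv.
have [Ldp _] := derivL2P dp.
have p'v : eqL2 p' v := eqL2_trans (eqL2_sym (derivL2_primitive Lp Lp' hp)) pv.
pose q x := p x - derivL2 v x.
have Lq : L2 q by exact: L2B.
have E g g' : L2 g -> L2 g' -> primitive g g' -> pairing g p + pairing g' p' = pairing g q.
  move=> Lg Lg' hg; rewrite (pairing_eqL2 Lg' Lg' Lp' Lv (eqL2_refl _) p'v).
  have := pairing_ibp Lg Lg' Lv Lv' hg hv; rewrite v0 mulr0 oppr0 => /eqP.
  by rewrite addr_eq0 => /eqP ->; rewrite pairingBr.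
have q0 : forall f, L2 f -> pairing f q = 0.
  apply: resol_range_dense => // f Lf; have LR := RL2 wl Lf.
  have LR' : L2 (fun x => f x - l * Rz l f x) := L2B Lf (L2Z l LR).
  by rewrite -(E _ _ LR LR' (primitive_resol semigroupT TstarS w0 growth wl Lf)) repr_resol.
have l0 : 0 < complex.Re l by rewrite (lt_trans w0).
have Le := L2_e l0; have := repr_e.
rewrite (E _ _ Le (L2Z _ Le) (primitive_e l)) q0// => /eqP.
by rewrite eq_sym oner_eq0.
Qed.

Lemma calME z : 0 < complex.Re z ->
  calM p z = pairing (e_ z) p + pairing (fun x => - z * e_ z x) p'.
Proof.
move=> z0; have Le := L2_e z0.
have i := pairing_ibp Le (L2Z (- z) Le) Lp Lp' (primitive_e z) hp.
rewrite e0 mul1r (pairingZl _ Le Lp) in i; rewrite (pairingZl _ Le Lp').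
have -> : calM p z = (1 - z ^+ 2) * pairing (e_ z) p + p 0 * z by rewrite pairingC.
have -> : pairing (e_ z) p' = z * pairing (e_ z) p - p 0 by rewrite -i; ring.
ring.
Qed.

Lemma calM_neq0 z : w < complex.Re z -> calM p z != 0.
Proof.
move=> wz; have z0 := lt_trans w0 wz; have Le := L2_e z0; have LeZ := L2Z (- z) Le.
apply/negP => /eqP; rewrite (calME z0) => E.
have de : domAp p (e_ z).
  split; first by apply/domAstarP; exists (fun x => - z * e_ z x); split => //; exact: primitive_e.
  by rewrite (repr_derivL2 Le LeZ (primitive_e z)).
have Lz := L2Z z Le.
have : opAp p (e_ z) (fun x => z * e_ z x).
  exists (e_ z); split => //; first exact: eqL2_refl.
  have /eqL2P d := derivL2_primitive Le LeZ (primitive_e z).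
  apply/eqL2P; apply: filterS d => x; rewrite /pos; case: ifP => // _ ->; ring.
move=> /(opAp_generator Le Lz) G.
(* The eigenvector [e_ z] would be the resolvent of [0], yet it vanishes nowhere. *)
have := generator_resol semigroupT TstarS w0 growth wz G.
have -> : (fun x => z * e_ z x - z * e_ z x) = fun x => 0 * e_ z x.
  by apply/funext => x; ring.
move=> /eqL2P /(ae_mem_itv ltr01) [x /andP[x0 _]].
rewrite /pos x0 (resolZ semigroupT TstarS w0 growth)// mul0r => /eqP.
by rewrite (negbTE (expC_neq0 _)).
Qed.

(** Apply the functional to [R(z) f = volt z f + R(z) f 0 * e_ z]. It is [0] on the left side and
    [calM p z] on [e_ z]; on [volt z f], one integration by parts and the transpose [shiftconv 1] of
    [volt] give the pairing of [f] with the numerator of [xi]. *)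
Lemma pairing_xi z f : w < complex.Re z -> L2 f -> pairing f (xi p z) = Rz z f 0.
Proof.
move=> wz Lf; have z0 := lt_trans w0 wz; have M0 := calM_neq0 wz.
have Le := L2_e z0; have LeZ := L2Z (- z) Le.
have LR := RL2 wz Lf; have hR := primitive_resol semigroupT TstarS w0 growth wz Lf.
have LR' : L2 (fun x => f x - z * Rz z f x) := L2B Lf (L2Z z LR).
have LV := volt_L2 z0 Lf; have hV := primitive_volt Lf z0.
have LV' : L2 (fun x => f x - z * volt z f x) := L2B Lf (L2Z z LV).
have dp : domAstar p by apply/domAstarP; exists p'.
have [Ldp _] := derivL2P dp.
have Lh : L2 (fun x => z * Rz z f x - f x) := L2B (L2Z z LR) Lf.
have LW := shiftconv_L2 1 z0 Lp.
(* Although built from [R(l)], the functional vanishes on the range of every [R(z)], since all these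
   ranges are the domain of the generator. *)
have R0 : pairing (Rz z f) p + pairing (fun x => f x - z * Rz z f x) p' = 0.
  have G : generator_graph T (Rz z f) (fun x => z * Rz z f x - f x).
    apply: (resol_generator semigroupT TstarS w0 growth wz LR Lh).
    have -> : (fun x => z * Rz z f x - (z * Rz z f x - f x)) = f by apply/funext => x; ring.
    exact: eqL2_refl.
  have [g [dg Rg hg]] := (opAp_generator LR Lh).1 G.
  have [dsg E] := dg; have [Lg' hgd] := derivL2P dsg; have [_ Lg _] := dsg.
  have dd : eqL2 (fun x => f x - z * Rz z f x) (derivL2 g).
    move/eqL2P: hg => hg; apply/eqL2P; apply: filterS hg => x; rewrite /pos; case: ifP => // _ k.
    by rewrite -[derivL2 g x]opprK -k; ring.
  rewrite -[RHS]E; congr (_ + _); first exact: (pairing_eqL2 LR Lg Lp Lp Rg (eqL2_refl _)).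
  exact: (pairing_eqL2 LR' Lg' Lp' Ldp dd (eqL2_sym (derivL2_primitive Lp Lp' hp))).
have i := pairing_ibp LV LV' Lp Lp' hV hp.
rewrite volt0 mul0r oppr0 in i.
have pV : pairing (volt z f) p = pairing f (shiftconv 1 z p) by exact: pairing_volt.
have RV : eqL2 (Rz z f) (fun x => Rz z f 0 * e_ z x + volt z f x).
  apply/eqL2P/filterE => x; rewrite /pos; case: ifP => // x0.
  by rewrite (resol_volt wz Lf (ltW x0)) addrC.
have RV' : eqL2 (fun x => f x - z * Rz z f x)
    (fun x => Rz z f 0 * (- z * e_ z x) + (f x - z * volt z f x)).
  move/eqL2P: RV => RV; apply/eqL2P; apply: filterS RV => x; rewrite /pos; case: ifP => // _ ->.
  ring.
have LRV : L2 (fun x => Rz z f 0 * e_ z x + volt z f x) := L2D (L2Z _ Le) LV.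
have LRV' : L2 (fun x => Rz z f 0 * (- z * e_ z x) + (f x - z * volt z f x)).
  exact: (L2D (L2Z _ LeZ) LV').
have R1 : Rz z f 0 * calM p z + (pairing (volt z f) p + pairing (fun x => f x - z * volt z f x) p') = 0.
  rewrite -[RHS]R0 (pairing_eqL2 LR LRV Lp Lp RV (eqL2_refl _)).
  rewrite (pairing_eqL2 LR' LRV' Lp' Lp' RV' (eqL2_refl _)).
  rewrite (pairingDl (L2Z (Rz z f 0) Le) LV Lp) (pairingZl _ Le Lp).
  rewrite (pairingDl (L2Z (Rz z f 0) LeZ) LV' Lp') (pairingZl _ LeZ Lp').
  by rewrite (calME z0); ring.
have LW2 : L2 (fun x => z * p x + p' x) := L2D (L2Z z Lp) Lp'.
have LX : L2 (fun x => (1 - z ^+ 2) * shiftconv 1 z p x + (z * p x + p' x)).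
  exact: (L2D (L2Z _ LW) LW2).
have [/eqL2P d Lc] : eqL2 (derivL2 p) p' /\ L2 (fun x => - (calM p z)^-1 *
    ((1 - z ^+ 2) * shiftconv 1 z p x + (z * p x + p' x))).
  by split; [exact: derivL2_primitive|exact: L2Z].
have xiE x : 0 < x -> xi p z x = - (calM p z)^-1 *
    ((1 - z ^+ 2) * shiftconv 1 z p x + (z * p x + derivL2 p x)).
  by move=> x0; rewrite /xi shiftconv1E//; field.
have xiE' : eqL2 (xi p z)
    (fun x => - (calM p z)^-1 * ((1 - z ^+ 2) * shiftconv 1 z p x + (z * p x + p' x))).
  apply/eqL2P; apply: filterS d => x; rewrite /pos; case: ifP => // x0 d.
  by rewrite xiE// d.
have Lxi : L2 (xi p z).
  apply/L2_pos; have -> : pos (xi p z) = pos (fun x => - (calM p z)^-1 *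
      ((1 - z ^+ 2) * shiftconv 1 z p x + (z * p x + derivL2 p x))).
    by apply/funext => x; rewrite /pos; case: ifP => // x0; exact: xiE.
  apply/L2_pos; apply: L2Z.
  exact: (L2D (L2Z _ LW) (L2D (L2Z z Lp) Ldp)).
rewrite (pairing_eqL2 Lf Lf Lxi Lc (eqL2_refl _) xiE') (pairingZr _ LX Lf).
rewrite (pairingDr (L2Z _ LW) LW2 Lf) (pairingZr _ LW Lf).
rewrite (pairingDr (L2Z _ Lp) Lp' Lf) (pairingZr _ Lp Lf) -pV.
have i2 : pairing (volt z f) p' = z * pairing (volt z f) p - pairing f p.
  move: i; rewrite (pairingBl Lf (L2Z z LV) Lp) (pairingZl _ LV Lp) => i.
  by apply/eqP; rewrite -subr_eq0 -i; apply/eqP; ring.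
move: R1; rewrite (pairingBl Lf (L2Z z LV) Lp') (pairingZl _ LV Lp') i2 => R1.
have R2 : Rz z f 0 * calM p z = - ((1 - z ^+ 2) * pairing (volt z f) p +
   (z * pairing f p + pairing f p')).
  by apply/eqP; rewrite -subr_eq0 -R1; apply/eqP; ring.
apply: (mulIf M0); rewrite R2; field.
exact: M0.
Qed.

End representer.

End boundary_functional.

(** * The sine integral *)

Section dirichlet.
Context {R : realType}.
Notation mu := (@lebesgue_measure R).
Notation RR := (measurableTypeR R).
Implicit Types (a b V p s : R).

Lemma lipschitz1 (h dh : R -> R) a b : (forall x : R, is_derive x (1 : R) h (dh x)) ->
  (forall x, `|dh x| <= 1) -> `|h a - h b| <= `|a - b|.
Proof.
move=> hd hL; wlog ab : a b / b <= a.
  move=> H; have [|ab] := leP b a; first exact: H.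
  by rewrite distrC (distrC a); apply: H; exact: ltW.
have [c _ ->] := MVT_segment ab (fun x _ => hd x) (continuous_subspaceT
  (fun x => differentiable_continuous ((derivable1_diffP _ _).1 (@ex_derive _ _ _ _ _ _ _ (hd x))))).
by rewrite normrM ler_piMl.
Qed.

Lemma sin_lip a b : `|sin a - sin b| <= `|a - b|.
Proof.
apply: (@lipschitz1 sin cos a b (fun x => is_derive_sin x)) => x.
by rewrite ler_norml cos_geN1 cos_le1.
Qed.

Lemma cos_lip a b : `|cos a - cos b| <= `|a - b|.
Proof.
apply: (@lipschitz1 cos (fun x => - sin x) a b (fun x => is_derive_cos x)) => x.
by rewrite normrN ler_norml sin_geN1 sin_le1.
Qed.

(** The range []0, 2^-1[] is that of the centred parameter of the segment, folded at [0]. As a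
    result [Si V] is the classical sine integral at [V / 2]. *)
Definition sincut V s : R := if (0 < s) && (s < 2^-1) then sin (V * s) / s else 0.

Definition Si V : R := \int[mu]_s sincut V s.

Lemma measurable_sin : measurable_fun setT (@sin R).
Proof. by apply: continuous_measurable_fun; exact: continuous_sin. Qed.

Lemma measurable_sincut2 : measurable_fun setT (fun q : RR * RR => sincut q.1 q.2).
Proof.
(* The reciprocal is written as an exponential of a logarithm, a composition of measurable
   functions. *)
have -> : (fun q : RR * RR => sincut q.1 q.2) = fun q : RR * RR =>
    if (0 < q.2) && (q.2 < 2^-1) then sin (q.1 * q.2) * expR (-1 * ln q.2) else 0.
  apply/funext => q; rewrite /sincut; case: ifP => // /andP[q0 _].
  by rewrite mulN1r expRN lnK// posrE.
apply: measurable_fun_ifT; last exact: measurable_cst.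
  exact: (measurableT_comp (measurable_between 0 2^-1) measurable_snd).
apply: measurable_funM.
  apply: (measurableT_comp measurable_sin).
  by apply: measurable_funM; [exact: measurable_fst|exact: measurable_snd].
have me := measurable_exp_lin (-1) (@measurable_ln R).
exact: (measurableT_comp me measurable_snd).
Qed.

Lemma measurable_sincut V : measurable_fun setT (sincut V).
Proof. exact: (measurable_fun_slice1 V measurable_sincut2). Qed.

Lemma measurable_Si : measurable_fun setT Si.
Proof. exact: (measurable_Rint mu measurable_sincut2). Qed.

Lemma sincut_le V s : `|sincut V s| <= `|V| * ((0 < s) && (s < 2^-1))%:R.
Proof.
rewrite /sincut; case: ifP => [/andP[s0 _]|_]; last by rewrite normr0 mulr0.
rewrite mulr1 normrM normfV (gtr0_norm s0) ler_pdivrMr//.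
have := sin_lip (V * s) 0; rewrite sin0 !subr0 => h; apply: (le_trans h).
by rewrite normrM (gtr0_norm s0).
Qed.

Lemma half0 : 0 <= 2^-1 :> R. Proof. by rewrite invr_ge0. Qed.

Lemma sincut_int V : mu.-integrable setT (EFin \o sincut V).
Proof.
apply/integrableP; split; first by apply/measurable_EFinP; exact: measurable_sincut.
apply: (@le_lt_trans _ _ (rint mu (fun s => `|V| * ((0 < s) && (s < 2^-1))%:R))).
  apply: integral_le_rint => //.
  - by apply: measurableT_comp => //; apply/measurable_EFinP; exact: measurable_sincut.
  - exact: (measurable_funM (measurable_cst _) (measurable_between_nat _ _)).
  - by move=> s; rewrite /= lee_fin; exact: sincut_le.
rewrite (rintZ mu (measurable_between_nat 0 2^-1) (fun s => ler0n _ _) (normr_ge0 V)).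
by rewrite (rint_between half0) -EFinM ltry.
Qed.

Lemma Si_le V : `|Si V| <= `|V| / 2.
Proof.
rewrite -lee_fin (EFin_normr_Rintegral measurableT); last exact: sincut_int.
apply: le_trans (le_abse_integral _ measurableT (measurable_int _ (sincut_int V))) _.
apply: (@le_trans _ _ (rint mu (fun s => `|V| * ((0 < s) && (s < 2^-1))%:R))).
  apply: integral_le_rint => //.
  - by apply: measurableT_comp => //; apply/measurable_EFinP; exact: measurable_sincut.
  - exact: (measurable_funM (measurable_cst _) (measurable_between_nat _ _)).
  - by move=> s; rewrite /= lee_fin; exact: sincut_le.
rewrite (rintZ mu (measurable_between_nat 0 2^-1) (fun s => ler0n _ _) (normr_ge0 V)).
by rewrite (rint_between half0) subr0 -EFinM.
Qed.

Lemma SiN V : Si (- V) = - Si V.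
Proof.
rewrite /Si -[RHS]mulN1r -(RintegralZl (-1) measurableT (sincut_int V)).
apply: eq_Rintegral => s _; rewrite /sincut; case: ifP => _; last by rewrite mulr0.
by rewrite mulNr sinN mulN1r mulNr.
Qed.

Lemma cI_realC (h : R -> R) : cI mu (fun x => (h x)%:C) = (\int[mu]_x h x)%:C.
Proof.
rewrite /cI /=; congr (_ +i* _).
by rewrite /Rintegral /= integral0.
Qed.

Lemma cauchy_tail V : 0 < V ->
  rint mu (fun p => if 0 < p then V / (p ^+ 2 + V ^+ 2) else 0) = (pi / 2)%:E.
Proof.
move=> V0; have Vn : V != 0 by rewrite gt_eqF.
have den p : p ^+ 2 + V ^+ 2 != 0 by rewrite gt_eqF// ltr_wpDl ?sqr_ge0// exprn_gt0.
have d (p : R) : is_derive p (1 : R) (fun p => atan (V^-1 * p)) (V / (p ^+ 2 + V ^+ 2)).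
  have lin : is_derive p (1 : R) (fun y => V^-1 * y) V^-1.
    have h := is_deriveM (is_derive_cst V^-1 p (1 : R)) (is_derive_id p (1 : R)).
    by apply: is_derive_eq h _; rewrite /GRing.scale/= mulr0 addr0 mulr1.
  have da : is_derive (V^-1 * p) (1 : R) (@atan R) ((1 + (V^-1 * p) ^+ 2)^-1) by exact: is_derive1_atan.
  have h := is_derive1_comp da lin.
  apply: is_derive_eq h _; have := den p => dp; field.
  by rewrite Vn dp.
have lim : (fun p => atan (V^-1 * p)) p @[p --> +oo] --> pi / 2.
  have h : V^-1 * p @[p --> +oo] --> +oo.
    by apply: gt0_cvgMry; [rewrite invr_gt0|exact: cvg_id].
  exact: (cvg_comp _ _ h (@cvgy_atan R)).
rewrite (rint_ftc _ _ d lim).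
- by rewrite mulr0 atan0 subr0.
- by move=> p _; rewrite divr_ge0 ?(ltW V0)// addr_ge0// sqr_ge0.
- move=> p; apply: cvgM; first exact: cvg_cst.
  apply: cvgV => //; apply: cvgD; last exact: cvg_cst.
  exact: exprn_continuous.
Qed.

Lemma Int_exp (z : R[i]) a : z != 0 -> 0 <= a ->
  Int 0 a (fun s => expC (z * s%:C)) = (expC (z * a%:C) - 1) / z.
Proof.
move=> z0 a0; have h := primitive_int (primitive_exp z) a0.
rewrite mulr0 expC0 in h; apply: (mulIf z0); rewrite divfK// h addrC addKr.
have [_ _ Lz] := primitive_exp z; have c1 := L2loc_iv a Lz (lexx 0).
rewrite /Int -[in RHS](mulfK z0 (cI mu (iv 0 a (fun x => z * expC (z * x%:C))))) mulrAC.
congr (_ * _); rewrite mulrC -(cIZ z^-1 c1); apply: cI_eq => y; rewrite /iv.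
by case: ifP => _; [rewrite mulKf|rewrite mulr0].
Qed.

Definition laplace_sin V (q : RR * RR) : R :=
  if (0 < q.1) && (q.1 < 2^-1) then (if 0 < q.2 then expR (- q.1 * q.2) else 0) * sin (V * q.1)
  else 0.

Lemma measurable_laplace_sin V : measurable_fun setT (laplace_sin V).
Proof.
apply: measurable_fun_ifT; last exact: measurable_cst.
  exact: (measurableT_comp (measurable_between 0 2^-1) measurable_fst).
apply: measurable_funM.
  apply: measurable_fun_ifT; last exact: measurable_cst.
    by apply: measurable_fun_ltr; [exact: measurable_cst|exact: measurable_snd].
  apply: (measurableT_comp (@measurable_expR R)); apply: measurable_funM; last exact: measurable_snd.
  exact: (measurableT_comp (@oppr_measurable R setT) measurable_fst).
apply: (measurableT_comp measurable_sin).
exact: (measurable_funM (measurable_cst _) measurable_fst).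
Qed.

Lemma laplace_sin_p V s : rint mu (fun p => `|laplace_sin V (s, p)|) = `|sincut V s|%:E.
Proof.
rewrite /laplace_sin /sincut /=; case: ifP => [/andP[s0 _]|_]; last first.
  by rewrite normr0 /rint integral0.
have E := rint_exp_tailZ 0 (normr_ge0 (sin (V * s))) s0.
rewrite mulr0 expR0 mulr1 in E; rewrite normrM normfV (gtr0_norm s0) -E.
congr rint; apply/funext => p; rewrite normrM mulrC /exp_tail; congr (_ * _).
by case: ifP => _; rewrite ?normr0// ger0_norm// expR_ge0.
Qed.

Lemma laplace_sin_fin V :
  (\int[mu]_s rint mu (fun p => normc ((laplace_sin V (s, p))%:C : R[i])) < +oo)%E.
Proof.
have -> : (fun s => rint mu (fun p => normc ((laplace_sin V (s, p))%:C : R[i]))) =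
    fun s => (`|sincut V s|)%:E.
  apply/funext => s; rewrite -laplace_sin_p; congr rint; apply/funext => p.
  by rewrite normc_real.
have /integrableP [_] := sincut_int V; apply: le_lt_trans; rewrite le_eqVlt.
by apply/orP; left; apply/eqP; apply: eq_integral.
Qed.

(** The integral over [s] is the imaginary part of [(e^(z/2) - 1) / z] with [z = - p + i V]. The
    endpoint [0] contributes the Cauchy kernel [V / (p^2 + V^2)], the endpoint [1/2] the error
    [rho], small because the modulus of [z] is at least [V]. *)
Lemma laplace_sin_inner V p : 0 < V -> 0 < p ->
  exists2 rho : R, `|rho| <= expR (- 2^-1 * p) / V &
    cI mu (fun s => (laplace_sin V (s, p))%:C) = (V / (p ^+ 2 + V ^+ 2) + rho)%:C.
Proof.
move=> V0 p0; pose z : R[i] := (- p) +i* V.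
have z0 : z != 0 by rewrite eq_complex /= (gt_eqF V0) andbF.
have e := Int_exp z0 half0.
have -> : (fun s => (laplace_sin V (s, p))%:C) =
    fun s => (complex.Im (iv 0 2^-1 (fun s => expC (z * s%:C)) s))%:C.
  apply/funext => s; rewrite /laplace_sin /iv /= p0; case: ifP => // _; congr (_ %:C).
  rewrite /expC mulrC [in RHS]mulrC cImMr cReMr cImMr /z /=; congr (_ * expR _); ring.
have nz : V <= normc z by rewrite -[leLHS](gtr0_norm V0); exact: (normc_geIm z).
exists (complex.Im (expC (z * (2^-1)%:C) / z)).
  apply: le_trans (normc_geIm _) _; rewrite normcM normc_expC cReMr normcV.
  have -> : complex.Re z * 2^-1 = - 2^-1 * p by rewrite /z /=; ring.
  rewrite ler_wpM2l ?expR_ge0// lef_pV2 ?posrE//; exact: lt_le_trans nz.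
rewrite cI_realC; congr (_ %:C).
have -> : \int[mu]_s complex.Im (iv 0 2^-1 (fun s => expC (z * s%:C)) s) =
    complex.Im (Int 0 2^-1 (fun s => expC (z * s%:C))) by [].
have d0 : p ^+ 2 + V ^+ 2 != 0 by rewrite gt_eqF// ltr_wpDl ?sqr_ge0// exprn_gt0.
have zi : z^-1 = (- p / (p ^+ 2 + V ^+ 2)) +i* (- V / (p ^+ 2 + V ^+ 2)).
  apply: (mulfI z0); rewrite mulfV//.
  by apply: ReImE; rewrite ?cReM ?cImM /=; field.
by rewrite e mulrBl mul1r cImD cImN addrC {1}zi /= mulNr opprK.
Qed.

Definition cauchy_cut V p : R := if 0 < p then V / (p ^+ 2 + V ^+ 2) else 0.

Lemma cauchy_cut_L1 V : 0 < V -> cL1 mu (fun p => (cauchy_cut V p)%:C : R[i]).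
Proof.
move=> V0; have gE := cauchy_tail V0.
have mg : measurable_fun setT (cauchy_cut V).
  apply: measurable_cut; apply: continuous_measurable_fun => p.
  apply: cvgM; first exact: cvg_cst.
  apply: cvgV; first by rewrite gt_eqF// ltr_wpDl ?sqr_ge0// exprn_gt0.
  apply: cvgD; last exact: cvg_cst.
  exact: exprn_continuous.
have g0 p : 0 <= cauchy_cut V p.
  rewrite /cauchy_cut; case: ifP => // _.
  by rewrite divr_ge0 ?(ltW V0)// addr_ge0// sqr_ge0.
split; first exact: cmeas_real.
have -> : (fun p => normc ((cauchy_cut V p)%:C : R[i])) = cauchy_cut V.
  by apply/funext => p; rewrite normc_real ger0_norm.
by rewrite [X in (X < _)%E]gE ltry.
Qed.

Lemma cI_cauchy_cut V : 0 < V -> cI mu (fun p => (cauchy_cut V p)%:C) = (pi / 2)%:C.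
Proof.
move=> V0; rewrite cI_realC; congr (_ %:C).
by have := cauchy_tail V0; rewrite /rint /Rintegral /cauchy_cut => ->.
Qed.

(* Write [1 / s] as [\int_(p > 0) expR (- s p)] and exchange the integrals. *)
Lemma Si_near_pihalf V : 0 < V -> `|Si V - pi / 2| <= 2 / V.
Proof.
move=> V0.
have mL : cmeas (fun q : RR * RR => (laplace_sin V q)%:C).
  by apply: cmeas_real; exact: measurable_laplace_sin.
have fin := laplace_sin_fin V.
have F := cI_fubini mL fin.
have inner s : 0 < s ->
    cI mu (fun p => ((if 0 < p then expR (- s * p) else 0) * sin (V * s))%:C) = (sin (V * s) / s)%:C.
  move=> s0; have E := rint_exp_tail 0 s0; rewrite mulr0 expR0 mulr1 in E.
  have c1 : cL1 mu (fun p => (exp_tail s 0 p)%:C : R[i]).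
    split; first by apply: cmeas_real; exact: measurable_exp_tail.
    have -> : (fun p => normc ((exp_tail s 0 p)%:C : R[i])) = exp_tail s 0.
      by apply/funext => p; rewrite normc_real ger0_norm// exp_tail_ge0.
    by rewrite E ltry.
  have Z := cIZ (sin (V * s))%:C c1.
  have e0 : cI mu (fun p => (exp_tail s 0 p)%:C) = (s^-1)%:C.
    rewrite cI_realC; congr (_ %:C).
    by move: E; rewrite /rint /Rintegral -/(exp_tail s 0) => ->.
  have -> : (sin (V * s) / s)%:C = (sin (V * s))%:C * (s^-1)%:C :> R[i] by rewrite -rmorphM.
  rewrite -e0 -Z; apply: cI_eq => p.
  by rewrite -rmorphM mulrC.
have e1 : cI mu (fun s => cI mu (fun p => (laplace_sin V (s, p))%:C)) = (Si V)%:C.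
  rewrite /Si -cI_realC; apply: cI_eq => s.
  rewrite /laplace_sin /sincut /=; case: ifP => [/andP[s0 _]|_]; last by rewrite cI0.
  exact: inner.
have swap : cmeas (fun q : RR * RR => (laplace_sin V (q.2, q.1))%:C).
  apply: cmeas_real; apply: (measurableT_comp (measurable_laplace_sin V)).
  by apply: measurable_fun_pair; [exact: measurable_snd|exact: measurable_fst].
have tail : cL1 mu (fun p => cI mu (fun s => (laplace_sin V (s, p))%:C)).
  apply: (cL1_cI (m1 := mu) (m2 := mu) swap).
  have mn := measurable_normc mL.
  by rewrite -(rint_tonelli mu mu mn (fun q => normc_ge0 _)).
have cg := cauchy_cut_L1 V0; have e2 := cI_cauchy_cut V0.
have D := cIB tail cg.
have : normc ((Si V)%:C - (pi / 2)%:C : R[i]) <= 2 / V.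
  rewrite -e1 F -e2 -D.
  have T2 : 0 < 2^-1 :> R by rewrite invr_gt0.
  have Vi : 0 <= V^-1 by rewrite invr_ge0 ltW.
  apply: (@norm_cI_le _ _ R mu _ (fun p => V^-1 * exp_tail 2^-1 0 p) (2 / V)).
  - by case: (cL1B tail cg).
  - exact: (measurable_funM (measurable_cst _) (measurable_exp_tail _ _)).
  - move=> p; rewrite /cauchy_cut /exp_tail; case: ifP => p0; last first.
      rewrite mulr0 subr0 (_ : cI mu _ = 0) ?normc0// -(cI0 mu); apply: cI_eq => s.
      by rewrite /laplace_sin /= p0 mul0r if_same.
    have [rho hr ->] := laplace_sin_inner V0 p0.
    by rewrite -rmorphB addrAC subrr add0r normc_real mulrC.
  - rewrite (rint_exp_tailZ 0 Vi T2) mulr0 expR0 mulr1 invrK lee_fin mulrC.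
    exact: lexx.
by rewrite -rmorphB normc_real.
Qed.

(** [Si V / pi] tends to [1/2] or [- 1/2] at the two ends of the line; the shift by [2^-1] makes the
    error vanish at both. *)
Definition step_err V : R := 2^-1 + Si V / pi - (0 < V)%R%:R.

Lemma measurable_step_err : measurable_fun setT step_err.
Proof.
apply: measurable_funB.
  apply: measurable_funD; first exact: measurable_cst.
  exact: (measurable_funM measurable_Si (measurable_cst _)).
have -> : (fun V : R => (0 < V)%R%:R : R) = fun V => if 0 < V then 1 else 0.
  by apply/funext => V; case: (0 < V).
exact: (measurable_cut 0 (measurable_cst _)).
Qed.

(** For [|V| <= 1] the bound [Si_le] gives an error at most [1]; beyond, [Si_near_pihalf], the
    oddness of [Si] and [2 <= pi] give [1 / |V|]. In both cases the bound [c] satisfies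
    [c^2 (1 + V^2) <= 2]. *)
Lemma step_err_sq V : step_err V ^+ 2 <= 2 / (1 + V ^+ 2).
Proof.
have p2 : 2 <= pi :> R := pi_ge2 R; have p0 : 0 < pi :> R by exact: lt_le_trans p2.
have d0 : 0 < 1 + V ^+ 2 by rewrite ltr_pwDl ?sqr_ge0.
rewrite ler_pdivlMr//.
have key c : 0 <= c -> `|step_err V| <= c -> c ^+ 2 * (1 + V ^+ 2) <= 2 ->
    step_err V ^+ 2 * (1 + V ^+ 2) <= 2.
  move=> c0 h1 h2; apply: le_trans h2; rewrite ler_wpM2r ?(ltW d0)//.
  by rewrite -(real_normK (num_real (step_err V))) lerXn2r ?nnegrE.
have [V1|V1] := leP `|V| 1.
  apply: (key 1) => //; last first.
    rewrite expr1n mul1r -[leRHS]/(1 + 1) lerD2l -(real_normK (num_real V)).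
    by rewrite exprn_ile1.
  have h : `|Si V / pi| <= 2^-1.
    rewrite normrM normfV (gtr0_norm p0) ler_pdivrMr//; apply: le_trans (Si_le V) _.
    by rewrite mulrC; apply: ler_pM => //; apply: le_trans V1 _; apply: le_trans p2; rewrite ler1n.
  move: h; rewrite /step_err !ler_norml => /andP[h1 h2]; case: (0 < V) => /=; lra.
have V0 : 0 < `|V| by exact: lt_trans V1.
apply: (key (`|V|^-1)); first by rewrite invr_ge0.
  have posc W : 0 < W -> `|2^-1 + Si W / pi - 1| <= W^-1.
    move=> W0; have -> : 2^-1 + Si W / pi - 1 = (Si W - pi / 2) / pi.
      rewrite mulrBl [pi / 2 / pi]mulrAC mulfV ?gt_eqF// mul1r.
      by move: (Si W / pi) => X; lra.
    rewrite normrM normfV (gtr0_norm p0) ler_pdivrMr//.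
    apply: le_trans (Si_near_pihalf W0) _.
    by rewrite mulrC ler_wpM2l// invr_ge0 ltW.
  rewrite /step_err; have [Vp|Vn|Ve] := ltgtP 0 V.
  - by rewrite (gtr0_norm Vp); exact: posc.
  - have := posc (- V); rewrite oppr_gt0 SiN (ltr0_norm Vn) => /(_ Vn).
    rewrite -(normrN (_ + _ - 1)) mulNr; congr (`|_| <= _).
    by move: (Si V / pi) => X /=; lra.
  - by move: V0; rewrite -Ve normr0 ltxx.
have V2 : 1 <= V ^+ 2.
  by rewrite -(real_normK (num_real V)) exprn_ege1// ltW.
rewrite exprVn real_normK ?num_real// mulrDr mulr1 mulVf; last by rewrite gt_eqF// (lt_le_trans _ V2).
rewrite -[leRHS]/(1 + 1) lerD2r invf_le1//; exact: lt_le_trans V2.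
Qed.

Lemma cauchy_half (r : R) : 0 < r ->
  rint mu (fun y => if 0 < y then 2 / (1 + (2 * r * y) ^+ 2) else 0)%R = (r^-1 * (pi / 2))%:E.
Proof.
move=> r0; have rn : r != 0 by rewrite gt_eqF.
have den y : 1 + (2 * r * y) ^+ 2 != 0 by rewrite gt_eqF// ltr_pwDl ?sqr_ge0.
have d (y : R) : is_derive y (1 : R) (fun y => r^-1 * atan (2 * r * y)) (2 / (1 + (2 * r * y) ^+ 2)).
  have lin : is_derive y (1 : R) (fun y => 2 * r * y) (2 * r).
    have h := is_deriveM (is_derive_cst (2 * r) y (1 : R)) (is_derive_id y (1 : R)).
    by apply: is_derive_eq h _; rewrite /GRing.scale/= mulr0 addr0 mulr1.
  have da : is_derive (2 * r * y) (1 : R) (@atan R) ((1 + (2 * r * y) ^+ 2)^-1) by exact: is_derive1_atan.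
  have h := is_deriveM (is_derive_cst r^-1 y (1 : R)) (is_derive1_comp da lin).
  apply: is_derive_eq h _; rewrite /GRing.scale/= mulr0 addr0.
  have := den y; move: (1 + _) => D dn; field.
  by rewrite dn rn.
have lim : (fun y => r^-1 * atan (2 * r * y)) y @[y --> +oo] --> r^-1 * (pi / 2).
  apply: cvgM; first exact: cvg_cst.
  have h : 2 * r * y @[y --> +oo] --> +oo.
    by apply: gt0_cvgMry; [rewrite mulr_gt0|exact: cvg_id].
  exact: (cvg_comp _ _ h (@cvgy_atan R)).
rewrite (rint_ftc _ _ d lim).
- by rewrite mulr0 atan0 mulr0 subr0.
- by move=> y _; rewrite divr_ge0// addr_ge0// sqr_ge0.
- move=> y; apply: cvgM; first exact: cvg_cst.
  apply: cvgV; first exact: den.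
  apply: cvgD; first exact: cvg_cst.
  apply: (continuous_comp (f := fun y => 2 * r * y) (g := fun y => y ^+ 2)).
    by apply: cvgM; [exact: cvg_cst|exact: cvg_id].
  exact: exprn_continuous.
Qed.

Definition cauchy_pos (r y : R) : R := if 0 < y then 2 / (1 + (2 * r * y) ^+ 2) else 0.

Lemma measurable_cauchy_pos r : measurable_fun setT (cauchy_pos r).
Proof.
apply: measurable_cut; apply: continuous_measurable_fun => y.
apply: cvgM; first exact: cvg_cst.
apply: cvgV; first by rewrite gt_eqF// ltr_pwDl ?sqr_ge0.
apply: cvgD; first exact: cvg_cst.
apply: (continuous_comp (f := fun y => 2 * r * y) (g := fun y => y ^+ 2)).
  by apply: cvgM; [exact: cvg_cst|exact: cvg_id].
exact: exprn_continuous.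
Qed.

Lemma cauchy_pos_ge0 r y : 0 <= cauchy_pos r y.
Proof. by rewrite /cauchy_pos; case: ifP => // _; rewrite divr_ge0// addr_ge0// sqr_ge0. Qed.

(** Each half of the line contributes at most [pi / (2 r)], and [pi < 4]. This estimate supplies the
    rate of convergence in the inversion formula. *)
Lemma rint_step_err (r c : R) : 0 < r ->
  (rint mu (fun x => step_err (2 * r * (c - x)) ^+ 2)%R <= (4 / r)%:E)%E.
Proof.
move=> r0.
have lin (a b : R) : measurable_fun setT (fun x : R => a * (b - x)).
  apply: measurable_funM => //; apply: measurable_funD => //; exact: oppr_measurable.
have mE : measurable_fun setT (fun x : R => step_err (2 * r * x) ^+ 2).
  apply: measurable_sq; apply: (measurableT_comp measurable_step_err).
  exact: measurable_funM.
have mE2 : measurable_fun setT (fun x : R => step_err (2 * r * (x + c)) ^+ 2).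
  by apply: (measurableT_comp mE); exact: measurable_funD.
have e1 := rint_shift c mE; have e2 := rint_opp mE2.
have -> : (fun x => step_err (2 * r * (c - x)) ^+ 2) = fun x => step_err (2 * r * (- x + c)) ^+ 2.
  by apply/funext => x; rewrite [c - x]addrC.
rewrite e2 e1.
have mq := measurable_cauchy_pos r.
have mqN : measurable_fun setT (fun y : R => cauchy_pos r (- y)).
  by apply: (measurableT_comp mq); exact: oppr_measurable.
have I : rint mu (cauchy_pos r) = (r^-1 * (pi / 2))%:E := cauchy_half r0.
have IN := rint_opp mq.
apply: (@le_trans _ _ (rint mu (fun y => cauchy_pos r y + cauchy_pos r (- y))%R)).
  apply: rint_ae_le => //.
  - exact: measurable_funD.
  - by move=> y; exact: sqr_ge0.
  - by move=> y; rewrite addr_ge0// cauchy_pos_ge0.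
  apply: filterS (ae_neq 0) => y /eqP y0; apply: le_trans (step_err_sq _) _.
  rewrite /cauchy_pos oppr_gt0 mulrN sqrrN.
  have [yp|yn|ye] := ltgtP 0 y; [by rewrite addr0|by rewrite add0r|].
  by rewrite ye eqxx in y0.
rewrite (rintD mu mq mqN (cauchy_pos_ge0 r) (fun y => cauchy_pos_ge0 r (- y))) IN I.
rewrite -EFinD lee_fin -mulrDr -splitr mulrC ler_wpM2r ?invr_ge0 ?(ltW r0)//.
by have := pihalf_lt2 R; lra.
Qed.

End dirichlet.

(** * The inversion formula *)

Section riemann.
Context {R : realType}.
Notation mu := (@lebesgue_measure R).
Notation RR := (measurableTypeR R).
Variables (G : R -> 'Fun(R)) (Q : R -> R).
Hypothesis mG : cmeas (fun q : RR * RR => G q.1 q.2).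
Hypothesis LQ : L2 (fun x => (Q x)%:C).
Hypothesis Q0 : forall x, 0 <= Q x.
Hypothesis Gle : forall s x, 0 <= s <= 1 -> 0 < x -> normc (G s x) <= Q x.
Hypothesis Glip : forall s s' x, 0 <= s <= 1 -> 0 <= s' <= 1 -> 0 < x ->
  normc (G s x - G s' x) <= `|s - s'| * Q x.

Lemma Int_norm_le (a b A : R) (h : 'Fun(R)) : a <= b -> cmeas (iv a b h) ->
  (forall s, a < s -> s < b -> normc (h s) <= A) -> normc (Int a b h) <= A * (b - a).
Proof.
move=> ab mh hA; have [A0|A0] := leP 0 A; last first.
  have [ab2|ba] := ltP a b; last by rewrite Int_ge// normc0 (@le_anti _ _ a b) ?ab ?ba// subrr mulr0.
  have m : a < (a + b) / 2 < b by apply/andP; split; lra.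
  by have := hA ((a + b) / 2); move: m => /andP[-> ->] /(_ isT isT) /(le_trans (normc_ge0 _)); rewrite leNgt A0.
have mm : measurable_fun setT (fun s : R => A * ((a < s) && (s < b))%:R).
  exact: (measurable_funM (measurable_cst A) (measurable_between_nat a b)).
apply: (@norm_cI_le _ _ R mu _ _ (A * (b - a)) mh mm).
- move=> s; rewrite /iv; case: ifP => [/andP[h1 h2]|_]; last by rewrite normc0 mulr0.
  by rewrite mulr1; exact: hA.
- rewrite (rintZ mu (measurable_between_nat a b) (fun s => ler0n _ _) A0).
  by rewrite (rint_between ab) -EFinM.
Qed.

Lemma L2_dom (h : 'Fun(R)) (A : R) : cmeas (pos h) -> 0 <= A ->
  (forall x, 0 < x -> normc (h x) <= A * Q x) -> L2 h /\ n2 h <= A ^+ 2 * n2 (fun x => (Q x)%:C).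
Proof.
move=> mh A0 hA; have LA := L2Z A%:C LQ; have [mA jA] := (L2P _).1 LA.
have le : (N2 mu (pos h) <= N2 mu (pos (fun x => (A%:C * (Q x)%:C)%R)))%E.
  apply: N2_le => // x; rewrite /pos; case: ifP => // x0.
  by rewrite normcM !normc_real (ger0_norm A0) (ger0_norm (Q0 x)); exact: hA.
have Lh : L2 h by apply/L2P; split => //; exact: le_lt_trans jA.
split => //; move: le; rewrite !n2E// lee_fin n2Z// normc_real real_normK//.
exact: num_real.
Qed.

Lemma cmeas_slice_s x : cmeas (fun s : R => G s x).
Proof. exact: (cmeas_slice2 x mG). Qed.

Lemma cmeas_slice_x s : cmeas (G s).
Proof. exact: (cmeas_slice1 s mG). Qed.

Lemma riemann_L2 s : 0 <= s <= 1 -> L2 (G s).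
Proof.
move=> s01; have [] := @L2_dom (G s) 1 _ ler01 => //.
- by apply: cmeas_pos_of; exact: cmeas_slice_x.
- by move=> x x0; rewrite mul1r; exact: Gle.
Qed.

(** The integral is taken at each [x] separately. It is also the L^2-valued integral over the
    segment, because [G] is Lipschitz in [s] with the square integrable factor [Q], see
    [riemann_cvg]. *)
Definition riemann_int : 'Fun(R) := fun x => Int 0 1 (fun s => G s x).

Lemma cmeas_riemann_int : cmeas riemann_int.
Proof.
suff m : cmeas (fun q : RR * RR => iv 0 1 (fun s => G s q.1) q.2) by exact: (cmeas_cI mu m).
apply: cmeas_if; [| |exact: cmeas_cst].
- exact: (measurableT_comp (measurable_between 0 1) measurable_snd).
- apply: (cmeas_comp mG (g := fun q : RR * RR => (q.2, q.1))).
  by apply: measurable_fun_pair; [exact: measurable_snd|exact: measurable_fst].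
Qed.

Lemma riemann_int_L2 : L2 riemann_int.
Proof.
have [] := @L2_dom riemann_int 1 _ ler01 => //.
- by apply: cmeas_pos_of; exact: cmeas_riemann_int.
- move=> x x0; rewrite mul1r; have := @Int_norm_le 0 1 (Q x) (fun s => G s x) ler01.
  rewrite subr0 mulr1; apply; first by apply: cmeas_iv; exact: cmeas_slice_s.
  by move=> s s0 s1; apply: Gle => //; rewrite !ltW.
Qed.

Let G_L1 a b x : 0 <= a -> b <= 1 -> 0 < x -> cL1 mu (iv a b (fun s => G s x)).
Proof.
move=> a0 b1 x0; have mi : cmeas (iv a b (fun s => G s x)) by apply: cmeas_iv; exact: cmeas_slice_s.
have [ab|ba] := leP a b; last first.
  rewrite (_ : iv a b _ = fun=> 0); first exact: cL1_0.
  apply/funext => s; rewrite /iv; case: ifP => // /andP[h1 h2].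
  by have := lt_trans (lt_trans h1 h2) ba; rewrite ltxx.
have mm : measurable_fun setT (fun s : R => Q x * ((a < s) && (s < b))%:R).
  exact: (measurable_funM (measurable_cst (Q x)) (measurable_between_nat a b)).
apply: (@cL1_le _ _ R mu _ _ mi mm).
- move=> s; rewrite /iv; case: ifP => [/andP[h1 h2]|_]; last by rewrite normc0 mulr0.
  by rewrite mulr1; apply: Gle => //; rewrite (ltW (le_lt_trans a0 h1)) (ltW (lt_le_trans h2 b1)).
- rewrite (rintZ mu (measurable_between_nat a b) (fun s => ler0n _ _) (Q0 x)).
  by rewrite (rint_between ab) -EFinM ltry.
Qed.

(** On each subinterval the tag is within [d] of the point of integration, so the Lipschitz bound
    costs at most [d * Q x] per unit length, and the lengths sum to [1]. *)
Lemma riemann_pointwise (n : nat) (s c : nat -> R) (d x : R) : 0 < x -> 0 <= d ->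
  s 0%N = 0 -> s n = 1 ->
  (forall i, (i < n)%N -> s i <= c i <= s i.+1 /\ s i.+1 - s i < d) ->
  normc (\sum_(i < n) (s i.+1 - s i)%:C * G (c i) x - riemann_int x) <= d * Q x.
Proof.
move=> x0 d0 s0 sn hs.
have mono i : (i < n)%N -> s i <= s i.+1.
  by move=> /hs [/andP[h1 h2] _]; exact: le_trans h2.
have pos_ i : (i <= n)%N -> 0 <= s i.
  elim: i => [|i ih] ile; first by rewrite s0.
  exact: le_trans (ih (ltnW ile)) (mono i ile).
have le1 i : (i <= n)%N -> s i <= 1.
  move=> ile; rewrite -sn -(subnK ile); move: (n - i)%N (subnK ile) => k.
  elim: k {ile} i => [|k ih] i e; first by rewrite add0n.
  have e' : (k + i.+1)%N = n by rewrite addnS -addSn.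
  have := ih i.+1 e'; rewrite addnS -addSn => h; apply: le_trans h.
  by apply: mono; rewrite -e addSn ltnS leq_addl.
have split m : (m <= n)%N -> Int 0 (s m) (fun t => G t x) =
    \sum_(i < m) Int (s i) (s i.+1) (fun t => G t x).
  elim: m => [|m ih] mn; first by rewrite big_ord0 s0 Int_ge.
  rewrite big_ord_recr/= -ih; last exact: ltnW.
  have m0 := pos_ m (ltnW mn); have m1 := le1 m.+1 mn; have mm := mono m mn.
  apply: (Int_split m0 mm); [exact: G_L1|apply: G_L1 => //|exact: G_L1].
  exact: le_trans mm m1.
rewrite /riemann_int -sn (split n (leqnn n)) -sumrB.
apply: le_trans (normc_sum n (fun i => (s i.+1 - s i)%:C * G (c i) x - Int (s i) (s i.+1) (fun t => G t x))) _.
have tele m : (m <= n)%N -> \sum_(i < m) (s i.+1 - s i) = s m.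
  elim: m => [|m ih] mn; first by rewrite big_ord0 s0.
  by rewrite big_ord_recr/= ih ?subrKC// ltnW.
have -> : d * Q x = \sum_(i < n) d * Q x * (s i.+1 - s i).
  by rewrite -mulr_sumr (tele n (leqnn n)) sn mulr1.
apply: ler_sum => i _; have [/andP[c1 c2] sd] := hs i (ltn_ord i).
have i0 := pos_ i (ltnW (ltn_ord i)); have i1 := le1 i.+1 (ltn_ord i).
have si := mono i (ltn_ord i).
have cc : cL1 mu (iv (s i) (s i.+1) (fun=> 1)).
  apply: cL1_iv; first by apply: cmeas_iv; exact: cmeas_cst.
  by rewrite N2_between// ltry.
have e1 := cIZ (G (c i) x) cc; have I1 := Int_1 si; rewrite /Int in I1.
have e2 := cIB (cL1Z (G (c i) x) cc) (G_L1 i0 i1 x0).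
have -> : (s i.+1 - s i)%:C * G (c i) x - Int (s i) (s i.+1) (fun t => G t x) =
    Int (s i) (s i.+1) (fun t => G (c i) x - G t x).
  rewrite -I1 mulrC -e1 /Int -e2; apply: cI_eq => t; rewrite /iv.
  by case: ifP => _; [rewrite mulr1|rewrite mulr0 subr0].
apply: (Int_norm_le si).
  by apply: cmeas_iv; apply: cmeasB; [exact: cmeas_cst|exact: cmeas_slice_s].
move=> t t1 t2.
have c01 : 0 <= c i <= 1 by rewrite (le_trans i0 c1) (le_trans c2 i1).
have t01 : 0 <= t <= 1 by rewrite (le_trans i0 (ltW t1)) (le_trans (ltW t2) i1).
apply: le_trans (Glip c01 t01 x0) _; rewrite ler_wpM2r//.
by rewrite ler_norml; apply/andP; split; lra.
Qed.

Lemma riemann_cvg (e : R) : 0 < e -> exists2 d : R, 0 < d &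
  forall (n : nat) (s c : nat -> R), s 0%N = 0 -> s n = 1 ->
    (forall i, (i < n)%N -> s i <= c i <= s i.+1 /\ s i.+1 - s i < d) ->
    normL2 (fun x => \sum_(i < n) (s i.+1 - s i)%:C * G (c i) x - riemann_int x) < e.
Proof.
move=> e0; pose N := normL2 (fun x => (Q x)%:C).
have N0 : 0 <= N by exact: normL2_ge0.
have N1 : 0 < N + 1 by rewrite ltr_wpDl.
exists (e / (N + 1)); first by rewrite divr_gt0.
move=> n s c s0 sn hs; set d := e / (N + 1); have d0 : 0 <= d by rewrite divr_ge0// ltW.
have ms : cmeas (fun x => \sum_(i < n) (s i.+1 - s i)%:C * G (c i) x - riemann_int x).
  apply: cmeasB; last exact: cmeas_riemann_int.
  elim: (n) => [|m ih]; first by under eq_fun do rewrite big_ord0; exact: cmeas_cst.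
  under eq_fun do rewrite big_ord_recr; apply: (cmeasD ih).
  by apply: cmeasM; [exact: cmeas_cst|exact: cmeas_slice_x].
have [Lh hn] := @L2_dom _ d (cmeas_pos_of ms) d0 (fun x x0 => riemann_pointwise x0 d0 s0 sn hs).
rewrite -(@ltr_pXn2r _ 2) ?nnegrE ?normL2_ge0 ?(ltW e0)//.
rewrite normL2_sqr; apply: le_lt_trans hn _; rewrite -normL2_sqr -/N -exprMn.
have dN : 0 <= d * N by exact: (mulr_ge0 d0 N0).
rewrite ltr_pXn2r ?nnegrE ?dN ?(ltW e0)//.
by rewrite /d mulrAC ltr_pdivrMr// ltr_pM2l// ltrDl.
Qed.

End riemann.

(** * Unimodular exponentials *)

Section cis.
Context {R : realType}.
Implicit Types a c : R.

Definition cis a : R[i] := cos a +i* sin a.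

Lemma normc_cis a : normc (cis a) = 1.
Proof. by rewrite /cis /= cos2Dsin2 sqrtr1. Qed.

Lemma cisD a c : cis (a + c) = cis a * cis c.
Proof. by apply: ReImE; rewrite ?cReM ?cImM /= ?cosD ?sinD //; ring. Qed.

Lemma cis_lip a c : normc (cis a - cis c) <= 2 * `|a - c|.
Proof.
apply: le_trans (normc_leReIm _) _; rewrite !(cReD, cReN, cImD, cImN) /= mulr2n mulrDl !mul1r.
by apply: lerD; [exact: cos_lip|exact: sin_lip].
Qed.

Lemma cis_sub a : cis a - cis (- a) = 'i%C * (2 * sin a)%:C.
Proof. by apply: ReImE; rewrite ?cReD ?cReN ?cImD ?cImN ?cReM ?cImM /= ?cosN ?sinN; ring. Qed.

Lemma measurable_cos : measurable_fun setT (@cos R).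
Proof. by apply: continuous_measurable_fun; exact: continuous_cos. Qed.

Lemma cmeas_cis d (X : measurableType d) (h : X -> R) : measurable_fun setT h ->
  cmeas (fun x => cis (h x)).
Proof. by move=> mh; split; [exact: (measurableT_comp measurable_cos mh)|exact: (measurableT_comp (@measurable_sin R) mh)]. Qed.

End cis.

(** * Symmetric integrals and bounded multipliers *)

Section symmetric_integrals.
Context {R : realType}.
Notation mu := (@lebesgue_measure R).

Lemma cL1_iv_bounded (a c A : R) (h : 'Fun(R)) : a <= c -> cmeas h ->
  (forall s, normc (h s) <= A) -> cL1 mu (iv a c h).
Proof.
move=> ac mh hA; have A0 : 0 <= A := le_trans (normc_ge0 _) (hA 0).
have mm : measurable_fun setT (fun s : R => A * ((a < s) && (s < c))%:R).
  exact: (measurable_funM (measurable_cst A) (measurable_between_nat a c)).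
apply: (@cL1_le _ _ R mu _ _ (cmeas_iv a c mh) mm).
- by move=> s; rewrite /iv; case: ifP => _; rewrite ?mulr1 ?hA// normc0 mulr0.
- rewrite (rintZ mu (measurable_between_nat a c) (fun s => ler0n _ _) A0).
  by rewrite (rint_between ac) -EFinM ltry.
Qed.

(** Brings together [s] and [- s], which is how exponentials become sines in [line_int]. *)
Lemma Int_symmetric (c A : R) (h : 'Fun(R)) : 0 <= c -> cmeas h ->
  (forall s, normc (h s) <= A) ->
  Int (- c) c h = Int 0 c (fun s => h s + h (- s)).
Proof.
move=> c0 mh hA; have cN : - c <= 0 by rewrite oppr_le0.
have mhN : cmeas (fun s : R => h (- s)) by apply: (cmeas_comp mh); exact: oppr_measurable.
have i1 := cL1_iv_bounded (le_trans cN c0) mh hA.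
have i2 := cL1_iv_bounded cN mh hA; have i3 := cL1_iv_bounded c0 mh hA.
have i4 := cL1_iv_bounded c0 mhN (fun s => hA (- s)).
rewrite (Int_split cN c0 i1 i2 i3) addrC.
have -> : Int (- c) 0 h = Int 0 c (fun s => h (- s)).
  rewrite /Int -cI_opp; last by case: i2.
  by apply: cI_eq => s; rewrite /iv ltrN2 oppr_lt0 andbC.
rewrite /Int -(cID i3 i4); apply: cI_eq => s; rewrite /iv.
by case: ifP => _ //; rewrite addr0.
Qed.

Lemma cL1_bounded_mul (h : R -> R) (g : 'Fun(R)) (A : R) : measurable_fun setT h ->
  (forall y, `|h y| <= A) -> cL1 mu g -> cL1 mu (fun y => (h y)%:C * g y).
Proof.
move=> mh hA [mg jg]; have A0 : 0 <= A := le_trans (normr_ge0 _) (hA 0).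
have mn := measurable_normc mg.
apply: (@cL1_le _ _ R mu _ (fun y => A * normc (g y))).
- exact: (cmeasM (cmeas_real mh) mg).
- exact: (measurable_funM (measurable_cst A) mn).
- by move=> y; rewrite normcM normc_real ler_wpM2r ?normc_ge0.
- rewrite (rintZ mu mn (fun y => normc_ge0 _) A0); exact: lte_mul_pinfty.
Qed.

Lemma sincut_lip (V W s : R) :
  `|sincut V s - sincut W s| <= `|V - W| * ((0 < s) && (s < 2^-1))%:R.
Proof.
rewrite /sincut; case: ifP => [/andP[s0 _]|_]; last by rewrite subr0 normr0 mulr0.
rewrite mulr1 -mulrBl normrM normfV (gtr0_norm s0) ler_pdivrMr//.
apply: le_trans (sin_lip _ _) _.
by rewrite -mulrBl normrM (gtr0_norm s0).
Qed.

Lemma step_err_le (V : R) : `|step_err V| <= 2.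
Proof.
rewrite -(@ler_pXn2r _ 2) ?nnegrE// real_normK ?num_real//.
apply: le_trans (step_err_sq V) _; rewrite ler_pdivrMr ?ltr_pwDl ?sqr_ge0//.
by have := sqr_ge0 V; lra.
Qed.

End symmetric_integrals.

Section sine_integral_bounds.
Context {R : realType}.
Notation mu := (@lebesgue_measure R).

Lemma sincut_cL1 (V : R) : cL1 mu (fun s => (sincut V s)%:C).
Proof.
have mI := measurable_between_nat 0 (2^-1 : R).
apply: (@cL1_le _ _ R mu _ _ (cmeas_real (measurable_sincut V)) (measurable_funM (measurable_cst `|V|) mI)).
  by move=> s; rewrite normc_real; exact: sincut_le.
rewrite (rintZ mu mI (fun s => ler0n _ _) (normr_ge0 V)).
by rewrite (rint_between (@half0 R)) -EFinM ltry.
Qed.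

Lemma Int_shift (a b c : R) (h : 'Fun(R)) : cmeas h ->
  Int (a + c) (b + c) h = Int a b (fun s => h (s + c)).
Proof.
move=> mh; rewrite /Int -(cI_shift c (cmeas_iv _ _ mh)); apply: cI_eq => s.
by rewrite /iv !ltrD2r.
Qed.

Lemma Si_bound (V : R) : `|Si V| <= 4 * pi.
Proof.
have p0 := pi_gt0 R; have := step_err_le V; rewrite /step_err => h.
(* The definition of [step_err] solved for [Si V]; any uniform bound serves the purpose. *)
have -> : Si V = pi * (2^-1 + Si V / pi - (0 < V)%R%:R) + pi * ((0 < V)%R%:R - 2^-1).
  rewrite -{1}(divfK (lt0r_neq0 p0) (Si V)); ring.
apply: le_trans (ler_normD _ _) _; rewrite !normrM (gtr0_norm p0).
have -> : 4 * pi = pi * 2 + pi * 2 :> R by ring.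
apply: lerD; apply: ler_wpM2l; rewrite ?(ltW p0)//.
by rewrite ler_norml; case: (0 < V) => /=; rewrite ?mulr1n ?mulr0n; apply/andP; split; lra.
Qed.

Lemma Si_diff_L1 (r Y : R) (h : 'Fun(R)) : cL1 mu h ->
  cL1 mu (fun y => (Si (2 * r * Y) - Si (2 * r * (Y + y)))%:C * h y).
Proof.
apply: (@cL1_bounded_mul _ (fun y => Si (2 * r * Y) - Si (2 * r * (Y + y))) h (8 * pi)).
  apply: measurable_funB; first exact: measurable_cst.
  apply: (measurableT_comp measurable_Si); apply: measurable_funM; first exact: measurable_cst.
  exact: measurable_funD.
move=> y; apply: le_trans (ler_normB _ _) _.
have -> : 8 * pi = 4 * pi + 4 * pi :> R by ring.
by apply: lerD; exact: Si_bound.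
Qed.

(** Separates the modulus, which becomes the weight in Minkowski's inequality, from a bounded phase.
    The reciprocal of the modulus goes through [ln] and [expR] for the sake of measurability, and
    the phase is [0] where [g] vanishes. *)
Lemma polar_decomposition (g : 'Fun(R)) : cmeas g -> exists sg : 'Fun(R),
  [/\ cmeas sg, forall y, normc (sg y) <= 1 & forall y, g y = (normc (g y))%:C * sg y].
Proof.
move=> mg; have mn := measurable_normc mg.
exists (fun y => if 0 < normc (g y) then (expR (-1 * ln (normc (g y))))%:C * g y else 0); split.
- apply: cmeas_if; [by apply: measurable_fun_ltr; [exact: measurable_cst|exact: mn]| |exact: cmeas_cst].
  apply: cmeasM mg; apply: cmeas_real.
  have me := measurable_exp_lin (-1) (@measurable_ln R).
  exact: (measurableT_comp me mn).
- move=> y; case: ifP => n0; last by rewrite normc0 ler01.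
  by rewrite normcM normc_real ger0_norm ?expR_ge0// mulN1r expRN lnK ?posrE// mulVf// gt_eqF.
- move=> y; case: ifP => n0.
    by rewrite mulrA -rmorphM mulN1r expRN lnK ?posrE// mulfV ?gt_eqF// mul1r.
  rewrite mulr0; apply: normc_eq0P; apply/eqP; rewrite eq_le normc_ge0 andbT.
  by rewrite leNgt n0.
Qed.

End sine_integral_bounds.

(** * The error made by replacing a step with the sine integral *)

Section step_estimate.
Context {R : realType}.
Notation mu := (@lebesgue_measure R).
Notation RR := (measurableTypeR R).
Variables (h : 'Fun(R)) (b t r A : R).
Hypotheses (b0 : 0 < b) (r0 : 0 < r) (A0 : 0 < A) (L1h : cL1 mu h).
Hypothesis hA : (rint mu (fun y => normc (h y)) <= A%:E)%E.

Definition step_diff x y : R := step_err (2 * r * (t - x)) - step_err (2 * r * (t - x + y)).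

(** With [h] equal to [kappa] this is the error of the inversion formula truncated at height [r],
    see [step_carry]; the constants [2^-1] cancel in [step_diff]. *)
Definition step_int : 'Fun(R) := fun x =>
  (expR (b * (t - x)))%:C * cI mu (fun y => (step_diff x y)%:C * h y).

Lemma measurable_step_diff : measurable_fun setT (fun q : RR * RR => step_diff q.2 q.1).
Proof.
have m1 : measurable_fun setT (fun q : RR * RR => t - q.2 : R).
  by apply: measurable_funB; [exact: measurable_cst|exact: measurable_snd].
have m2 : measurable_fun setT (fun q : RR * RR => t - q.2 + q.1 : R).
  exact: (measurable_funD m1 measurable_fst).
apply: measurable_funB.
  exact: (measurableT_comp (@measurable_step_err R) (measurable_funM (measurable_cst (2 * r)) m1)).
exact: (measurableT_comp (@measurable_step_err R) (measurable_funM (measurable_cst (2 * r)) m2)).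
Qed.

Lemma step_diff_L1 x : cL1 mu (fun y => (step_diff x y)%:C * h y).
Proof.
apply: (@cL1_bounded_mul _ (step_diff x) h (2 + 2)) => //.
  exact: (measurable_fun_slice2 x measurable_step_diff).
by move=> y; apply: le_trans (ler_normB _ _) _; apply: lerD; exact: step_err_le.
Qed.

(** [y] only translates the second step error, so the bound is uniform in it; [16] is
    [2 * (4 + 4)]. *)
Lemma rint_step_diff y :
  (rint mu (fun x => step_diff x y ^+ 2)%R <= (16 / r)%:E)%E.
Proof.
have lin (c : R) : measurable_fun setT (fun x : R => step_err (2 * r * (c - x)) ^+ 2).
  apply: measurable_sq; apply: (measurableT_comp (@measurable_step_err R)).
  apply: measurable_funM => //; apply: measurable_funD => //; exact: oppr_measurable.
have ms : measurable_fun setT (fun x : R => step_diff x y ^+ 2).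
  by apply: measurable_sq; exact: (measurable_fun_slice1 y measurable_step_diff).
have mD := measurable_funD (lin t) (lin (t + y)).
have p0 x : 0 <= step_err (2 * r * (t - x)) ^+ 2 + step_err (2 * r * (t + y - x)) ^+ 2.
  by rewrite addr_ge0 ?sqr_ge0.
have le x : step_diff x y ^+ 2 <=
    2 * (step_err (2 * r * (t - x)) ^+ 2 + step_err (2 * r * (t + y - x)) ^+ 2).
  have -> : t + y - x = t - x + y by ring.
  have gen (u v : R) : (u - v) ^+ 2 <= 2 * (u ^+ 2 + v ^+ 2) by have := sqr_ge0 (u + v); nra.
  exact: gen.
apply: (@le_trans _ _ (2%:E * ((4 / r)%:E + (4 / r)%:E))%E); last first.
  by rewrite -EFinD -EFinM lee_fin le_eqVlt; apply/orP; left; apply/eqP; ring.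
have m2 := measurable_funM (measurable_cst (2 : R)) mD.
have K := @rint_le _ _ R mu _ _ ms m2 (fun x => sqr_ge0 _) le.
apply: (le_trans K); have two : 0 <= 2 :> R by [].
have Z := rintZ mu mD p0 two; have D := rintD mu (lin t) (lin (t + y)) (fun x => sqr_ge0 _) (fun x => sqr_ge0 _).
rewrite (_ : rint mu _ = (2%:E * (rint mu (fun x => step_err (2 * r * (t - x)) ^+ 2)%R +
  rint mu (fun x => step_err (2 * r * (t + y - x)) ^+ 2)%R))%E); last by rewrite -D; exact: Z.
by apply: lee_wpmul2l => //; apply: leeD; exact: rint_step_err.
Qed.

(** Minkowski's inequality with weight [normc h], of mass at most [A]. For [0 < x] the factor
    [expR (b * (t - x))] is below [expR (b * t)], and [rint_step_diff] bounds the remaining slice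
    for every [y]. *)
Lemma step_int_N2 :
  cmeas (pos step_int) /\ (N2 mu (pos step_int) <= (A ^+ 2 * (expR (b * t) ^+ 2 * (16 / r)))%:E)%E.
Proof.
have [sg [msg sg1 sgE]] := polar_decomposition L1h.1.
have mm := measurable_normc L1h.1; have m0 y : 0 <= normc (h y) := normc_ge0 _.
pose F (q : RR * RR) : R[i] :=
  (if 0 < q.2 then (expR (b * (t - q.2)) * step_diff q.2 q.1)%:C else 0) * sg q.1.
have mF : cmeas F.
  apply: cmeasM; last exact: (cmeas_comp msg measurable_fst).
  apply: cmeas_if; [|apply: cmeas_real|exact: cmeas_cst].
    by apply: measurable_fun_ltr; [exact: measurable_cst|exact: measurable_snd].
  apply: measurable_funM measurable_step_diff.
  apply: (measurableT_comp (@measurable_expR R)); apply: measurable_funM; first exact: measurable_cst.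
  by apply: measurable_funB; [exact: measurable_cst|exact: measurable_snd].
have E : pos step_int = fun x => cI mu (fun y => (normc (h y))%:C * F (y, x)).
  apply/funext => x; rewrite /pos /F /=; case: ifP => x0; last first.
    by rewrite -[LHS](cI0 mu); apply: cI_eq => y; rewrite mul0r mulr0.
  rewrite /step_int -(cIZ (expR (b * (t - x)))%:C (step_diff_L1 x)); apply: cI_eq => y.
  by rewrite [in LHS](sgE y) rmorphM; ring.
have NF y : (N2 mu (fun x => F (y, x)) <= (expR (b * t) ^+ 2 * (16 / r))%:E)%E.
  have ms : measurable_fun setT (fun x : R => step_diff x y ^+ 2).
    by apply: measurable_sq; exact: (measurable_fun_slice1 y measurable_step_diff).
  have le x : normc (F (y, x)) ^+ 2 <= expR (b * t) ^+ 2 * step_diff x y ^+ 2.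
    rewrite -exprMn -[leRHS]real_normK ?num_real// ler_pXn2r ?nnegrE ?normc_ge0//.
    rewrite /F /= normcM; case: ifP => x0; last by rewrite normc0 mul0r.
    rewrite normc_real !normrM !(ger0_norm (expR_ge0 _)); apply: le_trans (ler_piMr _ (sg1 y)) _.
      by rewrite mulr_ge0 ?expR_ge0.
    by rewrite ler_wpM2r// ler_expR; have := mulr_gt0 b0 x0; lra.
  have m2 := measurable_funM (measurable_cst (expR (b * t) ^+ 2)) ms.
  have m1 := measurable_normc_sq (cmeas_slice1 y mF).
  have K := @rint_le _ _ R mu _ _ m1 m2 (fun x => sqr_ge0 _) le.
  apply: (le_trans K).
  have Z := rintZ mu ms (fun x => sqr_ge0 _) (sqr_ge0 (expR (b * t))).
  have e0 : (0 < (expR (b * t) ^+ 2)%:E)%E by rewrite lte_fin exprn_gt0// expR_gt0.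
  rewrite (_ : rint mu _ = ((expR (b * t) ^+ 2)%:E * rint mu (fun x => step_diff x y ^+ 2)%R)%E); last exact: Z.
  by rewrite [leRHS]EFinM; apply: lee_wpmul2l; [exact: ltW|exact: rint_step_diff].
have mG : cmeas (fun q : RR * RR => (normc (h q.2))%:C * F (q.2, q.1)).
  apply: cmeasM; first by apply: cmeas_real; exact: (measurableT_comp mm measurable_snd).
  by apply: (cmeas_comp mF); apply: measurable_fun_pair; [exact: measurable_snd|exact: measurable_fst].
split; first by rewrite E; exact: (cmeas_cI mu mG).
rewrite E; apply: le_trans (minkowski_integral_sq (m1 := mu) mu mm m0 A0 hA mF) _.
have C0 : 0 <= expR (b * t) ^+ 2 * (16 / r) by rewrite mulr_ge0 ?sqr_ge0// divr_ge0// ltW.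
rewrite expr2 -mulrA EFinM lee_pmul2l//.
apply: (@le_trans _ _ (rint mu (fun y => expR (b * t) ^+ 2 * (16 / r) * normc (h y)))).
  apply: integral_le_rint.
  - by move=> y; apply: mule_ge0; [rewrite lee_fin|exact: N2_ge0].
  - apply: emeasurable_funM; first exact/measurable_EFinP.
    exact: (measurable_rint mu (measurable_normc_sq mF) (fun q => sqr_ge0 _)).
  - exact: (measurable_funM (measurable_cst _) mm).
  by move=> y; rewrite [leRHS]EFinM muleC; apply: lee_wpmul2r => //; rewrite lee_fin.
rewrite (rintZ mu mm m0 C0) [leRHS]EFinM muleC; apply: lee_wpmul2r => //.
Qed.

End step_estimate.

(** * The integral along a vertical line *)

Section inversion.
Context {R : realType} (T : R -> 'Fun(R) -> 'Fun(R)).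
Notation mu := (@lebesgue_measure R).
Notation RR := (measurableTypeR R).
Hypothesis semigroupT : C0_semigroup T.
Hypothesis TstarS : forall (t : R) (f : 'Fun(R)), 0 <= t -> L2 f ->
  adjoint_graph (T t) (shiftS t f) f.
Variable w : R.
Hypothesis w0 : 0 < w.
Hypothesis growth : forall t f, 0 <= t -> L2 f ->
  n2 (T t f) <= expR (2 * w * (t + 1)) * n2 f.
Local Notation Rz := (resol T).
Variable b : R.
Hypothesis wb : w < b.
Implicit Types (g : 'Fun(R)) (eta s t x y Y : R).

Let b0 : 0 < b := lt_trans w0 wb.

Let L1 g x : L2 g -> cL1 mu (past T b%:C g x).
Proof. by move=> Lg; exact: (past_L1 semigroupT TstarS w0 growth). Qed.

Lemma expC_cis eta y : expC ((b +i* eta) * y%:C) = (expR (b * y))%:C * cis (eta * y).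
Proof. by rewrite /expC cReMr cImMr. Qed.

Lemma past_line eta g x y : past T (b +i* eta) g x y = cis (eta * y) * past T b%:C g x y.
Proof.
rewrite /past; case: ifP => _; last by rewrite mulr0.
rewrite -[b%:C]/(b +i* 0) !expC_cis mul0r.
have -> : cis 0 = 1 :> R[i] by rewrite /cis cos0 sin0.
by rewrite mulr1 mulrA [cis _ * _]mulrC.
Qed.

Lemma mul_expR_le (c y : R) : 0 < c -> 0 <= y -> y * expR (- c * y) <= c^-1.
Proof.
move=> c0 y0; rewrite -(ler_pM2l c0) mulfV ?gt_eqF// mulrA mulNr expRN ler_pdivrMr ?expR_gt0//.
by rewrite mul1r; apply: le_trans (expR_ge1Dx _); rewrite lerDr.
Qed.

(** Lowering the abscissa from [b] to the midpoint [b'] of [w] and [b] keeps integrability and frees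
    a factor [expR (c * y)], which absorbs [y] on the negative axis. This first moment makes [phi]
    Lipschitz and justifies the exchange in [si_fubini]. *)
Lemma past_moment g : L2 g -> cL1 mu (fun y => y%:C * past T b%:C g 0 y).
Proof.
move=> Lg; pose c := (b - w) / 2; have c0 : 0 < c by rewrite divr_gt0// subr_gt0.
pose b' := b - c; have wb' : w < b' by rewrite /b' /c; move: wb; lra.
have [m' j'] := past_L1 semigroupT TstarS w0 growth 0 (z := b'%:C) wb' Lg.
have mn := measurable_normc m'.
have ci : 0 <= c^-1 by rewrite invr_ge0 ltW.
have pw y : y < 0 -> normc (y%:C * (expC (b%:C * y%:C) * profile T g y)) <=
    c^-1 * normc (expC (b'%:C * y%:C) * profile T g y).
  move=> y0; rewrite normcM (normcM (expC (b%:C * _))) (normcM (expC (b'%:C * _))).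
  rewrite !normc_expC !cReMr normc_real -[complex.Re b%:C]/b -[complex.Re b'%:C]/b'.
  rewrite mulrA mulrA ler_wpM2r ?normc_ge0//.
  have -> : expR (b * y) = expR (- c * - y) * expR (b' * y).
    by rewrite -expRD; congr expR; rewrite /b'; ring.
  rewrite mulrA ler_wpM2r ?expR_ge0// ltr0_norm//; apply: mul_expR_le => //.
  by rewrite oppr_ge0 ltW.
apply: (@cL1_le _ _ R mu _ (fun y => c^-1 * normc (past T b'%:C g 0 y))).
- by apply: cmeasM; [exact: cmeas_real|case: (L1 0 Lg)].
- exact: (measurable_funM (measurable_cst _) mn).
- move=> y; rewrite /past; case: ifP => y0; last by rewrite mulr0 normc0 mulr0.
  exact: pw.
- rewrite (rintZ mu mn (fun y => normc_ge0 _) ci); exact: lte_mul_pinfty.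
Qed.

(** The Fourier transform of the exponentially weighted profile on the negative axis; it is the
    boundary value of the resolvent at [b + i eta], see [phiE]. *)
Definition phi eta g : R[i] := cI mu (fun y => cis (eta * y) * past T b%:C g 0 y).

Lemma phiE eta g : phi eta g = Rz (b +i* eta) g 0.
Proof.
rewrite /resol mulr0 expC0 mul1r; apply: cI_eq => y; exact: esym (past_line _ _ _ _).
Qed.

Let Mf g := fine (rint mu (fun y => normc (past T b%:C g 0 y))).
Let Mm g := fine (rint mu (fun y => normc (y%:C * past T b%:C g 0 y))).

Lemma phi_L1 eta g : L2 g -> cL1 mu (fun y => cis (eta * y) * past T b%:C g 0 y).
Proof.
move=> Lg; have [m j] := L1 0 Lg; split.
  by apply: cmeasM => //; apply: cmeas_cis; exact: measurable_funM.
by under eq_fun do rewrite normcM normc_cis mul1r.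
Qed.

Lemma phi_bound eta g : L2 g -> normc (phi eta g) <= Mf g.
Proof.
move=> Lg; have [m j] := L1 0 Lg; have [m' _] := phi_L1 eta Lg.
rewrite -lee_fin; apply: le_trans (norm_cI mu m') _.
rewrite /Mf fine_rint//; last by move=> y; exact: normc_ge0.
by under eq_fun do rewrite normcM normc_cis mul1r.
Qed.

Lemma phi_lip eta eta' g : L2 g ->
  normc (phi eta g - phi eta' g) <= 2 * `|eta - eta'| * Mm g.
Proof.
move=> Lg; have [m j] := past_moment Lg; have mn := measurable_normc m.
have c0 : 0 <= 2 * `|eta - eta'| by rewrite mulr_ge0.
have p1 := phi_L1 eta Lg; have p2 := phi_L1 eta' Lg; have D := cIB p1 p2.
rewrite /phi -D.
apply: (@norm_cI_le _ _ R mu _ (fun y => 2 * `|eta - eta'| * normc (y%:C * past T b%:C g 0 y))).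
- by case: (cL1B p1 p2).
- exact: (measurable_funM (measurable_cst _) mn).
- move=> y; rewrite -mulrBl !normcM normc_real mulrA ler_wpM2r ?normc_ge0//.
  by apply: le_trans (cis_lip _ _) _; rewrite -mulrBl normrM mulrA.
- rewrite (rintZ mu mn (fun y => normc_ge0 _) c0) /Mm [leRHS]EFinM fine_rint//.
  by move=> y; exact: normc_ge0.
Qed.

Section formula.
Variables f k : 'Fun(R).
Hypotheses (Lf : L2 f) (Lk : L2 k).
Hypothesis fk : forall z, w < complex.Re z ->
  Rz b%:C k 0 = (z - b%:C) * Rz z f 0 + Rz z k 0.
Hypothesis fE : forall x, 0 <= x -> f x = Rz b%:C k x.

Local Notation kappa := (past T b%:C k 0).

(** The resolvent identity between [b] and [b + i eta], taken at [0], reads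
    [i eta * phi eta f = phi 0 k - phi eta k]. Here membership of [f] in the domain pays off, as
    decay of order [1 / eta]. *)
Lemma phi_quotient eta : eta != 0 ->
  phi eta f = cI mu (fun y => (1 - cis (eta * y)) * kappa y) / ('i%C * eta%:C).
Proof.
move=> e0; have wz : w < complex.Re (b +i* eta) by [].
have ie : 'i%C * eta%:C != 0 :> R[i].
  by rewrite mulf_eq0 negb_or neq0Ci /=; rewrite eq_complex /= negb_and e0.
have := fk wz; rewrite -!phiE => E.
have c0 := phi_L1 0 Lk; have c1 := phi_L1 eta Lk; have D := cIB c0 c1.
have -> : cI mu (fun y => (1 - cis (eta * y)) * kappa y) = phi 0 k - phi eta k.
  rewrite /phi -D; apply: cI_eq => y; rewrite mul0r mulrBl; congr (_ * _ - _).
  by rewrite /cis cos0 sin0.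
have e1 : (b +i* eta) - b%:C = 'i%C * eta%:C.
  by apply: ReImE; rewrite ?cReD ?cReN ?cImD ?cImN ?cReM ?cImM /=; ring.
by rewrite E e1 addrK mulrC mulKf.
Qed.

Definition line x eta : R[i] := expC ((b +i* eta) * x%:C) * phi eta f.

(** The term [e^(i eta Y) (1 - e^(i eta y)) / (i eta)] and its counterpart at [- eta] add up to [2
    (sin (eta Y) - sin (eta (Y + y))) / eta], a real kernel that stays bounded near [eta = 0]. *)
Lemma line_sym Y eta : eta != 0 ->
  line Y eta + line Y (- eta) = (expR (b * Y))%:C *
    cI mu (fun y => (2 * (sin (eta * Y) - sin (eta * (Y + y))) / eta)%:C * kappa y).
Proof.
move=> e0; have eN : - eta != 0 by rewrite oppr_eq0.
have ec : eta%:C != 0 :> R[i] by rewrite eq_complex /= negb_and e0.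
have i0 : 'i%C != 0 :> R[i] := neq0Ci _.
have [m j] := L1 0 Lk.
have Lq (e : R) : cL1 mu (fun y => (1 - cis (e * y)) * kappa y).
  have := cL1B (phi_L1 0 Lk) (phi_L1 e Lk).
  by under [X in cL1 mu X]eq_fun => y do (rewrite mul0r -mulrBl {1}/cis cos0 sin0).
have pw y : cis (eta * Y) / ('i%C * eta%:C) * ((1 - cis (eta * y)) * kappa y) +
    cis (- eta * Y) / ('i%C * (- eta)%:C) * ((1 - cis (- eta * y)) * kappa y) =
    (2 * (sin (eta * Y) - sin (eta * (Y + y))) / eta)%:C * kappa y.
  have s1 := cis_sub (eta * Y); have s2 := cis_sub (eta * (Y + y)).
  rewrite mulrDr opprD !cisD in s2.
  have -> : (2 * (sin (eta * Y) - sin (eta * (Y + y))) / eta)%:C =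
      ((2 * sin (eta * Y))%:C - (2 * sin (eta * (Y + y)))%:C) / eta%:C :> R[i].
    by apply: (mulIf ec); rewrite divfK// -rmorphM -rmorphB; congr (_ %:C); field.
  rewrite !mulrA -mulrDl; congr (_ * _); rewrite !mulNr.
  apply: (mulfI ec); apply: (mulfI i0).
  have -> : 'i%C * (eta%:C * (((2 * sin (eta * Y))%:C - (2 * sin (eta * (Y + y)))%:C) / eta%:C)) =
      'i%C * (2 * sin (eta * Y))%:C - 'i%C * (2 * sin (eta * (Y + y)))%:C.
    by rewrite [_ / eta%:C]mulrC mulVKf// mulrBr.
  rewrite [eta * (Y + y)]mulrDr -s1 -s2 rmorphN; field.
  by rewrite ec i0.
rewrite /line !expC_cis !phi_quotient// -!mulrA -mulrDr; congr (_ * _).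
have E1 := cIZ (cis (eta * Y) / ('i%C * eta%:C)) (Lq eta).
have E2 := cIZ (cis (- eta * Y) / ('i%C * (- eta)%:C)) (Lq (- eta)).
have D := cID (cL1Z (cis (eta * Y) / ('i%C * eta%:C)) (Lq eta))
  (cL1Z (cis (- eta * Y) / ('i%C * (- eta)%:C)) (Lq (- eta))).
have R1 : cis (eta * Y) * (cI mu (fun y => (1 - cis (eta * y)) * kappa y) / ('i%C * eta%:C)) =
    cis (eta * Y) / ('i%C * eta%:C) * cI mu (fun y => (1 - cis (eta * y)) * kappa y).
  by rewrite mulrA mulrAC.
have R2 : cis (- eta * Y) * (cI mu (fun y => (1 - cis (- eta * y)) * kappa y) / ('i%C * (- eta)%:C)) =
    cis (- eta * Y) / ('i%C * (- eta)%:C) * cI mu (fun y => (1 - cis (- eta * y)) * kappa y).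
  by rewrite mulrA mulrAC.
rewrite R1 R2 -E1 -E2 -D; apply: cI_eq => y; exact: pw.
Qed.

Lemma line_bound Y eta : normc (line Y eta) <= expR (b * Y) * Mf f.
Proof.
rewrite /line expC_cis (normcM (_ * _)) (normcM (_%:C)) normc_cis mulr1 normc_real.
by rewrite ger0_norm ?expR_ge0// ler_wpM2l ?expR_ge0// phi_bound.
Qed.

Lemma Mf_ge0 : 0 <= Mf f.
Proof. exact: le_trans (normc_ge0 _) (phi_bound 0 Lf). Qed.

Lemma Mm_ge0 : 0 <= Mm f.
Proof. by apply: fine_ge0; apply: rint_ge0 => y; exact: normc_ge0. Qed.

Lemma line_lip Y eta eta' : normc (line Y eta - line Y eta') <=
  expR (b * Y) * (2 * `|eta - eta'| * (`|Y| * Mf f + Mm f)).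
Proof.
rewrite /line !expC_cis -!mulrA -mulrBr (normcM (_%:C)) normc_real ger0_norm ?expR_ge0//.
rewrite ler_wpM2l ?expR_ge0//.
have -> : cis (eta * Y) * phi eta f - cis (eta' * Y) * phi eta' f =
    (cis (eta * Y) - cis (eta' * Y)) * phi eta f + cis (eta' * Y) * (phi eta f - phi eta' f).
  by ring.
have -> : 2 * (`|eta - eta'| * (`|Y| * Mf f + Mm f)) =
    2 * `|eta - eta'| * `|Y| * Mf f + 2 * `|eta - eta'| * Mm f by ring.
apply: le_trans (le_normcD _ _) _; apply: lerD; last first.
  by rewrite normcM normc_cis mul1r; exact: phi_lip.
rewrite normcM; apply: ler_pM; rewrite ?normc_ge0 ?phi_bound//.
by apply: le_trans (cis_lip _ _) _; rewrite -mulrBl normrM mulrA.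
Qed.

Lemma cmeas_phi : cmeas (fun eta => phi eta f).
Proof.
have [m _] := L1 0 Lf.
suff mF : cmeas (fun q : RR * RR => cis (q.1 * q.2) * past T b%:C f 0 q.2).
  exact: (cmeas_cI mu mF).
apply: cmeasM; last exact: (cmeas_comp m measurable_snd).
by apply: cmeas_cis; apply: measurable_funM; [exact: measurable_fst|exact: measurable_snd].
Qed.

Variables (t r : R).
Hypotheses (t0 : 0 < t) (r0 : 0 < r).

(** The integrand of the formula at [z = b + i r (2 s - 1)] times the derivative [2 i r] of the
    parametrisation; [e^(zt)] and [e_ z x] are merged into [e^(z (t - x))]. *)
Definition seg s x : R[i] := (0 +i* (2 * r)) * line (t - x) (r * (2 * s - 1)).

(** Dominates both [seg] and its Lipschitz constant in [s]. The term [2 r Mf] is the size; in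
    [8 r^2] one factor [2 r] comes from the segment, another from [eta], and [2] from [cis_lip].
    Half of the decay of [expR (- b * x)] is spent on the factor [|t - x|], whence [2 / b] and the
    exponent [b / 2]. *)
Definition segQ x : R :=
  expR (b * t) * (2 * r * Mf f + 8 * r ^+ 2 * ((t + 2 / b) * Mf f + Mm f)) *
  expR (- (b / 2) * x).

Lemma segQ_ge0 x : 0 <= segQ x.
Proof.
have M0 := Mf_ge0; have M1 := Mm_ge0.
have c1 : 0 <= (t + 2 / b) * Mf f.
  by apply: mulr_ge0 => //; rewrite addr_ge0 ?divr_ge0 ?ltW.
have r2 : 0 <= 2 * r by rewrite mulr_ge0// ltW.
have r8 : 0 <= 8 * r ^+ 2 by rewrite mulr_ge0// sqr_ge0.
have c2 := addr_ge0 c1 M1; have c3 := addr_ge0 (mulr_ge0 r2 M0) (mulr_ge0 r8 c2).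
exact: mulr_ge0 (mulr_ge0 (expR_ge0 _) c3) (expR_ge0 _).
Qed.

Lemma segQ_L2 : L2 (fun x => (segQ x)%:C).
Proof.
have z0 : 0 < complex.Re ((b / 2)%:C : R[i]) by rewrite /= divr_gt0.
set C := expR (b * t) * (2 * r * Mf f + 8 * r ^+ 2 * ((t + 2 / b) * Mf f + Mm f)).
rewrite (_ : (fun x => _) = fun x => C%:C * e_ (b / 2)%:C x); first exact: (L2Z C%:C (L2_e z0)).
apply/funext => x; rewrite /segQ -/C rmorphM; congr (_ * _).
by rewrite /e_ /expC cReMr cImMr cReN cImN /= oppr0 mul0r cos0 sin0 mulr1.
Qed.

Lemma normc_imag (a : R) : normc (0 +i* a) = `|a|.
Proof. by rewrite /= expr0n /= add0r sqrtr_sqr. Qed.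

Lemma exp_seg x : 0 < x -> expR (b * (t - x)) <= expR (b * t) * expR (- (b / 2) * x).
Proof. by move=> x0; rewrite -expRD ler_expR; have := b0; nra. Qed.

Lemma exp_seg_mul x : 0 < x ->
  expR (b * (t - x)) * `|t - x| <= expR (b * t) * (t + 2 / b) * expR (- (b / 2) * x).
Proof.
move=> x0; have bn : b != 0 by rewrite gt_eqF.
have h2 : 0 < b / 2 by rewrite divr_gt0.
have e1 : expR (b * (t - x)) = expR (b * t) * (expR (- (b / 2) * x) * expR (- (b / 2) * x)).
  by rewrite -!expRD; congr expR; field.
have hk := mul_expR_le h2 (ltW x0); rewrite invf_div in hk.
have h3 := ltW (mulr_gt0 h2 x0).
have E1 : expR (- (b / 2) * x) <= 1 by rewrite -[leRHS]expR0 ler_expR mulNr oppr_le0.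
have E0 := expR_ge0 (- (b / 2) * x).
have -> : expR (b * (t - x)) * `|t - x| = expR (b * t) * (`|t - x| * expR (- (b / 2) * x)) *
    expR (- (b / 2) * x) by rewrite e1; ring.
apply: (ler_wpM2r E0); apply: ler_wpM2l; first exact: expR_ge0.
have tx : `|t - x| <= t + x.
  by apply: le_trans (ler_normB _ _) _; rewrite !gtr0_norm.
apply: le_trans (ler_wpM2r E0 tx) _.
by rewrite mulrDl lerD// ler_piMr// ltW.
Qed.

Lemma seg_bound s x : 0 < x -> normc (seg s x) <= segQ x.
Proof.
move=> x0; rewrite /seg normcM normc_imag ger0_norm; last by rewrite mulr_ge0// ltW.
have M0 := Mf_ge0; have M1 := Mm_ge0.
apply: le_trans (ler_wpM2l _ (line_bound _ _)) _; first by rewrite mulr_ge0// ltW.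
have e := exp_seg x0.
have c1 : 0 <= (t + 2 / b) * Mf f.
  by apply: mulr_ge0 => //; rewrite addr_ge0 ?divr_ge0 ?ltW.
have rM : 0 <= 2 * r * Mf f by rewrite mulr_ge0// mulr_ge0// ltW.
apply: (@le_trans _ _ (2 * r * Mf f * (expR (b * t) * expR (- (b / 2) * x)))).
  have -> : 2 * r * (expR (b * (t - x)) * Mf f) = 2 * r * Mf f * expR (b * (t - x)) by ring.
  exact: (ler_wpM2l rM).
rewrite /segQ mulrCA mulrA ler_wpM2r ?expR_ge0// ler_wpM2l ?expR_ge0// lerDl.
by rewrite mulr_ge0 ?addr_ge0// mulr_ge0// sqr_ge0.
Qed.

Lemma seg_lip s s' x : 0 < x -> normc (seg s x - seg s' x) <= `|s - s'| * segQ x.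
Proof.
move=> x0; rewrite /seg -mulrBr normcM normc_imag ger0_norm; last by rewrite mulr_ge0// ltW.
have M0 := Mf_ge0; have M1 := Mm_ge0; have r2 : 0 <= 2 * r by rewrite mulr_ge0// ltW.
apply: le_trans (ler_wpM2l r2 (line_lip _ _ _)) _.
have -> : r * (2 * s - 1) - r * (2 * s' - 1) = 2 * r * (s - s') by ring.
rewrite (normrM (2 * r)) (ger0_norm r2).
have e1 := exp_seg x0; have e2 := exp_seg_mul x0; have d0 := normr_ge0 (s - s').
have rM : 0 <= 2 * r * Mf f by rewrite mulr_ge0.
have E0 := expR_ge0 (b * t); have E1 := expR_ge0 (- (b / 2) * x).
have -> : 2 * r * (expR (b * (t - x)) * (2 * (2 * r * `|s - s'|) * (`|t - x| * Mf f + Mm f))) =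
  `|s - s'| * (8 * r ^+ 2 * (expR (b * (t - x)) * `|t - x| * Mf f + expR (b * (t - x)) * Mm f)).
  by ring.
rewrite ler_wpM2l//.
apply: (@le_trans _ _ (8 * r ^+ 2 * (expR (b * t) * (t + 2 / b) * expR (- (b / 2) * x) * Mf f +
    expR (b * t) * expR (- (b / 2) * x) * Mm f))).
  apply: ler_wpM2l; first by rewrite mulr_ge0// sqr_ge0.
  by apply: lerD; apply: ler_wpM2r.
have -> : 8 * r ^+ 2 * (expR (b * t) * (t + 2 / b) * expR (- (b / 2) * x) * Mf f +
    expR (b * t) * expR (- (b / 2) * x) * Mm f) =
  expR (b * t) * (8 * r ^+ 2 * ((t + 2 / b) * Mf f + Mm f)) * expR (- (b / 2) * x) by ring.
by rewrite /segQ ler_wpM2r// ler_wpM2l// lerDr.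
Qed.

Lemma cmeas_seg : cmeas (fun q : RR * RR => seg q.1 q.2).
Proof.
have me : measurable_fun setT (fun q : RR * RR => r * (2 * q.1 - 1) : R).
  apply: measurable_funM; first exact: measurable_cst.
  apply: measurable_funB; last exact: measurable_cst.
  by apply: measurable_funM; [exact: measurable_cst|exact: measurable_fst].
have mY : measurable_fun setT (fun q : RR * RR => t - q.2 : R).
  by apply: measurable_funB; [exact: measurable_cst|exact: measurable_snd].
apply: cmeasM; first exact: cmeas_cst.
have -> : (fun q : RR * RR => line (t - q.2) (r * (2 * q.1 - 1))) = fun q =>
    (expR (b * (t - q.2)))%:C * cis (r * (2 * q.1 - 1) * (t - q.2)) * phi (r * (2 * q.1 - 1)) f.
  by apply/funext => q; rewrite /line expC_cis.
apply: cmeasM; last exact: (cmeas_comp cmeas_phi me).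
apply: cmeasM; last by apply: cmeas_cis; exact: measurable_funM.
apply: cmeas_real; apply: (measurableT_comp (@measurable_expR R)).
exact: (measurable_funM (measurable_cst b) mY).
Qed.

Definition si_kernel Y (q : RR * RR) : R[i] :=
  (sincut (2 * r * Y) q.1 - sincut (2 * r * (Y + q.2)) q.1)%:C * kappa q.2.

Lemma cmeas_si_kernel Y : cmeas (si_kernel Y).
Proof.
have [mk jk] := L1 0 Lk.
have mg : measurable_fun setT (fun q : RR * RR => (2 * r * (Y + q.2), q.1) : RR * RR).
  apply: measurable_fun_pair; last exact: measurable_fst.
  apply: measurable_funM; first exact: measurable_cst.
  by apply: measurable_funD; [exact: measurable_cst|exact: measurable_snd].
apply: cmeasM; last exact: (cmeas_comp mk measurable_snd).
apply: cmeas_real; apply: measurable_funB.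
  exact: (measurableT_comp (measurable_sincut (2 * r * Y)) measurable_fst).
exact: (measurableT_comp (@measurable_sincut2 R) mg).
Qed.

Lemma si_kernel_le Y (s y : R) : normc (si_kernel Y (s, y)) <=
  2 * r * ((0 < s) && (s < 2^-1))%:R * normc (y%:C * kappa y).
Proof.
have r2 : 0 <= 2 * r by rewrite mulr_ge0// ltW.
rewrite (normcM (_%:C)) (normcM y%:C) !normc_real mulrA ler_wpM2r ?normc_ge0//.
apply: le_trans (sincut_lip _ _ _) _.
by rewrite /= -mulrBr opprD addNKr normrM normrN (ger0_norm r2) mulrAC.
Qed.

Lemma si_kernel_slice Y s : cL1 mu (fun y => si_kernel Y (s, y)).
Proof.
have c0 : 0 <= 2 * r * ((0 < s) && (s < 2^-1))%:R :> R.
  by rewrite mulr_ge0 ?ler0n// mulr_ge0// ltW.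
have [my jy] := past_moment Lk; have mn := measurable_normc my.
apply: (@cL1_le _ _ R mu _ _ (cmeas_slice1 s (cmeas_si_kernel Y)) (measurable_funM (measurable_cst _) mn)).
  by move=> y; exact: si_kernel_le.
by rewrite (rintZ mu mn (fun y => normc_ge0 _) c0); exact: lte_mul_pinfty.
Qed.

(** The two cut sines differ by at most [2 r |y|] on []0, 1/2[], so the first moment of [kappa]
    gives absolute integrability in both variables. *)
Lemma si_kernel_fin Y : (\int[mu]_s rint mu (fun y => normc (si_kernel Y (s, y))) < +oo)%E.
Proof.
have [my jy] := past_moment Lk; have mn := measurable_normc my; have mF := cmeas_si_kernel Y.
have r2 : 0 <= 2 * r by rewrite mulr_ge0// ltW.
have mI := measurable_between_nat 0 (2^-1 : R).
apply: (@le_lt_trans _ _ (rint mu (fun s => 2 * r * Mm k * ((0 < s) && (s < 2^-1))%:R))).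
  apply: integral_le_rint.
  - by move=> s; apply: rint_ge0 => y; exact: normc_ge0.
  - exact: (measurable_rint mu (measurable_normc mF) (fun q => normc_ge0 _)).
  - exact: (measurable_funM (measurable_cst _) mI).
  move=> s; have c0 : 0 <= 2 * r * ((0 < s) && (s < 2^-1))%:R :> R by rewrite mulr_ge0 ?ler0n.
  apply: (@le_trans _ _ (rint mu (fun y => 2 * r * ((0 < s) && (s < 2^-1))%:R * normc (y%:C * kappa y)))).
    apply: rint_le; [exact: (measurable_normc (cmeas_slice1 s mF))|
      exact: (measurable_funM (measurable_cst _) mn)|by move=> y; exact: normc_ge0|exact: si_kernel_le].
  rewrite (rintZ mu mn (fun y => normc_ge0 _) c0) /Mm.
  have -> : rint mu (fun y => normc (y%:C * kappa y)) =
      (fine (rint mu (fun y => normc (y%:C * kappa y))))%:E.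
    by rewrite fine_rint// => y; exact: normc_ge0.
  by rewrite -EFinM lee_fin mulrAC.
have M1 : 0 <= 2 * r * Mm k by rewrite mulr_ge0//; apply: fine_ge0; apply: rint_ge0 => y; exact: normc_ge0.
by rewrite (rintZ mu mI (fun s => ler0n _ _) M1) (rint_between (@half0 R)) -EFinM ltry.
Qed.

Lemma si_fubini Y : cI mu (fun s => cI mu (fun y => si_kernel Y (s, y))) =
  cI mu (fun y => (Si (2 * r * Y) - Si (2 * r * (Y + y)))%:C * kappa y).
Proof.
rewrite (cI_fubini (m1 := mu) (m2 := mu) (cmeas_si_kernel Y) (si_kernel_fin Y)).
apply: cI_eq => y.
have E s : si_kernel Y (s, y) =
    kappa y * ((sincut (2 * r * Y) s)%:C - (sincut (2 * r * (Y + y)) s)%:C).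
  by rewrite /si_kernel/= mulrC rmorphB.
have c1 := sincut_cL1 (2 * r * Y); have c2 := sincut_cL1 (2 * r * (Y + y)).
rewrite (cI_eq mu E) (cIZ (kappa y) (cL1B c1 c2)) (cIB c1 c2) !cI_realC mulrC.
by rewrite -rmorphB.
Qed.

Lemma cmeas_line Y : cmeas (line Y).
Proof.
have -> : line Y = fun eta => (expR (b * Y))%:C * cis (eta * Y) * phi eta f.
  by apply/funext => eta; rewrite /line expC_cis.
apply: cmeasM cmeas_phi; apply: cmeasM; first exact: cmeas_cst.
by apply: cmeas_cis; exact: (measurable_funM (@measurable_id _ _ _) (measurable_cst Y)).
Qed.

Lemma line_int Y : Int 0 1 (fun s => line Y (r * (2 * s - 1))) =
  (expR (b * Y) / r)%:C * cI mu (fun y => (Si (2 * r * Y) - Si (2 * r * (Y + y)))%:C * kappa y).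
Proof.
pose h s := line Y (2 * r * s).
have mh : cmeas h.
  by apply: (cmeas_comp (cmeas_line Y)); exact: measurable_funM.
(* Recentre the parameter: [r (2 s - 1) = 2 r (s - 1/2)], after which the interval is symmetric
   about [0]. *)
have -> : Int 0 1 (fun s => line Y (r * (2 * s - 1))) = Int 0 1 (fun s => h (s - 2^-1)).
  by congr (Int 0 1); apply/funext => s; rewrite /h; congr line; field.
rewrite -Int_shift// sub0r.
have -> : 1 - 2^-1 = 2^-1 :> R by field.
rewrite (Int_symmetric (@half0 R) mh (fun s => line_bound _ _)) -si_fubini.
have M0 := cL1_cI (cmeas_si_kernel Y) (si_kernel_fin Y).
rewrite -(cIZ _ M0) /Int; apply: cI_eq => s; rewrite /iv.
case: ifP => [/andP[s0 s1]|ns]; last first.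
  have -> : (fun y => si_kernel Y (s, y)) = fun=> 0.
    by apply/funext => y; rewrite /si_kernel/= /sincut ns subrr mul0r.
  by rewrite (cI0 mu) mulr0.
have s2 : 2 * r * s != 0 by rewrite !mulf_neq0 ?gt_eqF.
rewrite /h mulrN (line_sym Y s2) [(expR (b * Y) / r)%:C]rmorphM -[RHS]mulrA; congr (_ * _).
rewrite -(cIZ (r^-1)%:C (si_kernel_slice Y s)); apply: cI_eq => y.
rewrite /si_kernel [RHS]mulrA -rmorphM; congr (_%:C * _).
rewrite /sincut s0 s1 /= [2 * r * Y * s]mulrAC [2 * r * (Y + y) * s]mulrAC; field.
by rewrite !gt_eqF.
Qed.

Lemma riemann_formula x :
  (2%:R * pi%:C * 'i%C)^-1 * riemann_int seg x = (expR (b * (t - x)))%:C *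
    cI mu (fun y => ((Si (2 * r * (t - x)) - Si (2 * r * (t - x + y))) / pi)%:C * kappa y).
Proof.
have c : cL1 mu (fun y => (Si (2 * r * (t - x)) - Si (2 * r * (t - x + y)))%:C * kappa y).
  exact: Si_diff_L1 (L1 0 Lk).
have l : cL1 mu (iv 0 1 (fun s => line (t - x) (r * (2 * s - 1)))).
  apply: (cL1_iv_bounded ler01 _ (fun s => line_bound _ _)).
  apply: (cmeas_comp (cmeas_line _)).
  apply: measurable_funM; first exact: measurable_cst.
  by apply: measurable_funB; [exact: measurable_funM|exact: measurable_cst].
have -> : riemann_int seg x = (0 +i* (2 * r)) * Int 0 1 (fun s => line (t - x) (r * (2 * s - 1))).
  rewrite /riemann_int /Int -(cIZ _ l); apply: cI_eq => s; rewrite /iv /seg.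
  by case: ifP => // _; rewrite mulr0.
rewrite line_int.
have -> : cI mu (fun y => ((Si (2 * r * (t - x)) - Si (2 * r * (t - x + y))) / pi)%:C * kappa y) =
    (pi^-1)%:C * cI mu (fun y => (Si (2 * r * (t - x)) - Si (2 * r * (t - x + y)))%:C * kappa y).
  by rewrite -(cIZ (pi^-1)%:C c); apply: cI_eq => y; rewrite [RHS]mulrA -rmorphM [pi^-1 * _]mulrC.
rewrite !mulrA; congr (_ * _).
have -> : 0 +i* (2 * r) = 'i%C * (2%:R * r%:C) :> R[i].
  by apply: ReImE; rewrite ?cReM ?cImM /=; ring.
rewrite [(expR _ / r)%:C]rmorphM fmorphV [X in _ = _ * X]fmorphV.
have rc : r%:C != 0 :> R[i] by rewrite eq_complex /= negb_and gt_eqF.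
have pc : pi%:C != 0 :> R[i] by rewrite eq_complex /= negb_and gt_eqF ?pi_gt0.
have i0 : 'i%C != 0 :> R[i] := neq0Ci _.
(* The constants collapse to [1 / pi]: [2 i r] from the segment, [1 / r] from [line_int], and
   [1 / (2 pi i)] in front. *)
have key (P Q I E : R[i]) : P != 0 -> Q != 0 -> I != 0 ->
    (2%:R * P * I)^-1 * (I * (2%:R * Q)) * (E / Q) = E / P.
  by move=> P0 Q0 I0; field; rewrite P0 Q0 I0.
exact: key.
Qed.

(** What [T t f] holds on []0, t[]: the profile of [f] at the negative point [x - t], expressed
    through [f = R(b) k]. *)
Definition carry x : R[i] :=
  if x < t then (expR (b * (t - x)))%:C * cI mu (past T b%:C k (x - t)) else 0.

(** From [f = R(b) k] follows [T_t f = R(b) T_t k], whose past integral at [x] is that of [k] at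
    [x - t]. For [x >= t] this is [f (x - t)], the shift; for [x < t] it is [carry]. *)
Lemma carry_eq : eqL2 (T t f) (fun x => shiftS t f x + carry x).
Proof.
have wb' : w < complex.Re b%:C by [].
have LR := resol_L2 semigroupT TstarS w0 growth wb' Lk.
have LTk := T_L2 semigroupT (ltW t0) Lk; have LTf := T_L2 semigroupT (ltW t0) Lf.
have fR : eqL2 f (Rz b%:C k).
  apply/eqL2P; apply: aeW => x; rewrite /pos; case: ifP => // x0; exact: fE (ltW x0).
apply: eqL2_trans (T_eqL2 semigroupT (ltW t0) Lf LR fR) _.
apply: eqL2_trans (resol_T semigroupT TstarS w0 growth wb' (ltW t0) Lk) _.
apply/eqL2P; apply: aeW => x; rewrite /pos; case: ifP => // x0.
rewrite /resol (past_shift semigroupT TstarS w0 growth x wb' (ltW t0) Lk) mulrA -expCD.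
have -> : - b%:C * x%:C + b%:C * t%:C = (b * (t - x))%:C.
  by rewrite rmorphM rmorphB; ring.
have eR (c : R) : expC c%:C = (expR c)%:C by rewrite /expC /= cos0 sin0 mulr1.
rewrite eR /shiftS /carry; case: ltP => xt; first by rewrite add0r.
rewrite addr0 fE ?subr_ge0// /resol; congr (_ * _).
by rewrite -eR; congr expC; rewrite rmorphM !rmorphB; ring.
Qed.

Lemma step_carry x : (2%:R * pi%:C * 'i%C)^-1 * riemann_int seg x - carry x =
  step_int kappa b t r x.
Proof.
rewrite riemann_formula /step_int.
(* For [y < 0] this is the indicator of [x < t] together with [y <= x - t]; it agrees with the
   cut-off in [carry] except at the single point [y = x - t]. *)
pose ind y : R := (0 < t - x)%R%:R - (0 < t - x + y)%R%:R.
have [mk jk] := L1 0 Lk.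
have mi : measurable_fun setT ind.
  apply: measurable_funB; first exact: measurable_cst.
  rewrite (_ : (fun y : R => (0 < t - x + y)%R%:R) = fun y => if 0 < t - x + y then 1 else 0).
    apply: measurable_fun_ifT => //; apply: measurable_fun_ltr => //.
    by apply: measurable_funD.
  by apply/funext => y; case: ifP.
have c2 : cL1 mu (fun y => (ind y)%:C * kappa y).
  apply: (@cL1_bounded_mul _ ind kappa 1 mi _ (L1 0 Lk)) => y; rewrite /ind.
  by case: (0 < t - x); case: (0 < t - x + y); rewrite ?subrr ?subr0 ?sub0r ?normrN ?normr0 ?normr1.
have c1 := cL1Z (pi^-1)%:C (Si_diff_L1 r (t - x) (L1 0 Lk)).
have -> : carry x = (expR (b * (t - x)))%:C * cI mu (fun y => (ind y)%:C * kappa y).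
  rewrite /carry; case: ltP => xt; last first.
    rewrite -[LHS](mulr0 (expR (b * (t - x)))%:C); congr (_ * _); rewrite -[LHS](cI0 mu).
    apply: cI_eq => y; rewrite /past; case: ifP => y0; last by rewrite mulr0.
    rewrite /ind !ltNge subr_le0 xt /= (_ : t - x + y <= 0) /= ?subrr ?mul0r//.
    by rewrite -[0]addr0 lerD// ?subr_le0// ltW.
  congr (_ * _); apply: cI_ae; [exact: cmeas_past|by case: c2|].
  apply: filterS (ae_neq (x - t)) => y /eqP yn; rewrite /past /ind subr_gt0 xt.
  have xt0 : x - t < 0 by rewrite subr_lt0.
  have -> : (0 < t - x + y) = ~~ (y < x - t).
    have -> : t - x + y = y - (x - t) by ring.
    by rewrite subr_gt0 -leNgt le_eqVlt eq_sym (negbTE yn).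
  case: ltP => yx; first by rewrite (lt_trans yx xt0) subr0 mul1r.
  by rewrite subrr mul0r.
have e1 : cI mu (fun y => ((Si (2 * r * (t - x)) - Si (2 * r * (t - x + y))) / pi)%:C * kappa y) =
    cI mu (fun y => (pi^-1)%:C * ((Si (2 * r * (t - x)) - Si (2 * r * (t - x + y)))%:C * kappa y)).
  by apply: cI_eq => y; rewrite [RHS]mulrA -rmorphM [pi^-1 * _]mulrC.
have D := cIB c1 c2.
rewrite e1 -mulrBr; congr (_ * _); rewrite -D; apply: cI_eq => y.
rewrite [X in X - _]mulrA -rmorphM -mulrBl -rmorphB; congr (_ %:C * _).
rewrite /step_diff /step_err /ind !(pmulr_rgt0 _ (mulr_gt0 (ltr0Sn R 1) r0)).
ring.
Qed.

Lemma riemann_seg_L2 : L2 (riemann_int seg).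
Proof.
apply: (riemann_int_L2 cmeas_seg segQ_L2 segQ_ge0).
by move=> s x _; exact: seg_bound.
Qed.

Lemma inversion_n2 A : 0 < A -> (rint mu (fun y => normc (kappa y)) <= A%:E)%E ->
  n2 (fun x => (2%:R * pi%:C * 'i%C)^-1 * riemann_int seg x - (T t f x - shiftS t f x)) <=
  A ^+ 2 * (expR (b * t) ^+ 2 * (16 / r)).
Proof.
move=> A0 hA; have LJ := L2Z (2%:R * pi%:C * 'i%C)^-1 riemann_seg_L2.
have LT := T_L2 semigroupT (ltW t0) Lf; have [LS _ _] := TstarS (ltW t0) Lf.
have [mS NS] := step_int_N2 t b0 r0 A0 (L1 0 Lk) hA.
have LST : L2 (step_int kappa b t r).
  by apply/L2P; split => //; exact: le_lt_trans NS (ltry _).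
rewrite (n2_eqL2 (L2B LJ (L2B LT LS)) LST); first exact: N2_n2_le LST NS.
have := carry_eq; move/eqL2P => E; apply/eqL2P; apply: filterS E => x.
rewrite /pos; case: ifP => // _ ->; rewrite -step_carry; ring.
Qed.

End formula.

Section inversion_limit.
Variables (f h f' : 'Fun(R)) (t : R).
Hypotheses (Gf : generator_graph T f h) (hf : primitive f f') (t0 : 0 < t).

Let k : 'Fun(R) := fun x => b%:C * f x - h x.

Lemma generator_L2 : L2 f /\ L2 h.
Proof. by have [Lf [_ Lh _]] := Gf. Qed.

(** [f] is its own continuous representative, so the almost everywhere identity of [generator_resol]
    holds at every point, in particular at [0]. *)
Lemma generator_pointwise z x : w < complex.Re z -> 0 <= x ->
  f x = Rz z (fun y => z * f y - h y) x.
Proof.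
move=> wz x0; have [Lf Lh] := generator_L2; have Lz := L2B (L2Z z Lf) Lh.
have hR := primitive_resol semigroupT TstarS w0 growth wz Lz.
exact: primitive_eqL2 hf hR (generator_resol semigroupT TstarS w0 growth wz Gf) x0.
Qed.

(** Apply [R(z)] to [k = (z f - h) - (z - b) f] and evaluate at [0], where both [R(z) (z f - h)] and
    [R(b) k] equal [f 0]. *)
Lemma generator_resol0 z : w < complex.Re z ->
  Rz b%:C k 0 = (z - b%:C) * Rz z f 0 + Rz z k 0.
Proof.
move=> wz; have [Lf Lh] := generator_L2; have wb' : w < complex.Re b%:C by [].
have E := generator_pointwise wz (lexx 0); rewrite /k -(generator_pointwise wb' (lexx 0)) E.
have B c := resolB semigroupT TstarS w0 growth 0 wz (L2Z c Lf) Lh.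
have Z c := resolZ semigroupT TstarS w0 growth c 0 wz Lf.
by rewrite !B !Z; ring.
Qed.

Lemma inversion_cvg : cvgL2 (pinfty_nbhs R)
  (fun r x => (2%:R * pi%:C * 'i%C)^-1 * riemann_int (seg f t r) x)
  (fun x => T t f x - shiftS t f x).
Proof.
have [Lf Lh] := generator_L2; have Lk : L2 k := L2B (L2Z b%:C Lf) Lh.
have wb' : w < complex.Re b%:C by [].
have LT := T_L2 semigroupT (ltW t0) Lf; have [LS _ _] := TstarS (ltW t0) Lf.
pose A := fine (rint mu (fun y => normc (past T b%:C k 0 y))) + 1.
have n0 y : 0 <= normc (past T b%:C k 0 y) := normc_ge0 _.
have A0 : 0 < A by rewrite ltr_wpDl//; apply: fine_ge0; apply: rint_ge0 => y; exact: n0.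
have hA : (rint mu (fun y => normc (past T b%:C k 0 y)) <= A%:E)%E.
  have [_ j] := L1 0 Lk.
  have -> : rint mu (fun y => normc (past T b%:C k 0 y)) =
      (fine (rint mu (fun y => normc (past T b%:C k 0 y))))%:E by rewrite fine_rint.
  by rewrite lee_fin lerDl.
have C0 : 0 <= A ^+ 2 * (expR (b * t) ^+ 2 * 16) by rewrite mulr_ge0 ?sqr_ge0// mulr_ge0 ?sqr_ge0.
apply: n2_cvgL2; first exact: L2B LT LS.
(* Beyond this value of [r] the bound of [inversion_n2] is at most [e]. *)
move=> e e0; exists (A ^+ 2 * (expR (b * t) ^+ 2 * 16) / e); split; first exact: num_real.
move=> r hr; have r0 : 0 < r by apply: le_lt_trans hr; rewrite divr_ge0// ltW.
split; first exact: L2Z (riemann_seg_L2 Lf t0 r0).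
apply: le_trans (inversion_n2 Lf Lk generator_resol0 (fun x => generator_pointwise wb') t0 r0 A0 hA) _.
have -> : A ^+ 2 * (expR (b * t) ^+ 2 * (16 / r)) = A ^+ 2 * (expR (b * t) ^+ 2 * 16) / r by ring.
by move: hr; rewrite ltr_pdivrMr// ler_pdivrMr// [e * r]mulrC => /ltW.
Qed.

(** Tagged sums of [F] along the segment are tagged sums of [seg] over [[0, 1]], since increments of
    [segment_pt] are [2 i r] times increments of [s]. *)
Lemma segment_seg (F : R[i] -> 'Fun(R)) r : 0 < r ->
  (forall z x, w < complex.Re z -> F z x = expC (z * t%:C) * Rz z f 0 * e_ z x) ->
  segment_integral F (b -i* r) (b +i* r) (riemann_int (seg f t r)).
Proof.
move=> r0 hF; have [Lf _] := generator_L2.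
have E s : segment_pt (b -i* r) (b +i* r) s = b +i* (r * (2 * s - 1)).
  by apply: ReImE; rewrite /segment_pt !(cReD, cReM, cReN, cImD, cImM, cImN) /=; ring.
have EF s x : F (segment_pt (b -i* r) (b +i* r) s) x = line f (t - x) (r * (2 * s - 1)).
  rewrite hF E// /line phiE mulrAC -expCD; congr (expC _ * _).
  by rewrite [(t - x)%:C]rmorphB; ring.
have c0 : 0 +i* (2 * r) != 0 :> R[i].
  by rewrite eq_complex /= eqxx /= mulf_neq0// gt_eqF.
have mG := cmeas_seg Lf t r; have LQ := segQ_L2 f t r; have Q0 := segQ_ge0 Lf t0 r0.
have Gle s x (s01 : 0 <= s <= 1) (x0 : 0 < x) := seg_bound Lf t0 r0 s x0.
have Glip s s' x (s01 : 0 <= s <= 1) (s01' : 0 <= s' <= 1) (x0 : 0 < x) := seg_lip Lf t0 r0 s s' x0.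
split.
- move=> s s01; rewrite (_ : F _ = fun x => (0 +i* (2 * r))^-1 * seg f t r s x).
    exact: L2Z (riemann_L2 mG LQ Q0 Gle s01).
  by apply/funext => x; rewrite EF /seg mulKf.
- exact: riemann_int_L2 mG LQ Q0 Gle.
- move=> e e0; have [d d0 hd] := riemann_cvg mG LQ Q0 Gle Glip e0.
  exists d => // n s c s0 sn hs; have := hd n s c s0 sn hs.
  congr (normL2 _ < _); apply/funext => x; congr (_ - _); apply: eq_bigr => i _.
  rewrite EF /seg mulrA; congr (_ * _); rewrite !E.
  by apply: ReImE; rewrite !(cReD, cReM, cReN, cImD, cImM, cImN) /=; ring.
Qed.

End inversion_limit.

End inversion.

Theorem theorem3p2 (R : realType) (T : R -> 'Fun(R) -> 'Fun(R))
    (semigroupT : C0_semigroup T)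
    (TstarS : forall (t : R) (f : 'Fun(R)), 0 <= t -> L2 f ->
       adjoint_graph (T t) (shiftS t f) f) :
  exists p : 'Fun(R),
    [/\ calO p,
        forall f h : 'Fun(R), L2 f -> L2 h -> (generator_graph T f h <-> opAp p f h) &
        exists a : R,
          [/\ 0 < a,
              forall z : R[i], a < complex.Re z -> calM p z != 0 &
              forall (f : 'Fun(R)) (t b : R), domAp p f -> 0 < t -> a < b ->
                exists (J : R -> 'Fun(R)) (L : 'Fun(R)),
                  [/\ forall r : R, 0 < r ->
                        segment_integral
                          (fun z x =>
                             expC (z * t%:C) * pairing f (xi p z) * e_ z x)
                          (b -i* r) (b +i* r) (J r),
                      cvgL2 (pinfty_nbhs R)
                        (fun r x => (2%:R * pi%:C * 'i%C)^-1 * J r x) L &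
                      eqL2 (T t f) (fun x => shiftS t f x + L x)]]].
Proof.
have [w w0 growth] := T_growth semigroupT TstarS.
have [p [p' [Lp Lp' hp repr]]] := exists_boundary_rep semigroupT TstarS w0 growth.
have gen := opAp_generator semigroupT TstarS w0 growth Lp Lp' hp repr.
exists p; split => //; first exact: (calO_repr semigroupT TstarS w0 growth Lp Lp' hp repr).
(* The growth exponent serves as the abscissa: to its right the Laplace integral of every orbit
   converges. *)
exists w; split => // [z wz|f t b domf t0 wb].
  exact: (calM_neq0 semigroupT TstarS w0 growth Lp Lp' hp repr wz).
have [df _] := domf; have [Ldf hf] := derivL2P df; have [_ Lf _] := df.
have Gf : generator_graph T f (fun x => - derivL2 f x).
  apply/(gen f _ Lf (L2N Ldf)); exists f; split => //; exact: eqL2_refl.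
(* The limit is named outright as [T t f - S_t f], so the content lies in the convergence of the
   truncated integrals to it. *)
exists (fun r => riemann_int (seg T b f t r)), (fun x => T t f x - shiftS t f x); split.
- move=> r r0; apply: (segment_seg semigroupT TstarS w0 growth wb Gf t0 r0) => z x wz.
  by rewrite (pairing_xi semigroupT TstarS w0 growth Lp Lp' hp repr wz Lf).
- exact: (inversion_cvg semigroupT TstarS w0 growth wb Gf hf t0).
- rewrite (_ : (fun x => _) = T t f); first exact: eqL2_refl.
  by apply/funext => x; rewrite subrKC.
Qed.
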